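(* Suppose that $f\in L\log L(\mathbb{T}^2)$. Then for any $A>0$, $$\lim_{m\to\infty}\frac{1}{m+1}\sum_{n=0}^{m}\left(\exp\left(A\left|S_{nn}(x,y,f)-f(x,y)\right|\right)-1\right)=0$$ for almost every $(x,y)\in\mathbb{T}^2$.
   Context: $\mathbb{T}=[-\pi,\pi)=\mathbb{R}/2\pi\mathbb{Z}$; functions on $\mathbb{T}^2$ are identified with functions on $\mathbb{R}^2$ that are $2\pi$-periodic in each variable. Integrals and ''almost every'' are with respect to Lebesgue measure. $\log^+u=\log u$ if $u>1$ and $\log^+u=0$ otherwise. $L\log L(\mathbb{T}^2)$ is the class of measurable functions $f$ on $\mathbb{T}^2$ with $\iint_{\mathbb{T}^2}|f|\log^+|f|<\infty$ (such $f$ are integrable). Fourier coefficients: $\widehat f(j,k)=\frac{1}{4\pi^2}\iint_{\mathbb{T}^2}f(x,y)e^{-i(jx+ky)}\,dx\,dy$. Quadratic partial sums, for $n=0,1,2,\dots$: $S_{nn}(x,y,f)=\sum_{j=-n}^{n}\sum_{k=-n}^{n}\widehat f(j,k)e^{i(jx+ky)}$. *)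

(* Defs.v *)
From HB Require Import structures.
From mathcomp Require Import all_boot all_order all_algebra.
From mathcomp Require Import complex.
From mathcomp Require Import all_classical all_reals all_analysis.

Set Implicit Arguments.
Unset Strict Implicit.
Unset Printing Implicit Defensive.

Import Order.TTheory GRing.Theory Num.Theory.
Import numFieldNormedType.Exports.

Local Open Scope classical_set_scope.
Local Open Scope ring_scope.
Local Open Scope complex_scope.

Section Defs.
Context {R : realType}.

(* [lebesgue_measure] lives on the Borel sets. Lebesgue measure on the plane is
   the completion of its square, so that measurability below is Lebesgue
   measurability; the completion is obtained by Caratheodory extension, as for
   [completed_lebesgue_measure] on the line. *)
Local Notation borel_measure2 := (@lebesgue_measure R \x @lebesgue_measure R)%E.
Local Notation plane := (caratheodory_type (borel_measure2^*)%mu).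

Definition lebesgue_measure2 : set plane -> \bar R :=
  @completed_measure_extension _ _ _ borel_measure2.

HB.instance Definition _ := Measure.on lebesgue_measure2.

(* A fundamental domain of R^2 / (2 pi Z)^2. Functions on the torus are
   functions on the plane satisfying [periodic2]. *)
Definition torus2 : set plane :=
  [set z : R * R | (- pi <= z.1 < pi) && (- pi <= z.2 < pi)].

Definition periodic2 (f : R * R -> R[i]) : Prop :=
  forall x y, f (x + 2 * pi, y) = f (x, y) /\ f (x, y + 2 * pi) = f (x, y).

(* The library norm on [R[i]] takes its values in [R[i]]; this is the same
   modulus with values in [R]. *)
Definition modulus (w : R[i]) : R := Normc.normc w.

Definition logp (u : R) : R := if 1 < u then ln u else 0.

Definition LlogL (f : R * R -> R[i]) : Prop :=
  [/\ periodic2 f,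
      measurable_fun torus2 (fun z : plane => complex.Re (f z)),
      measurable_fun torus2 (fun z : plane => complex.Im (f z)) &
      (\int[lebesgue_measure2]_(z in torus2)
         (modulus (f z) * logp (modulus (f z)))%:E < +oo)%E].

Definition cintegral (g : R * R -> R[i]) : R[i] :=
  Rintegral lebesgue_measure2 torus2 (fun z => complex.Re (g z)) +i*
  Rintegral lebesgue_measure2 torus2 (fun z => complex.Im (g z)).

Definition cis (t : R) : R[i] := cos t +i* sin t.

Definition fourier_coef (f : R * R -> R[i]) (j k : int) : R[i] :=
  ((4 * pi ^+ 2)^-1)%:C *
  cintegral (fun z => f z * cis (- (j%:~R * z.1 + k%:~R * z.2))).

(* The ordinals below [2n+1], shifted by [n], enumerate -n, ..., n. *)
Definition partial_sum (f : R * R -> R[i]) (n : nat) (z : R * R) : R[i] :=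
  \sum_(j < n.*2.+1) \sum_(k < n.*2.+1)
    let j' : int := j%:Z - n%:Z in
    let k' : int := k%:Z - n%:Z in
    fourier_coef f j' k' * cis (j'%:~R * z.1 + k'%:~R * z.2).

End Defs.

(* Main.v *)
(** Square partial sums are controlled through a weak type inequality for
    trigonometric sums, and trigonometric polynomials are dense in L log L.

    The indicator of the square max(|j|,|k|) <= n differs from the multiplier
    r^max(|j|,|k|) by a half sum of one-dimensional gaps sgn(j)(1_{|j| <= n} - r^|j|)
    in the rows and in the columns, applied to the two conjugates of f with symbols
    sgn(j + k) and sgn(j - k). Hence S_nn f is a radial mean of f plus four
    one-dimensional conjugate partial sums of these conjugates.

    For g integrable on the circle, outside a set of measure O(|g|_1 / lam) given by
    the maximal function and a Marcinkiewicz integral, the conjugate partial sums of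
    g have mean oscillation O(lam) over every window of indices n; the John-Nirenberg
    inequality turns this into exponential square sums. The radial mean is bounded by
    Hopf's maximal ergodic theorem, as r^max(|j|,|k|) factors through the Poisson
    kernels in the two diagonal directions. The conjugates map L log L to L^1, by
    duality with the exponential integrability of conjugates of bounded functions. *)

Require Import Defs.
From HB Require Import structures.
From mathcomp Require Import all_boot all_order all_algebra.
From mathcomp Require Import complex.
From mathcomp Require Import all_classical all_reals all_analysis.
From mathcomp Require Import measurable_realfun.
From mathcomp Require Import ring lra zify.

Set Implicit Arguments.
Unset Strict Implicit.
Unset Printing Implicit Defensive.

Import Order.TTheory GRing.Theory Num.Theory.
Import numFieldNormedType.Exports.
Local Open Scope classical_set_scope.
Local Open Scope ring_scope.

(** * Dirichlet, Fejer and Poisson kernels *)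

Section Kernels.
Context {R : realType}.
Implicit Types (t u v x nu : R) (n l a : nat).

(** The weak type bound for square sums involves the L^1 norms of the half-plane conjugates. Young's
    inequality against the exponential turns such a norm into an L log L size plus a constant, and
    this constant does not shrink with f. A parameter [K] is therefore kept inside the logarithm: it
    divides the constant, and polynomials are shown to be dense for every [K].

    An arbitrary A > 0 is reached because the level lam is free. Outside a small set the exponential
    sums are bounded at exponent 1/(8 [exp_const] lam); convexity of exp turns this into a bound of
    order A lam for the means, so smallness comes from lam and not from the size of the sums.

    The conjugates of f itself are never formed. The estimates are made for Fejer means, finite sums
    on which every operator is a multiplier, with constants independent of the degree; the
    exceptional sets then pass to the limit as a lower limit of sets. Functions are real until the
    end: real and imaginary parts separate because the squares of frequencies are symmetric. *)

Lemma sin_ge_half (y : R) : 0 <= y <= pi / 2 -> y / 2 <= sin y.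
Proof.
move=> /andP[y0 y1]; have pi0 := @pi_gt0 R.
have [->|yn0] := eqVneq y 0; first by rewrite mul0r sin0.
have yp : 0 < y by rewrite lt_neqAle eq_sym yn0.
(* Writing sin y = 2 sin(y/2) cos(y/2) and sin(y/2) = cos c * (y/2) leaves two cosines on [0, pi/4],
   whose product is at least 1/2. *)
have c4 (z : R) : 0 <= z <= pi / 4 -> 1 / 2 <= cos z ^+ 2.
  move=> /andP[z0 z1]; have cz : 0 <= cos (z *+ 2).
    by apply: cos_ge0_pihalf; rewrite (mulr2n z); apply/andP; split; lra.
  by move: cz; rewrite cos_mulr2n; lra.
have [c cin] : exists2 c, c \in `]0, (y / 2)[ & sin (y / 2) - sin 0 = cos c * (y / 2 - 0).
  apply: (@MVT R sin cos); first by rewrite divr_gt0.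
  by apply: continuous_subspaceT => z; exact: continuous_sin.
rewrite sin0 !subr0 => sE.
have cb : 0 <= c <= pi / 4.
  by move: cin; rewrite in_itv/= => /andP[/ltW-> ?]/=; apply/ltW/(lt_le_trans _ (_ : y / 2 <= _)) => //; lra.
have h1 := c4 _ cb; have h2 : 1 / 2 <= cos (y / 2) ^+ 2 by apply: c4; apply/andP; split; lra.
have p1 : 0 <= cos c by apply: cos_ge0_pihalf; move/andP: cb => [? ?]; apply/andP; split; lra.
have p2 : 0 <= cos (y / 2) by apply: cos_ge0_pihalf; apply/andP; split; lra.
rewrite (_ : sin y = 2 * (sin (y / 2) * cos (y / 2))); last first.
  rewrite {1}(_ : y = (y / 2) *+ 2) ?sin_mulr2n; last by field.
  by ring.
rewrite sE.
have h3 : 1 / 2 <= cos c * cos (y / 2).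
  rewrite -(@ler_pXn2r _ 2) ?nnegrE ?mulr_ge0//.
  rewrite [leLHS]expr2 exprMn.
  by apply: ler_pM; rewrite ?divr_ge0.
rewrite (_ : 2 * _ = (cos c * cos (y / 2)) * y); last by field.
by have := ler_wpM2r y0 h3; lra.
Qed.

Lemma normr_sin_half_ge v : `|v| <= pi -> `|v| / 4 <= `|sin (v / 2)|.
Proof.
have [v0|v0] := leP 0 v => vpi.
  rewrite (ger0_norm v0) in vpi *; have h : 0 <= v / 2 <= pi / 2 by apply/andP; split; lra.
  by have := sin_ge_half h => sv; rewrite [leRHS]ger0_norm; lra.
rewrite (ltr0_norm v0) in vpi *; have h : 0 <= - v / 2 <= pi / 2 by apply/andP; split; lra.
by have := sin_ge_half h; rewrite mulNr sinN => sv; rewrite [leRHS]ler0_norm; lra.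
Qed.

(** The conjugate Dirichlet kernel. *)
Definition cdirichlet n t : R := \sum_(0 <= k < n) sin (k.+1%:R * t).

(** Away from the singularity the kernel is half a cotangent, free of n, minus one oscillating term.
    The identity is kept multiplied by the sine so that it also holds where the sine vanishes. *)
Lemma cdirichletE n t :
  2 * sin (t / 2) * cdirichlet n t = cos (t / 2) - cos ((n%:R + 1 / 2) * t).
Proof.
rewrite /cdirichlet; elim: n => [|n IH].
  by rewrite big_geq// mulr0 (_ : (0 + 1 / 2) * t = t / 2) ?subrr//; ring.
rewrite big_nat_recr//= mulrDr IH.
rewrite (_ : (n.+1%:R + 1 / 2) * t = n.+1%:R * t + t / 2); last by field.
rewrite (_ : (n%:R + 1 / 2) * t = n.+1%:R * t - t / 2); last by rewrite -natr1; field.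
by rewrite cosB cosD; ring.
Qed.

Lemma cdirichlet_window a n l t : (a <= n < a + l)%N ->
  `|cdirichlet n t - cdirichlet a t| <= l%:R.
Proof.
move=> /andP[an nl]; rewrite /cdirichlet (big_cat_nat (leq0n a) an)/= [X in X - _]addrC addrK.
apply: (le_trans (ler_norm_sum _ _ _)).
apply: (@le_trans _ _ (\sum_(a <= i < n) 1)).
  by apply: ler_sum => i _; exact: sin_max.
by rewrite sumr_const_nat -mulr_natr mul1r ler_nat leq_subLR ltnW.
Qed.

Lemma cdirichlet_le n t : `|cdirichlet n t| <= n%:R.
Proof.
apply: (le_trans (ler_norm_sum _ _ _)).
apply: (@le_trans _ _ (\sum_(0 <= i < n) 1)).
  by apply: ler_sum => i _; exact: sin_max.
by rewrite sumr_const_nat subn0.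
Qed.

(** Both sides are the real part of exp(i nu) |sum_k exp(i k u)|^2: summing over differences of
    indices produces a Fejer kernel. *)
Lemma sum_cos_diff n nu u :
  \sum_(0 <= k < n) \sum_(0 <= m < n) cos (nu + (k%:R - m%:R) * u) =
  cos nu * ((\sum_(0 <= k < n) cos (k%:R * u)) ^+ 2 +
            (\sum_(0 <= k < n) sin (k%:R * u)) ^+ 2).
Proof.
set C := \sum_(0 <= k < n) cos _; set S := \sum_(0 <= k < n) sin _.
transitivity (\sum_(0 <= k < n) ((cos nu * cos (k%:R * u) - sin nu * sin (k%:R * u)) * C
  + (sin nu * cos (k%:R * u) + cos nu * sin (k%:R * u)) * S)).
  apply: eq_bigr => k _; rewrite /C /S !mulr_sumr -big_split/=; apply: eq_bigr => m _.
  by rewrite mulrBl cosD cosB sinB; ring.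
rewrite big_split/= -!mulr_suml.
rewrite sumrB -!mulr_sumr big_split/= -!mulr_sumr -/C -/S; ring.
Qed.

Lemma sqr_sum_cos_sin_le n u :
  (\sum_(0 <= k < n) cos (k%:R * u)) ^+ 2 +
  (\sum_(0 <= k < n) sin (k%:R * u)) ^+ 2 <= n%:R ^+ 2.
Proof.
have := sum_cos_diff n 0 u; rewrite cos0 mul1r => <-.
apply: (@le_trans _ _ (\sum_(0 <= k < n) \sum_(0 <= m < n) 1)).
  by apply: ler_sum => k _; apply: ler_sum => m _; exact: cos_le1.
by rewrite !sumr_const_nat subn0 -[leLHS]mulr_natr expr2.
Qed.

(** Multiplied by 2 sin(u/2), the geometric sum of exp(i k u) telescopes to a difference of two
    numbers of modulus 1, whose square is at most 4. *)
Lemma sqr_sum_cos_sin_sin n u :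
  sin (u / 2) ^+ 2 * ((\sum_(0 <= k < n) cos (k%:R * u)) ^+ 2 +
  (\sum_(0 <= k < n) sin (k%:R * u)) ^+ 2) <= 1.
Proof.
set C := \sum_(0 <= k < n) cos _; set S := \sum_(0 <= k < n) sin _.
have hC : 2 * sin (u / 2) * C = sin ((n%:R - 1 / 2) * u) + sin (u / 2).
  rewrite /C; elim: n {C S} => [|n IH].
    rewrite big_geq// mulr0 sub0r mulNr sinN [1 / 2 * u]mulrC mulrA mulr1; ring.
  rewrite big_nat_recr//= mulrDr IH.
  rewrite (_ : (n.+1%:R - 1 / 2) * u = n%:R * u + u / 2); last by rewrite -natr1; field.
  rewrite (_ : (n%:R - 1 / 2) * u = n%:R * u - u / 2); last by field.
  by rewrite [in RHS]sinD [in LHS]sinB; ring.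
have hS : 2 * sin (u / 2) * S = cos (u / 2) - cos ((n%:R - 1 / 2) * u).
  rewrite /S; elim: n {C S hC} => [|n IH].
    rewrite big_geq// mulr0 sub0r mulNr cosN [1 / 2 * u]mulrC mulrA mulr1; ring.
  rewrite big_nat_recr//= mulrDr IH.
  rewrite (_ : (n.+1%:R - 1 / 2) * u = n%:R * u + u / 2); last by rewrite -natr1; field.
  rewrite (_ : (n%:R - 1 / 2) * u = n%:R * u - u / 2); last by field.
  by rewrite cosB cosD; ring.
have : (2 * sin (u / 2) * C) ^+ 2 + (2 * sin (u / 2) * S) ^+ 2 <= 4.
  rewrite hC hS.
  have e1 := cos2Dsin2 (u / 2); have e2 := cos2Dsin2 ((n%:R - 1 / 2) * u).
  set c := cos (u / 2) in e1 *; set s := sin (u / 2) in e1 *.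
  set c' := cos _ in e2 *; set s' := sin _ in e2 *.
  have h1 : 0 <= (s - s') ^+ 2 by exact: sqr_ge0.
  have h2 : 0 <= (c + c') ^+ 2 by exact: sqr_ge0.
  by nra.
by rewrite !exprMn; lra.
Qed.

(** The closed form of the sum of r^k sin(k t) over k >= 1. The kernel [poisson] is normalised to
    have constant term 1, that is mean 1 over a period. *)
Definition cpoisson (r t : R) : R := r * sin t / (1 - 2 * r * cos t + r ^+ 2).
Definition poisson (r t : R) : R := (1 - r ^+ 2) / (1 - 2 * r * cos t + r ^+ 2).

Lemma poisson_denE (r t : R) :
  1 - 2 * r * cos t + r ^+ 2 = (1 - r) ^+ 2 + 2 * r * (1 - cos t).
Proof. ring. Qed.

Lemma poisson_den_ge (r t : R) : 0 <= r -> (1 - r) ^+ 2 <= 1 - 2 * r * cos t + r ^+ 2.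
Proof.
move=> r0; rewrite poisson_denE lerDl mulr_ge0 ?mulr_ge0// subr_ge0; exact: cos_le1.
Qed.

Lemma poisson_den_gt0 (r t : R) : 0 <= r < 1 -> 0 < 1 - 2 * r * cos t + r ^+ 2.
Proof.
move=> /andP[r0 r1]; apply: lt_le_trans (poisson_den_ge _ r0).
by rewrite exprn_gt0// subr_gt0.
Qed.

Lemma poisson_ge0 (r t : R) : 0 <= r < 1 -> 0 <= poisson r t.
Proof.
move=> r01; rewrite divr_ge0 ?(ltW (poisson_den_gt0 _ r01))//.
by move/andP: r01 => [r0 r1]; rewrite subr_ge0 expr_le1// ltW.
Qed.

(** Multiplication by the denominator telescopes the partial sum, and the two boundary terms are the
    remainder. The error is geometric and uniform in t, which later allows convolutions to be
    computed term by term. *)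
Lemma cpoisson_series (r t : R) n : 0 <= r < 1 ->
  `|cpoisson r t - \sum_(0 <= k < n) r ^+ k.+1 * sin (k.+1%:R * t)| <=
  2 * r ^+ n / (1 - r) ^+ 2.
Proof.
move=> r01; have D0 := poisson_den_gt0 t r01; have /andP[r0 r1] := r01.
set D := (X in 0 < X) in D0; set S := \sum_(0 <= k < n) _.
have SE : D * S = r * sin t - (r ^+ n.+1 * sin (n.+1%:R * t) - r ^+ n.+2 * sin (n%:R * t)).
  rewrite /S; elim: n {S} => [|n IH].
    by rewrite big_geq// mulr0 mul0r sin0 mulr0 !mul1r expr1; ring.
  rewrite big_nat_recr//= mulrDr IH /D.
  have e1 : n.+2%:R * t = n.+1%:R * t + t by rewrite -natr1; ring.
  have e2 : n%:R * t = n.+1%:R * t - t by rewrite -[n.+1%:R]natr1; ring.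
  rewrite e1 (_ : sin (n%:R * t) = sin (n.+1%:R * t - t)) ?e2// in IH *.
  by rewrite sinB sinD !exprS; ring.
have -> : cpoisson r t - S = (r ^+ n.+1 * sin (n.+1%:R * t) - r ^+ n.+2 * sin (n%:R * t)) / D.
  by apply: (mulfI (lt0r_neq0 D0)); rewrite mulrBr SE /cpoisson -/D; field; exact: lt0r_neq0.
rewrite normrM normfV (gtr0_norm D0); apply: ler_pM => //; rewrite ?invr_ge0 ?(ltW D0)//.
  rewrite (_ : 2 * r ^+ n = r ^+ n + r ^+ n); last by ring.
  apply: (le_trans (ler_normB _ _)).
  have h k x : (n <= k)%N -> `|r ^+ k * sin x| <= r ^+ n.
    move=> nk; rewrite normrM ger0_norm ?exprn_ge0// -[leRHS]mulr1.
    by apply: ler_pM; rewrite ?exprn_ge0// ?sin_max// ler_wiXn2l// ltW.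
  by apply: lerD; apply: h; [exact: leqnSn|exact: leqW].
by rewrite lef_pV2 ?posrE// ?exprn_gt0 ?subr_gt0//; exact: poisson_den_ge.
Qed.

Lemma poisson_series (r t : R) n : 0 <= r < 1 ->
  `|poisson r t - (1 + 2 * \sum_(0 <= k < n) r ^+ k.+1 * cos (k.+1%:R * t))| <=
  4 * r ^+ n / (1 - r) ^+ 2.
Proof.
move=> r01; have D0 := poisson_den_gt0 t r01; have /andP[r0 r1] := r01.
set D := (X in 0 < X) in D0; set S := \sum_(0 <= k < n) _.
have SE : D * (1 + 2 * S) = 1 - r ^+ 2
    - 2 * (r ^+ n.+1 * cos (n.+1%:R * t) - r ^+ n.+2 * cos (n%:R * t)).
  rewrite /S; elim: n {S} => [|n IH].
    by rewrite big_geq// !mulr0 mul0r cos0 mul1r expr1 /D; ring.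
  rewrite big_nat_recr//= (mulrDr 2) addrA (mulrDr D) IH /D.
  have e1 : n.+2%:R * t = n.+1%:R * t + t by rewrite -natr1; ring.
  have e2 : n%:R * t = n.+1%:R * t - t by rewrite -[n.+1%:R]natr1; ring.
  by rewrite e2 e1 cosB cosD !exprS; ring.
have -> : poisson r t - (1 + 2 * S) =
    2 * (r ^+ n.+1 * cos (n.+1%:R * t) - r ^+ n.+2 * cos (n%:R * t)) / D.
  by apply: (mulfI (lt0r_neq0 D0)); rewrite mulrBr SE /poisson -/D; field; exact: lt0r_neq0.
rewrite normrM normfV (gtr0_norm D0); apply: ler_pM => //; rewrite ?invr_ge0 ?(ltW D0)//.
  rewrite normrM ger0_norm//.
  rewrite (_ : 4 * r ^+ n = 2 * (r ^+ n + r ^+ n)); last by ring.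
  rewrite ler_pM2l//; apply: (le_trans (ler_normB _ _)).
  have h k x : (n <= k)%N -> `|r ^+ k * cos x| <= r ^+ n.
    move=> nk; rewrite normrM ger0_norm ?exprn_ge0// -[leRHS]mulr1.
    by apply: ler_pM; rewrite ?exprn_ge0// ?cos_max// ler_wiXn2l// ltW.
  by apply: lerD; apply: h; [exact: leqnSn|exact: leqW].
by rewrite lef_pV2 ?posrE// ?exprn_gt0 ?subr_gt0//; exact: poisson_den_ge.
Qed.

(** A Harnack inequality: 1 - r' <= 1 - r^2 <= 2 (1 - r), so the denominators differ by a factor at
    most 4, while the numerators are ordered the right way. *)
Lemma poisson_le (r r' t : R) : 0 <= r < 1 -> r ^+ 2 <= r' <= r ->
  poisson r t <= 4 * poisson r' t.
Proof.
move=> r01 /andP[h1 h2]; have /andP[r0 r1] := r01.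
have r'0 : 0 <= r' by apply: le_trans h1; exact: sqr_ge0.
have r'01 : 0 <= r' < 1 by rewrite r'0 (le_lt_trans h2).
have D0 := poisson_den_gt0 t r01; have D'0 := poisson_den_gt0 t r'01.
rewrite /poisson mulrA ler_pdivrMr// mulrAC ler_pdivlMr//.
have hc : 0 <= 1 - cos t by rewrite subr_ge0; exact: cos_le1.
have e : 1 - 2 * r' * cos t + r' ^+ 2 <= 4 * (1 - 2 * r * cos t + r ^+ 2).
  rewrite !poisson_denE.
  have a1 : (1 - r') ^+ 2 <= 4 * (1 - r) ^+ 2.
    rewrite (_ : 4 * (1 - r) ^+ 2 = (2 * (1 - r)) ^+ 2); last by ring.
    by rewrite ler_pXn2r// ?nnegrE; nra.
  by nra.
have e2 : 1 - r ^+ 2 <= 1 - r' ^+ 2.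
  by rewrite lerD2l lerN2 ler_pXn2r// ?nnegrE.
have e3 : 0 <= 1 - r ^+ 2 by nra.
apply: (@le_trans _ _ ((1 - r ^+ 2) * (4 * (1 - 2 * r * cos t + r ^+ 2)))).
  exact: ler_wpM2l.
by rewrite mulrA (mulrC _ 4) ler_wpM2r ?(ltW D0)// ler_wpM2l.
Qed.

End Kernels.

(** * Integrals of nonnegative real functions *)

Section NonnegativeIntegrals.
Context d (T : measurableType d) (R : realType) (m : {measure set T -> \bar R}).
Implicit Types (D A : set T) (f g : T -> R).

Lemma ge0_le_intR D f g : measurable D -> measurable_fun D f -> measurable_fun D g ->
  (forall x, D x -> 0 <= f x) -> (forall x, D x -> f x <= g x) ->
  (\int[m]_(x in D) (f x)%:E <= \int[m]_(x in D) (g x)%:E)%E.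
Proof.
move=> mD mf mg f0 fg; apply: ge0_le_integral => //; try exact/measurable_EFinP.
Qed.

Lemma ge0_intRD D f g : measurable D -> measurable_fun D f -> measurable_fun D g ->
  (forall x, D x -> 0 <= f x) -> (forall x, D x -> 0 <= g x) ->
  (\int[m]_(x in D) (f x + g x)%:E =
   \int[m]_(x in D) (f x)%:E + \int[m]_(x in D) (g x)%:E)%E.
Proof.
move=> mD mf mg f0 g0; under eq_integral do rewrite EFinD.
by rewrite ge0_integralD//; exact/measurable_EFinP.
Qed.

Lemma ge0_intRZ D (k : R) f : measurable D -> measurable_fun D f ->
  (forall x, D x -> 0 <= f x) -> 0 <= k ->
  (\int[m]_(x in D) (k * f x)%:E = k%:E * \int[m]_(x in D) (f x)%:E)%E.
Proof.
move=> mD mf f0 k0; under eq_integral do rewrite EFinM.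
by rewrite ge0_integralZl_EFin//; exact/measurable_EFinP.
Qed.

Lemma intR_indic D A f :
  (\int[m]_(x in D) (f x * \1_A x)%:E = \int[m]_(x in D `&` A) (f x)%:E)%E.
Proof.
rewrite integral_mkcondr; apply: eq_integral => x _.
by rewrite patchE indicE; case: ifPn => _; rewrite ?mulr1 ?mulr0.
Qed.

Lemma intR_indicT A f : (\int[m]_x (f x * \1_A x)%:E = \int[m]_(x in A) (f x)%:E)%E.
Proof. by rewrite intR_indic setTI. Qed.

End NonnegativeIntegrals.

(** The continuous functions x / (x^2 + 1/(n+1)) converge to the inverse everywhere, including at 0,
    where the inverse is 0 by convention. *)
Lemma measurable_inv (R : realType) : measurable_fun [set: R] (@GRing.inv R).
Proof.
pose h (n : nat) (x : R) := x / (x ^+ 2 + n.+1%:R^-1).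
apply: (@measurable_fun_cvg _ _ _ _ h) => [n|x _].
  apply: continuous_measurable_fun => x; apply: cvgM; first exact: cvg_id.
  apply: cvgV; first by rewrite lt0r_neq0// ltr_wpDl ?sqr_ge0.
  by apply: cvgD; [exact: exprn_continuous|exact: cvg_cst].
have [->|x0] := eqVneq x 0.
  by rewrite /h invr0; under eq_fun do rewrite mul0r; exact: cvg_cst.
have -> : x^-1 = x / (x ^+ 2 + 0) by rewrite addr0; field.
apply: cvgM; first exact: cvg_cst.
apply: cvgV; first by rewrite addr0 sqrf_eq0.
by apply: cvgD; [exact: cvg_cst|exact: cvg_harmonic].
Qed.

Lemma measurable_section1 (R : realType) d1 d2 (T1 : measurableType d1) (T2 : measurableType d2)
  (F : T1 * T2 -> R) x :
  measurable_fun setT F -> measurable_fun setT (fun y => F (x, y)).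
Proof. by move=> mF; apply: (measurableT_comp mF); exact: measurable_pair1. Qed.

Lemma measurable_section2 (R : realType) d1 d2 (T1 : measurableType d1) (T2 : measurableType d2)
  (F : T1 * T2 -> R) y :
  measurable_fun setT F -> measurable_fun setT (fun x => F (x, y)).
Proof. by move=> mF; apply: (measurableT_comp mF); exact: measurable_pair2. Qed.

(** * The Cauchy weight and averages over balls *)

Section Kappa.
Context {R : realType}.
Local Notation mu := (@lebesgue_measure R).

(** The Cauchy kernel at scale rho, normalised to the value 1 at 0. It dominates both the Fejer
    kernel of order 1/rho and the tails of 1/u^2 outside a ball of radius rho, up to powers of
    rho. *)
Definition kap (rho u : R) : R := rho ^+ 2 / (rho ^+ 2 + u ^+ 2).

Lemma kap_ge0 (rho u : R) : 0 <= kap rho u.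
Proof. by rewrite divr_ge0 ?addr_ge0 ?sqr_ge0. Qed.

Lemma kap_le1 (rho u : R) : kap rho u <= 1.
Proof.
rewrite /kap; have [->|h] := eqVneq (rho ^+ 2 + u ^+ 2) 0.
  by rewrite invr0 mulr0.
rewrite ler_pdivrMr ?mul1r ?lerDl ?sqr_ge0//.
by rewrite lt_neqAle eq_sym h addr_ge0 ?sqr_ge0.
Qed.

Lemma kap_den_gt0 (rho u : R) : 0 < rho -> 0 < rho ^+ 2 + u ^+ 2.
Proof. by move=> r0; rewrite ltr_pwDl ?exprn_gt0 ?sqr_ge0. Qed.

Lemma kapN (rho u : R) : kap rho (- u) = kap rho u.
Proof. by rewrite /kap sqrrN. Qed.

Lemma kap_homo (r r' u : R) : 0 < r -> r <= r' -> kap r u <= kap r' u.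
Proof.
move=> r0 rr'; have r'0 := lt_le_trans r0 rr'.
rewrite /kap ler_pdivrMr ?kap_den_gt0// mulrAC ler_pdivlMr ?kap_den_gt0//.
have : r ^+ 2 <= r' ^+ 2 by rewrite ler_pXn2r ?nnegrE// ltW.
have := sqr_ge0 u; nra.
Qed.

(** One step of a decomposition into scales growing by 4: outside the ball the weight falls by 8 at
    each step, faster than the radius grows, so the balls contribute a geometric series. *)
Lemma kap_step (rho u : R) : 0 < rho ->
  kap rho u <= \1_(ball (0:R) (4 * rho)) u + 8^-1 * kap (4 * rho) u.
Proof.
move=> r0; rewrite indicE; have [h|h] := boolP (u \in _).
  by rewrite (le_trans (kap_le1 _ _))// lerDl mulr_ge0// kap_ge0.
have {}h : 4 * rho <= `|u|.
  by move: h; rewrite notin_setE /ball/= sub0r normrN => /negP; rewrite -leNgt.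
rewrite add0r /kap ler_pdivrMr ?kap_den_gt0//.
have d0 : 0 < (4 * rho) ^+ 2 + u ^+ 2 by rewrite kap_den_gt0// mulr_gt0.
rewrite mulrA mulrAC ler_pdivlMr//.
have : (4 * rho) ^+ 2 <= u ^+ 2.
  have r40 : 0 <= 4 * rho by rewrite mulr_ge0// ltW.
  by rewrite -[leRHS]real_normK ?num_real// ler_pXn2r ?nnegrE.
have := exprn_gt0 2 r0; nra.
Qed.

Lemma measurable_kap (rho s : R) : 0 < rho ->
  measurable_fun [set: R] (fun t : R => kap rho (t - s)).
Proof.
move=> r0; apply: continuous_measurable_fun => t.
apply: cvgM; first exact: cvg_cst.
apply: cvgV; first by rewrite lt0r_neq0// kap_den_gt0.
apply: cvgD; first exact: cvg_cst.
apply: (@continuous_comp _ _ _ (fun x : R => x - s) (fun x => x ^+ 2)); last exact: exprn_continuous.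
by apply: cvgB => //; exact: cvg_cst.
Qed.

Lemma ball_shift (s r t : R) : ball (0:R) r (t - s) = ball s r t.
Proof. by rewrite /ball/= sub0r normrN distrC. Qed.

(** By [kap_step] the integral I(r) at scale r satisfies I(r) <= 4 A r + I(4 r)/8, and 8 A r is the
    fixed point of this recursion. After n steps the remainder is at most 8^-n S; the total mass S
    serves only to make it vanish. *)
Lemma integral_kap_le (G : R -> R) (A S s rho : R) :
  measurable_fun [set: R] G -> (forall t, 0 <= G t) ->
  (\int[mu]_t (G t)%:E <= S%:E)%E -> 0 <= A -> 0 < rho ->
  (forall r, rho <= r -> (\int[mu]_(t in ball s r) (G t)%:E <= (A * r)%:E)%E) ->
  (\int[mu]_t (G t * kap rho (t - s))%:E <= (8 * A * rho)%:E)%E.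
Proof.
move=> mG G0 GS A0 rho0 HA.
have mK r : 0 < r -> measurable_fun [set: R] (fun t : R => G t * kap r (t - s)).
  by move=> r0; apply/measurable_funM => //; exact: measurable_kap.
have K0 r t : 0 <= G t * kap r (t - s) by rewrite mulr_ge0 ?kap_ge0.
have mB r : measurable_fun [set: R] (\1_(ball s r) : R -> R).
  by apply: measurable_indic; exact: measurable_ball.
have step r : rho <= r -> (\int[mu]_t (G t * kap r (t - s))%:E <=
    (4 * A * r)%:E + 8^-1%:E * \int[mu]_t (G t * kap (4 * r) (t - s))%:E)%E.
  move=> rr; have r0 := lt_le_trans rho0 rr.
  have r40 : 0 < 4 * r by rewrite mulr_gt0.
  apply: (@le_trans _ _ (\int[mu]_t (G t * \1_(ball s (4 * r)) t +
     8^-1 * (G t * kap (4 * r) (t - s)))%:E)%E).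
    apply: ge0_le_intR => //; first exact: mK.
      apply: measurable_funD; first by apply: measurable_funM; [exact: mG|exact: mB].
      by apply: measurable_funM => //; exact: mK.
    move=> t _; rewrite (mulrCA 8^-1) -mulrDr.
    rewrite ler_wpM2l//; apply: (le_trans (kap_step _ r0)).
    by rewrite lerD2r !indicE -!topredE/= /in_set/= ball_shift.
  rewrite ge0_intRD//; first last.
  - by move=> t _; rewrite mulr_ge0.
  - by move=> t _; rewrite mulr_ge0.
  - by apply: measurable_funM => //; exact: mK.
  - by apply: measurable_funM; [exact: mG|exact: mB].
  rewrite ge0_intRZ//; last exact: mK.
  apply: leeD => //; rewrite intR_indicT (_ : 4 * A * r = A * (4 * r)); last by ring.
  by apply: HA; lra.
have it n : forall r, rho <= r ->
    (\int[mu]_t (G t * kap r (t - s))%:E <= (8 * A * r + 8^-1 ^+ n * S)%:E)%E.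
  elim: n => [|n IH] r rr; have r0 := lt_le_trans rho0 rr.
    rewrite expr0 mul1r EFinD (le_trans _ (leeDr _ _))//; last first.
      by rewrite lee_fin !mulr_ge0// ltW.
    apply: le_trans GS; apply: ge0_le_intR => //; first exact: mK.
    by move=> t _; rewrite -[leRHS]mulr1 ler_wpM2l// kap_le1.
  apply: (le_trans (step _ rr)).
  have h : rho <= 4 * r by lra.
  apply: (@le_trans _ _ ((4 * A * r)%:E + 8^-1%:E * (8 * A * (4 * r) + 8^-1 ^+ n * S)%:E)%E).
    by apply: leeD => //; apply: lee_wpmul2l; [rewrite lee_fin|exact: IH].
  rewrite -EFinM -EFinD lee_fin exprS.
  have -> : 4 * A * r + 8^-1 * (8 * A * (4 * r) + 8^-1 ^+ n * S) = 8 * A * r + 8^-1 * 8^-1 ^+ n * S.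
    by field.
  by [].
apply/lee_addgt0Pr => e e0.
have [n hn] : exists n : nat, 8^-1 ^+ n * S <= e.
  have : (fun n : nat => (8^-1 : R) ^+ n * S) @ \oo --> (0 : R).
    rewrite -(mul0r S); apply: cvgM; last exact: cvg_cst.
    by apply: cvg_expr; rewrite ger0_norm// invf_lt1//; lra.
  move=> /cvgr_le /(_ _ e0)[N _ hN]; exists N; apply: hN => /=; exact: leqnn.
by apply: (le_trans (it n rho _)) => //; rewrite -EFinD lee_fin lerD2l.
Qed.
End Kappa.

(** * The Calderon-Zygmund exceptional set *)

Section CalderonZygmundSet.
Context {R : realType}.
Local Notation mu := (@lebesgue_measure R).
Variables (G : R -> R) (S lam : R).
Hypotheses (mG : measurable_fun [set: R] G) (G0 : forall t, 0 <= G t).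
Hypotheses (GS : (\int[mu]_t (G t)%:E <= S%:E)%E) (lam0 : 0 < lam).

Definition good_set : set R := [set x | (HL_maximal G x <= lam%:E)%E].
Local Notation E := good_set.

Let locG : locally_integrable setT G.
Proof.
apply: open_integrable_locally; first exact: openT.
apply/integrableP; split; first exact/measurable_EFinP.
rewrite (le_lt_trans _ (ltry S))//; apply: le_trans GS.
by under eq_integral do rewrite /= ger0_norm//.
Qed.

Lemma measurable_good_set : measurable E.
Proof.
rewrite -[E]setTI; apply: emeasurable_fun_infty_c => //.
exact: (measurable_HL_maximal locG).
Qed.

Lemma good_setC_le : (mu (~` E) <= (3 / lam * S)%:E)%E.
Proof.
have -> : ~` E = [set x | (HL_maximal G x > lam%:E)%E].
  by apply/seteqP; split => x /=; rewrite /E/=; [move/negP; rewrite -ltNge|move=> h; apply/negP; rewrite -ltNge].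
apply: (le_trans (maximal_inequality locG lam0)).
rewrite [leRHS]EFinM; apply: (@lee_wpmul2l _ (3 / lam)%:E); first by rewrite lee_fin divr_ge0 ?(ltW lam0).
by apply: le_trans GS; under eq_integral do rewrite /= ger0_norm//.
Qed.

Lemma good_set_ball x r : E x -> 0 < r -> (\int[mu]_(t in ball x r) (G t)%:E <= (2 * lam * r)%:E)%E.
Proof.
move=> Ex r0.
have : (iavg G (ball x r) <= lam%:E)%E.
  by apply: le_trans Ex; apply: ereal_sup_ubound; exists r => //=; rewrite in_itv/= r0.
rewrite /iavg (lebesgue_measure_ball _ (ltW r0)).
rewrite inver ifF; last by apply/negbTE; rewrite mulrn_eq0/= gt_eqF.
under eq_integral do rewrite /= ger0_norm//.
rewrite lee_pdivrMl ?mulrn_wgt0// => h; apply: (le_trans h).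
by rewrite -EFinM lee_fin mulr2n; lra.
Qed.

(** If the good set is empty this is identically 0, by the value of [inf] on the empty set. *)
Definition gdist (t : R) : R := inf [set `|t - e| | e in E].

Let lbd t : has_lbound [set `|t - e| | e in E].
Proof. by exists 0 => _ [e _ <-]. Qed.

Lemma gdist_ge0 t : 0 <= gdist t.
Proof.
rewrite /gdist; have [->|/set0P ne] := eqVneq [set `|t - e| | e in E] set0.
  by rewrite inf0.
by apply: lb_le_inf => // _ [e _ <-].
Qed.

Lemma gdist_le t e : E e -> gdist t <= `|t - e|.
Proof. by move=> Ee; apply: ge_inf; [exact: lbd|exists e]. Qed.

Lemma gdist_adherent t d x : E x -> 0 < d -> exists2 e, E e & `|t - e| < gdist t + d.
Proof.
move=> Ex d0; have [|_ [e Ee <-] h] := @inf_adherent _ [set `|t - e| | e in E] _ d0.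
  by split; [exists `|t - x|, x|exact: lbd].
by exists e.
Qed.

Lemma gdist_lip t t' : gdist t <= gdist t' + `|t - t'|.
Proof.
have [E0|/set0P[x Ex]] := eqVneq E set0.
  by rewrite /gdist E0 !image_set0 inf0 add0r.
apply/ler_addgt0Pr => d d0; have [e Ee he] := gdist_adherent t' Ex d0.
apply: (le_trans (gdist_le t Ee)).
have := ler_distD t' t e; lra.
Qed.

Lemma measurable_gdist : measurable_fun [set: R] gdist.
Proof.
apply: continuous_measurable_fun => t; apply/cvgrPdist_le => e e0.
near=> s; have h : `|t - s| <= e by near: s; exact: cvgr_dist_le.
rewrite ler_norml; have := gdist_lip t s; have := gdist_lip s t.
rewrite (distrC s); lra.
Unshelve. all: by end_near. Qed.

(** A ball of radius r whose centre is within r of the good set lies in a ball of radius 3 r around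
    a good point; the third r absorbs the fact that the distance need not be attained. *)
Lemma gdist_ball x u r : E x -> 0 < r -> gdist u <= r ->
  (\int[mu]_(t in ball u r) (G t)%:E <= (6 * lam * r)%:E)%E.
Proof.
move=> Ex r0 ur; have [e Ee he] := gdist_adherent u Ex r0.
apply: (@le_trans _ _ (\int[mu]_(t in ball e (3 * r)) (G t)%:E)%E).
  apply: ge0_subset_integral => //; try exact: measurable_ball.
  - by apply/measurable_EFinP; exact: measurable_funS mG.
  - by move=> t _; rewrite lee_fin.
  - move=> t; rewrite /ball/= => h; have := ler_distD u e t; rewrite (distrC e u); lra.
apply: (le_trans (good_set_ball Ee _)); first by rewrite mulr_gt0.
by rewrite lee_fin; lra.
Qed.

(* The Marcinkiewicz integral of [G] with respect to the good set: it bounds the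
   contribution of the pairs of points far from [x] where the averages of [G] are
   not controlled. *)
Definition marcinkiewicz (x : R) : \bar R :=
  (\int[mu]_t (G t * (gdist t / (x - t) ^+ 2))%:E)%E.
Local Notation J := marcinkiewicz.
Local Notation B := (`[(-4)%R, 4%R]%classic : set R).

Definition marcinkiewicz_kernel (z : R * R) : R := G z.2 * (gdist z.2 / (z.1 - z.2) ^+ 2).

Lemma marcinkiewicz_kernel_ge0 z : 0 <= marcinkiewicz_kernel z.
Proof. by rewrite /marcinkiewicz_kernel mulr_ge0// divr_ge0 ?gdist_ge0 ?sqr_ge0. Qed.

Lemma measurable_marcinkiewicz_kernel : measurable_fun [set: R * R] marcinkiewicz_kernel.
Proof.
apply: measurable_funM; first by apply: measurableT_comp => //.
apply: measurable_funM; first by apply: (measurableT_comp measurable_gdist).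
apply: (measurableT_comp (@measurable_inv _)).
by apply: (measurable_funX 2); apply: measurable_funB.
Qed.

Lemma measurable_marcinkiewicz : measurable_fun [set: R] J.
Proof.
apply: (@measurable_fun_fubini_tonelli_F _ _ _ _ _ mu (EFin \o marcinkiewicz_kernel)).
  by apply/measurable_EFinP; exact: measurable_marcinkiewicz_kernel.
by move=> z; rewrite lee_fin marcinkiewicz_kernel_ge0.
Qed.

Let mu_B : mu B = 8%:E.
Proof.
rewrite lebesgue_measure_itv/= lte_fin ifT; last by lra.
by rewrite -EFinB; congr EFin; lra.
Qed.

(** This is [integral_kap_le] for the indicator of [B], which has mass 8 in all and at most 2 r in a
    ball of radius r. *)
Let int_kap_B t d : 0 < d -> (\int[mu]_x (\1_B x * kap d (x - t))%:E <= (16 * d)%:E)%E.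
Proof.
move=> d0; rewrite (_ : 16 * d = 8 * 2 * d); last by ring.
apply: (@integral_kap_le _ (\1_B) 2 8) => //.
- by have -> : (\int[mu]_t0 (\1_B t0)%:E = mu B)%E; [rewrite integral_indic// setIT|rewrite mu_B].
- move=> r dr; rewrite integral_indic//; last exact: measurable_ball.
  apply: (@le_trans _ _ (mu (ball t r))).
    apply: le_measure; rewrite ?inE; [|exact: measurable_ball|exact: subIsetr].
    by apply: measurableI => //; exact: measurable_ball.
  by rewrite lebesgue_measure_ball ?lee_fin ?mulr_natl//; lra.
Qed.

(** By Tonelli it suffices to integrate in x first. For x good, |x - t| is at least d = [gdist t],
    so d / (x - t)^2 <= (2/d) [kap d (x - t)], and the weight has integral at most 16 d over [B].
    Points t with d = 0 contribute nothing. *)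
Lemma int_marcinkiewicz : (\int[mu]_(x in E `&` B) J x <= (32 * S)%:E)%E.
Proof.
pose F (z : R * R) : R := \1_(E `&` B) z.1 * marcinkiewicz_kernel z.
have mEB : measurable (E `&` B) by apply: measurableI => //; exact: measurable_good_set.
have mF : measurable_fun [set: R * R] F.
  apply: measurable_funM; last exact: measurable_marcinkiewicz_kernel.
  by apply: (measurableT_comp (measurable_indic _)) => //.
have F0 z : 0 <= F z by rewrite mulr_ge0// marcinkiewicz_kernel_ge0.
rewrite (_ : (\int[mu]_(x in E `&` B) J x)%E = (\int[mu]_x \int[mu]_t (F (x, t))%:E)%E); last first.
  rewrite integral_mkcond; apply: eq_integral => x _; rewrite patchE.
  rewrite /F/= indicE; case: ifPn => _; last by under eq_integral do rewrite mul0r; rewrite integral0.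
  by apply: eq_integral => t _; rewrite mul1r.
rewrite (@fubini_tonelli _ _ _ _ _ mu mu (EFin \o F)); [|exact/measurable_EFinP|by move=> z; rewrite lee_fin].
apply: (@le_trans _ _ (\int[mu]_t (32 * G t)%:E)%E).
  apply: ge0_le_integral => //.
  - by move=> t _; apply: integral_ge0 => x _; rewrite lee_fin.
  - apply: (@measurable_fun_fubini_tonelli_G _ _ _ _ _ mu (EFin \o F)); first exact/measurable_EFinP.
    by move=> z; rewrite lee_fin.
  - by apply/measurable_EFinP; apply: measurable_funM.
  move=> t _.
  have mkt (c : R) : 0 < gdist t -> measurable_fun [set: R] (fun x : R => c * (\1_B x * kap (gdist t) (x - t))).
    move=> d0; apply: measurable_funM => //; apply: measurable_funM; last exact: measurable_kap.
    exact: measurable_indic.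
  rewrite /F/marcinkiewicz_kernel/=.
  have := gdist_ge0 t; rewrite le_eqVlt => /orP[/eqP d0|d0].
    under eq_integral do rewrite -d0 mul0r !mulr0.
    by rewrite integral0 lee_fin mulr_ge0.
  apply: (@le_trans _ _ (\int[mu]_x ((2 / gdist t * G t) * (\1_B x * kap (gdist t) (x - t)))%:E)%E).
    apply: ge0_le_intR => //.
    - exact: (measurable_section2 t mF).
    - exact: mkt.
    - by move=> x _; exact: (F0 (x, t)).
    - move=> x _; rewrite indicI/=.
      rewrite [X in X * _ * _]indicE; case: (boolP (x \in E)) => [/set_mem xE|_]; last first.
        rewrite !mul0r; apply: mulr_ge0; last by rewrite mulr_ge0 ?kap_ge0.
        by apply: mulr_ge0 => //; rewrite divr_ge0// ltW.
      rewrite [leRHS](_ : _ = \1_B x * (G t * (2 / gdist t * kap (gdist t) (x - t)))); last by ring.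
      rewrite mul1r; apply: ler_wpM2l => //; apply: ler_wpM2l => //.
      have h := gdist_le t xE.
      have h2 : gdist t ^+ 2 <= (x - t) ^+ 2.
        by rewrite -[leRHS]real_normK ?num_real// distrC ler_pXn2r ?nnegrE// ltW.
      have h3 := exprn_gt0 2 d0.
      rewrite /kap mulrA ler_pdivlMr ?kap_den_gt0// mulrAC ler_pdivrMr; last lra.
      rewrite (_ : 2 / gdist t * gdist t ^+ 2 = 2 * gdist t); last by field; lra.
      nra.
  rewrite ge0_intRZ//; first last.
  - by rewrite mulr_ge0// divr_ge0// ltW.
  - by move=> x _; rewrite mulr_ge0// kap_ge0.
  - by have := mkt 1 d0; under eq_fun do rewrite mul1r.
  apply: (@le_trans _ _ ((2 / gdist t * G t)%:E * (16 * gdist t)%:E)%E).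
    by apply: lee_wpmul2l; [rewrite lee_fin mulr_ge0// divr_ge0// ltW|exact: int_kap_B].
  rewrite -EFinM lee_fin.
  by rewrite [leLHS](_ : _ = 32 * G t)//; field; exact: lt0r_neq0.
rewrite ge0_intRZ//; rewrite EFinM; apply: lee_wpmul2l => //.
Qed.

(** The interval [B] contains [-pi, pi], the range of the points x considered later. Its measure is
    at most (3 + 32) S / lam: the constant 3 is that of the maximal inequality, and 32 comes from
    Chebyshev's inequality for the Marcinkiewicz integral. *)
Definition bad_set : set R := ~` E `|` ((E `&` B) `&` [set x | (lam%:E < J x)%E]).

Lemma measurable_bad_set : measurable bad_set.
Proof.
apply: measurableU; first by apply: measurableC; exact: measurable_good_set.
have mEB : measurable (E `&` B) by apply: measurableI => //; exact: measurable_good_set.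
apply: emeasurable_fun_o_infty => //.
exact: measurable_funTS measurable_marcinkiewicz.
Qed.

Lemma bad_set_le : (mu bad_set <= (35 * S / lam)%:E)%E.
Proof.
have mEB : measurable (E `&` B) by apply: measurableI => //; exact: measurable_good_set.
have mN : measurable ((E `&` B) `&` [set x | (lam%:E < J x)%E]).
  by apply: emeasurable_fun_o_infty => //; exact: measurable_funTS measurable_marcinkiewicz.
have J0 x : (0 <= J x)%E by apply: integral_ge0 => t _; rewrite lee_fin mulr_ge0// divr_ge0 ?gdist_ge0 ?sqr_ge0.
have hU := @measureU2 _ _ _ mu _ _ (measurableC measurable_good_set) mN.
rewrite /bad_set; apply: (le_trans hU).
rewrite (_ : 35 * S / lam = 3 / lam * S + 32 * S / lam); last by ring.
rewrite EFinD; apply: leeD; first exact: good_setC_le.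
have : (lam%:E * mu ((E `&` B) `&` [set x | (lam%:E < J x)%E]) <= (32 * S)%:E)%E.
  apply: le_trans int_marcinkiewicz.
  have := @le_integral_abse _ _ _ mu _ mEB J lam (measurable_funTS measurable_marcinkiewicz) lam0.
  have -> : (\int[mu]_(x in E `&` B) `|J x| = \int[mu]_(x in E `&` B) J x)%E.
    by apply: eq_integral => x _; rewrite gee0_abs.
  apply: le_trans; apply: lee_wpmul2l; first by rewrite lee_fin ltW.
  apply: le_measure; rewrite ?inE//.
    have -> : (E `&` B) `&` [set x | (lam%:E <= `|J x|)%E] = (E `&` B) `&` [set x | (lam%:E <= J x)%E].
      by congr (_ `&` _); apply/seteqP; split => x /=; rewrite gee0_abs.
    by apply: emeasurable_fun_c_infty => //; exact: measurable_funTS measurable_marcinkiewicz.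
  by move=> x [? /= h]; split => //=; rewrite gee0_abs// ltW.
by rewrite -lee_pdivlMl// => h; apply: (le_trans h); rewrite -EFinM lee_fin mulrC.
Qed.

Lemma bad_setN x : ~ bad_set x -> -4 <= x <= 4 -> E x /\ (J x <= lam%:E)%E.
Proof.
move=> nb x4; have Ex : E x by apply: contrapT => h; apply: nb; left.
by split => //; rewrite leNgt; apply/negP => h; apply: nb; right.
Qed.

Let far x rho (u : R) : R := \1_(~` ball x rho) u / (x - u) ^+ 2.

Let far_ge0 x rho u : 0 <= far x rho u.
Proof. by rewrite divr_ge0 ?sqr_ge0. Qed.

Let mfar x rho : measurable_fun [set: R] (far x rho).
Proof.
apply: measurable_funM; first by apply: measurable_indic; apply: measurableC; exact: measurable_ball.
apply: (measurableT_comp (@measurable_inv _)).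
by apply: (measurable_funX 2); apply: measurable_funB.
Qed.

Let far_kap x rho u : 0 < rho -> far x rho u <= 2 / rho ^+ 2 * kap rho (u - x).
Proof.
move=> r0; rewrite /far indicE; case: (boolP (u \in _)) => [|_]; last first.
  by rewrite mul0r mulr_ge0 ?kap_ge0// divr_ge0 ?sqr_ge0.
rewrite inE /setC/ball/= => /negP; rewrite -leNgt => h.
have h2 : rho ^+ 2 <= (x - u) ^+ 2.
  by rewrite -[leRHS]real_normK ?num_real// ler_pXn2r ?nnegrE// ltW.
have h3 := exprn_gt0 2 r0.
rewrite mul1r /kap mulrA divfK ?lt0r_neq0// -[(u - x)]opprB sqrrN.
rewrite ler_pdivlMr; last lra.
rewrite mulrC ler_pdivrMr; lra.
Qed.

(** The tail of 1/(x - u)^2 is at most 2/rho^2 times the Cauchy weight, whose integral against G is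
    controlled at good points: 32 = 2 * 8 * 2. *)
Lemma good_set_tail x rho : E x -> 0 < rho ->
  (\int[mu]_u (G u * (rho * far x rho u))%:E <= (32 * lam)%:E)%E.
Proof.
move=> Ex r0.
have mk : measurable_fun [set: R] (fun u : R => G u * kap rho (u - x)).
  by apply: measurable_funM => //; exact: measurable_kap.
apply: (@le_trans _ _ (\int[mu]_u (2 / rho * (G u * kap rho (u - x)))%:E)%E).
  apply: ge0_le_intR => //.
  - by apply: measurable_funM => //; apply: measurable_funM => //; exact: mfar.
  - by apply: measurable_funM.
  - by move=> u _; rewrite mulr_ge0// mulr_ge0 ?far_ge0// ltW.
  - move=> u _; rewrite (mulrCA (2 / rho)) ler_wpM2l//.
    have := ler_wpM2l (ltW r0) (far_kap x u r0); move/le_trans; apply.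
    by rewrite le_eqVlt; apply/orP; left; apply/eqP; field; exact: lt0r_neq0.
rewrite ge0_intRZ//; [|by move=> u _; rewrite mulr_ge0// kap_ge0|by rewrite divr_ge0// ltW].
apply: (@le_trans _ _ ((2 / rho)%:E * (8 * (2 * lam) * rho)%:E)%E).
  apply: lee_wpmul2l; first by rewrite lee_fin divr_ge0// ltW.
  apply: (integral_kap_le _ _ GS) => //; first by rewrite mulr_ge0// ltW.
  by move=> r rr; apply: good_set_ball => //; exact: lt_le_trans rr.
rewrite -EFinM lee_fin le_eqVlt; apply/orP; left; apply/eqP; field; exact: lt0r_neq0.
Qed.

Let H rho (z : R * R) : R := G z.1 * G z.2 * kap rho (z.2 - z.1).

(** The inequality 2 p q <= p^2 + q^2 and the symmetry of the kernel reduce the two factors 1/|x -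
    u| and 1/|x - v| to a single 1/(x - u)^2. The inner integral in v is then at most 48 lam (rho +
    [gdist u]); the rho part is a tail, at most 32 lam, and the other is the Marcinkiewicz integral
    at x, at most lam. Hence 1584 = 48 * 33. *)
Lemma far_far_le x rho : ~ bad_set x -> -4 <= x <= 4 -> 0 < rho ->
  (\int[mu]_u \int[mu]_v
    (\1_(~` ball x rho) u * \1_(~` ball x rho) v *
     (G u * G v * (`|x - u|^-1 * `|x - v|^-1)) * kap rho (v - u))%:E
     <= (1584 * lam ^+ 2)%:E)%E.
Proof.
move=> nb x4 r0; have [Ex Jx] := bad_setN nb x4.
pose a (z : R * R) : R := far x rho z.1 * H rho z.
have mH : measurable_fun [set: R * R] (H rho).
  apply: measurable_funM.
    by apply: measurable_funM; apply: (measurableT_comp mG).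
  have mk0 : measurable_fun [set: R] (fun t : R => kap rho (t - 0)) by exact: measurable_kap.
  have := measurableT_comp mk0 (measurable_funB (@measurable_snd _ _ R R) (@measurable_fst _ _ R R)).
  by rewrite /comp/=; under eq_fun do rewrite subr0.
have mfar1 : measurable_fun [set: R * R] (fun z : R * R => far x rho z.1).
  by apply: (measurableT_comp (mfar x rho)).
have mfar2 : measurable_fun [set: R * R] (fun z : R * R => far x rho z.2).
  by apply: (measurableT_comp (mfar x rho)).
have H0 z : 0 <= H rho z by rewrite /H mulr_ge0 ?kap_ge0// mulr_ge0.
have ma : measurable_fun [set: R * R] a by apply: measurable_funM.
have a0 z : 0 <= a z by rewrite mulr_ge0// far_ge0.
have HC u v : H rho (u, v) = H rho (v, u).
  by rewrite /H/= (mulrC (G u)) -[(v - u)]opprB kapN.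
have bound : (\int[mu]_u \int[mu]_v (a (u, v))%:E <= (1584 * lam ^+ 2)%:E)%E.
  apply: (@le_trans _ _ (\int[mu]_u (48 * lam * (G u * (rho * far x rho u)) +
     48 * lam * (G u * (gdist u / (x - u) ^+ 2)))%:E)%E).
    apply: ge0_le_integral => //.
    - by move=> u _; apply: integral_ge0 => v _; rewrite lee_fin.
    - apply: (@measurable_fun_fubini_tonelli_F _ _ _ _ _ mu (EFin \o a)); first exact/measurable_EFinP.
      by move=> z; rewrite lee_fin.
    - apply/measurable_EFinP; apply: measurable_funD; apply: measurable_funM => //.
        by apply: measurable_funM => //; apply: measurable_funM => //; exact: mfar.
      exact: (measurable_section1 x measurable_marcinkiewicz_kernel).
    move=> u _; rewrite /a/H/=.
    (* Averages of G around u are not controlled at scales below [gdist u]. Enlarging the scale to r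
       makes them so, at the price of the term [gdist u] in the bound. *)
    pose r := Num.max rho (gdist u).
    have rr : rho <= r by rewrite le_max lexx.
    have r_gt0 : 0 < r by exact: lt_le_trans rr.
    apply: (@le_trans _ _ (\int[mu]_v (far x rho u * G u * (G v * kap r (v - u)))%:E)%E).
      apply: ge0_le_intR => //.
      - exact: (measurable_section1 u ma).
      - apply: measurable_funM => //; apply: measurable_funM => //; exact: measurable_kap.
      - by move=> v _; exact: (a0 (u, v)).
      - move=> v _.
        rewrite (_ : far x rho u * (_ * _) = far x rho u * G u * G v * kap rho (v - u)); last by ring.
        rewrite (_ : far x rho u * G u * (_ * _) = far x rho u * G u * G v * kap r (v - u)); last by ring.
        by rewrite ler_wpM2l ?kap_homo// mulr_ge0// mulr_ge0// far_ge0.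
    rewrite ge0_intRZ//; first last.
    - by rewrite mulr_ge0// far_ge0.
    - by move=> v _; rewrite mulr_ge0// kap_ge0.
    - by apply: measurable_funM => //; exact: measurable_kap.
    apply: (@le_trans _ _ ((far x rho u * G u)%:E * (8 * (6 * lam) * r)%:E)%E).
      apply: lee_wpmul2l; first by rewrite lee_fin mulr_ge0// far_ge0.
      apply: (integral_kap_le _ _ GS) => //; first by rewrite mulr_ge0// ltW.
      move=> s rs; apply: (gdist_ball Ex); first exact: lt_le_trans rs.
      by apply: le_trans rs; rewrite le_max lexx orbT.
    rewrite -EFinM lee_fin.
    have fle : far x rho u <= (x - u) ^- 2.
      by rewrite /far indicE; case: (_ \in _); rewrite ?mul1r// mul0r invr_ge0 sqr_ge0.
    have hr : r <= rho + gdist u.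
      by rewrite ge_max lerDl lerDr gdist_ge0 ltW.
    apply: (@le_trans _ _ (far x rho u * G u * (8 * (6 * lam) * (rho + gdist u)))).
      apply: ler_wpM2l; first by rewrite mulr_ge0// far_ge0.
      by apply: ler_wpM2l hr; have := ltW lam0; lra.
    have := far_ge0 x rho u; set F := far x rho u in fle *; move=> F0.
    rewrite (_ : F * G u * (8 * (6 * lam) * (rho + gdist u)) =
      48 * lam * (G u * (rho * F)) + 48 * lam * (G u * (gdist u * F))); last by ring.
    rewrite lerD2l ler_wpM2l//; first by rewrite mulr_ge0// ltW.
    by rewrite ler_wpM2l// ler_wpM2l// gdist_ge0.
  have l48 : 0 <= 48 * lam by rewrite mulr_ge0// ltW.
  have p1 u : 0 <= G u * (rho * far x rho u).
    by rewrite mulr_ge0// mulr_ge0 ?far_ge0// ltW.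
  have p2 u : 0 <= G u * (gdist u / (x - u) ^+ 2).
    by rewrite mulr_ge0// divr_ge0 ?gdist_ge0 ?sqr_ge0.
  have m1 : measurable_fun [set: R] (fun u : R => G u * (rho * far x rho u)).
    by apply: measurable_funM => //; apply: measurable_funM => //; exact: mfar.
  have m2 : measurable_fun [set: R] (fun u : R => G u * (gdist u / (x - u) ^+ 2)).
    exact: (measurable_section1 x measurable_marcinkiewicz_kernel).
  rewrite ge0_intRD//; [|exact: measurable_funM|exact: measurable_funM|by move=> u _; rewrite mulr_ge0|by move=> u _; rewrite mulr_ge0].
  rewrite !ge0_intRZ//.
  apply: (@le_trans _ _ ((48 * lam)%:E * (32 * lam)%:E + (48 * lam)%:E * lam%:E)%E).
    by apply: leeD; apply: lee_wpmul2l; rewrite ?lee_fin//; exact: good_set_tail.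
  rewrite -!EFinM -EFinD lee_fin; lra.
pose a' (z : R * R) := a (z.2, z.1).
have ma' : measurable_fun [set: R * R] a'.
  by apply: measurableT_comp; [exact: ma|exact: measurable_fun_pair].
pose b (z : R * R) := \1_(~` ball x rho) z.1 * \1_(~` ball x rho) z.2 *
     (G z.1 * G z.2 * (`|x - z.1|^-1 * `|x - z.2|^-1)) * kap rho (z.2 - z.1).
have mf : measurable_fun [set: R] (fun u : R => \1_(~` ball x rho) u * `|x - u|^-1).
  apply: measurable_funM; first by apply: measurable_indic; apply: measurableC; exact: measurable_ball.
  apply: (measurableT_comp (@measurable_inv _)).
  by apply: measurableT_comp => //; apply: measurable_funB.
have bE z : b z = (\1_(~` ball x rho) z.1 * `|x - z.1|^-1) * (\1_(~` ball x rho) z.2 * `|x - z.2|^-1) * H rho z.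
  by rewrite /b/H; ring.
have mb : measurable_fun [set: R * R] b.
  rewrite (funext bE); apply: measurable_funM => //.
  by apply: measurable_funM; apply: (measurableT_comp mf).
have b0 z : 0 <= b z by rewrite bE; apply: mulr_ge0 => //; apply: mulr_ge0; rewrite divr_ge0.
rewrite -[leLHS](@fubini_tonelli1 _ _ _ _ _ mu mu (EFin \o b)); [|exact/measurable_EFinP|by move=> z; rewrite lee_fin].
apply: (@le_trans _ _ (\int[(mu \x mu)%E]_z (2^-1 * (a z + a' z))%:E)%E).
  apply: ge0_le_intR => //; first by apply: measurable_funM => //; exact: measurable_funD.
  move=> [u v] _; rewrite bE /a'/a/= -(HC u v) -mulrDl [leRHS]mulrA.
  apply: ler_wpM2r => //.
  have sq w : far x rho w = (\1_(~` ball x rho) w * `|x - w|^-1) ^+ 2.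
    by rewrite exprMn exprVn real_normK ?num_real// /far indicE; case: (_ \in _); rewrite ?expr1n ?expr0n.
  rewrite !sq; move: (_ / `|x - u|) (_ / `|x - v|) => p q.
  by have := sqr_ge0 (p - q); rewrite sqrrB -mulr_natr; lra.
have a'0 z : 0 <= a' z by exact: a0.
rewrite ge0_intRZ//; [|exact: measurable_funD|by move=> z _; rewrite addr_ge0].
rewrite ge0_intRD//.
have -> : (\int[(mu \x mu)%E]_z (a' z)%:E = \int[(mu \x mu)%E]_z (a z)%:E)%E.
  rewrite (@fubini_tonelli1 _ _ _ _ _ mu mu (EFin \o a')); [|exact/measurable_EFinP|by move=> z; rewrite lee_fin].
  by rewrite (@fubini_tonelli2 _ _ _ _ _ mu mu (EFin \o a)); [|exact/measurable_EFinP|by move=> z; rewrite lee_fin].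
rewrite (@fubini_tonelli1 _ _ _ _ _ mu mu (EFin \o a)); [|exact/measurable_EFinP|by move=> z; rewrite lee_fin].
apply: (@le_trans _ _ (2^-1%:E * ((1584 * lam ^+ 2)%:E + (1584 * lam ^+ 2)%:E))%E).
  by apply: lee_wpmul2l; [rewrite lee_fin|apply: leeD].
rewrite -EFinD -EFinM lee_fin; lra.
Qed.

End CalderonZygmundSet.

(** * Bounded integrands and sums of squared integrals *)

Section RealIntegrals.
Context d (T : measurableType d) (R : realType) (m : {measure set T -> \bar R}).
Implicit Types (A : set T) (f g w : T -> R).

Lemma bounded_integrable A f (M : R) : measurable A -> (m A < +oo)%E -> measurable_fun A f ->
  (forall x, A x -> `|f x| <= M) -> m.-integrable A (EFin \o f).
Proof.
move=> mA Aoo mf fM; apply: measurable_bounded_integrable => //.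
exists M; split; first exact: num_real.
by move=> x Mx y Ay /=; rewrite (le_trans (fM _ Ay))// ltW.
Qed.

Lemma normr_Rintegral_le A f (r : R) : measurable A -> m.-integrable A (EFin \o f) ->
  (\int[m]_(x in A) (`|f x|)%:E <= r%:E)%E -> `|Rintegral m A f| <= r.
Proof.
move=> mA fi h; rewrite -lee_fin EFin_normr_Rintegral//.
apply: le_trans (le_abse_integral _ mA _) _; first by case/integrableP: fi.
exact: h.
Qed.

Lemma Rintegral_fsum A (I : Type) (s : seq I) (F : I -> T -> R) : measurable A ->
  (forall i, m.-integrable A (EFin \o F i)) ->
  Rintegral m A (fun x => \sum_(i <- s) F i x) = \sum_(i <- s) Rintegral m A (F i).
Proof.
move=> mA Fi; elim: s => [|i s IH].
  rewrite big_nil; under eq_Rintegral do rewrite big_nil.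
  by rewrite Rintegral_cst// mul0r.
rewrite big_cons -IH; under eq_Rintegral do rewrite big_cons.
rewrite RintegralD//.
rewrite [X in m.-integrable _ X](_ : _ = (fun x => \sum_(i <- s) (F i x)%:E)%E).
  by apply: integrable_sum => // i0 _; exact: Fi.
by apply/funext => x /=; rewrite sumEFin.
Qed.

(** Each square is the double integral of w(u) w(v) c_i(u) c_i(v). Absolute values are taken only
    after summation over i, which preserves the cancellation in the kernel sum_i c_i(u) c_i(v). *)
Lemma sum_sqr_Rintegral_le A (I : Type) (s : seq I) (c : I -> T -> R) w (M : R) :
  measurable A -> (m A < +oo)%E ->
  measurable_fun A w -> (forall x, A x -> `|w x| <= M) ->
  (forall i, measurable_fun A (c i)) -> (forall i x, `|c i x| <= 1) ->
  measurable_fun A (fun u => \int[m]_(v in A)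
      (`|w u| * `|w v| * `|\sum_(i <- s) c i u * c i v|)%:E)%E ->
  ((\sum_(i <- s) (Rintegral m A (fun u => w u * c i u)) ^+ 2)%:E <=
   \int[m]_(u in A) \int[m]_(v in A)
      (`|w u| * `|w v| * `|\sum_(i <- s) c i u * c i v|)%:E)%E.
Proof.
move=> mA Aoo mw wM mc c1 mK.
pose J i := Rintegral m A (fun u => w u * c i u).
have wc i : m.-integrable A (EFin \o (fun u => w u * c i u)).
  apply: (@bounded_integrable _ _ M) => //; first exact: measurable_funM.
  move=> x Ax; rewrite normrM -[leRHS]mulr1; apply: ler_pM => //; exact: wM.
have M0 x : A x -> 0 <= M by move=> Ax; apply: le_trans (wM _ Ax).
pose C u := \sum_(i <- s) J i * c i u.
have mC : measurable_fun A C.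
  by apply: measurable_sum => i; apply: measurable_funM.
have CB u : `|C u| <= \sum_(i <- s) `|J i|.
  apply: (le_trans (ler_norm_sum _ _ _)); apply: ler_sum => i _.
  by rewrite normrM -[leRHS]mulr1; apply: ler_pM.
have eqL : \sum_(i <- s) J i ^+ 2 = Rintegral m A (fun u => w u * C u).
  rewrite /C; under eq_Rintegral do rewrite mulr_sumr.
  rewrite Rintegral_fsum//.
    apply: eq_bigr => i _; rewrite expr2 {2}/J -RintegralZl//.
    by apply: eq_Rintegral => u _; rewrite mulrCA.
  move=> i; apply: (@bounded_integrable _ _ (M * `|J i|)) => //.
    by apply: measurable_funM => //; apply: measurable_funM.
  move=> x Ax; rewrite !normrM; apply: ler_pM => //; first exact: wM.
  by rewrite -[leRHS]mulr1; apply: ler_pM.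
have wCi : m.-integrable A (EFin \o (fun u => w u * C u)).
  apply: (@bounded_integrable _ _ (M * \sum_(i <- s) `|J i|)) => //; first exact: measurable_funM.
  by move=> x Ax; rewrite normrM; apply: ler_pM => //; exact: wM.
rewrite eqL; apply: (@le_trans _ _ (`|Rintegral m A (fun u => w u * C u)|)%:E).
  by rewrite lee_fin ler_norm.
rewrite EFin_normr_Rintegral//; apply: le_trans (le_abse_integral _ mA _) _.
  by case/integrableP: wCi.
apply: ge0_le_integral => //.
- apply/measurable_EFinP; apply: measurableT_comp => //; exact: measurable_funM.
move=> u Au.
rewrite (_ : C u = Rintegral m A (fun v => w v * \sum_(i <- s) c i u * c i v)); last first.
  rewrite /C; under [in RHS]eq_Rintegral do rewrite mulr_sumr.
  rewrite Rintegral_fsum//.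
    apply: eq_bigr => i _; rewrite /J mulrC -RintegralZl//.
    by apply: eq_Rintegral => v _; rewrite mulrCA.
  move=> i; apply: (@bounded_integrable _ _ M) => //.
    by apply: measurable_funM => //; apply: measurable_funM.
  move=> x Ax; rewrite !normrM -[leRHS]mulr1; apply: ler_pM => //; first exact: wM.
  by rewrite -[leRHS]mulr1; apply: ler_pM.
have mKu : measurable_fun A (fun v => \sum_(i <- s) c i u * c i v).
  by apply: measurable_sum => i; apply: measurable_funM.
have KB v : `|\sum_(i <- s) c i u * c i v| <= \sum_(i <- s) 1.
  apply: (le_trans (ler_norm_sum _ _ _)); apply: ler_sum => i _.
  by rewrite normrM -[leRHS]mulr1; apply: ler_pM.
have wKi : m.-integrable A (EFin \o (fun v => w v * \sum_(i <- s) c i u * c i v)).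
  apply: (@bounded_integrable _ _ (M * \sum_(i <- s) 1)) => //; first exact: measurable_funM.
  by move=> x Ax; rewrite normrM; apply: ler_pM => //; exact: wM.
rewrite /= normrM EFinM EFin_normr_Rintegral//.
rewrite [leRHS](_ : _ = \int[m]_(v in A) (`|w u|%:E *
    (`|w v| * `|\sum_(i <- s) c i u * c i v|)%:E))%E; last first.
  by apply: eq_integral => v _; rewrite -EFinM mulrA.
rewrite ge0_integralZl_EFin//; last first.
  apply/measurable_EFinP; apply: measurable_funM; exact: measurableT_comp.
apply: lee_wpmul2l; first by rewrite lee_fin.
apply: le_trans (le_abse_integral _ mA _) _; first by case/integrableP: wKi.
by under eq_integral do rewrite /= normrM.
Qed.

End RealIntegrals.

(** * Convolutions over a period and kernel bounds *)

Section ConjugateSums.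
Context {R : realType}.
Local Notation mu := (@lebesgue_measure R).
Implicit Types (g : R -> R) (x u v t rho : R) (a l n : nat).

(** Centred at x, so that x - u stays in [-pi, pi], where sin((x - u)/2) is bounded below by a
    multiple of |x - u|. *)
Definition period x : set R := `[x - pi, x + pi]%classic.

(** With the factor 1/pi, the kernels [cdirichlet] and [cpoisson] act on frequencies as conjugation
    multipliers, while [poisson] acts with an additional factor 2. *)
Definition conv (k g : R -> R) x : R :=
  pi^-1 * Rintegral mu (period x) (fun u => g u * k (x - u)).

Lemma measurable_period x : measurable (period x : set (measurableTypeR R)).
Proof. exact: measurable_itv. Qed.

Lemma period_lty x : (mu (period x) < +oo)%E.
Proof.
rewrite lebesgue_measure_itv/= lte_fin; case: ifP => _; last exact: ltry.
by rewrite -EFinB ltry.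
Qed.

Lemma periodP x u : period x u -> `|x - u| <= pi.
Proof. by rewrite /period/= in_itv/= ler_norml => /andP[? ?]; apply/andP; split; lra. Qed.

Lemma pi_le4 : (pi : R) <= 4.
Proof. by have := @pihalf_lt2 R; lra. Qed.

Lemma invpi_le1 : (pi : R)^-1 <= 1.
Proof. by rewrite invf_le1 ?pi_gt0//; have := @pi_ge2 R; lra. Qed.

Lemma measurable_sin : measurable_fun [set: R] (@sin R).
Proof. by apply: continuous_measurable_fun; exact: continuous_sin. Qed.

Lemma measurable_cos : measurable_fun [set: R] (@cos R).
Proof. by apply: continuous_measurable_fun; exact: continuous_cos. Qed.

Lemma measurable_cdirichlet n : measurable_fun [set: R] (cdirichlet n).
Proof.
apply: measurable_sum => k; apply: (measurableT_comp measurable_sin).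
by apply: measurable_funM.
Qed.

Lemma measurable_cpoisson (r : R) : measurable_fun [set: R] (cpoisson r).
Proof.
apply: measurable_funM; first by apply: measurable_funM => //; exact: measurable_sin.
apply: (measurableT_comp (@measurable_inv _)).
apply: measurable_funD => //; apply: measurable_funB => //.
by apply: measurable_funM => //; exact: measurable_cos.
Qed.

Lemma measurable_reflect (k : R -> R) x : measurable_fun [set: R] k ->
  measurable_fun [set: R] (fun u : R => k (x - u)).
Proof. by move=> mk; apply: (measurableT_comp mk); apply: measurable_funB. Qed.

(** From (r sin t)^2 <= 2 r (1 - cos t) the denominator is at least (1 - r)^2 + (r sin t)^2, hence
    at least 2 (1 - r) |r sin t|. *)
Lemma cpoisson_le (r t : R) : 0 <= r < 1 -> `|cpoisson r t| <= (2 * (1 - r))^-1.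
Proof.
move=> r01; have D0 := poisson_den_gt0 t r01; have /andP[r0 r1] := r01.
rewrite /cpoisson normrM normfV (gtr0_norm D0) ler_pdivrMr// [leRHS]mulrC ler_pdivlMr; last lra.
have s2 : (r * sin t) ^+ 2 <= 2 * r * (1 - cos t).
  rewrite exprMn sin2cos2 (_ : 1 - cos t ^+ 2 = (1 - cos t) * (1 + cos t)); last by ring.
  have h1 : 0 <= 1 - cos t by rewrite subr_ge0 cos_le1.
  have h2 : 1 + cos t <= 2 by have := cos_le1 t; lra.
  have h3 : r ^+ 2 <= r by rewrite expr2 ler_piMr// ltW.
  have h4 := cos_geN1 t.
  apply: (@le_trans _ _ (r * ((1 - cos t) * 2))); last by lra.
  have h5 : 0 <= 1 + cos t by lra.
  have h6 : (1 - cos t) * (1 + cos t) <= (1 - cos t) * 2 by exact: ler_wpM2l.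
  by apply: ler_pM h6 => //; exact: sqr_ge0.
rewrite poisson_denE.
have := sqr_ge0 (1 - r - `|r * sin t|); rewrite -[(r * sin t) ^+ 2]real_normK ?num_real// in s2.
by nra.
Qed.

(** With s = sin(v/2) and c = cos(v/2) the difference is exactly c (1 - r)^2 / (2 s D), where D is
    the Poisson denominator. Since |s| >= |v|/4 and D >= v^2/16, it is at most 32 (1 - r)^2 / |v|^3,
    and one factor (1 - r)/|v| is at most 1. *)
Lemma hcot_cpoisson_le (r v : R) : 0 <= r < 1 -> 1 - r <= `|v| -> `|v| <= pi ->
  `|cos (v / 2) / (2 * sin (v / 2)) - cpoisson r v| <= 32 * (1 - r) / v ^+ 2.
Proof.
move=> r01 rv vpi; have D0 := poisson_den_gt0 v r01; have /andP[r0 r1] := r01.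
set s := sin (v / 2); set c := cos (v / 2).
have v0 : 0 < `|v| by apply: lt_le_trans rv; lra.
have hs : `|v| / 4 <= `|s| by exact: normr_sin_half_ge.
have s0 : s != 0 by rewrite -normr_gt0; lra.
have ev : v = (v / 2) *+ 2 by rewrite -mulr_natr; field.
have sv : sin v = 2 * s * c by rewrite [in LHS]ev sin_mulr2n -mulr_natr -/s -/c; ring.
have cv : cos v = 1 - 2 * s ^+ 2.
  by rewrite [in LHS]ev cos_mulr2n -mulr_natr -/c cos2sin2 -/s; ring.
set D := 1 - 2 * r * cos v + r ^+ 2 in D0.
have DE : D = (1 - r) ^+ 2 + 4 * r * s ^+ 2 by rewrite /D cv; ring.
have -> : c / (2 * s) - cpoisson r v = c * (1 - r) ^+ 2 / (2 * s * D).
  rewrite /cpoisson -/D sv; move: (lt0r_neq0 D0) => Dn0.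
  have -> : c * (1 - r) ^+ 2 = c * (D - 4 * r * s ^+ 2) by rewrite DE; ring.
  by field; rewrite s0 Dn0.
(* Both terms of D are at least their coefficient times v^2/16, because v^2/16 <= 1, and (1 - r)^2 +
   4 r = (1 + r)^2 >= 1. *)
have D1 : v ^+ 2 / 16 <= D.
  have s2 : v ^+ 2 / 16 <= s ^+ 2.
    rewrite -(real_normK (num_real v)) -(real_normK (num_real s)).
    rewrite (_ : _ / 16 = (`|v| / 4) ^+ 2); last by field.
    by rewrite ler_pXn2r ?nnegrE// divr_ge0.
  have v16 : v ^+ 2 <= 16.
    rewrite -(real_normK (num_real v)) (_ : 16 = 4 ^+ 2); last by rewrite expr2; ring.
    by rewrite ler_pXn2r ?nnegrE//; exact: le_trans pi_le4.
  rewrite DE; have h1 : 4 * r * (v ^+ 2 / 16) <= 4 * r * s ^+ 2 by apply: ler_wpM2l => //; lra.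
  have h2 := sqr_ge0 (1 - r).
  have h3 : (1 - r) ^+ 2 * (v ^+ 2 / 16) <= (1 - r) ^+ 2 by rewrite ler_piMr//; lra.
  have h4 := sqr_ge0 v; nra.
have -> : `|c * (1 - r) ^+ 2 / (2 * s * D)| = `|c| * (1 - r) ^+ 2 / (2 * `|s| * D).
  rewrite normrM normfV [`|c * _|]normrM [`|2 * s * D|]normrM [`|2 * s|]normrM.
  by rewrite (ger0_norm (sqr_ge0 (1 - r))) (gtr0_norm D0) (ger0_norm (ler0n R 2)).
have e0 : 0 < 1 - r by lra.
have c1 : `|c| <= 1 by exact: cos_max.
rewrite ler_pdivrMr; last by rewrite !mulr_gt0// normr_gt0.
have v2 : v ^+ 2 = `|v| ^+ 2 by rewrite real_normK ?num_real.
have v20 : 0 < v ^+ 2 by rewrite v2 exprn_gt0.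
apply: (@le_trans _ _ ((1 - r) ^+ 2)); first by rewrite ler_piMl ?sqr_ge0.
apply: (@le_trans _ _ (32 * (1 - r) / v ^+ 2 * (2 * (`|v| / 4) * (v ^+ 2 / 16)))).
  rewrite (_ : _ * (2 * _ * _) = (1 - r) * `|v|); last by field; rewrite -normr_gt0.
  by rewrite expr2 ler_pM2l.
apply: ler_wpM2l; first by rewrite divr_ge0 ?sqr_ge0// mulr_ge0// ltW.
by apply: ler_pM; rewrite ?divr_ge0 ?sqr_ge0 ?mulr_ge0//; lra.
Qed.

(** The number of terms bounds the kernel by 4 l^2 and the sine bounds it by 16/u^2; adding the two
    estimates, after multiplication by 1/l^2 and u^2, gives 20 = 4 + 16. *)
Lemma fejer_kernel_le l u : (0 < l)%N -> `|u| <= pi ->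
  (\sum_(0 <= k < l.*2) cos (k%:R * u)) ^+ 2 +
  (\sum_(0 <= k < l.*2) sin (k%:R * u)) ^+ 2 <= 20 * l%:R ^+ 2 * kap l%:R^-1 u.
Proof.
move=> l0 upi; set K := _ + _.
have h1 : K <= (l.*2)%:R ^+ 2 by exact: sqr_sum_cos_sin_le.
have h2 : sin (u / 2) ^+ 2 * K <= 1 by exact: sqr_sum_cos_sin_sin.
have K0 : 0 <= K by rewrite addr_ge0 ?sqr_ge0.
have l0' : 0 < l%:R :> R by rewrite ltr0n.
have h3 : u ^+ 2 / 16 <= sin (u / 2) ^+ 2.
  rewrite -(real_normK (num_real u)) -(real_normK (num_real (sin _))).
  rewrite (_ : _ / 16 = (`|u| / 4) ^+ 2); last by field.
  rewrite ler_pXn2r ?nnegrE// ?divr_ge0//; exact: normr_sin_half_ge.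
have h4 : u ^+ 2 * K <= 16 by have := ler_wpM2r K0 h3; lra.
have h5 : K / l%:R ^+ 2 <= 4.
  rewrite ler_pdivrMr ?exprn_gt0//; apply: (le_trans h1).
  by rewrite -muln2 natrM; lra.
rewrite /kap exprVn (_ : 20 * l%:R ^+ 2 * _ = 20 / (l%:R ^- 2 + u ^+ 2)); last first.
  by rewrite mulrA -(mulrA 20) mulfV ?mulr1// expf_neq0// lt0r_neq0.
rewrite ler_pdivlMr; first by lra.
by rewrite ltr_pwDl ?invr_gt0 ?exprn_gt0 ?sqr_ge0.
Qed.

(** For each of the first l values of m, the index k - m runs through 0, ..., l - 1. Replacing the
    window sum by this double sum of differences turns a Dirichlet kernel into a Fejer kernel, which
    is nonnegative and decays like 1/u^2. *)
Lemma sum_window_le l (F : R -> R) : (forall y, 0 <= F y) ->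
  l%:R * (\sum_(0 <= q < l) F q%:R) <=
  \sum_(0 <= m < l.*2) \sum_(0 <= k < l.*2) F (k%:R - m%:R).
Proof.
move=> F0; apply: (@le_trans _ _ (\sum_(0 <= m < l) \sum_(0 <= k < l.*2) F (k%:R - m%:R))).
  rewrite mulrC mulr_natr -[X in _ *+ X]subn0 -sumr_const_nat.
  apply: ler_sum_nat => m /andP[_ ml].
  rewrite (@big_cat_nat _ _ _ m 0 l.*2)//=; last by rewrite -addnn ltnW// ltn_addr.
  rewrite (@big_cat_nat _ _ _ (m + l)%N m l.*2)//=; [|exact: leq_addr|by rewrite -addnn leq_add2r ltnW].
  rewrite -[leLHS]add0r -[leLHS]addr0 -addrA.
  apply: lerD; first exact: sumr_ge0.
  apply: lerD; last exact: sumr_ge0.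
  have := @big_addn R 0 +%R 0%N (m + l)%N m xpredT (fun i => F (i%:R - m%:R)).
  rewrite add0n addKn => ->.
  by apply: ler_sum => q _; rewrite natrD addrK.
rewrite [leRHS](@big_cat_nat _ _ _ l)//=; last by rewrite -addnn leq_addr.
by rewrite lerDl; apply: sumr_ge0 => m _; apply: sumr_ge0.
Qed.

End ConjugateSums.

(** * Oscillation of conjugate partial sums over a window *)

Section WindowEstimate.
Context {R : realType}.
Local Notation mu := (@lebesgue_measure R).
Variables (g : R -> R) (M S lam : R).
Hypotheses (mg : measurable_fun [set: R] g) (gM : forall u, `|g u| <= M).

(** Integrable on the line and equal to |g| on the period around any x in [-pi, pi]. The interval
    consists of three whole periods, so that its mass is three times that of |g| over one. *)
Definition cutoff (u : R) : R := `|g u| * \1_(`[- (3 * pi), 3 * pi]%classic : set R) u.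
Local Notation G := cutoff.

Hypotheses (GS : (\int[mu]_t (G t)%:E <= S%:E)%E) (lam0 : 0 < lam).

Lemma measurable_cutoff : measurable_fun [set: R] G.
Proof.
apply: measurable_funM; first exact: measurableT_comp.
by apply: measurable_indic; exact: measurable_itv.
Qed.

Lemma cutoff_ge0 u : 0 <= G u.
Proof. by rewrite mulr_ge0. Qed.

Lemma cutoff_period x u : - pi <= x <= pi -> period x u -> G u = `|g u|.
Proof.
move=> /andP[x1 x2]; rewrite /period/= in_itv/= => /andP[u1 u2].
by rewrite /G indicE mem_set ?mulr1//= in_itv/=; have := @pi_ge0 R => ?; apply/andP; split; lra.
Qed.

Variables (x : R).
Hypotheses (xpi : - pi <= x <= pi) (xbad : ~ bad_set G lam x).

Let x4 : -4 <= x <= 4.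
Proof. by move/andP: xpi => [? ?]; have := @pi_le4 R => ?; apply/andP; split; lra. Qed.

Let Ex : good_set G lam x := (bad_setN xbad x4).1.

Let M0 : 0 <= M.
Proof. exact: le_trans (gM 0). Qed.

Variable l : nat.
Hypothesis l0 : (0 < l)%N.
(** The splitting radius: kernels whose orders lie in a common window of length l differ by at most
    l, which is harmless on a ball of radius 1/l around a good point. *)
Let rho : R := l%:R^-1.

Let l0' : 0 < l%:R :> R.
Proof. by rewrite ltr0n. Qed.

Let rho0 : 0 < rho.
Proof. by rewrite invr_gt0. Qed.

Let far (u : R) : R := \1_(~` ball x rho) u.
Let near (u : R) : R := \1_(ball x rho) u.

Let near_far u : near u + far u = 1.
Proof. by rewrite /near/far !indicE in_setC; case: (_ \in _); rewrite ?addr0 ?add0r. Qed.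

Let mfar : measurable_fun [set: R] far.
Proof. by apply: measurable_indic; apply: measurableC; exact: measurable_ball. Qed.

Let mnear : measurable_fun [set: R] near.
Proof. by apply: measurable_indic; exact: measurable_ball. Qed.

Let farP u : far u = 0 \/ (far u = 1 /\ rho <= `|x - u|).
Proof.
rewrite /far indicE; case: (boolP (u \in _)) => [|_]; last by left.
by rewrite inE /setC/ball/= => /negP; rewrite -leNgt; right.
Qed.

Let w (u : R) : R := g u * far u / (2 * sin ((x - u) / 2)).

Let mw : measurable_fun [set: R] w.
Proof.
apply: measurable_funM; first exact: measurable_funM.
apply: (measurableT_comp (@measurable_inv _)); apply: measurable_funM => //.
apply: (measurableT_comp (@measurable_sin _)); apply: measurable_funM => //.
exact: measurable_funB.
Qed.

Let w_le u : period x u -> `|w u| <= 2 * (far u * (G u * `|x - u|^-1)).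
Proof.
move=> pu; rewrite (cutoff_period xpi pu) /w; have [->|[-> hu]] := farP u.
  by rewrite mulr0 !mul0r normr0 mulr0.
rewrite mulr1 mul1r normrM mulrCA ler_wpM2l// normfV.
have v0 : 0 < `|x - u| by exact: lt_le_trans hu.
have h := normr_sin_half_ge (periodP pu).
rewrite -[leRHS]invrK invfM invrK lef_pV2 ?posrE ?normr_gt0; last 2 first.
- by rewrite mulf_neq0// -normr_gt0; lra.
- by rewrite mulr_gt0.
by rewrite normrM ger0_norm//; lra.
Qed.

Let wM u : period x u -> `|w u| <= 2 * M * l%:R.
Proof.
move=> pu; apply: (le_trans (w_le pu)); rewrite -mulrA ler_wpM2l//.
have [->|[-> hu]] := farP u; first by rewrite mul0r mulr_ge0// ltW.
have v0 : 0 < `|x - u| by exact: lt_le_trans hu.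
rewrite mul1r (cutoff_period xpi pu); rewrite ?mul1r; apply: ler_pM => //.
by rewrite -[leRHS]invrK lef_pV2 ?posrE.
Qed.

(** Only one side of x is considered at a time, so that two points differ by at most pi and
    [fejer_kernel_le] applies to their difference. The sum of squares becomes a double integral
    against a Fejer kernel of order 2 l, which the Cauchy weight at scale 1/l dominates, and
    [far_far_le] bounds it. *)
Let side_sum (A : set R) a : measurable A ->
  (forall u v, A u -> A v -> `|u - v| <= pi) ->
  \sum_(0 <= q < l) (Rintegral mu (period x)
    (fun u => w u * \1_A u * cos ((a%:R + q%:R + 1 / 2) * (x - u)))) ^+ 2
  <= l%:R * (80 * 1584 * lam ^+ 2).
Proof.
move=> mA hA.
have mAi : measurable_fun [set: R] (\1_A : R -> R) by exact: measurable_indic.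
pose wA u := w u * \1_A u.
have mwA : measurable_fun [set: R] wA by exact: measurable_funM.
have wA_le u : `|wA u| <= `|w u|.
  by rewrite normrM ler_piMr// indicE; case: (_ \in _); rewrite ?normr1 ?normr0.
(* The sines only enlarge the sum of squares, but with them the kernel sum_i c_i(u) c_i(v) depends
   on v - u alone and is a cosine times a Fejer kernel. *)
pose c (bj : bool * (nat * nat)) (u : R) : R :=
  let nu := (a%:R + 1 / 2 + (bj.2.2%:R - bj.2.1%:R)) * (x - u) in
  if bj.1 then cos nu else sin nu.
pose J := [seq (k, m) | k <- index_iota 0 l.*2, m <- index_iota 0 l.*2].
pose s := [seq (true, j) | j <- J] ++ [seq (false, j) | j <- J].
pose F (y : R) := (Rintegral mu (period x) (fun u => wA u * cos ((a%:R + 1 / 2 + y) * (x - u)))) ^+ 2.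
have F0 y : 0 <= F y by exact: sqr_ge0.
have step1 : l%:R * (\sum_(0 <= q < l) F q%:R) <=
    \sum_(i <- s) (Rintegral mu (period x) (fun u => wA u * c i u)) ^+ 2.
  apply: (le_trans (sum_window_le l F0)).
  rewrite /s big_cat !big_map /J !big_allpairs/=.
  by rewrite lerDl; apply: sumr_ge0 => i _; apply: sumr_ge0 => k _; exact: sqr_ge0.
have KE u v : \sum_(i <- s) c i u * c i v = cos ((a%:R + 1 / 2) * (v - u)) *
   ((\sum_(0 <= k < l.*2) cos (k%:R * (v - u))) ^+ 2 +
    (\sum_(0 <= k < l.*2) sin (k%:R * (v - u))) ^+ 2).
  rewrite -sum_cos_diff /s big_cat !big_map/= -big_split/= /J big_allpairs exchange_big/=.
  apply: eq_bigr => k _; apply: eq_bigr => m _.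
  rewrite -cosB; congr cos; ring.
pose K (z : R * R) := \sum_(i <- s) c i z.1 * c i z.2.
have mc i : measurable_fun [set: R] (c i).
  rewrite /c; case: i.1.
    apply: (measurableT_comp (@measurable_cos _)); apply: measurable_funM => //; exact: measurable_funB.
  apply: (measurableT_comp (@measurable_sin _)); apply: measurable_funM => //; exact: measurable_funB.
have c1 i u : `|c i u| <= 1 by rewrite /c; case: i.1; [exact: cos_max|exact: sin_max].
have mK : measurable_fun [set: R * R] K.
  apply: measurable_sum => i; apply: measurable_funM; exact: (measurableT_comp (mc i)).
pose H (z : R * R) : R := (`|wA z.1| * `|wA z.2| * `|K z|) * (\1_(period x) z.1 * \1_(period x) z.2).
have mp : measurable_fun [set: R] (\1_(period x) : R -> R).
  by apply: measurable_indic; exact: measurable_period.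
have mwA' : measurable_fun [set: R] (fun u => `|wA u|) by exact: measurableT_comp.
have mH : measurable_fun [set: R * R] H.
  apply: measurable_funM; apply: measurable_funM.
  - by apply: measurable_funM; [exact: (measurableT_comp mwA')|exact: (measurableT_comp mwA')].
  - exact: measurableT_comp.
  - exact: (measurableT_comp mp).
  - exact: (measurableT_comp mp).
have H0 z : 0 <= H z by rewrite !mulr_ge0.
have FE u v : (\int[mu]_(v in period x) (`|wA u| * `|wA v| * `|K (u, v)|)%:E)%E
   = (\int[mu]_v (`|wA u| * `|wA v| * `|K (u, v)| * \1_(period x) v)%:E)%E.
  by rewrite intR_indicT.
have bnd := @sum_sqr_Rintegral_le _ _ _ mu (period x) _ s c wA (2 * M * l%:R)
  (measurable_period x) (period_lty x) (measurable_funTS mwA).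
have {}bnd : ((\sum_(i <- s) (Rintegral mu (period x) (fun u => wA u * c i u)) ^+ 2)%:E <=
    \int[mu]_u \int[mu]_v (H (u, v))%:E)%E.
  apply: (le_trans (bnd _ _ _ _)).
  - by move=> u pu; apply: (le_trans (wA_le u)); exact: wM.
  - by move=> i; apply: measurable_funTS; exact: mc.
  - exact: c1.
  - apply: measurable_funTS.
    have : measurable_fun [set: R] (fubini_F mu
       (fun z : R * R => (`|wA z.1| * `|wA z.2| * `|K z| * \1_(period x) z.2)%:E)).
      apply: measurable_fun_fubini_tonelli_F; last by move=> z; rewrite lee_fin !mulr_ge0.
      apply/measurable_EFinP; apply: measurable_funM; last exact: (measurableT_comp mp).
      apply: measurable_funM; last exact: measurableT_comp.
      by apply: measurable_funM; [exact: (measurableT_comp mwA')|exact: (measurableT_comp mwA')].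
    by rewrite /fubini_F/=; under eq_fun do rewrite intR_indicT.
  rewrite integral_mkcond le_eqVlt; apply/orP; left; apply/eqP; apply: eq_integral => u _.
  rewrite patchE /H/=; case: ifPn => pu; last first.
    by under eq_integral do rewrite indicE (negbTE pu) mul0r mulr0; rewrite integral0.
  rewrite -intR_indicT; apply: eq_integral => v _.
  by rewrite [\1_(period x) u]indicE pu mul1r.
rewrite (_ : \sum_(0 <= q < l) _ = \sum_(0 <= q < l) F q%:R); last first.
  apply: eq_bigr => q _; congr (_ ^+ 2); apply: eq_Rintegral => u _.
  by rewrite -/(wA u) addrAC.
rewrite -(ler_pM2l l0'); apply: (le_trans step1); rewrite -lee_fin; apply: (le_trans bnd).
pose X (z : R * R) : R := far z.1 * far z.2 *
     (G z.1 * G z.2 * (`|x - z.1|^-1 * `|x - z.2|^-1)) * kap rho (z.2 - z.1).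
have G0 := cutoff_ge0; have mG := measurable_cutoff.
have X0 z : 0 <= X z.
  rewrite /X mulr_ge0 ?kap_ge0// mulr_ge0 ?mulr_ge0 ?invr_ge0//.
have mX : measurable_fun [set: R * R] X.
  have mi : measurable_fun [set: R] (fun u : R => `|x - u|^-1).
    apply: (measurableT_comp (@measurable_inv _)).
    by apply: measurableT_comp => //; apply: measurable_funB.
  apply: measurable_funM.
    apply: measurable_funM.
      by apply: measurable_funM; [exact: (measurableT_comp mfar)|exact: (measurableT_comp mfar)].
    apply: measurable_funM.
      by apply: measurable_funM; [exact: (measurableT_comp mG)|exact: (measurableT_comp mG)].
    by apply: measurable_funM; [exact: (measurableT_comp mi)|exact: (measurableT_comp mi)].
  have mk0 : measurable_fun [set: R] (fun t : R => kap rho (t - 0)) by exact: measurable_kap.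
  have := measurableT_comp mk0 (measurable_funB (@measurable_snd _ _ R R) (@measurable_fst _ _ R R)).
  by rewrite /comp/=; under eq_fun do rewrite subr0.
rewrite -[leLHS](@fubini_tonelli1 _ _ _ _ _ mu mu (EFin \o H)); [|exact/measurable_EFinP|by move=> z; rewrite lee_fin].
(* Here 80 = 2 * 2 * 20: a factor 2 from each of the two bounds on [w], and 20 from the Fejer
   kernel. *)
apply: (@le_trans _ _ (\int[(mu \x mu)%E]_z (80 * l%:R ^+ 2 * X z)%:E)%E).
  apply: ge0_le_intR => //; first exact: measurable_funM.
  move=> [u v] _; rewrite /H/=.
  have R0 : 0 <= 80 * l%:R ^+ 2 * X (u, v) by rewrite mulr_ge0// mulr_ge0 ?sqr_ge0.
  have [pu|pu] := boolP (u \in period x); last by rewrite [\1_(period x) u]indicE (negbTE pu) mul0r mulr0.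
  have [pv|pv] := boolP (v \in period x); last by rewrite [\1_(period x) v]indicE (negbTE pv) !mulr0.
  rewrite !indicE pu pv !mulr1.
  have [Au|Au] := boolP (u \in A); last by rewrite /wA indicE (negbTE Au) mulr0 normr0 !mul0r.
  have [Av|Av] := boolP (v \in A); last by rewrite /wA [\1_A v]indicE (negbTE Av) mulr0 normr0 mulr0 mul0r.
  rewrite !inE in pu pv Au Av.
  have h1 := le_trans (wA_le u) (w_le pu); have h2 := le_trans (wA_le v) (w_le pv).
  have h3 : `|K (u, v)| <= 20 * l%:R ^+ 2 * kap rho (v - u).
    rewrite /K/= KE normrM; apply: (@le_trans _ _ (1 * (20 * l%:R ^+ 2 * kap rho (v - u)))); last by rewrite mul1r.
    apply: ler_pM => //; first exact: cos_max.
    by rewrite ger0_norm ?addr_ge0 ?sqr_ge0//; apply: fejer_kernel_le => //; exact: hA.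
  apply: (@le_trans _ _ (2 * (far u * (G u / `|x - u|)) * (2 * (far v * (G v / `|x - v|))) * (20 * l%:R ^+ 2 * kap rho (v - u)))).
    by apply: ler_pM => //; apply: ler_pM.
  by rewrite le_eqVlt; apply/orP; left; apply/eqP; rewrite /X/=; ring.
have k80 : 0 <= 80 * l%:R ^+ 2 :> R by rewrite mulr_ge0 ?sqr_ge0.
rewrite ge0_intRZ//.
rewrite (@fubini_tonelli1 _ _ _ _ _ mu mu (EFin \o X)); [|exact/measurable_EFinP|by move=> z; rewrite lee_fin].
apply: (@le_trans _ _ ((80 * l%:R ^+ 2)%:E * (1584 * lam ^+ 2)%:E)%E).
  apply: lee_wpmul2l; first by rewrite lee_fin mulr_ge0 ?sqr_ge0.
  exact: (far_far_le mG G0 GS lam0 xbad x4 rho0).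
by rewrite -EFinM lee_fin le_eqVlt; apply/orP; left; apply/eqP; ring.
Qed.

(** The leading 3 comes from (A - B - C)^2 <= 3 (A^2 + B^2 + C^2); the terms are the near part, at
    most 2 lam, and the two sides of x. *)
Definition window_const : R := 3 * (4 + 2 * (80 * 1584)).

Let near_le : (\int[mu]_u (G u * near u)%:E <= (2 * lam * rho)%:E)%E.
Proof.
rewrite intR_indicT; exact: (good_set_ball cutoff_ge0 Ex rho0).
Qed.

Let restrict_le (F : R -> R) (b : R) : measurable_fun [set: R] F -> (forall u, 0 <= F u) ->
  (\int[mu]_u (F u)%:E <= b%:E)%E -> (\int[mu]_(u in period x) (F u)%:E <= b%:E)%E.
Proof.
move=> mF F0; apply: le_trans; apply: ge0_subset_integral => //.
- exact: measurable_period.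
- exact/measurable_EFinP.
- by move=> u _; rewrite lee_fin.
Qed.

Definition tau n : R := conv (cdirichlet n) g x.

(** The part of the conjugate sums that does not depend on the order n within the window starting at
    a: the kernel is frozen at order a near x and replaced by half a cotangent far from x. *)
Let ccenter (a : nat) : R := pi^-1 * Rintegral mu (period x)
  (fun u => g u * (near u * cdirichlet a (x - u) +
                   far u * (cos ((x - u) / 2) / (2 * sin ((x - u) / 2))))).

Let right_side : set R := `[x, x + pi]%classic.
Let left_side : set R := `[x - pi, x[%classic.

(** Near x the kernels of orders n and a differ by at most l, and the mass of |g| there is at most 2
    lam / l. Far from x only the oscillating term of [cdirichletE] is left after subtraction of the
    centre; it is cut at x into its two sides. The factor 1/pi is discarded as being at most 1. *)
Let tauE a n : (a <= n < a + l)%N ->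
  (tau n - ccenter a) ^+ 2 <= 3 * (4 * lam ^+ 2 +
   (Rintegral mu (period x) (fun u => w u * \1_right_side u * cos ((n%:R + 1 / 2) * (x - u)))) ^+ 2 +
   (Rintegral mu (period x) (fun u => w u * \1_left_side u * cos ((n%:R + 1 / 2) * (x - u)))) ^+ 2).
Proof.
move=> anl; have mG := measurable_cutoff; have G0 := cutoff_ge0.
have mcd k : measurable_fun [set: R] (fun u => cdirichlet k (x - u)).
  by apply: measurable_reflect; exact: measurable_cdirichlet.
have mA (A : set R) : measurable A -> measurable_fun [set: R] (\1_A : R -> R).
  exact: measurable_indic.
have iA (A : set R) u : `|\1_A u| <= 1 :> R.
  by rewrite indicE; case: (_ \in _); rewrite ?normr1 ?normr0.
have mr : measurable right_side by exact: measurable_itv.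
have ml : measurable left_side by exact: measurable_itv.
have mcot : measurable_fun [set: R] (fun u : R => cos ((x - u) / 2) / (2 * sin ((x - u) / 2))).
  have mh : measurable_fun [set: R] (fun u : R => (x - u) / 2).
    by apply: measurable_funM => //; exact: measurable_funB.
  apply: measurable_funM; first exact: (measurableT_comp (@measurable_cos _)).
  apply: (measurableT_comp (@measurable_inv _)); apply: measurable_funM => //.
  exact: (measurableT_comp (@measurable_sin _)).
have mcos : measurable_fun [set: R] (fun u : R => cos ((n%:R + 1 / 2) * (x - u))).
  by apply: (measurableT_comp (@measurable_cos _)); apply: measurable_funM => //; exact: measurable_funB.
have cotB u : period x u -> `|far u * (cos ((x - u) / 2) / (2 * sin ((x - u) / 2)))| <= 2 * l%:R.
  move=> pu; have [->|[-> hu]] := farP u; first by rewrite mul0r normr0 mulr_ge0// ltW.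
  have v0 : 0 < `|x - u| by exact: lt_le_trans hu.
  have h := normr_sin_half_ge (periodP pu).
  rewrite mul1r normrM normfV; apply: (@le_trans _ _ (1 * (2 * `|x - u|^-1))); last first.
    by rewrite mul1r ler_wpM2l// -[leRHS]invrK lef_pV2 ?posrE.
  apply: ler_pM => //; first exact: cos_max.
  rewrite -[leRHS]invrK invfM invrK lef_pV2 ?posrE ?normr_gt0; last 2 first.
  - by rewrite mulf_neq0// -normr_gt0; lra.
  - by rewrite mulr_gt0.
  by rewrite normrM ger0_norm//; lra.
pose X u := g u * (near u * (cdirichlet n (x - u) - cdirichlet a (x - u))).
pose Yr u := w u * \1_right_side u * cos ((n%:R + 1 / 2) * (x - u)).
pose Yl u := w u * \1_left_side u * cos ((n%:R + 1 / 2) * (x - u)).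
pose Z u := g u * (near u * cdirichlet a (x - u) +
                   far u * (cos ((x - u) / 2) / (2 * sin ((x - u) / 2)))).
have mX : measurable_fun [set: R] X.
  by apply: measurable_funM => //; apply: measurable_funM => //; exact: measurable_funB.
have mYr : measurable_fun [set: R] Yr.
  by apply: measurable_funM => //; apply: measurable_funM => //; exact: mA.
have mYl : measurable_fun [set: R] Yl.
  by apply: measurable_funM => //; apply: measurable_funM => //; exact: mA.
have mZ : measurable_fun [set: R] Z.
  by apply: measurable_funM => //; apply: measurable_funD; apply: measurable_funM.
have Xle u : period x u -> `|X u| <= l%:R * (G u * near u).
  move=> pu; rewrite (cutoff_period xpi pu) /X !normrM.
  rewrite [leRHS](_ : _ = `|g u| * (near u * l%:R)); last by ring.
  apply: ler_wpM2l => //; rewrite ger0_norm//; apply: ler_wpM2l => //.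
  exact: cdirichlet_window.
have iX : mu.-integrable (period x) (EFin \o X).
  apply: (@bounded_integrable _ _ _ _ _ _ (M * l%:R)); [exact: measurable_period|exact: period_lty|exact: measurable_funTS|].
  move=> u pu; apply: (le_trans (Xle _ pu)); rewrite mulrC ler_wpM2r ?(ltW l0')//.
  rewrite (cutoff_period xpi pu) -[leRHS]mulr1; apply: ler_pM => //.
  by apply: le_trans (iA (ball x rho) u); exact: ler_norm.
have iYr : mu.-integrable (period x) (EFin \o Yr).
  apply: (@bounded_integrable _ _ _ _ _ _ (2 * M * l%:R * 1 * 1)); [exact: measurable_period|exact: period_lty|exact: measurable_funTS|].
  move=> u pu; rewrite normrM [`|w u * _|]normrM; apply: ler_pM => //; last exact: cos_max.
  by apply: ler_pM => //; exact: wM.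
have iYl : mu.-integrable (period x) (EFin \o Yl).
  apply: (@bounded_integrable _ _ _ _ _ _ (2 * M * l%:R * 1 * 1)); [exact: measurable_period|exact: period_lty|exact: measurable_funTS|].
  move=> u pu; rewrite normrM [`|w u * _|]normrM; apply: ler_pM => //; last exact: cos_max.
  by apply: ler_pM => //; exact: wM.
have iZ : mu.-integrable (period x) (EFin \o Z).
  apply: (@bounded_integrable _ _ _ _ _ _ (M * (1 * a%:R + 2 * l%:R))); [exact: measurable_period|exact: period_lty|exact: measurable_funTS|].
  move=> u pu; rewrite normrM; apply: ler_pM => //.
  apply: (le_trans (ler_normD _ _)); apply: lerD; last exact: cotB.
  by rewrite normrM; apply: ler_pM => //; [exact: iA|exact: cdirichlet_le].
have dec u : period x u -> g u * cdirichlet n (x - u) = X u + Z u - Yr u - Yl u.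
  move=> pu.
  have rl : \1_right_side u + \1_left_side u = 1 :> R.
    move: pu; rewrite /period/= in_itv/= => /andP[u1 u2].
    have [xu|ux] := leP x u.
      have r1 : u \in right_side by rewrite inE /right_side/= in_itv/= xu.
      have l1 : u \notin left_side by rewrite notin_setE /left_side/= in_itv/= ltNge xu andbF.
      by rewrite !indicE r1 (negbTE l1) addr0.
    have r1 : u \notin right_side by rewrite notin_setE /right_side/= in_itv/= leNgt ux.
    have l1 : u \in left_side by rewrite inE /left_side/= in_itv/= u1 ux.
    by rewrite !indicE l1 (negbTE r1) add0r.
  have -> : X u + Z u - Yr u - Yl u = X u + Z u - w u * cos ((n%:R + 1 / 2) * (x - u)).
    by rewrite /Yr /Yl -[w u in RHS]mulr1 -rl; ring.
  rewrite /X /Z /w; have nf := near_far u.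
  have [f0|[f1 hu]] := farP u.
    by rewrite f0 addr0 in nf; rewrite f0 nf; ring.
  have n0 : near u = 0 by rewrite f1 in nf; lra.
  have s0 : sin ((x - u) / 2) != 0.
    rewrite -normr_gt0; apply: lt_le_trans (normr_sin_half_ge (periodP pu)).
    by rewrite divr_gt0//; exact: lt_le_trans hu.
  rewrite f1 n0; have := cdirichletE n (x - u).
  set s := sin _ in s0 *; set c1 := cos _; set c2 := cos _ => h.
  have -> : cdirichlet n (x - u) = (c1 - c2) / (2 * s) by rewrite -h; field.
  by field.
have tE : tau n - ccenter a = pi^-1 * (Rintegral mu (period x) X - Rintegral mu (period x) Yr - Rintegral mu (period x) Yl).
  rewrite /tau /conv /ccenter -mulrBr; congr (_ * _).
  rewrite (_ : Rintegral mu (period x) (fun u => g u * cdirichlet n (x - u)) =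
    Rintegral mu (period x) (fun u => X u + Z u - Yr u - Yl u)); last first.
    by apply: eq_Rintegral => u; rewrite inE => pu; exact: dec.
  have iXZ : mu.-integrable (period x) (EFin \o (fun u => X u + Z u)).
    exact: (integrableD (measurable_period x) iX iZ).
  have iXZY : mu.-integrable (period x) (EFin \o (fun u => X u + Z u - Yr u)).
    exact: (integrableB (measurable_period x) iXZ iYr).
  rewrite (RintegralB (measurable_period x) iXZY iYl) (RintegralB (measurable_period x) iXZ iYr).
  by rewrite (RintegralD (measurable_period x) iX iZ) -/Z; ring.
have Xb : `|Rintegral mu (period x) X| <= 2 * lam.
  apply: normr_Rintegral_le => //; first exact: measurable_period.
  apply: (@le_trans _ _ (\int[mu]_(u in period x) (l%:R * (G u * near u))%:E)%E).
    apply: ge0_le_intR => //; first exact: measurable_period.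
      by apply: measurable_funTS; exact: measurableT_comp.
    by apply: measurable_funTS; apply: measurable_funM => //; exact: measurable_funM.
  rewrite ge0_intRZ; [|exact: measurable_period|by apply: measurable_funTS; exact: measurable_funM|by move=> u _; rewrite mulr_ge0|exact: ltW].
  apply: (@le_trans _ _ (l%:R%:E * (2 * lam * rho)%:E)%E).
    apply: lee_wpmul2l; first by rewrite lee_fin ltW.
    apply: restrict_le near_le; first exact: measurable_funM.
    by move=> u; rewrite mulr_ge0.
  by rewrite -EFinM lee_fin le_eqVlt; apply/orP; left; apply/eqP; rewrite /rho; field; exact: lt0r_neq0.
rewrite tE; move: (Rintegral mu (period x) X) Xb => A Xb.
change (Rintegral mu (period x) (fun u => w u * \1_right_side u * cos ((n%:R + 1 / 2) * (x - u))))
  with (Rintegral mu (period x) Yr).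
change (Rintegral mu (period x) (fun u => w u * \1_left_side u * cos ((n%:R + 1 / 2) * (x - u))))
  with (Rintegral mu (period x) Yl).
move: (Rintegral mu (period x) Yr) (Rintegral mu (period x) Yl) => B C.
rewrite exprMn; apply: (@le_trans _ _ (1 * (A - B - C) ^+ 2)).
  by rewrite ler_wpM2r ?sqr_ge0// exprn_ile1 ?invpi_le1// invr_ge0 pi_ge0.
have A2 : A ^+ 2 <= 4 * lam ^+ 2.
  rewrite -(real_normK (num_real A)) (_ : 4 * lam ^+ 2 = (2 * lam) ^+ 2); last by ring.
  by rewrite ler_pXn2r ?nnegrE// mulr_ge0// ltW.
have h1 := sqr_ge0 (A + B); have h2 := sqr_ge0 (A + C); have h3 := sqr_ge0 (B - C).
nra.
Qed.

(* The bound is uniform in the length [l] of the window: the conjugate partial sums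
   have bounded mean oscillation in [n]. *)
Lemma window_oscillation a : \sum_(a <= n < a + l) (tau n - ccenter a) ^+ 2 <=
  l%:R * (window_const * lam ^+ 2).
Proof.
have mr : measurable right_side by exact: measurable_itv.
have ml : measurable left_side by exact: measurable_itv.
apply: (le_trans (ler_sum_nat (fun n => @tauE a n))).
rewrite -mulr_sumr !big_split/= sumr_const_nat addKn.
have sh (A : set R) : \sum_(a <= n < a + l) (Rintegral mu (period x)
    (fun u => w u * \1_A u * cos ((n%:R + 1 / 2) * (x - u)))) ^+ 2 =
  \sum_(0 <= q < l) (Rintegral mu (period x)
    (fun u => w u * \1_A u * cos ((a%:R + q%:R + 1 / 2) * (x - u)))) ^+ 2.
  rewrite -{1}[a]add0n big_addn addKn; apply: eq_bigr => q _.
  by rewrite natrD (addrC q%:R).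
rewrite !sh.
have h1 := @side_sum right_side a mr; have h2 := @side_sum left_side a ml.
have {}h1 := h1 _; have {}h2 := h2 _.
rewrite /window_const -(mulr_natl (4 * lam ^+ 2)).
apply: (@le_trans _ _ (3 * (l%:R * (4 * lam ^+ 2) + l%:R * (80 * 1584 * lam ^+ 2) + l%:R * (80 * 1584 * lam ^+ 2)))); last first.
  by rewrite le_eqVlt; apply/orP; left; apply/eqP; ring.
rewrite ler_wpM2l//; apply: lerD; first apply: lerD => //.
  apply: h1 => u v; rewrite /right_side/= !in_itv/= => /andP[? ?] /andP[? ?].
  by rewrite ler_norml; apply/andP; split; lra.
apply: h2 => u v; rewrite /left_side/= !in_itv/= => /andP[? ?] /andP[? ?].
by rewrite ler_norml; apply/andP; split; lra.
Qed.

Lemma conj_poisson_center (r : R) : 0 <= r < 1 -> rho / 2 <= 1 - r <= rho ->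
  `|ccenter 0 - conv (cpoisson r) g x| <= 1026 * lam.
Proof.
move=> r01 /andP[r1 r2]; have mG := measurable_cutoff; have G0 := cutoff_ge0.
have rlt : 0 < 1 - r by lra.
have mq : measurable_fun [set: R] (fun u => cpoisson r (x - u)).
  by apply: measurable_reflect; exact: measurable_cpoisson.
have mcot : measurable_fun [set: R] (fun u : R => cos ((x - u) / 2) / (2 * sin ((x - u) / 2))).
  have mh : measurable_fun [set: R] (fun u : R => (x - u) / 2).
    by apply: measurable_funM => //; exact: measurable_funB.
  apply: measurable_funM; first exact: (measurableT_comp (@measurable_cos _)).
  apply: (measurableT_comp (@measurable_inv _)); apply: measurable_funM => //.
  exact: (measurableT_comp (@measurable_sin _)).
have qB v : `|cpoisson r v| <= l%:R.
  apply: (le_trans (cpoisson_le v r01)).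
  rewrite -[leRHS]invrK lef_pV2 ?posrE ?invr_gt0 ?mulr_gt0// -/rho; lra.
pose Z u := g u * (near u * cdirichlet 0 (x - u) +
                   far u * (cos ((x - u) / 2) / (2 * sin ((x - u) / 2)))).
pose Q u := g u * cpoisson r (x - u).
have cd0 v : cdirichlet 0 v = 0 :> R by rewrite /cdirichlet big_geq.
have mZ : measurable_fun [set: R] Z.
  apply: measurable_funM => //; apply: measurable_funD; apply: measurable_funM => //.
  by apply: measurable_reflect; exact: measurable_cdirichlet.
have mQ : measurable_fun [set: R] Q by exact: measurable_funM.
pose fx u : R := far u / (x - u) ^+ 2.
have fx0 u : 0 <= fx u by rewrite divr_ge0 ?sqr_ge0.
have mfx : measurable_fun [set: R] fx.
  apply: measurable_funM => //; apply: (measurableT_comp (@measurable_inv _)).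
  by apply: (measurable_funX 2); apply: measurable_funB.
have ZQ u : period x u -> `|Z u - Q u| <= l%:R * (G u * near u) + 32 * (G u * (rho * fx u)).
  move=> pu; rewrite /Z /Q /fx -mulrBr normrM (cutoff_period xpi pu) cd0 mulr0 add0r.
  have nf := near_far u; have [f0|[f1 hu]] := farP u.
    rewrite f0 addr0 in nf; rewrite f0 nf !mul0r sub0r normrN !mulr0 addr0 mulr1 mulrC.
    by apply: ler_wpM2r => //; exact: qB.
  have n0 : near u = 0 by rewrite f1 in nf; lra.
  rewrite f1 n0 mulr0 mulr0 add0r mul1r.
  rewrite mulrCA ler_wpM2l//; apply: (le_trans (hcot_cpoisson_le r01 _ (periodP pu))).
    exact: le_trans hu.
  by rewrite div1r mulrA ler_wpM2r ?invr_ge0 ?sqr_ge0// ler_wpM2l.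
have v2l u : far u * (x - u) ^- 2 <= l%:R ^+ 2.
  have [->|[-> hu]] := farP u; first by rewrite mul0r sqr_ge0.
  rewrite mul1r -(real_normK (num_real (x - u))) -[leRHS]invrK lef_pV2 ?posrE ?invr_gt0 ?exprn_gt0//.
    by rewrite -exprVn ler_pXn2r ?nnegrE// ltW.
  exact: lt_le_trans hu.
have iQ : mu.-integrable (period x) (EFin \o Q).
  apply: (@bounded_integrable _ _ _ _ _ _ (M * l%:R)); [exact: measurable_period|exact: period_lty|exact: measurable_funTS|].
  by move=> u pu; rewrite normrM; apply: ler_pM.
have n1 u : near u <= 1 by rewrite /near indicE; case: (_ \in _).
have nn0 u : 0 <= near u by [].
have iD : mu.-integrable (period x) (EFin \o (fun u => Z u - Q u)).
  apply: (@bounded_integrable _ _ _ _ _ _ (l%:R * (M * 1) + 32 * (M * (rho * l%:R ^+ 2)))).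
  - exact: measurable_period.
  - exact: period_lty.
  - by apply: measurable_funTS; exact: measurable_funB.
  move=> u pu; apply: (le_trans (ZQ u pu)); rewrite (cutoff_period xpi pu).
  apply: lerD; [apply: ler_wpM2l; first exact: ltW|apply: ler_wpM2l => //].
    exact: ler_pM.
  apply: ler_pM => //; first by rewrite mulr_ge0// ltW.
  by apply: ler_wpM2l; [exact: ltW|exact: v2l].
have iZ : mu.-integrable (period x) (EFin \o Z).
  have := integrableD (measurable_period x) iD iQ.
  apply: eq_integrable; first exact: measurable_period.
  by move=> u _ /=; rewrite -EFinD subrK.
have -> : ccenter 0 - conv (cpoisson r) g x = pi^-1 * Rintegral mu (period x) (fun u => Z u - Q u).
  by rewrite RintegralB//; [rewrite mulrBr|exact: measurable_period].
rewrite normrM; apply: (@le_trans _ _ (1 * `|Rintegral mu (period x) (fun u => Z u - Q u)|)).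
  by apply: ler_wpM2r => //; rewrite ger0_norm ?invpi_le1// invr_ge0 pi_ge0.
rewrite mul1r; apply: normr_Rintegral_le => //; first exact: measurable_period.
have m1 : measurable_fun [set: R] (fun u => l%:R * (G u * near u)).
  by apply: measurable_funM => //; exact: measurable_funM.
have m2 : measurable_fun [set: R] (fun u => 32 * (G u * (rho * fx u))).
  by apply: measurable_funM => //; apply: measurable_funM => //; exact: measurable_funM.
have p1 u : 0 <= l%:R * (G u * near u) by rewrite mulr_ge0 ?mulr_ge0// ltW.
have p2 u : 0 <= 32 * (G u * (rho * fx u)).
  by rewrite mulr_ge0// mulr_ge0// mulr_ge0// ltW.
apply: (@le_trans _ _ (\int[mu]_(u in period x) (l%:R * (G u * near u) + 32 * (G u * (rho * fx u)))%:E)%E).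
  apply: ge0_le_intR => //; first exact: measurable_period.
    by apply: measurable_funTS; apply: measurableT_comp => //; exact: measurable_funB.
  by apply: measurable_funTS; exact: measurable_funD.
apply: restrict_le; first exact: measurable_funD.
  by move=> u; rewrite addr_ge0.
have q1 u : 0 <= G u * near u by rewrite mulr_ge0.
have q2 u : 0 <= G u * (rho * fx u) by rewrite mulr_ge0// mulr_ge0// ltW.
have n1' : measurable_fun [set: R] (fun u => G u * near u) by exact: measurable_funM.
have n2' : measurable_fun [set: R] (fun u => G u * (rho * fx u)).
  by apply: measurable_funM => //; exact: measurable_funM.
rewrite ge0_intRD// !ge0_intRZ//.
apply: (@le_trans _ _ (l%:R%:E * (2 * lam * rho)%:E + 32%:E * (32 * lam)%:E)%E).
  apply: leeD; apply: lee_wpmul2l; rewrite ?lee_fin ?(ltW l0')//.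
  exact: (good_set_tail mG G0 GS lam0 Ex rho0).
rewrite -!EFinM -EFinD lee_fin (_ : l%:R * (2 * lam * rho) = 2 * lam); first lra.
by rewrite /rho; field; exact: lt0r_neq0.
Qed.

(** Obtained from (A + B)^2 <= 2 A^2 + 2 B^2, where A is the oscillation over the window starting at
    0 and B compares its centre with the conjugate Poisson mean. *)
Definition initial_const : R := 2 * window_const + 2 * 1026 ^+ 2.

Lemma initial_window (r : R) : 0 <= r < 1 -> rho / 2 <= 1 - r <= rho ->
  \sum_(0 <= n < l) (tau n - conv (cpoisson r) g x) ^+ 2 <= l%:R * (initial_const * lam ^+ 2).
Proof.
move=> r01 rr; have h := conj_poisson_center r01 rr; have h0 := window_oscillation 0.
rewrite add0n in h0.
have c0 : 0 <= 1026 * lam by apply: mulr_ge0; [exact: ler0n|exact: ltW].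
rewrite /initial_const mulrDl -mulrA -mulrA -exprMn mulrDr.
move: (1026 * lam) c0 h => c c0 h.
apply: (@le_trans _ _ (\sum_(0 <= n < l) (2 * (tau n - ccenter 0) ^+ 2 + 2 * c ^+ 2))).
  apply: ler_sum_nat => n _.
  have h2 : (ccenter 0 - conv (cpoisson r) g x) ^+ 2 <= c ^+ 2.
    move: (ccenter 0 - conv (cpoisson r) g x) h => A h; rewrite -(real_normK (num_real A)).
    by rewrite ler_pXn2r ?nnegrE.
  have := sqr_ge0 (tau n - ccenter 0 - (ccenter 0 - conv (cpoisson r) g x)); nra.
rewrite big_split/= -mulr_sumr sumr_const_nat subn0 -(mulr_natl (2 * _ ^+ 2)).
by rewrite lerD2r mulrCA ler_wpM2l.
Qed.

End WindowEstimate.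

(** * Exponential estimates over windows *)

Section JohnNirenberg.
Context {R : realType}.
Implicit Types (t : nat -> R) (a l i : nat).

(** Here exp y <= 1/(1 - y), and (1 - y)(1 + y + 2 y^2) = 1 + y^2 (1 - 2 y) >= 1. *)
Lemma expR_le_quad (y : R) : y <= 1 / 2 -> expR y <= 1 + y + 2 * y ^+ 2.
Proof.
move=> y2; have h := expR_ge1Dx (- y).
have h1 : 0 < 1 - y by lra.
have -> : expR y = (expR (- y))^-1 by rewrite expRN invrK.
apply: (@le_trans _ _ (1 - y)^-1); first by rewrite lef_pV2 ?posrE ?expR_gt0.
rewrite invf_ple ?posrE//; last by have := sqr_ge0 (1 + y); have := sqr_ge0 y; lra.
rewrite -[leLHS]mul1r ler_pdivrMr; last by have := sqr_ge0 (1 + y); have := sqr_ge0 y; lra.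
by have := sqr_ge0 y; nra.
Qed.

(* Bellman function of the dyadic John-Nirenberg inequality: [v] is the variance
   over a window and [d] half the difference of the means over its two halves. *)
Let b (v : R) : R := 1 + 3 * v - v ^+ 2.

(** This is the inequality needed to merge two halves of a window: their means are shifted by +d and
    -d from the common mean, and the variance of the whole is the mean of the two variances plus
    d^2. *)
Lemma bellman_step (d v1 v2 : R) : 0 <= v1 -> 0 <= v2 -> (v1 + v2) / 2 + d ^+ 2 <= 1 ->
  expR (d / 4) * b v1 + expR (- d / 4) * b v2 <= 2 * b ((v1 + v2) / 2 + d ^+ 2).
Proof.
move=> v10 v20 h.
have d1 : `|d| <= 1.
  rewrite -(@ler_pXn2r _ 2) ?nnegrE// expr1n real_normK ?num_real//; lra.
move: d1; rewrite ler_norml => /andP[d1 d2].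
have s := sqr_ge0 d.
have v11 : v1 <= 2 by lra.
have v21 : v2 <= 2 by lra.
have b1 : 0 <= b v1 by rewrite /b; nra.
have b2 : 0 <= b v2 by rewrite /b; nra.
have e1 : expR (d / 4) <= 1 + d / 4 + 2 * (d / 4) ^+ 2 by apply: expR_le_quad; lra.
have e2 : expR (- d / 4) <= 1 - d / 4 + 2 * (d / 4) ^+ 2.
  have -> : 1 - d / 4 + 2 * (d / 4) ^+ 2 = 1 + (- d / 4) + 2 * (- d / 4) ^+ 2 by ring.
  by apply: expR_le_quad; lra.
apply: (@le_trans _ _ ((1 + d / 4 + 2 * (d / 4) ^+ 2) * b v1 + (1 - d / 4 + 2 * (d / 4) ^+ 2) * b v2)).
  by apply: lerD; apply: ler_wpM2r.
(* In these variables the defect is essentially a quadratic form in d and D: the slope of [b]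
   supplies a multiple of d^2, its concavity supplies D^2, and together they absorb the cross term d
   D. *)
pose V := (v1 + v2) / 2; pose D := (v1 - v2) / 2.
have -> : v1 = V + D by rewrite /V /D; field.
have -> : v2 = V - D by rewrite /V /D; field.
have V0 : 0 <= V by rewrite /V; lra.
have V1 : V + d ^+ 2 <= 1 by [].
have -> : (V + D + (V - D)) / 2 = V by field.
rewrite /b; rewrite -subr_ge0.
have -> : 2 * (1 + 3 * (V + d ^+ 2) - (V + d ^+ 2) ^+ 2) -
  ((1 + d / 4 + 2 * (d / 4) ^+ 2) * (1 + 3 * (V + D) - (V + D) ^+ 2) +
   (1 - d / 4 + 2 * (d / 4) ^+ 2) * (1 + 3 * (V - D) - (V - D) ^+ 2)) =
  2 * (d ^+ 2 * (3 - 2 * V - d ^+ 2)) + 2 * D ^+ 2 * (1 + d ^+ 2 / 8)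
   - (1 + 3 * V - V ^+ 2) * d ^+ 2 / 4 - d * D * (3 - 2 * V) / 2.
  by field.
have q1 : 1 + 3 * V - V ^+ 2 <= 3 by nra.
have q2 : d ^+ 2 <= d ^+ 2 * (3 - 2 * V - d ^+ 2) by rewrite ler_peMr//; lra.
have q3 : (1 + 3 * V - V ^+ 2) * d ^+ 2 <= 3 * d ^+ 2 by apply: ler_wpM2r.
have q4 : D ^+ 2 <= D ^+ 2 * (1 + d ^+ 2 / 8) by rewrite ler_peMr ?sqr_ge0//; lra.
have q5 : d * D * (3 - 2 * V) <= 3 * (`|d| * `|D|).
  apply: (le_trans (ler_norm _)); rewrite !normrM mulrC; apply: ler_wpM2r.
    by rewrite mulr_ge0.
  by rewrite ler_norml; apply/andP; split; lra.
have q6 : `|d| ^+ 2 = d ^+ 2 by rewrite real_normK ?num_real.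
have q7 : `|D| ^+ 2 = D ^+ 2 by rewrite real_normK ?num_real.
have q8 := sqr_ge0 (`|d| - `|D|).
nra.
Qed.

Definition wmean t a l : R := (\sum_(a <= n < a + l) t n) / l%:R.
Definition wvar t a l : R := (\sum_(a <= n < a + l) (t n - wmean t a l) ^+ 2) / l%:R.

Lemma sum_sqr_center t a l (c : R) : (0 < l)%N ->
  \sum_(a <= n < a + l) (t n - c) ^+ 2 = l%:R * wvar t a l + l%:R * (wmean t a l - c) ^+ 2.
Proof.
move=> l0; have l0' : l%:R != 0 :> R by rewrite pnatr_eq0 -lt0n.
rewrite /wvar mulrCA mulfV// mulr1.
have mE : \sum_(a <= n < a + l) t n = l%:R * wmean t a l by rewrite /wmean; field.
set m := wmean t a l in mE *.
have ex (x : R) : \sum_(a <= n < a + l) (t n - x) ^+ 2 =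
    \sum_(a <= n < a + l) (t n) ^+ 2 - 2 * x * (l%:R * m) + l%:R * x ^+ 2.
  rewrite -mE mulr_sumr -sumrB [l%:R * _]mulr_natl.
  have -> : x ^+ 2 *+ l = \sum_(a <= n < a + l) x ^+ 2 by rewrite sumr_const_nat addKn.
  rewrite -big_split/=.
  by apply: eq_bigr => n _; ring.
rewrite !ex; ring.
Qed.

Lemma wvar_ge0 t a l : 0 <= wvar t a l.
Proof. by rewrite divr_ge0// sumr_ge0// => n _; exact: sqr_ge0. Qed.

Lemma wvar_le t a l (c B : R) : (0 < l)%N ->
  \sum_(a <= n < a + l) (t n - c) ^+ 2 <= l%:R * B -> wvar t a l <= B.
Proof.
move=> l0; rewrite sum_sqr_center// -mulrDr ler_pM2l ?ltr0n// => h.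
by have := sqr_ge0 (wmean t a l - c); lra.
Qed.

Lemma wmean_dist t a l (c B : R) : (0 < l)%N ->
  \sum_(a <= n < a + l) (t n - c) ^+ 2 <= l%:R * B -> (wmean t a l - c) ^+ 2 <= B.
Proof.
move=> l0; rewrite sum_sqr_center// -mulrDr ler_pM2l ?ltr0n// => h.
by have := wvar_ge0 t a l; lra.
Qed.

(** Induction on dyadic length, merging halves with [bellman_step]. The hypothesis on all windows
    keeps each variance in [0, 1], where [b] lies between 1 and 3; a window of length 1 has
    exponential average 1. *)
Lemma john_nirenberg t : (forall a l, (0 < l)%N -> wvar t a l <= 1) ->
  forall i a, \sum_(a <= n < a + 2 ^ i) expR ((t n - wmean t a (2 ^ i)) / 4) <=
    (2 ^ i)%:R * b (wvar t a (2 ^ i)).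
Proof.
move=> tv; elim=> [|i IH] a.
  rewrite expn0 addn1 big_nat1 mul1r /b /wmean addn1 big_nat1 divr1 subrr mul0r expR0.
  have h := wvar_ge0 t a 1; have h1 := tv a 1%N isT; nra.
set l := (2 ^ i)%N; have l0 : (0 < l)%N by rewrite expn_gt0.
have l0' : l%:R != 0 :> R by rewrite pnatr_eq0 -lt0n.
have e2 : (2 ^ i.+1 = l + l)%N by rewrite expnS mul2n addnn.
rewrite e2; have IH1 := IH a; have IH2 := IH (a + l)%N; rewrite -/l in IH1 IH2.
set m1 := wmean t a l in IH1; set m2 := wmean t (a + l)%N l in IH2.
set v1 := wvar t a l in IH1; set v2 := wvar t (a + l)%N l in IH2.
have cut (F : nat -> R) : \sum_(a <= n < a + (l + l)) F n =
    \sum_(a <= n < a + l) F n + \sum_(a + l <= n < a + l + l) F n.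
  by rewrite addnA (@big_cat_nat _ _ _ (a + l)%N)//= ?leq_addr.
pose d := (m1 - m2) / 2.
have mE : wmean t a (l + l) = (m1 + m2) / 2.
  by rewrite /wmean cut /m1 /m2 /wmean natrD (_ : l%:R + l%:R = 2 * l%:R); [field|ring].
have vE : wvar t a (l + l) = (v1 + v2) / 2 + d ^+ 2.
  have ll0 : (0 < l + l)%N by rewrite addn_gt0 l0.
  have := sum_sqr_center t a (wmean t a (l + l)) ll0.
  rewrite subrr expr0n mulr0 addr0 cut !sum_sqr_center// -/m1 -/m2 -/v1 -/v2 mE => h.
  apply: (mulfI (_ : (l + l)%:R != 0 :> R)); first by rewrite pnatr_eq0 -lt0n.
  by rewrite -h natrD /d; field.
rewrite cut vE mE.
have sh1 : \sum_(a <= n < a + l) expR ((t n - (m1 + m2) / 2) / 4) =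
    expR (d / 4) * \sum_(a <= n < a + l) expR ((t n - m1) / 4).
  by rewrite mulr_sumr; apply: eq_bigr => n _; rewrite -expRD /d; congr expR; field.
have sh2 : \sum_(a + l <= n < a + l + l) expR ((t n - (m1 + m2) / 2) / 4) =
    expR (- d / 4) * \sum_(a + l <= n < a + l + l) expR ((t n - m2) / 4).
  by rewrite mulr_sumr; apply: eq_bigr => n _; rewrite -expRD /d; congr expR; field.
rewrite sh1 sh2.
apply: (@le_trans _ _ (expR (d / 4) * (l%:R * b v1) + expR (- d / 4) * (l%:R * b v2))).
  by apply: lerD; apply: ler_wpM2l => //; exact: expR_ge0.
rewrite natrD [leLHS](_ : _ = l%:R * (expR (d / 4) * b v1 + expR (- d / 4) * b v2)); last by ring.
rewrite [leRHS](_ : _ = l%:R * (2 * b ((v1 + v2) / 2 + d ^+ 2))); last by ring.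
apply: ler_wpM2l => //; apply: bellman_step; try exact: wvar_ge0.
by rewrite -vE; apply: tv; rewrite addn_gt0 l0.
Qed.

Lemma exp_window t (B q : R) i : 0 < B ->
  (forall a l, (0 < l)%N -> exists c, \sum_(a <= n < a + l) (t n - c) ^+ 2 <= l%:R * B ^+ 2) ->
  \sum_(0 <= n < 2 ^ i) (t n - q) ^+ 2 <= (2 ^ i)%:R * B ^+ 2 -> `|q| <= B ->
  \sum_(0 <= n < 2 ^ i) expR (`|t n| / (4 * B)) <= (2 ^ i)%:R * 12.
Proof.
move=> B0 osc ini qB; have l0 : (0 < 2 ^ i)%N by rewrite expn_gt0.
have Bn0 : B != 0 by rewrite gt_eqF.
have main (s : R) : s ^+ 2 = 1 ->
    \sum_(0 <= n < 2 ^ i) expR (s * (t n - wmean t 0 (2 ^ i)) / (4 * B)) <= (2 ^ i)%:R * 3.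
  move=> s1; pose u n := s * t n / B.
  have uv a l : (0 < l)%N -> wvar u a l <= 1.
    move=> ll; have [c hc] := osc a l ll.
    apply: (@wvar_le u a l (s * c / B)) => //; rewrite mulr1.
    have -> : \sum_(a <= n < a + l) (u n - s * c / B) ^+ 2 =
        (B ^+ 2)^-1 * \sum_(a <= n < a + l) (t n - c) ^+ 2.
      rewrite mulr_sumr; apply: eq_bigr => n _.
      by rewrite /u -mulrBl -mulrBr !exprMn s1 mul1r exprVn mulrC.
    by rewrite ler_pdivrMl ?exprn_gt0// mulrC.
  have um : wmean u 0 (2 ^ i) = s * wmean t 0 (2 ^ i) / B.
    rewrite /wmean /u -mulr_suml -mulr_sumr; ring.
  have := john_nirenberg uv i 0; rewrite add0n um => h.
  apply: le_trans (_ : (2 ^ i)%:R * b (wvar u 0 (2 ^ i)) <= _); last first.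
    rewrite ler_pM2l ?ltr0n//; have := uv 0%N _ l0; have := wvar_ge0 u 0 (2 ^ i).
    by rewrite /b; nra.
  apply: le_trans h; rewrite le_eqVlt; apply/orP; left; apply/eqP.
  by apply: eq_bigr => n _; congr expR; rewrite /u; field.
set m := wmean t 0 (2 ^ i) in main.
have mq : `|m| <= 2 * B.
  have : (m - q) ^+ 2 <= B ^+ 2 by apply: (@wmean_dist t 0 (2 ^ i) q).
  rewrite -(real_normK (num_real (m - q))) ler_pXn2r ?nnegrE ?(ltW B0)// => h.
  by have := ler_distD q m 0; rewrite !subr0; lra.
have p1 := main 1 (expr1n _ _); have p2 := main (-1) (sqrr_sign _ 1).
apply: (@le_trans _ _ (\sum_(0 <= n < 2 ^ i) 2 * (expR (1 * (t n - m) / (4 * B)) + expR (-1 * (t n - m) / (4 * B))))).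
  apply: ler_sum => n _.
  have e2 : expR (1 / 2 : R) <= 2.
    by have := @expR_le_quad (1 / 2) (lexx _); lra.
  have h1 : `|t n| <= `|t n - m| + 2 * B.
    by have := ler_distD m (t n) 0; rewrite !subr0; lra.
  apply: (@le_trans _ _ (expR (1 / 2) * expR (`|t n - m| / (4 * B)))).
    rewrite -expRD ler_expR (_ : 1 / 2 + _ = (`|t n - m| + 2 * B) / (4 * B)); last by field.
    by rewrite ler_pM2r// invr_gt0 mulr_gt0.
  apply: ler_pM => //; try exact: expR_ge0.
  rewrite mul1r mulN1r; have [h|h] := leP 0 (t n - m).
    by rewrite ger0_norm// lerDl expR_ge0.
  by rewrite ltr0_norm// lerDr expR_ge0.
rewrite -mulr_sumr big_split/=; lra.
Qed.

End JohnNirenberg.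

(** * Trigonometric sums on the line *)

Section TrigIntegrals.
Context {R : realType}.
Local Notation mu := (@lebesgue_measure R).
Implicit Types (x u phi a b : R) (n : int).

Lemma Rintegral_period_FTC (f F : R -> R) x : continuous f ->
  (forall u, is_derive u (1 : R) F (f u)) ->
  Rintegral mu (period x) f = F (x + pi) - F (x - pi).
Proof.
move=> cf dF; have pi0 := @pi_gt0 R.
rewrite /Rintegral /period (@continuous_FTC2 _ f F)//.
- lra.
- exact: continuous_subspaceT.
- split=> //.
  + apply: cvg_at_right_filter; apply: differentiable_continuous.
    by apply/derivable1_diffP; case: (dF (x - pi)).
  + apply: cvg_at_left_filter; apply: differentiable_continuous.
    by apply/derivable1_diffP; case: (dF (x + pi)).
- by move=> u _; rewrite derive1E; case: (dF u).
Qed.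

Lemma cosD_int2pi n y : cos (y + n%:~R * (2 * pi)) = cos y :> R.
Proof.
have per : periodic (@cos R) (2 * pi).
  by move=> z; rewrite mulr_natl mulr2n addrA !cosDpi opprK.
case: n => k.
  by rewrite -pmulrn [X in y + X]mulr_natl (periodicn per).
rewrite -(periodicn per k.+1 (y + _)) -mulr_natl NegzE mulrNz -pmulrn; congr cos; ring.
Qed.

Lemma sinD_int2pi n y : sin (y + n%:~R * (2 * pi)) = sin y :> R.
Proof.
have := cosD_int2pi n (y - pi / 2).
have e z : cos (z - pi / 2) = sin z :> R.
  by rewrite cosB cos_pihalf sin_pihalf mulr0 mulr1 add0r.
by rewrite (_ : y - _ + _ = y + n%:~R * (2 * pi) - pi / 2) ?e//; ring.
Qed.

(** The phase phi lets the restriction of a double trigonometric sum to a row, a column or a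
    diagonal be a sum of such terms. For n > 0, replacing (a, b) by (-b, a) is conjugation. *)
Definition trig n phi a b u : R :=
  a * cos (n%:~R * u + phi) + b * sin (n%:~R * u + phi).

Lemma is_derive_trig n phi a b u :
  is_derive u (1 : R) (trig n phi a b) (n%:~R * trig n phi b (- a) u).
Proof.
have d : is_derive u (1 : R) (fun u : R => n%:~R * u + phi) (n%:~R).
  by apply: is_derive_eq; rewrite /GRing.scale/= mulr1 addr0.
have dc := @is_derive1_comp _ (@cos R) _ _ _ _ (is_derive_cos _) d.
have ds := @is_derive1_comp _ (@sin R) _ _ _ _ (is_derive_sin _) d.
apply: is_derive_eq (is_deriveD (is_deriveZ a dc) (is_deriveZ b ds)) _.
by rewrite /trig /GRing.scale/=; ring.
Qed.

Lemma continuous_trig n phi a b : continuous (trig n phi a b).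
Proof.
move=> u; apply: differentiable_continuous; apply/derivable1_diffP.
by case: (is_derive_trig n phi a b u).
Qed.

Lemma measurable_trig n phi a b : measurable_fun [set: R] (trig n phi a b).
Proof. apply: continuous_measurable_fun; exact: continuous_trig. Qed.

Lemma normr_trig_le n phi a b u : `|trig n phi a b u| <= `|a| + `|b|.
Proof.
apply: le_trans (ler_normD _ _) _; rewrite !normrM.
by apply: lerD; rewrite ler_piMr// ler_norml ?cos_geN1 ?cos_le1 ?sin_geN1 ?sin_le1.
Qed.

Lemma trigD2pi n phi a b u : trig n phi a b (u + 2 * pi) = trig n phi a b u.
Proof.
rewrite /trig; have -> : n%:~R * (u + 2 * pi) + phi = n%:~R * u + phi + n%:~R * (2 * pi) by ring.
by rewrite cosD_int2pi sinD_int2pi.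
Qed.

Lemma trig_integrable n phi a b x : mu.-integrable (period x) (EFin \o trig n phi a b).
Proof.
apply: (@bounded_integrable _ _ _ _ _ _ (`|a| + `|b|)).
- exact: measurable_period.
- exact: period_lty.
- by apply: measurable_funTS; exact: measurable_trig.
- by move=> u _; exact: normr_trig_le.
Qed.

Lemma Rintegral_trig n phi a b x :
  Rintegral mu (period x) (trig n phi a b) = 2 * pi * (n == 0)%:R * trig 0 phi a b x.
Proof.
have [->|n0] := eqVneq n 0.
  have e u : trig 0 phi a b u = trig 0 phi a b x by rewrite /trig !mul0r.
  have d u : is_derive u (1 : R) (fun u : R => trig 0 phi a b x * u) (trig 0 phi a b x).
    by apply: is_derive_eq; rewrite /GRing.scale/= mulr1.
  rewrite (@eq_Rintegral _ _ _ mu _ (fun=> trig 0 phi a b x)); last by move=> u _; exact: e.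
  rewrite (Rintegral_period_FTC x _ d); last by move=> ?; exact: cvg_cst.
  by rewrite /= mulr1n; move: (trig _ _ _ _ _) (pi : R) => ? ?; ring.
have n0' : n%:~R != 0 :> R by rewrite intr_eq0.
have d u : is_derive u (1 : R) (trig n phi (- (b / n%:~R)) (a / n%:~R)) (trig n phi a b u).
  apply: is_derive_eq (is_derive_trig _ _ _ _ _) _; rewrite /trig; field.
  by rewrite n0'.
rewrite (Rintegral_period_FTC x _ d); last exact: continuous_trig.
rewrite (_ : x + pi = x - pi + 2 * pi); last by ring.
by rewrite trigD2pi subrr mulr0 mul0r.
Qed.

Let trig_mul_sin a b (al be : R) : (a * cos al + b * sin al) * sin be =
  - (b / 2) * cos (al + be) + a / 2 * sin (al + be) +
  (b / 2 * cos (al - be) + - (a / 2) * sin (al - be)).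
Proof. by rewrite cosB sinB cosD sinD; field. Qed.

Let trig_mul_cos a b (al be : R) : (a * cos al + b * sin al) * cos be =
  a / 2 * cos (al + be) + b / 2 * sin (al + be) +
  (a / 2 * cos (al - be) + b / 2 * sin (al - be)).
Proof. by rewrite cosB sinB cosD sinD; field. Qed.

(** Product formulas leave the frequencies n - (k+1) and n + (k+1), and only a zero frequency
    survives integration over a period. The two cases n = k+1 and n = -(k+1) carry opposite
    signs. *)
Lemma conv_sin_trig k n phi a b x :
  conv (fun t => sin (k.+1%:R * t)) (trig n phi a b) x =
  ((n == k.+1%:Z)%:R - (n == - k.+1%:Z)%:R) * trig n phi (- b) a x.
Proof.
rewrite /conv; set K : R := k.+1%:R.
have e u : trig n phi a b u * sin (K * (x - u)) =
    trig (n - k.+1%:Z) (phi + K * x) (- (b / 2)) (a / 2) u +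
    trig (n + k.+1%:Z) (phi - K * x) (b / 2) (- (a / 2)) u.
  rewrite /trig -/K; set al := n%:~R * u + phi; set be := K * (x - u).
  have -> : (n - k.+1%:Z)%:~R * u + (phi + K * x) = al + be.
    by rewrite intrB -pmulrn -/K /al /be; ring.
  have -> : (n + k.+1%:Z)%:~R * u + (phi - K * x) = al - be.
    by rewrite intrD -pmulrn -/K /al /be; ring.
  exact: trig_mul_sin.
under eq_Rintegral do rewrite e.
rewrite RintegralD; [|exact: measurable_period|exact: trig_integrable|exact: trig_integrable].
rewrite !Rintegral_trig subr_eq0 addr_eq0.
have pi0 : (pi : R) != 0 by rewrite gt_eqF ?pi_gt0.
have nz : (k.+1%:Z == - k.+1%:Z) = false by [].
have [->|h1] := eqVneq n k.+1%:Z.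
  rewrite nz /trig -pmulrn -/K !mul0r !add0r [K * x + phi]addrC.
  by rewrite /= !mulr0n !mulr1n; move: (cos _) (sin _) (cos _) (sin _) (pi : R) pi0 => ? ? ? ? p p0; field.
have [->|h2] := eqVneq n (- k.+1%:Z); last first.
  by rewrite /= !mulr0n; move: (trig _ _ _ _ _) (trig _ _ _ _ _) (trig _ _ _ _ _) => ? ? ?; ring.
rewrite /trig mulrNz -pmulrn -/K !mul0r !add0r mulNr [_ + phi]addrC ?mulNr.
by rewrite /= !mulr0n !mulr1n; move: (cos _) (sin _) (cos _) (sin _) (pi : R) pi0 => ? ? ? ? p p0; field.
Qed.

Lemma conv_cos_trig k n phi a b x :
  conv (fun t => cos (k.+1%:R * t)) (trig n phi a b) x =
  ((n == k.+1%:Z)%:R + (n == - k.+1%:Z)%:R) * trig n phi a b x.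
Proof.
rewrite /conv; set K : R := k.+1%:R.
have e u : trig n phi a b u * cos (K * (x - u)) =
    trig (n - k.+1%:Z) (phi + K * x) (a / 2) (b / 2) u +
    trig (n + k.+1%:Z) (phi - K * x) (a / 2) (b / 2) u.
  rewrite /trig -/K; set al := n%:~R * u + phi; set be := K * (x - u).
  have -> : (n - k.+1%:Z)%:~R * u + (phi + K * x) = al + be.
    by rewrite intrB -pmulrn -/K /al /be; ring.
  have -> : (n + k.+1%:Z)%:~R * u + (phi - K * x) = al - be.
    by rewrite intrD -pmulrn -/K /al /be; ring.
  exact: trig_mul_cos.
under eq_Rintegral do rewrite e.
rewrite RintegralD; [|exact: measurable_period|exact: trig_integrable|exact: trig_integrable].
rewrite !Rintegral_trig subr_eq0 addr_eq0.
have pi0 : (pi : R) != 0 by rewrite gt_eqF ?pi_gt0.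
have nz : (k.+1%:Z == - k.+1%:Z) = false by [].
have [->|h1] := eqVneq n k.+1%:Z.
  rewrite nz /trig -pmulrn -/K !mul0r !add0r [K * x + phi]addrC.
  by rewrite /= !mulr0n !mulr1n; move: (cos _) (sin _) (cos _) (sin _) (pi : R) pi0 => ? ? ? ? p p0; field.
have [->|h2] := eqVneq n (- k.+1%:Z); last first.
  by rewrite /= !mulr0n; move: (trig _ _ _ _ _) (trig _ _ _ _ _) (trig _ _ _ _ _) => ? ? ?; ring.
rewrite /trig mulrNz -pmulrn -/K !mul0r !add0r mulNr [_ + phi]addrC.
by rewrite /= !mulr0n !mulr1n; move: (cos _) (sin _) (cos _) (sin _) (pi : R) pi0 => ? ? ? ? p p0; field.
Qed.

Lemma conv_1_trig n phi a b x :
  conv (fun=> 1) (trig n phi a b) x = 2 * (n == 0)%:R * trig n phi a b x.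
Proof.
rewrite /conv (@eq_Rintegral _ _ _ mu _ (trig n phi a b)); last by move=> u _; rewrite mulr1.
have pi0 : (pi : R) != 0 by rewrite gt_eqF ?pi_gt0.
by rewrite Rintegral_trig; have [->|_] := eqVneq n 0; rewrite ?mulr0 ?mul0r ?mulr0 ?mulr1//; move: (pi : R) pi0 => p p0; field.
Qed.

Lemma sum_freq_sg (W : nat -> R) n (N : nat) :
  \sum_(0 <= k < N) W k.+1 * ((n == k.+1%:Z)%:R - (n == - k.+1%:Z)%:R) =
  (sgz n)%:~R * (`|n| <= N)%N%:R * W `|n|%N.
Proof.
elim: N => [|N IH].
  rewrite big_geq// leqn0 absz_eq0; case: eqP => [->|_]; first by rewrite sgz0 !mul0r.
  by rewrite mulr0 mul0r.
rewrite big_nat_recr//= IH.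
have [->|h1] := eqVneq n N.+1%:Z.
  rewrite (_ : (N.+1%:Z == - N.+1%:Z) = false)//= leqnn ltnn mulr0 mul0r add0r.
  by rewrite gtr0_sgz// subr0 !mulr1 mul1r.
have [->|h2] := eqVneq n (- N.+1%:Z).
  by rewrite abszN/= leqnn ltnn mulr0 mul0r add0r sgzN gtr0_sgz// sub0r !mulrN1 mulr1 mulN1r.
rewrite subrr mulr0 addr0; congr (_ * _%:R * _).
by congr (nat_of_bool _); apply/idP/idP; lia.
Qed.

Lemma sum_freq (W : nat -> R) n (N : nat) : n != 0 ->
  \sum_(0 <= k < N) W k.+1 * ((n == k.+1%:Z)%:R + (n == - k.+1%:Z)%:R) =
  (`|n| <= N)%N%:R * W `|n|%N.
Proof.
move=> n0; elim: N => [|N IH].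
  by rewrite big_geq// leqn0 absz_eq0 (negbTE n0) mul0r.
rewrite big_nat_recr//= IH.
have [->|h1] := eqVneq n N.+1%:Z.
  rewrite (_ : (N.+1%:Z == - N.+1%:Z) = false)//= leqnn ltnn mul0r add0r.
  by rewrite addr0 mulr1 mul1r.
have [->|h2] := eqVneq n (- N.+1%:Z).
  by rewrite abszN/= leqnn ltnn mul0r !add0r mulr1 mul1r.
rewrite addr0 mulr0 addr0; congr (_%:R * _).
by congr (nat_of_bool _); apply/idP/idP; lia.
Qed.

Lemma conv_sumr (I : Type) (s : seq I) (n : I -> int) (phi a b : I -> R) (k : R -> R) (M : R) x :
  measurable_fun [set: R] k -> (forall t, `|k t| <= M) ->
  conv k (fun u => \sum_(p <- s) trig (n p) (phi p) (a p) (b p) u) x =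
  \sum_(p <- s) conv k (trig (n p) (phi p) (a p) (b p)) x.
Proof.
move=> mk kM; rewrite /conv -mulr_sumr; congr (_ * _).
under eq_Rintegral do rewrite mulr_suml.
apply: Rintegral_fsum; first exact: measurable_period.
move=> p; apply: (@bounded_integrable _ _ _ _ _ _ ((`|a p| + `|b p|) * M)).
- exact: measurable_period.
- exact: period_lty.
- apply: measurable_funTS; apply: measurable_funM; first exact: measurable_trig.
  exact: measurable_reflect.
- by move=> u _; rewrite normrM ler_pM// normr_trig_le.
Qed.

Lemma eq0_geometric (d C r : R) (N0 : nat) : 0 <= r < 1 ->
  (forall N, (N0 <= N)%N -> `|d| <= C * r ^+ N) -> d = 0.
Proof.
move=> /andP[r0 r1] h; apply/eqP; rewrite -normr_le0.
have c0 : (fun N => C * r ^+ N) @ \oo --> (0 : R).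
  by rewrite -[X in _ --> X](mulr0 C); apply: cvgMr; apply: cvg_expr; rewrite ger0_norm.
by apply: (cvgr_to_ge c0); exists N0 => // N /= /h.
Qed.

Let period_measure x : fine (mu (period x)) = 2 * pi.
Proof.
rewrite lebesgue_measure_itv/= lte_fin ifT /=; first by ring.
by have := @pi_gt0 R; lra.
Qed.

Section Bounded.
Variables (g : R -> R) (M : R).
Hypotheses (mg : measurable_fun [set: R] g) (gM : forall u, `|g u| <= M).

Lemma conv_integrable (k : R -> R) (e : R) x :
  measurable_fun [set: R] k -> (forall t, `|k t| <= e) ->
  mu.-integrable (period x) (EFin \o (fun u => g u * k (x - u))).
Proof.
move=> mk ke; apply: (@bounded_integrable _ _ _ _ _ _ (M * e)).
- exact: measurable_period.
- exact: period_lty.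
- by apply: measurable_funTS; apply: measurable_funM => //; exact: measurable_reflect.
- by move=> u _; rewrite normrM ler_pM.
Qed.

Lemma normr_conv_le (k : R -> R) (e : R) x :
  measurable_fun [set: R] k -> (forall t, `|k t| <= e) -> `|conv k g x| <= 2 * M * e.
Proof.
move=> mk ke; have M0 : 0 <= M by exact: le_trans (gM 0).
have e0 : 0 <= e by exact: le_trans (ke 0).
have pi0 := @pi_gt0 R.
rewrite /conv normrM gtr0_norm ?invr_gt0// ler_pdivrMl//.
apply: le_trans (le_normr_Rintegral (measurable_period x) (conv_integrable x mk ke)) _.
rewrite [leRHS](_ : _ = Rintegral mu (period x) (fun=> M * e)); last first.
  rewrite Rintegral_cst; last exact: measurable_period.
  by rewrite period_measure; move: (pi : R) => p; ring.
apply: le_Rintegral; first exact: measurable_period.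
- by have := integrable_abse (conv_integrable x mk ke).
- apply: (@bounded_integrable _ _ _ _ _ _ `|M * e|) => //; first exact: measurable_period.
  exact: period_lty.
- by move=> u _; rewrite normrM ler_pM.
Qed.

Lemma convB (k k' : R -> R) (e e' : R) x :
  measurable_fun [set: R] k -> (forall t, `|k t| <= e) ->
  measurable_fun [set: R] k' -> (forall t, `|k' t| <= e') ->
  conv (fun t => k t - k' t) g x = conv k g x - conv k' g x.
Proof.
move=> mk ke mk' ke'; rewrite /conv -mulrBr; congr (_ * _).
rewrite -RintegralB; [|exact: measurable_period|exact: conv_integrable mk ke|exact: conv_integrable mk' ke'].
by apply: eq_Rintegral => u _; rewrite mulrBr.
Qed.

Lemma convZ (c : R) (k : R -> R) (e : R) x :
  measurable_fun [set: R] k -> (forall t, `|k t| <= e) ->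
  conv (fun t => c * k t) g x = c * conv k g x.
Proof.
move=> mk ke; rewrite /conv mulrCA; congr (_ * _).
rewrite -RintegralZl; [|exact: measurable_period|exact: conv_integrable mk ke].
by apply: eq_Rintegral => u _; rewrite mulrCA.
Qed.

Lemma conv_suml (I : Type) (s : seq I) (k : I -> R -> R) (e : I -> R) x :
  (forall i, measurable_fun [set: R] (k i)) -> (forall i t, `|k i t| <= e i) ->
  conv (fun t => \sum_(i <- s) k i t) g x = \sum_(i <- s) conv (k i) g x.
Proof.
move=> mk ke; rewrite /conv -mulr_sumr; congr (_ * _).
under eq_Rintegral do rewrite mulr_sumr.
apply: Rintegral_fsum; first exact: measurable_period.
by move=> i; exact: conv_integrable (ke i).
Qed.

(** A convolution is identified through approximations of its kernel that are uniformly
    geometrically close and whose convolutions eventually equal c: the difference is bounded by a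
    multiple of r^N for all large N. *)
Lemma conv_eq_geometric (k : R -> R) (e : R) (F : nat -> R -> R) (E : nat -> R) (C r c : R) (N0 : nat) x :
  0 <= r < 1 -> measurable_fun [set: R] k -> (forall t, `|k t| <= e) ->
  (forall N, measurable_fun [set: R] (F N)) -> (forall N t, `|F N t| <= E N) ->
  (forall N t, `|k t - F N t| <= C * r ^+ N) ->
  (forall N, (N0 <= N)%N -> conv (F N) g x = c) -> conv k g x = c.
Proof.
move=> r01 mk ke mF FE kF h; apply/eqP; rewrite -subr_eq0; apply/eqP.
apply: (@eq0_geometric _ (2 * M * C) r N0 r01) => N N0N.
rewrite -(h N N0N) -(convB _ mk ke (mF N) (FE N)) -mulrA.
apply: normr_conv_le; last exact: kF.
exact: measurable_funB.
Qed.

End Bounded.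

Lemma conv_cdirichlet_trig N n phi a b x :
  conv (cdirichlet N) (trig n phi a b) x =
  (sgz n)%:~R * (`|n| <= N)%N%:R * trig n phi (- b) a x.
Proof.
have mg := measurable_trig n phi a b; have gM := normr_trig_le n phi a b.
rewrite /cdirichlet (@conv_suml _ _ mg gM _ _ _ (fun=> 1)); last 2 first.
- by move=> k; apply: (measurableT_comp (@measurable_sin _)); exact: measurable_funM.
- by move=> k t; rewrite ler_norml sin_geN1 sin_le1.
under eq_bigr do rewrite conv_sin_trig -[X in X * _]mul1r.
by rewrite -mulr_suml (sum_freq_sg (fun=> 1)) mulr1.
Qed.

Lemma conv_cpoisson_trig (r : R) n phi a b x : 0 <= r < 1 ->
  conv (cpoisson r) (trig n phi a b) x = (sgz n)%:~R * r ^+ `|n|%N * trig n phi (- b) a x.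
Proof.
move=> r01; have mg := measurable_trig n phi a b; have gM := normr_trig_le n phi a b.
have /andP[r0 r1] := r01.
have ms k : measurable_fun [set: R] (fun t : R => sin (k.+1%:R * t)).
  by apply: (measurableT_comp (@measurable_sin _)); exact: measurable_funM.
have sb k t : `|sin (k.+1%:R * t) : R| <= 1 by rewrite ler_norml sin_geN1 sin_le1.
have rb k t : `|r ^+ k.+1 * sin (k.+1%:R * t)| <= 1.
  rewrite normrM -[leRHS]mulr1 ler_pM//.
  by rewrite ger0_norm ?exprn_ge0// exprn_ile1// ltW.
refine (@conv_eq_geometric _ _ mg gM _ _ (fun N t => \sum_(0 <= k < N) r ^+ k.+1 * sin (k.+1%:R * t))
  (fun N => \sum_(0 <= k < N) 1) (2 / (1 - r) ^+ 2) r _ `|n|%N _ r01 (measurable_cpoisson r) (fun t => cpoisson_le t r01) _ _ _ _).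
- by move=> N; apply: measurable_sum => k; exact: measurable_funM.
- by move=> N t; apply: le_trans (ler_norm_sum _ _ _) _; apply: ler_sum => k _; exact: rb.
- by move=> N t; rewrite mulrAC; exact: cpoisson_series.
move=> N nN; rewrite (@conv_suml _ _ mg gM _ _ _ (fun=> 1)); last 2 first.
- by move=> k; exact: measurable_funM.
- exact: rb.
under eq_bigr do rewrite (convZ mg gM _ _ (ms _) (sb _)) conv_sin_trig mulrA.
by rewrite -mulr_suml (sum_freq_sg (fun k => r ^+ k)) nN mulr1.
Qed.

Lemma measurable_poisson (r : R) : measurable_fun [set: R] (poisson r).
Proof.
apply: measurable_funM => //; apply: (measurableT_comp (@measurable_inv _)).
apply: measurable_funD => //; apply: measurable_funB => //.
by apply: measurable_funM => //; exact: measurable_cos.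
Qed.

Lemma poisson_bound (r t : R) : 0 <= r < 1 -> `|poisson r t| <= ((1 - r) ^+ 2)^-1.
Proof.
move=> r01; have /andP[r0 r1] := r01; rewrite ger0_norm ?poisson_ge0//.
rewrite -[leRHS]mul1r; apply: ler_pM; rewrite ?invr_ge0 ?(ltW (poisson_den_gt0 _ r01))//.
- by rewrite subr_ge0 expr_le1// ltW.
- by rewrite gerBl sqr_ge0.
- by rewrite lef_pV2 ?posrE ?poisson_den_gt0 ?exprn_gt0 ?subr_gt0// poisson_den_ge.
Qed.

Lemma conv_poisson_trig (r : R) n phi a b x : 0 <= r < 1 ->
  conv (poisson r) (trig n phi a b) x = 2 * r ^+ `|n|%N * trig n phi a b x.
Proof.
move=> r01; have mg := measurable_trig n phi a b; have gM := normr_trig_le n phi a b.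
have /andP[r0 r1] := r01.
have ms k : measurable_fun [set: R] (fun t : R => cos (k.+1%:R * t)).
  by apply: (measurableT_comp (@measurable_cos _)); exact: measurable_funM.
have sb k t : `|cos (k.+1%:R * t) : R| <= 1 by rewrite ler_norml cos_geN1 cos_le1.
have rb k t : `|2 * r ^+ k.+1 * cos (k.+1%:R * t)| <= 2.
  rewrite !normrM -[leRHS]mulr1 -mulrA ler_pM// ?normr_nat//.
  rewrite -[leRHS]mulr1 ler_pM//.
  by rewrite ger0_norm ?exprn_ge0// exprn_ile1// ltW.
(* The Poisson series is written as a difference of 1 and a sum of opposites so that [convB] applies
   to it. *)
pose F N (t : R) := 1 - (\sum_(0 <= k < N) - (2 * r ^+ k.+1 * cos (k.+1%:R * t))).
have mF1 k : measurable_fun [set: R] (fun t : R => - (2 * r ^+ k.+1 * cos (k.+1%:R * t))).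
  by apply: measurableT_comp => //; exact: measurable_funM.
have FE1 k t : `|- (2 * r ^+ k.+1 * cos (k.+1%:R * t))| <= 2 by rewrite normrN.
have mF2 N : measurable_fun [set: R] (fun t : R => \sum_(0 <= k < N) - (2 * r ^+ k.+1 * cos (k.+1%:R * t))).
  by apply: measurable_sum.
have FE2 N t : `|\sum_(0 <= k < N) - (2 * r ^+ k.+1 * cos (k.+1%:R * t))| <= \sum_(0 <= k < N) 2.
  by apply: le_trans (ler_norm_sum _ _ _) _; apply: ler_sum => k _.
refine (@conv_eq_geometric _ _ mg gM _ _ F (fun N => 1 + \sum_(0 <= k < N) 2) (4 / (1 - r) ^+ 2) r _
  `|n|%N _ r01 (measurable_poisson r) (fun t => poisson_bound t r01) _ _ _ _).
- by move=> N; apply: measurable_funB.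
- by move=> N t; apply: le_trans (ler_normB _ _) _; rewrite normr1 lerD2l.
- move=> N t; rewrite mulrAC; apply: le_trans (poisson_series t N r01).
  rewrite /F sumrN opprK mulr_sumr; under eq_bigr do rewrite -mulrA.
  exact: lexx.
move=> N nN; rewrite (@convB _ _ mg gM _ _ 1 (\sum_(0 <= k < N) 2)) => //; last first.
  by move=> t; rewrite normr1.
rewrite (@conv_suml _ _ mg gM _ _ _ (fun=> 2))// conv_1_trig.
have e k : conv (fun t : R => - (2 * r ^+ k.+1 * cos (k.+1%:R * t))) (trig n phi a b) x =
    r ^+ k.+1 * ((n == k.+1%:Z)%:R + (n == - k.+1%:Z)%:R) * (- 2 * trig n phi a b x).
  rewrite (_ : (fun t => _) = (fun t => (- (2 * r ^+ k.+1)) * cos (k.+1%:R * t))); last first.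
    by apply/funext => t; rewrite mulNr.
  rewrite (convZ mg gM _ _ (ms k) (sb k)) conv_cos_trig.
  by move: (_ + _) (trig _ _ _ _ _) (_ ^+ _) => c ? ?; ring.
under eq_bigr do rewrite e.
rewrite -mulr_suml mulNr mulrN opprK.
have [->|n0] := eqVneq n 0.
  rewrite big1 ?mulr0 ?mul0r ?addr0; first by rewrite absz0 expr0 !mulr1.
  by move=> k _; rewrite (_ : (0 == k.+1%:Z) = false)// (_ : (0 == - k.+1%:Z) = false)// addr0 mulr0.
by rewrite (sum_freq (fun k => r ^+ k) _ n0) nN mul1r mulr0 mul0r add0r mulrCA mulrA.
Qed.

End TrigIntegrals.

(** * Translation invariance and integrals of periodic functions *)

Section PeriodicShift.
Context {R : realType}.
Local Notation mu := (@lebesgue_measure R).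
Local Open Scope ereal_scope.

(** The pushforward by a translation agrees with the measure on half-open intervals, which determine
    it. *)
Lemma lebesgue_measure_shift (t : R) (A : set R) : measurable A ->
  pushforward mu (fun x : R => (x + t)%R : measurableTypeR R) A = mu A.
Proof.
move=> mA.
have mt : measurable_fun [set: measurableTypeR R] (fun x : R => (x + t)%R : measurableTypeR R).
  by apply: measurable_funD.
pose mixin := isMeasurableFun.Build _ _ _ _ _ mt.
pose phi : {mfun measurableTypeR R >-> measurableTypeR R} := HB.pack (fun x : R => (x + t)%R : measurableTypeR R) mixin.
apply/esym; apply: (@lebesgue_measure_unique _ (pushforward mu phi)) => //= _ [[a b]] _ <-.
rewrite /pushforward/= (_ : phi @^-1` _ = `](a - t)%R, (b - t)%R]%classic); last first.
  by apply/seteqP; split => x /=; rewrite !in_itv/= ltrBlDr lerBrDr.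
rewrite !lebesgue_measure_itv/= !lte_fin ltrD2r -!EFinD; case: ifP => // _.
by congr _%:E; ring.
Qed.

Lemma ge0_integral_split (f : R -> \bar R) (a b c : R) :
  measurable_fun [set: R] f -> (forall x, 0 <= f x) -> (a <= b)%R -> (b <= c)%R ->
  \int[mu]_(x in `[a, c[) f x = \int[mu]_(x in `[a, b[) f x + \int[mu]_(x in `[b, c[) f x.
Proof.
move=> mf f0 ab bc; rewrite -ge0_integral_setU//=.
- congr integral; apply/seteqP; split => x /=; rewrite !in_itv/=.
    by move=> /andP[-> xc]; have [|bx] := ltP x b; [left|right].
  by move=> [/andP[-> xb]|/andP[bx ->]]/=; rewrite ?(lt_le_trans xb)// (le_trans ab).
- exact: measurable_funTS.
- apply/disj_setPS => x/=; rewrite !in_itv/= => -[/andP[_ h1] /andP[h2 _]].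
  by move: (lt_le_trans h1 h2); rewrite ltxx.
Qed.

Lemma ge0_integral_shift (f : R -> \bar R) (t a b : R) :
  measurable_fun [set: R] f -> (forall x, 0 <= f x) ->
  \int[mu]_(x in `[a, b[) f (x + t)%R = \int[mu]_(x in `[(a + t)%R, (b + t)%R[) f x.
Proof.
move=> mf f0.
have mt : measurable_fun [set: measurableTypeR R] (fun x : R => (x + t)%R : measurableTypeR R).
  by apply: measurable_funD.
have -> : `[a, b[%classic = (fun x : R => (x + t)%R : measurableTypeR R) @^-1` `[(a + t)%R, (b + t)%R[%classic.
  by apply/seteqP; split => x /=; rewrite !in_itv/= lerD2r ltrD2r.
rewrite -(@ge0_integral_pushforward _ _ _ _ _ _ mt mu _ f)//; last exact: measurable_funTS.
by apply: eq_measure_integral => A mA _; exact: lebesgue_measure_shift.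
Qed.

Definition cycle : set R := `[- pi, pi[%classic%R.

Lemma measurable_cycle : measurable cycle.
Proof. exact: measurable_itv. Qed.

Variable f : R -> \bar R.
Hypotheses (mf : measurable_fun [set: R] f) (f0 : forall x, 0 <= f x)
  (fper : forall x, f (x + 2 * pi)%R = f x).

(** The shifted cycle sticks out by [pi, pi + t), and moving this piece back by one period fills the
    gap [-pi, -pi + t). *)
Lemma integral_cycle_shift_pos (t : R) : (0 <= t <= 2 * pi)%R ->
  \int[mu]_(x in cycle) f (x + t)%R = \int[mu]_(x in cycle) f x.
Proof.
move=> /andP[t0 t2]; rewrite /cycle ge0_integral_shift//.
have e a b c := @ge0_integral_split f a b c mf f0.
have pi0 := @pi_ge0 R.
rewrite (e (- pi + t)%R pi)%R; [|lra|lra].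
rewrite [RHS](e (- pi)%R (- pi + t)%R); [|lra|lra].
rewrite addeC; congr (_ + _).
have := @ge0_integral_shift f (2 * pi)%R (- pi)%R (- pi + t)%R mf f0.
rewrite (_ : - pi + 2 * pi = pi :> R)%R; last by lra.
rewrite (_ : - pi + t + 2 * pi = pi + t :> R)%R; last by lra.
by move=> <-; apply: eq_integral.
Qed.

Lemma integral_cycle_shift (t : R) : (`|t| <= 2 * pi)%R ->
  \int[mu]_(x in cycle) f (x + t)%R = \int[mu]_(x in cycle) f x.
Proof.
rewrite ler_norml => /andP[t1 t2]; have [t0|t0] := leP 0%R t.
  by apply: integral_cycle_shift_pos; rewrite t0.
rewrite -(@integral_cycle_shift_pos (t + 2 * pi)%R); last by apply/andP; split; lra.
by apply: eq_integral => x _; rewrite addrA fper.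
Qed.

Lemma integral_3cycle : \int[mu]_(x in `[(- (3 * pi))%R, (3 * pi)%R]) f x =
  3%:R%:E * \int[mu]_(x in cycle) f x.
Proof.
have pi0 := @pi_ge0 R.
rewrite -integral_itv_bndo_bndc; last exact: measurable_funTS.
have e a b c := @ge0_integral_split f a b c mf f0.
rewrite (e _ (- pi)%R); [|lra|lra].
rewrite (e (- pi)%R pi); [|lra|lra].
have -> : \int[mu]_(x in `[pi, (3 * pi)%R[) f x = \int[mu]_(x in cycle) f x.
  rewrite (_ : 3 * pi = pi + 2 * pi)%R; last by lra.
  rewrite {1}(_ : pi = - pi + 2 * pi :> R)%R; last by lra.
  by rewrite -ge0_integral_shift//; apply: eq_integral.
have -> : \int[mu]_(x in `[(- (3 * pi))%R, (- pi)%R[) f x = \int[mu]_(x in cycle) f x.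
  have := @ge0_integral_shift f (2 * pi)%R (- (3 * pi))%R (- pi)%R mf f0.
  rewrite (_ : - (3 * pi) + 2 * pi = - pi :> R)%R; last by lra.
  rewrite (_ : - pi + 2 * pi = pi :> R)%R; last by lra.
  by move=> <-; apply/esym; apply: eq_integral.
rewrite (_ : 3%:R = 1 + (1 + 1) :> R)%R; last by lra.
by rewrite EFinD ge0_muleDl ?lee_fin// mul1e EFinD ge0_muleDl ?lee_fin// mul1e.
Qed.

End PeriodicShift.

(** * Exponential bounds over dyadic windows *)

Section ExpWindow.
Context {R : realType}.
Local Notation mu := (@lebesgue_measure R).

(* Chosen so that the square of each radius is the previous one: the Poisson
   averages of all scales are iterates of a finest one. *)
Definition dyadic_radius (i : nat) : R := expR (- ((2 ^ i)%:R)^-1).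

Lemma dyadic_radius01 i : 0 <= dyadic_radius i < 1.
Proof.
by rewrite expR_ge0/= -expR0 ltr_expR oppr_lt0 invr_gt0 ltr0n expn_gt0.
Qed.

(** These are the bounds under which [initial_window] accepts the conjugate Poisson mean as centre
    of the window of length 2^i starting at 0. *)
Lemma dyadic_radius_window i :
  ((2 ^ i)%:R)^-1 / 2 <= 1 - dyadic_radius i <= ((2 ^ i)%:R)^-1.
Proof.
rewrite /dyadic_radius; set t := _^-1.
have t0 : 0 < t by rewrite invr_gt0 ltr0n expn_gt0.
have t1 : t <= 1 by rewrite invf_le1 ?ltr0n ?expn_gt0// ler1n expn_gt0.
apply/andP; split; last by have := expR_ge1Dx (- t); lra.
have h : 1 + t <= expR t by exact: expR_ge1Dx.
have p : 0 < 1 + t by lra.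
have : expR (- t) <= (1 + t)^-1 by rewrite expRN lef_pV2 ?posrE ?expR_gt0.
have : (1 + t)^-1 * (1 + t) = 1 by rewrite mulVf// gt_eqF.
move: ((1 + t)^-1) (expR (- t)) => v w vt wv.
have v0 : 1 / 2 <= v by nra.
nra.
Qed.

Lemma window_const_ge0 : 0 <= window_const :> R.
Proof.
rewrite /window_const; apply: mulr_ge0; first exact: ler0n.
apply: addr_ge0; first exact: ler0n.
by apply: mulr_ge0; [exact: ler0n|apply: mulr_ge0; exact: ler0n].
Qed.

Lemma initial_const_ge0 : 0 <= initial_const :> R.
Proof.
rewrite /initial_const; apply: addr_ge0; last by apply: mulr_ge0; [exact: ler0n|exact: sqr_ge0].
by apply: mulr_ge0; [exact: ler0n|exact: window_const_ge0].
Qed.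

(** At least 1, hence at most its own square; so the square of [exp_const * lam] dominates both
    window constants times lam^2. *)
Definition exp_const : R := 1 + window_const + initial_const.

Lemma exp_const_ge1 : 1 <= exp_const.
Proof.
have w0 := window_const_ge0.
rewrite /exp_const -addrA lerDl addr_ge0//; exact: initial_const_ge0.
Qed.

(** The sequence passed to [exp_window] is the conjugate sums minus the conjugate Poisson mean, with
    q = 0. Subtracting a constant leaves the oscillations unchanged, and the exceptional set is the
    same for every i. *)
Lemma exp_window_conv (g : R -> R) (M S lam : R) x i :
  measurable_fun [set: R] g -> (forall u, `|g u| <= M) ->
  (\int[mu]_t (cutoff g t)%:E <= S%:E)%E -> 0 < lam -> - pi <= x <= pi ->
  ~ bad_set (cutoff g) lam x ->
  \sum_(0 <= n < 2 ^ i)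
    expR (`|conv (cdirichlet n) g x - conv (cpoisson (dyadic_radius i)) g x| / (4 * (exp_const * lam)))
  <= (2 ^ i)%:R * 12.
Proof.
move=> mg gM gS lam0 xpi xbad.
have w0 := window_const_ge0.
have i0 := initial_const_ge0.
have K1 := exp_const_ge1.
have B0 : 0 < exp_const * lam by rewrite mulr_gt0// (lt_le_trans ltr01).
have KK : exp_const <= exp_const ^+ 2 :> R by rewrite expr2 ler_peMr// (le_trans ler01).
have le2 l (c : R) : 0 <= c <= exp_const -> l%:R * (c * lam ^+ 2) <= l%:R * (exp_const * lam) ^+ 2.
  move=> /andP[c0 cK]; rewrite ler_wpM2l// exprMn ler_wpM2r ?sqr_ge0//.
  exact: le_trans cK KK.
apply: (@exp_window _ _ _ 0) => //.
- move=> a l l0.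
  have aux c : \sum_(a <= n < a + l) (tau g x n - c) ^+ 2 <= l%:R * (window_const * lam ^+ 2) ->
      exists c, \sum_(a <= n < a + l) (conv (cdirichlet n) g x -
        conv (cpoisson (dyadic_radius i)) g x - c) ^+ 2 <= l%:R * (exp_const * lam) ^+ 2.
    move=> h; exists (c - conv (cpoisson (dyadic_radius i)) g x).
    apply: le_trans (le2 l window_const _); last first.
      by apply/andP; split => //; rewrite /exp_const; lra.
    apply: le_trans h; rewrite le_eqVlt; apply/orP; left; apply/eqP.
    by apply: eq_bigr => n _; congr (_ ^+ 2); rewrite /tau; ring.
  exact: (aux _ (@window_oscillation _ g M S lam mg gM gS lam0 x xpi xbad l l0 a)).
- apply: le_trans (le2 (2 ^ i)%N initial_const _); last first.
    by apply/andP; split => //; rewrite /exp_const; lra.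
  have l0 : (0 < 2 ^ i)%N by rewrite expn_gt0.
  apply: le_trans (@initial_window _ g M S lam mg gM gS lam0 x xpi xbad _ l0 _ (dyadic_radius01 i) (dyadic_radius_window i)).
  by rewrite le_eqVlt; apply/orP; left; apply/eqP; apply: eq_bigr => n _; rewrite subr0.
- by rewrite normr0 ltW.
Qed.

End ExpWindow.

(** * Lebesgue measure on the torus *)

Section TorusMeasure.
Context {R : realType}.
Local Notation mu := (@lebesgue_measure R).
Local Notation borel2 := (@lebesgue_measure R \x @lebesgue_measure R)%E.
Local Notation plane := (caratheodory_type (borel2^*)%mu).
Local Notation m2 := (@lebesgue_measure2 R).
Local Notation RR := (measurableTypeR R * measurableTypeR R)%type.
Local Open Scope ereal_scope.
Implicit Types (A : set (R * R)) (F : R * R -> \bar R).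

Lemma borel_plane A : measurable (A : set RR) -> measurable (A : set plane).
Proof.
move=> mA; apply: (@sub_caratheodory _ _ _ borel2).
exact: sub_sigma_algebra.
Qed.

Lemma lebesgue_measure2E A : measurable (A : set RR) -> m2 A = borel2 A.
Proof. by move=> mA; exact: measurable_mu_extE. Qed.

Lemma measurable_fun_plane d (T : measurableType d) (f : R * R -> T) (D : set (R * R)) :
  measurable_fun [set: RR] f -> measurable (D : set plane) -> measurable_fun (D : set plane) f.
Proof.
move=> mf mD _ B mB; apply: measurableI => //.
by apply: borel_plane; rewrite -[X in measurable X]setTI; exact: mf.
Qed.

Lemma torus2E : @torus2 R = cycle `*` cycle.
Proof.
by apply/seteqP; split => z; rewrite /torus2 /cycle /= !in_itv/= => /andP.
Qed.

Lemma measurable_torus2_borel : measurable (@torus2 R : set RR).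
Proof. by rewrite torus2E; apply: measurableX; exact: measurable_cycle. Qed.

Lemma measurable_torus2 : measurable (@torus2 R : set plane).
Proof. exact: borel_plane measurable_torus2_borel. Qed.

(** The identity from the completed plane to the Borel plane is measurable and pushes [m2] forward
    to the product measure. Tonelli's theorem thus becomes available for Borel integrands. *)
Lemma ge0_integral_plane (D : set (R * R)) F : measurable (D : set RR) ->
  measurable_fun [set: RR] F -> (forall z, 0 <= F z) ->
  \int[m2]_(z in D) F z = \int[borel2]_(z in D) F z.
Proof.
move=> mD mF F0.
have mid : measurable_fun [set: plane] (fun z : plane => (z : RR)).
  by apply: measurable_fun_plane => //; exact: measurableT.
have := @ge0_integral_pushforward _ _ plane RR _ _ mid m2 D F mD (measurable_funTS mF).
move=> /(_ (fun z _ => F0 z)) <-.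
apply: eq_measure_integral => A mA _.
exact: lebesgue_measure2E.
Qed.

Let torusF F : measurable_fun [set: RR] F -> (forall z, 0 <= F z) ->
  measurable_fun [set: RR] (F \_ torus2) /\ (forall z, 0 <= (F \_ torus2) z).
Proof.
move=> mF F0; split; last by move=> z; rewrite patchE; case: ifP.
by apply/(measurable_restrictT _ measurable_torus2_borel); exact: measurable_funTS.
Qed.

Let patchF F x y : (F \_ torus2) (x, y) = ((fun y => F (x, y)) \_ cycle) y * (\1_cycle x)%:E.
Proof.
rewrite !patchE torus2E indicE; case: (boolP (x \in cycle)) => xc; case: (boolP (y \in cycle)) => yc.
- by rewrite mem_set ?mule1//; split; exact: set_mem.
- by rewrite memNset ?mul0e// => -[_ /= h]; move/negP: yc; apply; exact: mem_set.
- by rewrite memNset ?mule0// => -[h _]; move/negP: xc; apply; exact: mem_set.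
- by rewrite memNset ?mul0e// => -[h _]; move/negP: xc; apply; exact: mem_set.
Qed.

Lemma ge0_integral_torus2 F : measurable_fun [set: RR] F -> (forall z, 0 <= F z) ->
  \int[m2]_(z in torus2) F z = \int[mu]_(x in cycle) \int[mu]_(y in cycle) F (x, y).
Proof.
move=> mF F0; rewrite ge0_integral_plane//; last exact: measurable_torus2_borel.
have [mG G0] := torusF mF F0.
rewrite integral_mkcond (@fubini_tonelli1 _ _ _ _ _ mu mu _ mG G0).
rewrite [RHS]integral_mkcond; apply: eq_integral => x _; rewrite /fubini_F patchE.
under eq_integral do rewrite patchF.
case: ifPn => xc; rewrite indicE ?xc ?(negbTE xc).
  by under eq_integral do rewrite mule1; rewrite -integral_mkcond.
by under eq_integral do rewrite mule0; rewrite integral0.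
Qed.

Lemma ge0_integral_torus2_swap F : measurable_fun [set: RR] F -> (forall z, 0 <= F z) ->
  \int[m2]_(z in torus2) F z = \int[mu]_(y in cycle) \int[mu]_(x in cycle) F (x, y).
Proof.
move=> mF F0; rewrite ge0_integral_plane//; last exact: measurable_torus2_borel.
have [mG G0] := torusF mF F0.
rewrite integral_mkcond (@fubini_tonelli2 _ _ _ _ _ mu mu _ mG G0).
rewrite [RHS]integral_mkcond; apply: eq_integral => y _; rewrite /fubini_G patchE.
have e x : (F \_ torus2) (x, y) = ((fun x => F (x, y)) \_ cycle) x * (\1_cycle y)%:E.
  rewrite patchF !patchE !indicE.
  by case: (x \in _); case: (y \in _); rewrite ?mule0 ?mul0e ?mule1.
under eq_integral do rewrite e.
case: ifPn => xc; rewrite indicE ?xc ?(negbTE xc).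
  by under eq_integral do rewrite mule1; rewrite -integral_mkcond.
by under eq_integral do rewrite mule0; rewrite integral0.
Qed.

Lemma cycle_measure : mu cycle = (2 * pi)%:E.
Proof.
rewrite lebesgue_measure_itv/= lte_fin ifT; last by have := @pi_gt0 R; lra.
by rewrite -EFinB; congr _%:E; ring.
Qed.

Lemma torus2_measure : m2 torus2 = (4 * pi ^+ 2)%:E.
Proof.
rewrite lebesgue_measure2E; last exact: measurable_torus2_borel.
rewrite torus2E product_measure1E; try exact: measurable_cycle.
transitivity (mu cycle * mu cycle) => //.
by rewrite !cycle_measure -EFinM; congr _%:E; ring.
Qed.

Lemma torus2_lty : m2 torus2 < +oo.
Proof. by rewrite torus2_measure ltry. Qed.

Section Invariance.
Variable F : R * R -> \bar R.
Hypotheses (mF : measurable_fun [set: RR] F) (F0 : forall z, 0 <= F z).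
Hypotheses (per1 : forall x y, F (x + 2 * pi, y)%R = F (x, y))
  (per2 : forall x y, F (x, y + 2 * pi)%R = F (x, y)).

Let mF1 x : measurable_fun [set: R] (fun y => F (x, y)).
Proof. by apply: (measurableT_comp mF); exact: measurable_pair1. Qed.

Let mF2 y : measurable_fun [set: R] (fun x => F (x, y)).
Proof. by apply: (measurableT_comp mF); exact: measurable_pair2. Qed.

Lemma integral_torus2_shift (s t : R) : (`|s| <= 2 * pi)%R -> (`|t| <= 2 * pi)%R ->
  \int[m2]_(z in torus2) F (z.1 + s, z.2 + t)%R = \int[m2]_(z in torus2) F z.
Proof.
move=> hs ht.
have mshift (u v : R) : measurable_fun [set: RR] (fun z : RR => (z.1 + u, z.2 + v)%R : RR).
  by apply/measurable_fun_pairP; split; apply: measurable_funD.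
rewrite (ge0_integral_torus2 (F := fun z => F (z.1 + s, z.2 + t)%R))//; last first.
  exact: (measurableT_comp mF (mshift s t)).
under eq_integral => x _ do rewrite /= (@integral_cycle_shift _ (fun y => F (x + s, y)%R))//.
rewrite -(ge0_integral_torus2 (F := fun z => F (z.1 + s, z.2)%R))//; last first.
  rewrite (_ : (fun z => _) = (fun z : RR => F (z.1 + s, z.2 + 0)%R)); last first.
    by apply/funext => z; rewrite addr0.
  exact: (measurableT_comp mF (mshift s 0%R)).
rewrite (ge0_integral_torus2_swap (F := fun z => F (z.1 + s, z.2)%R))//; last first.
  rewrite (_ : (fun z => _) = (fun z : RR => F (z.1 + s, z.2 + 0)%R)); last first.
    by apply/funext => z; rewrite addr0.
  exact: (measurableT_comp mF (mshift s 0%R)).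
under eq_integral => y _ do rewrite /= (@integral_cycle_shift _ (fun x => F (x, y)))//.
by rewrite -(ge0_integral_torus2_swap (F := F)).
Qed.

(** For fixed x the shear is a translation in y. It slices the torus along lines of direction (1,
    e), on which the half-plane conjugation for e = 1 or e = -1 becomes one-dimensional. *)
Lemma integral_torus2_shear (e : R) : (`|e| <= 1)%R ->
  \int[m2]_(z in torus2) F z =
  \int[mu]_(y in cycle) \int[mu]_(x in cycle) F (x, y + e * x)%R.
Proof.
move=> e1.
have mshear : measurable_fun [set: RR] (fun z : RR => (z.1, z.2 + e * z.1)%R : RR).
  apply/measurable_fun_pairP; split; first exact: measurable_fst.
  apply: measurable_funD; first exact: measurable_snd.
  by apply: measurable_funM => //; exact: measurable_fst.
rewrite -(ge0_integral_torus2_swap (F := fun z => F (z.1, z.2 + e * z.1)%R))//; last first.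
  exact: (measurableT_comp mF mshear).
rewrite (ge0_integral_torus2 (F := F))// (ge0_integral_torus2 (F := fun z => F (z.1, z.2 + e * z.1)%R))//; last first.
  exact: (measurableT_comp mF mshear).
apply: eq_integral => x xc /=.
rewrite (@integral_cycle_shift _ (fun y => F (x, y)))// normrM.
move: xc; rewrite inE /cycle/= in_itv/= => /andP[x1 x2].
have hx : (`|x| <= pi)%R by rewrite ler_norml x1 ltW.
have pi0 := @pi_ge0 R.
apply: (@le_trans _ _ (1 * pi)%R); first exact: ler_pM.
lra.
Qed.

End Invariance.
End TorusMeasure.

(** * Square sums as one-dimensional conjugate sums *)

Section LineSums.
Context {R : realType}.
Local Notation mu := (@lebesgue_measure R).
Variables (I : Type) (s : seq I) (n : I -> int) (phi : I -> R).
Implicit Types (a b m : I -> R).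

(** The multiplier m is kept apart from the coefficients a and b: kernels act on m, and conjugation
    rotates (a, b) to (-b, a). *)
Definition line_sum a b m (u : R) : R :=
  \sum_(p <- s) m p * trig (n p) (phi p) (a p) (b p) u.

Lemma line_sumE a b m :
  line_sum a b m = (fun u => \sum_(p <- s) trig (n p) (phi p) (m p * a p) (m p * b p) u).
Proof.
apply/funext => u; apply: eq_bigr => p _; rewrite /trig; ring.
Qed.

Definition line_bound a b m : R := \sum_(p <- s) (`|m p * a p| + `|m p * b p|).

Lemma normr_line_sum_le a b m u : `|line_sum a b m u| <= line_bound a b m.
Proof.
rewrite line_sumE; apply: le_trans (ler_norm_sum _ _ _) _.
by apply: ler_sum => p _; exact: normr_trig_le.
Qed.

Lemma measurable_line_sum a b m : measurable_fun [set: R] (line_sum a b m).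
Proof. by rewrite line_sumE; apply: measurable_sum => p; exact: measurable_trig. Qed.

Lemma line_sumD2pi a b m u : line_sum a b m (u + 2 * pi) = line_sum a b m u.
Proof. by apply: eq_bigr => p _; rewrite trigD2pi. Qed.

Lemma conv_line_sum_cdirichlet N a b m x : conv (cdirichlet N) (line_sum a b m) x =
  line_sum (fun p => - b p) a (fun p => m p * ((sgz (n p))%:~R * (`|n p| <= N)%N%:R)) x.
Proof.
rewrite line_sumE (conv_sumr _ _ _ _ _ x (measurable_cdirichlet N) (cdirichlet_le N)).
apply: eq_bigr => p _; rewrite conv_cdirichlet_trig /trig; ring.
Qed.

Lemma conv_line_sum_cpoisson (r : R) a b m x : 0 <= r < 1 ->
  conv (cpoisson r) (line_sum a b m) x =
  line_sum (fun p => - b p) a (fun p => m p * ((sgz (n p))%:~R * r ^+ `|n p|%N)) x.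
Proof.
move=> r01; rewrite line_sumE.
rewrite (conv_sumr _ _ _ _ _ x (measurable_cpoisson r) (fun t => cpoisson_le t r01)).
by apply: eq_bigr => p _; rewrite conv_cpoisson_trig// /trig; ring.
Qed.

Lemma conv_line_sum_poisson (r : R) a b m x : 0 <= r < 1 ->
  conv (poisson r) (line_sum a b m) x =
  2 * line_sum a b (fun p => m p * r ^+ `|n p|%N) x.
Proof.
move=> r01; rewrite line_sumE.
rewrite (conv_sumr _ _ _ _ _ x (measurable_poisson r) (fun t => poisson_bound t r01)).
by rewrite mulr_sumr; apply: eq_bigr => p _; rewrite conv_poisson_trig// /trig; ring.
Qed.

End LineSums.

(** * Monotonicity of convolutions *)

Section ConvMonotone.
Context {R : realType}.
Local Notation mu := (@lebesgue_measure R).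

Lemma le_conv (g g' k k' : R -> R) (M M' e e' : R) x :
  measurable_fun [set: R] g -> (forall u, `|g u| <= M) ->
  measurable_fun [set: R] g' -> (forall u, `|g' u| <= M') ->
  measurable_fun [set: R] k -> (forall u, `|k u| <= e) ->
  measurable_fun [set: R] k' -> (forall u, `|k' u| <= e') ->
  (forall u, g u * k (x - u) <= g' u * k' (x - u)) -> conv k g x <= conv k' g' x.
Proof.
move=> mg gM mg' gM' mk ke mk' ke' h; rewrite /conv ler_wpM2l ?invr_ge0 ?pi_ge0//.
apply: le_Rintegral; first exact: measurable_period.
- exact: (conv_integrable mg gM x mk ke).
- exact: (conv_integrable mg' gM' x mk' ke').
- by move=> u _.
Qed.

End ConvMonotone.

Section PlaneTrigSums.
Context {R : realType}.
Local Notation mu := (@lebesgue_measure R).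
Local Notation RR := (measurableTypeR R * measurableTypeR R)%type.
Variable s : seq (int * int).
Implicit Types (a b m : int * int -> R) (z : R * R) (p : int * int).

Definition phase p z : R := p.1%:~R * z.1 + p.2%:~R * z.2.

Definition tp a b m z : R :=
  \sum_(p <- s) m p * (a p * cos (phase p z) + b p * sin (phase p z)).

Lemma tp_row a b m y :
  (fun u => tp a b m (u, y)) = line_sum s fst (fun p => p.2%:~R * y) a b m.
Proof. by []. Qed.

Lemma tp_col a b m x :
  (fun u => tp a b m (x, u)) = line_sum s snd (fun p => p.1%:~R * x) a b m.
Proof.
by apply/funext => u; apply: eq_bigr => p _; rewrite /trig /phase/= [_ + p.2%:~R * _]addrC.
Qed.

(** Along the direction (1, e) the frequency p becomes p.1 + e p.2, the quantity whose sign defines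
    [half_mult e]. *)
Lemma tp_diag a b m (e : int) z :
  (fun u => tp a b m (z.1 + u, z.2 + e%:~R * u)) =
  line_sum s (fun p => p.1 + p.2 * e) (phase^~ z) a b m.
Proof.
apply/funext => u; apply: eq_bigr => p _; rewrite /trig /phase/=.
by rewrite (_ : p.1%:~R * (z.1 + u) + _ = (p.1 + p.2 * e)%:~R * u + (p.1%:~R * z.1 + p.2%:~R * z.2))// intrD intrM; ring.
Qed.

Lemma measurable_phase p : measurable_fun [set: RR] (phase p : RR -> R).
Proof.
by apply: measurable_funD; apply: measurable_funM => //.
Qed.

Lemma measurable_tp a b m : measurable_fun [set: RR] (tp a b m : RR -> R).
Proof.
apply: measurable_sum => p; apply: measurable_funM => //.
apply: measurable_funD; apply: measurable_funM => //.
- by apply: (measurableT_comp (@measurable_cos R)); exact: measurable_phase.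
- by apply: (measurableT_comp (@measurable_sin R)); exact: measurable_phase.
Qed.

Lemma normr_tp_le a b m z : `|tp a b m z| <= line_bound s a b m.
Proof.
case: z => x y; have := normr_line_sum_le s fst (fun p => p.2%:~R * y) a b m x.
by rewrite -tp_row.
Qed.

Lemma tp_per1 a b m x y : tp a b m (x + 2 * pi, y) = tp a b m (x, y).
Proof.
by have := line_sumD2pi s fst (fun p => p.2%:~R * y) a b m x; rewrite -tp_row.
Qed.

Lemma tp_per2 a b m x y : tp a b m (x, y + 2 * pi) = tp a b m (x, y).
Proof.
by have := line_sumD2pi s snd (fun p => p.1%:~R * x) a b m y; rewrite -tp_col.
Qed.

Lemma eq_tp a b m m' : m =1 m' -> tp a b m =1 tp a b m'.
Proof. by move=> e z; apply: eq_bigr => p _; rewrite e. Qed.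

Lemma tpD a b m m' z : tp a b (fun p => m p + m' p) z = tp a b m z + tp a b m' z.
Proof. by rewrite /tp -big_split/=; apply: eq_bigr => p _; rewrite mulrDl. Qed.

Lemma tpZ a b m (c : R) z : tp a b (fun p => c * m p) z = c * tp a b m z.
Proof. by rewrite /tp mulr_sumr; apply: eq_bigr => p _; rewrite mulrA. Qed.

Lemma tpN a b m z : tp (fun p => - a p) (fun p => - b p) m z = - tp a b m z.
Proof. by rewrite /tp -sumrN; apply: eq_bigr => p _; ring. Qed.

Definition square_mult (N : nat) p : R := (maxn `|p.1| `|p.2| <= N)%N%:R.
Definition radial_mult (r : R) p : R := r ^+ maxn `|p.1| `|p.2|.
(* [half_mult e] with [e = 1] or [e = -1] is the symbol of the conjugation with
   respect to the half-plane [p.1 + e p.2 > 0]. *)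
Definition half_mult (e : int) p : R := (sgz (p.1 + p.2 * e))%:~R.

Definition conj_half a b e z : R := tp (fun p => - b p) a (half_mult e) z.

Definition row_diff a b e N r z : R :=
  conv (cdirichlet N) (fun u => conj_half a b e (u, z.2)) z.1 -
  conv (cpoisson r) (fun u => conj_half a b e (u, z.2)) z.1.

Definition col_diff a b e N r z : R :=
  conv (cdirichlet N) (fun u => conj_half a b e (z.1, u)) z.2 -
  conv (cpoisson r) (fun u => conj_half a b e (z.1, u)) z.2.

Definition gap N r (j : int) : R := (sgz j)%:~R * ((`|j| <= N)%N%:R - r ^+ `|j|%N).

(** Two conjugations are composed, one in the half-plane and one along the row. The rotation of (a,
    b), done twice, gives (-a, -b), hence the minus sign. *)
Lemma row_diffE a b e N r z : 0 <= r < 1 ->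
  row_diff a b e N r z = - tp a b (fun p => half_mult e p * gap N r p.1) z.
Proof.
case: z => x y r01; rewrite /row_diff /conj_half/= tp_row conv_line_sum_cdirichlet.
rewrite conv_line_sum_cpoisson// -tpN /line_sum /tp -sumrB; apply: eq_bigr => p _.
by rewrite /gap /trig /phase/=; ring.
Qed.

Lemma col_diffE a b e N r z : 0 <= r < 1 ->
  col_diff a b e N r z = - tp a b (fun p => half_mult e p * gap N r p.2) z.
Proof.
case: z => x y r01; rewrite /col_diff /conj_half/= tp_col conv_line_sum_cdirichlet.
rewrite conv_line_sum_cpoisson// -tpN /line_sum /tp -sumrB; apply: eq_bigr => p _.
by rewrite /gap /trig /phase/= [_ + p.1%:~R * _]addrC; ring.
Qed.

(** If |j| > |k|, both j + k and j - k have the sign of j: the row terms add up and the column terms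
    cancel. If |k| > |j| the roles are exchanged, and if |j| = |k| one of the two half-plane symbols
    vanishes. *)
Lemma square_mult_decomp N r p :
  square_mult N p - radial_mult r p =
  1 / 2 * (half_mult 1 p * gap N r p.1 + half_mult 1 p * gap N r p.2 +
           half_mult (-1) p * gap N r p.1 - half_mult (-1) p * gap N r p.2).
Proof.
case: p => j k; rewrite /square_mult /radial_mult /half_mult /gap/= mulr1 mulrN1.
pose psi (q : nat) : R := (q <= N)%N%:R - r ^+ q.
have psi0 : psi 0%N = 0 by rewrite /psi leq0n expr0 subrr.
rewrite -/(psi (maxn `|j| `|k|)) -/(psi `|j|%N) -/(psi `|k|%N).
(* The square of the sign is 1 except at 0, where [psi] itself vanishes. *)
have sq (q : int) : psi `|q|%N = (sgz q)%:~R * (sgz q)%:~R * psi `|q|%N.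
  rewrite -intrM mulz_sg; case: eqP => [->|_]; last by rewrite mul1r.
  by rewrite absz0 psi0 mulr0.
have [jk|kj|jk] := ltngtP `|j|%N `|k|%N.
- have -> : sgz (j + k) = sgz k by lia.
  have -> : sgz (j - k) = - sgz k by lia.
  by rewrite [LHS]sq mulrNz; field.
- have -> : sgz (j + k) = sgz j by lia.
  have -> : sgz (j - k) = sgz j by lia.
  by rewrite [LHS]sq; field.
- have [->|->] : k = j \/ k = - j by lia.
    have -> : sgz (j + j) = sgz j by lia.
    by rewrite subrr sgz0 [LHS]sq; field.
  rewrite subrr opprK abszN sgz0 sgzN mulrNz.
  have -> : sgz (j + j) = sgz j by lia.
  by rewrite [LHS]sq; field.
Qed.

Lemma tp_square_decomp a b N r z : 0 <= r < 1 ->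
  tp a b (square_mult N) z = tp a b (radial_mult r) z -
    1 / 2 * (row_diff a b 1 N r z + col_diff a b 1 N r z +
             row_diff a b (-1) N r z - col_diff a b (-1) N r z).
Proof.
move=> r01; rewrite !row_diffE// !col_diffE// /tp -!sumrN -!big_split/= mulr_sumr.
rewrite -sumrB; apply: eq_bigr => p _.
rewrite (_ : square_mult N p = radial_mult r p + (square_mult N p - radial_mult r p)); last by ring.
rewrite square_mult_decomp.
move: (half_mult 1 p) (half_mult (-1) p) (gap N r p.1) (gap N r p.2) (radial_mult r p) => h1 h2 g1 g2 q.
by move: (a p * _ + _) => w; ring.
Qed.

Lemma expR_half (x y : R) : expR ((x + y) / 2) <= (expR x + expR y) / 2.
Proof.
have -> : (x + y) / 2 = x / 2 + y / 2 by lra.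
rewrite expRD; have e (w : R) : expR w = expR (w / 2) ^+ 2.
  by rewrite expr2 -expRD; congr expR; lra.
by rewrite (e x) (e y); have := sqr_ge0 (expR (x / 2) - expR (y / 2)); nra.
Qed.

Lemma expR_quarter (x y z w : R) :
  expR ((x + y + z + w) / 4) <= (expR x + expR y + expR z + expR w) / 4.
Proof.
have -> : (x + y + z + w) / 4 = ((x + y) / 2 + (z + w) / 2) / 2 by lra.
apply: le_trans (expR_half _ _) _.
by have := expR_half x y; have := expR_half z w; lra.
Qed.

Let sum4_le (S1 S2 S3 S4 L : R) : S1 <= L * 12 -> S2 <= L * 12 -> S3 <= L * 12 ->
  S4 <= L * 12 -> 2 * ((S1 + S2 + S3 + S4) / 4) <= L * 24.
Proof. by move=> *; lra. Qed.

Let expR_eighth : expR (1 / 8 : R) <= 2.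
Proof. by have h : 1 / 8 <= 1 / 2 :> R; [lra|have := @expR_le_quad R (1 / 8) h; lra]. Qed.

Lemma square_window a b (lam : R) i z : 0 < lam ->
  let r := dyadic_radius i in
  let W (D : nat -> R) := \sum_(0 <= n < 2 ^ i) expR (`|D n| / (4 * (exp_const * lam))) <= (2 ^ i)%:R * 12 in
  `|tp a b (radial_mult r) z| <= lam ->
  W (fun n => row_diff a b 1 n r z) -> W (fun n => col_diff a b 1 n r z) ->
  W (fun n => row_diff a b (-1) n r z) -> W (fun n => col_diff a b (-1) n r z) ->
  \sum_(0 <= n < 2 ^ i) expR (`|tp a b (square_mult n) z| / (8 * (exp_const * lam))) <= (2 ^ i)%:R * 24.
Proof.
move=> lam0 r W hV W1 W2 W3 W4; rewrite {}/W in W1 W2 W3 W4.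
have K1 := @exp_const_ge1 R; have K0 : 0 < exp_const :> R by exact: lt_le_trans K1.
set K := (exp_const : R) in K1 K0 W1 W2 W3 W4 *.
have B0 : 0 < K * lam by rewrite mulr_gt0.
set B := K * lam in W1 W2 W3 W4 B0 *.
have lB : lam <= B by rewrite /B ler_peMl// ltW.
set d1 := fun n => row_diff a b 1 n r z in W1; set d2 := fun n => col_diff a b 1 n r z in W2.
set d3 := fun n => row_diff a b (-1) n r z in W3; set d4 := fun n => col_diff a b (-1) n r z in W4.
apply: (@le_trans _ _ (\sum_(0 <= n < 2 ^ i) 2 * ((expR (`|d1 n| / (4 * B)) + expR (`|d2 n| / (4 * B)) +
    expR (`|d3 n| / (4 * B)) + expR (`|d4 n| / (4 * B))) / 4))); last first.
  rewrite -mulr_sumr -mulr_suml !big_split/=.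
  exact: sum4_le W1 W2 W3 W4.
apply: ler_sum => n _.
apply: (@le_trans _ _ (expR (1 / 8) * expR ((`|d1 n| / (4 * B) + `|d2 n| / (4 * B) +
    `|d3 n| / (4 * B) + `|d4 n| / (4 * B)) / 4))); last first.
  by apply: ler_pM; [exact: expR_ge0|exact: expR_ge0|exact: expR_eighth|exact: expR_quarter].
rewrite -expRD ler_expR.
have -> : 1 / 8 + (`|d1 n| / (4 * B) + `|d2 n| / (4 * B) + `|d3 n| / (4 * B) + `|d4 n| / (4 * B)) / 4 =
  (B + 1 / 2 * (`|d1 n| + `|d2 n| + `|d3 n| + `|d4 n|)) / (8 * B).
  by field; rewrite gt_eqF.
rewrite ler_pM2r ?invr_gt0 ?mulr_gt0//.
rewrite (tp_square_decomp _ _ _ _ (dyadic_radius01 i)) -/r.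
apply: le_trans (ler_normB _ _) _; apply: lerD; first exact: le_trans lB.
rewrite normrM ger0_norm// ler_wpM2l//.
apply: le_trans (ler_normB _ _) _; apply: lerD => //.
apply: le_trans (ler_normD _ _) _; apply: lerD => //.
exact: ler_normD.
Qed.

End PlaneTrigSums.

(** * Weak type bounds from slices *)

Section SliceEstimates.
Context {R : realType}.
Local Notation mu := (@lebesgue_measure R).
Local Notation m2 := (@lebesgue_measure2 R).
Local Notation RR := (measurableTypeR R * measurableTypeR R)%type.
Local Open Scope ereal_scope.

Lemma measurable_cycle_row (F : R * R -> \bar R) : measurable_fun [set: RR] F ->
  (forall z, 0 <= F z) ->
  measurable_fun [set: R] (fun x => \int[mu]_(y in cycle) F (x, y)).
Proof.
move=> mF F0.
have mG : measurable_fun [set: RR] (fun z : RR => F z * (\1_(cycle : set R) z.2)%:E).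
  apply: emeasurable_funM => //; apply/measurable_EFinP.
  have mi : measurable_fun [set: R] (\1_(cycle : set R) : R -> R).
    by apply: measurable_indic; exact: measurable_cycle.
  exact: (measurableT_comp mi (@measurable_snd _ _ _ _)).
have G0 z : 0 <= F z * (\1_(cycle : set R) z.2)%:E by rewrite mule_ge0 ?lee_fin.
have := @measurable_fun_fubini_tonelli_F _ _ _ _ _ mu _ mG G0.
congr measurable_fun; apply/funext => x; rewrite /fubini_F/= [RHS]integral_mkcond.
apply: eq_integral => y _; rewrite patchE indicE.
by case: ifPn => _; rewrite ?mule1 ?mule0.
Qed.

Lemma measurable_cycle_col (F : R * R -> \bar R) : measurable_fun [set: RR] F ->
  (forall z, 0 <= F z) ->
  measurable_fun [set: R] (fun y => \int[mu]_(x in cycle) F (x, y)).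
Proof.
move=> mF F0.
have mG : measurable_fun [set: RR] (fun z : RR => F z * (\1_(cycle : set R) z.1)%:E).
  apply: emeasurable_funM => //; apply/measurable_EFinP.
  have mi : measurable_fun [set: R] (\1_(cycle : set R) : R -> R).
    by apply: measurable_indic; exact: measurable_cycle.
  exact: (measurableT_comp mi (@measurable_fst _ _ _ _)).
have G0 z : 0 <= F z * (\1_(cycle : set R) z.1)%:E by rewrite mule_ge0 ?lee_fin.
have := @measurable_fun_fubini_tonelli_G _ _ _ _ _ mu _ mG G0.
congr measurable_fun; apply/funext => y; rewrite /fubini_G/= [RHS]integral_mkcond.
apply: eq_integral => x _; rewrite patchE indicE.
by case: ifPn => _; rewrite ?mule1 ?mule0.
Qed.

(** Here 105 = 35 * 3: the measure of the bad set is controlled by the mass of the cutoff, which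
    covers three periods. *)
Lemma slice_bad_le (h : R -> R) (M lam : R) (A : set R) :
  measurable_fun [set: R] h -> (forall u, `|h u| <= M)%R ->
  (forall u, h (u + 2 * pi) = h u)%R -> (0 < lam)%R ->
  measurable A -> A `<=` bad_set (cutoff h) lam ->
  mu A <= (105 / lam)%:E * \int[mu]_(x in cycle) (`|h x|)%:E.
Proof.
move=> mh hM hper lam0 mA Ab.
have mah : measurable_fun [set: R] (fun x => (`|h x|)%:E).
  by apply/measurable_EFinP; exact: measurableT_comp.
have cutE : \int[mu]_t (cutoff h t)%:E = 3%:R%:E * \int[mu]_(x in cycle) (`|h x|)%:E.
  rewrite -(integral_3cycle (f := fun x => (`|h x|)%:E))//.
    by rewrite /cutoff intR_indicT.
  by move=> x; rewrite hper.
have fin : \int[mu]_(x in cycle) (`|h x|)%:E \is a fin_num.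
  rewrite ge0_fin_numE; last by apply: integral_ge0.
  apply: (@le_lt_trans _ _ (\int[mu]_(x in cycle) M%:E)).
    apply: ge0_le_integral => //; first exact: measurable_cycle.
    - exact: measurable_funTS.
    - by move=> x _; rewrite lee_fin.
  by rewrite integral_cst; [rewrite -[X in X < _]/(M%:E * mu cycle) cycle_measure -EFinM ltry|exact: measurable_cycle].
rewrite -(fineK fin); set s := fine _.
have cutS : \int[mu]_t (cutoff h t)%:E <= (3 * s)%:E by rewrite cutE EFinM /s fineK.
have := bad_set_le (measurable_cutoff mh) (cutoff_ge0 h) cutS lam0 => hb.
apply: le_trans (le_trans _ hb) _.
  apply: le_measure => //; rewrite inE//.
  exact: (measurable_bad_set lam (measurable_cutoff mh) (cutoff_ge0 h) cutS).
rewrite -EFinM lee_fin le_eqVlt; apply/orP; left; apply/eqP.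
have -> : (105 = 35 * 3 :> R)%R by ring.
by rewrite !mulrA mulrAC.
Qed.

Variables (g : R * R -> R) (M lam : R) (E : set (R * R)).
Hypotheses (mg : measurable_fun [set: RR] (g : RR -> R)) (gM : forall z, (`|g z| <= M)%R)
  (lam0 : (0 < lam)%R) (mE : measurable (E : set RR)) (ET : E `<=` torus2).

Let mg1 : measurable_fun [set: RR] (fun z => (`|g z|)%:E).
Proof. by apply/measurable_EFinP; exact: measurableT_comp. Qed.

Let mE1 : measurable_fun [set: RR] (fun z => (\1_E z)%:E : \bar R).
Proof. by apply/measurable_EFinP; exact: measurable_indic. Qed.

Let m2E : m2 E = \int[m2]_(z in torus2) (\1_E z)%:E.
Proof.
rewrite integral_indic ?setIidl//; first exact: measurable_torus2.
exact: borel_plane.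
Qed.

(** The slices of [E] are only compared with the bad sets of the slices of g, so joint measurability
    is asked of [E] alone; Tonelli then integrates the one-dimensional bound. *)
Lemma row_weak : (forall x y, g (x + 2 * pi, y)%R = g (x, y)) ->
  (forall x y, E (x, y) -> bad_set (cutoff (fun u => g (u, y))) lam x) ->
  m2 E <= (105 / lam)%:E * \int[m2]_(z in torus2) (`|g z|)%:E.
Proof.
move=> per Eb; rewrite m2E.
have c0 : (0 <= 105 / lam)%R by rewrite divr_ge0// ltW.
rewrite (ge0_integral_torus2_swap (F := fun z => (\1_E z)%:E))//.
rewrite (ge0_integral_torus2_swap (F := fun z => (`|g z|)%:E))//.
have mr := @measurable_cycle_col (fun z => (`|g z|)%:E) mg1 (fun z => normr_ge0 _).
rewrite -ge0_integralZl_EFin//; last 3 first.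
- exact: measurable_cycle.
- by move=> y _; exact: integral_ge0.
- exact: measurable_funTS.
apply: ge0_le_integral => //.
- exact: measurable_cycle.
- by move=> y _; apply: integral_ge0 => x _; rewrite lee_fin.
- by apply: measurable_funTS; apply: (measurable_cycle_col (F := fun z => (\1_E z)%:E)) => // z; rewrite lee_fin.
- by apply: measurable_funTS; apply: emeasurable_funM => //.
move=> y _.
have mEy : measurable [set x : R | E (x, y)].
  rewrite -[X in measurable X]setTI.
  by apply: (@measurable_pair2 _ _ _ _ y) => //.
rewrite (_ : \int[mu]_(x in cycle) (\1_E (x, y))%:E = mu ([set x | E (x, y)] `&` cycle)); last first.
  rewrite -integral_indic => //; last exact: measurable_cycle.
apply: (slice_bad_le (M := M)) => //.
- exact: measurable_section2.
- by apply: measurableI => //; exact: measurable_cycle.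
- by move=> x [/= Exy _]; exact: Eb.
Qed.

Lemma col_weak : (forall x y, g (x, y + 2 * pi)%R = g (x, y)) ->
  (forall x y, E (x, y) -> bad_set (cutoff (fun u => g (x, u))) lam y) ->
  m2 E <= (105 / lam)%:E * \int[m2]_(z in torus2) (`|g z|)%:E.
Proof.
move=> per Eb; rewrite m2E.
have c0 : (0 <= 105 / lam)%R by rewrite divr_ge0// ltW.
rewrite (ge0_integral_torus2 (F := fun z => (\1_E z)%:E))//.
rewrite (ge0_integral_torus2 (F := fun z => (`|g z|)%:E))//.
have mr := @measurable_cycle_row (fun z => (`|g z|)%:E) mg1 (fun z => normr_ge0 _).
rewrite -ge0_integralZl_EFin//; last 3 first.
- exact: measurable_cycle.
- by move=> y _; exact: integral_ge0.
- exact: measurable_funTS.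
apply: ge0_le_integral => //.
- exact: measurable_cycle.
- by move=> y _; apply: integral_ge0 => x _; rewrite lee_fin.
- by apply: measurable_funTS; apply: (measurable_cycle_row (F := fun z => (\1_E z)%:E)) => // z; rewrite lee_fin.
- by apply: measurable_funTS; apply: emeasurable_funM => //.
move=> x _.
have mEx : measurable [set y : R | E (x, y)].
  rewrite -[X in measurable X]setTI.
  exact: (measurable_pair1 x).
rewrite (_ : \int[mu]_(y in cycle) (\1_E (x, y))%:E = mu ([set y | E (x, y)] `&` cycle)); last first.
  rewrite -integral_indic => //; last exact: measurable_cycle.
apply: (slice_bad_le (M := M)) => //.
- exact: measurable_section1.
- by apply: measurableI => //; exact: measurable_cycle.
- by move=> y [/= Exy _]; exact: Eb.
Qed.

End SliceEstimates.

(** * Comparison of radial means at neighbouring radii *)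

Section PoissonPositivity.
Context {R : realType}.

(** The multiplier r^|n| is convolution with the Poisson kernel, so the positivity of the kernel and
    its Harnack inequality [poisson_le] pass to nonnegative sums. *)
Lemma line_sum_poisson_le (I : Type) (s : seq I) (n : I -> int) (phi a b m : I -> R) (r r' x : R) :
  0 <= r < 1 -> r ^+ 2 <= r' <= r -> (forall u, 0 <= line_sum s n phi a b m u) ->
  0 <= line_sum s n phi a b (fun p => m p * r ^+ `|n p|%N) x <=
  4 * line_sum s n phi a b (fun p => m p * r' ^+ `|n p|%N) x.
Proof.
move=> r01 rr' h; have /andP[r0 r1] := r01; have /andP[rr1 rr2] := rr'.
have r'01 : 0 <= r' < 1.
  by rewrite (le_trans _ rr1) ?sqr_ge0//= (le_lt_trans rr2).
have e1 := conv_line_sum_poisson s n phi a b m x r01.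
have e2 := conv_line_sum_poisson s n phi a b m x r'01.
have ml := measurable_line_sum s n phi a b m.
have lb := normr_line_sum_le s n phi a b m.
have c0 : 0 <= conv (poisson r) (line_sum s n phi a b m) x.
  have <- : conv (fun=> 0) (line_sum s n phi a b m) x = 0.
    rewrite /conv (_ : (fun u => _) = cst 0); last by apply/funext => u; rewrite mulr0.
    by rewrite Rintegral_cst ?mul0r ?mulr0//; exact: measurable_period.
  apply: (le_conv (e := 0) ml lb ml lb _ _ (measurable_poisson r) (fun t => poisson_bound t r01)) => //.
  - by move=> u; rewrite normr0.
  - by move=> u; rewrite mulr0 mulr_ge0// poisson_ge0.
have c4 : conv (poisson r) (line_sum s n phi a b m) x <= 4 * conv (poisson r') (line_sum s n phi a b m) x.
  rewrite -(convZ ml lb 4 x (measurable_poisson r') (fun t => poisson_bound t r'01)).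
  apply: (le_conv ml lb ml lb (measurable_poisson r) (fun t => poisson_bound t r01)
    (k' := fun t => 4 * poisson r' t) (e' := 4 * ((1 - r') ^+ 2)^-1)).
  - by apply: measurable_funM => //; exact: measurable_poisson.
  - by move=> u; rewrite normrM normr_nat ler_wpM2l// poisson_bound.
  - by move=> u; rewrite ler_wpM2l// poisson_le.
by apply/andP; split; lra.
Qed.

Variable s : seq (int * int).
Implicit Types (a b m : int * int -> R) (z : R * R).

Definition diag_mult (e : int) (r : R) (p : int * int) : R := r ^+ `|(p.1 + p.2 * e)%R|%N.

Lemma tp_diag_poisson_le a b m e (r r' : R) z : 0 <= r < 1 -> r ^+ 2 <= r' <= r ->
  (forall z, 0 <= tp s a b m z) ->
  0 <= tp s a b (fun p => m p * diag_mult e r p) z <=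
  4 * tp s a b (fun p => m p * diag_mult e r' p) z.
Proof.
move=> r01 rr' h.
have at0 m' : tp s a b m' z = line_sum s (fun p => p.1 + p.2 * e) (phase^~ z) a b m' 0.
  by rewrite -tp_diag mulr0 !addr0 -surjective_pairing.
rewrite !at0; apply: line_sum_poisson_le => // u.
by rewrite -tp_diag.
Qed.

(* max(|j|, |k|) = (|j + k| + |j - k|) / 2. *)
Lemma radial_multE (r : R) p : 0 <= r ->
  radial_mult r p = diag_mult 1 (Num.sqrt r) p * diag_mult (-1) (Num.sqrt r) p.
Proof.
move=> r0; rewrite /radial_mult /diag_mult -exprD -{1}(sqr_sqrtr r0) -exprM.
by congr (_ ^+ _); lia.
Qed.

(** The radial multiplier factors through the two diagonal directions at the radius sqrt r, and each
    direction costs a factor 4. The condition on r and r' passes to their square roots. *)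
Lemma tp_radial_poisson_le a b m (r r' : R) z : 0 <= r < 1 -> r ^+ 2 <= r' <= r ->
  (forall z, 0 <= tp s a b m z) ->
  0 <= tp s a b (fun p => m p * radial_mult r p) z <=
  16 * tp s a b (fun p => m p * radial_mult r' p) z.
Proof.
move=> r01 rr' h; have /andP[r0 r1] := r01; have /andP[rr1 rr2] := rr'.
have r'0 : 0 <= r' by apply: le_trans rr1; exact: sqr_ge0.
set q := Num.sqrt r; set q' := Num.sqrt r'.
have q01 : 0 <= q < 1 by rewrite sqrtr_ge0 -sqrtr1 ltr_sqrt.
have qq' : q ^+ 2 <= q' <= q.
  rewrite sqr_sqrtr//; apply/andP; split; last exact: ler_wsqrtr.
  by rewrite -(ger0_norm r0) -sqrtr_sqr ler_wsqrtr.
have q'01 : 0 <= q' < 1.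
  by move/andP: qq' => [_ h1]; rewrite sqrtr_ge0/= (le_lt_trans h1)//; case/andP: q01.
have q'q' : q' ^+ 2 <= q' <= q' by rewrite lexx andbT expr2 ler_piMr ?sqrtr_ge0// ltW//; case/andP: q'01.
have qq : q ^+ 2 <= q <= q by rewrite lexx andbT expr2 ler_piMr ?sqrtr_ge0// ltW//; case/andP: q01.
have e (t : R) : 0 <= t -> tp s a b (fun p => m p * radial_mult t p) z =
    tp s a b (fun p => m p * diag_mult 1 (Num.sqrt t) p * diag_mult (-1) (Num.sqrt t) p) z.
  by move=> t0; apply: eq_tp => p; rewrite radial_multE// mulrA.
rewrite !e// -/q -/q'.
pose n1 p := m p * diag_mult 1 q p; pose n1' p := m p * diag_mult 1 q' p.
have p1 w : 0 <= tp s a b n1 w by case/andP: (tp_diag_poisson_le 1 w q01 qq h).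
have p1' w : 0 <= tp s a b n1' w by case/andP: (tp_diag_poisson_le 1 w q'01 q'q' h).
(* The comparison in the first direction is kept as the positivity of a sum, to which the Poisson
   mean in the second direction, at radius [q'], can be applied. *)
have p2 w : 0 <= tp s a b (fun p => 4 * n1' p - n1 p) w.
  rewrite (tpD _ _ _ (fun p => 4 * n1' p) (fun p => - n1 p)) tpZ.
  rewrite (_ : tp s a b (fun p => - n1 p) w = - tp s a b n1 w); last first.
    by rewrite -mulN1r -tpZ; apply: eq_tp => p; rewrite mulN1r.
  by rewrite subr_ge0; case/andP: (tp_diag_poisson_le 1 w q01 qq' h).
have /andP[h1 _] := tp_diag_poisson_le (-1) z q01 qq' p1.
have /andP[_ h2] := tp_diag_poisson_le (-1) z q01 qq' p1.
have /andP[h3 _] := tp_diag_poisson_le (-1) z q'01 q'q' p2.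
have e3 : tp s a b (fun p => (4 * n1' p - n1 p) * diag_mult (-1) q' p) z =
    4 * tp s a b (fun p => n1' p * diag_mult (-1) q' p) z - tp s a b (fun p => n1 p * diag_mult (-1) q' p) z.
  by rewrite /tp mulr_sumr -sumrB; apply: eq_bigr => p _; ring.
by rewrite h1/=; move: h2 h3; rewrite e3; lra.
Qed.

End PoissonPositivity.

(** * The radial maximal function *)

Section PlaneSigmaFinite.
Context {R : realType}.
Local Notation mu := (@lebesgue_measure R).
Local Notation borel2 := (@lebesgue_measure R \x @lebesgue_measure R)%E.
Local Notation RR := (measurableTypeR R * measurableTypeR R)%type.

Let borel2_sigma_finite : sigma_finite [set: RR] borel2.
Proof.
exists (fun n : nat => `[- n%:R, n%:R]%classic `*` `[- n%:R, n%:R]%classic).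
  rewrite predeqE => -[x y]; split=> // _.
  exists (maxn (Num.truncn `|x|).+1 (Num.truncn `|y|).+1) => //; split => /=; rewrite in_itv/= -ler_norml ltW//.
    by apply: lt_le_trans (truncnS_gt _) _; rewrite ler_nat leq_maxl.
  by apply: lt_le_trans (truncnS_gt _) _; rewrite ler_nat leq_maxr.
move=> n; split; first by apply: measurableX; exact: measurable_itv.
rewrite product_measure1E; try exact: measurable_itv.
have h : Order.lt (mu `[(- n%:R : R), n%:R]%classic) +oo%E.
  by rewrite lebesgue_measure_itv/=; case: ifP => _; rewrite ?ltry// -EFinB ltry.
by apply: lte_mul_pinfty => //; rewrite ge0_fin_numE.
Qed.

(** The product measure with its sigma-finiteness attached, as required by Tonelli's theorem between
    the plane and a line. *)
Definition plane_measure : {sigma_finite_measure set RR -> \bar R} :=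
  HB.pack borel2 (Measure_isSigmaFinite.Build _ _ _ borel2 borel2_sigma_finite).

End PlaneSigmaFinite.

Section PoissonAverage.
Context {R : realType}.
Local Notation mu := (@lebesgue_measure R).
Local Notation m2 := (@lebesgue_measure2 R).
Local Notation borel2 := (@lebesgue_measure R \x @lebesgue_measure R)%E.
Local Notation RR := (measurableTypeR R * measurableTypeR R)%type.
Variables (e rho : R).
Hypotheses (e1 : `|e| <= 1) (rho01 : 0 <= rho < 1).
Implicit Types (F : R * R -> R).

(** The factor 1/2 makes the total weight 1, as [conv] divides by pi and not by 2 pi. This is an
    averaging operator along the direction (1, e), defined for arbitrary functions and not only for
    trigonometric sums, since it must act on a running maximum. *)
Definition poisson_average F (z : R * R) : R :=
  1 / 2 * conv (poisson rho) (fun u => F (z.1 + u, z.2 + e * u)) 0.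

Let mline : measurable_fun [set: (RR * measurableTypeR R)%type]
  (fun w : (RR * measurableTypeR R)%type => (w.1.1 + w.2, w.1.2 + e * w.2) : RR).
Proof.
have m11 : measurable_fun [set: (RR * measurableTypeR R)%type] (fun w : (RR * measurableTypeR R)%type => w.1.1).
  by apply: (measurableT_comp (@measurable_fst _ _ _ _)); exact: measurable_fst.
have m12 : measurable_fun [set: (RR * measurableTypeR R)%type] (fun w : (RR * measurableTypeR R)%type => w.1.2).
  by apply: (measurableT_comp (@measurable_snd _ _ _ _)); exact: measurable_fst.
have m2' : measurable_fun [set: (RR * measurableTypeR R)%type] (fun w : (RR * measurableTypeR R)%type => w.2).
  exact: measurable_snd.
by apply/measurable_fun_pairP; split; apply: measurable_funD => //; apply: measurable_funM.
Qed.

Let mslice F z : measurable_fun [set: RR] (F : RR -> R) ->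
  measurable_fun [set: R] (fun u => F (z.1 + u, z.2 + e * u)).
Proof.
move=> mF; have mFl := measurableT_comp mF mline.
exact: (measurable_section1 z mFl).
Qed.

Lemma poisson_average_cst (c : R) z : poisson_average (fun=> c) z = c.
Proof.
rewrite /poisson_average (_ : (fun u => c) = trig 0 0 c 0); last first.
  by apply/funext => u; rewrite /trig mul0r addr0 cos0 sin0 mulr0 addr0 mulr1.
rewrite conv_poisson_trig// /trig absz0 expr0 mul0r addr0 cos0 sin0; lra.
Qed.

Let weight_ge0 (u : R) : 0 <= (2 * pi)^-1 * poisson rho (0 - u).
Proof. by apply: mulr_ge0; [rewrite invr_ge0 mulr_ge0 ?pi_ge0|exact: poisson_ge0]. Qed.

Let poisson_mass : (\int[mu]_(u in period 0) ((2 * pi)^-1 * poisson rho (0 - u))%:E = 1)%E.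
Proof.
have mk := measurable_poisson rho; have kb := fun t => poisson_bound t rho01.
have ki := @conv_integrable _ (fun=> 1) `|1| (measurable_cst _) (fun=> lexx _) (poisson rho) _ 0 mk kb.
have := poisson_average_cst 1 0; rewrite /poisson_average /conv mulrA.
rewrite -RintegralZl//; last exact: measurable_period.
rewrite /Rintegral => h; transitivity (1%:E : \bar R) => //; rewrite -[X in _ = X%:E]h fineK.
  by apply: eq_integral => u _; congr _%:E; rewrite !mul1r invfM.
apply: integrable_fin_num; first exact: measurable_period.
have := integrableZl (measurable_period 0) (1 / 2 / pi) ki.
by apply: eq_integrable => //; exact: measurable_period.
Qed.

Section Bounded.
Variables (F : R * R -> R) (M : R).
Hypotheses (mF : measurable_fun [set: RR] (F : RR -> R)) (FM : forall z, `|F z| <= M).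

Lemma poisson_averageD_cst (c : R) z :
  poisson_average (fun w => F w + c) z = poisson_average F z + c.
Proof.
rewrite -[in RHS](poisson_average_cst c z) /poisson_average -mulrDr; congr (_ * _).
rewrite /conv -mulrDr; congr (_ * _).
have mk := measurable_poisson rho; have kb := fun t => poisson_bound t rho01.
rewrite -RintegralD; last 3 first.
- exact: measurable_period.
- exact: (conv_integrable (mslice z mF) (fun u => FM _) 0 mk kb).
- apply: (@conv_integrable _ (fun=> c) `|c| _ _ (poisson rho) _ 0 mk kb) => //.
by apply: eq_Rintegral => u _; rewrite mulrDl.
Qed.

Lemma le_poisson_average F' M' z :
  measurable_fun [set: RR] (F' : RR -> R) -> (forall z, `|F' z| <= M') ->
  (forall w, F w <= F' w) -> poisson_average F z <= poisson_average F' z.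
Proof.
move=> mF' FM' h; rewrite /poisson_average ler_wpM2l//.
have mk := measurable_poisson rho; have kb := fun t => poisson_bound t rho01.
apply: (le_conv (mslice z mF) (fun u => FM _) (mslice z mF') (fun u => FM' _) mk kb mk kb) => u.
by rewrite ler_wpM2r// poisson_ge0.
Qed.

Hypothesis F0 : forall z, 0 <= F z.

Let K (w : RR * measurableTypeR R) : R :=
  (2 * pi)^-1 * (F (w.1.1 + w.2, w.1.2 + e * w.2) * poisson rho (0 - w.2)).

Let mK : measurable_fun [set: (RR * measurableTypeR R)%type] K.
Proof.
apply: measurable_funM => //; apply: measurable_funM; first exact: (measurableT_comp mF mline).
apply: (measurableT_comp (measurable_poisson rho)); apply: measurable_funB => //.
Qed.

Let K0 w : 0 <= K w.
Proof.
rewrite /K; apply: mulr_ge0; first by rewrite invr_ge0 mulr_ge0 ?pi_ge0.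
by apply: mulr_ge0 => //; exact: poisson_ge0.
Qed.

Let averageE z : (poisson_average F z)%:E = (\int[mu]_(u in period 0) (K (z, u))%:E)%E.
Proof.
have mk := measurable_poisson rho; have kb := fun t => poisson_bound t rho01.
have ki := conv_integrable (mslice z mF) (fun u => FM _) 0 mk kb.
have h : poisson_average F z = Rintegral mu (period 0) (fun u => K (z, u)).
  rewrite /poisson_average /conv mulrA -RintegralZl//; last exact: measurable_period.
  apply: eq_Rintegral => u _; rewrite /K/=; congr (_ * _).
  by rewrite invfM mulrC mul1r mulrC.
rewrite h /Rintegral fineK//; apply: integrable_fin_num; first exact: measurable_period.
have := integrableZl (measurable_period 0) (2 * pi)^-1 ki.
by apply: eq_integrable => //; exact: measurable_period.
Qed.

Let KD (w : RR * measurableTypeR R) : \bar R := ((K w)%:E * (\1_(period 0) w.2)%:E)%E.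

Let mKD : measurable_fun setT KD.
Proof.
apply: emeasurable_funM; first exact/measurable_EFinP.
apply/measurable_EFinP.
have mi : measurable_fun [set: R] (\1_(period 0) : R -> R).
  by apply: measurable_indic; exact: measurable_period.
exact: (measurableT_comp mi (@measurable_snd _ _ _ _)).
Qed.

Let KD0 w : (0 <= KD w)%E.
Proof. by rewrite /KD mule_ge0// lee_fin. Qed.

Let averageE' z : (poisson_average F z)%:E = (\int[mu]_u KD (z, u))%E.
Proof.
rewrite averageE [LHS]integral_mkcond; apply: eq_integral => u _.
by rewrite patchE /KD indicE/=; case: ifPn => _; rewrite ?mule1 ?mule0.
Qed.

Lemma measurable_poisson_average : measurable_fun [set: RR] (poisson_average F : RR -> R).
Proof.
apply/measurable_EFinP; rewrite (_ : EFin \o _ = (fun z : RR => \int[mu]_u KD (z, u))%E); last first.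
  by apply/funext => z /=; exact: averageE'.
exact: (@measurable_fun_fubini_tonelli_F _ _ _ _ _ mu _ mKD KD0).
Qed.

Lemma poisson_average_ge0 z : 0 <= poisson_average F z.
Proof. by rewrite -lee_fin averageE'; apply: integral_ge0. Qed.

Hypotheses (per1 : forall x y, F (x + 2 * pi, y) = F (x, y))
  (per2 : forall x y, F (x, y + 2 * pi) = F (x, y)).

Lemma poisson_average_per1 x y : poisson_average F (x + 2 * pi, y) = poisson_average F (x, y).
Proof.
rewrite /poisson_average; congr (_ * conv _ _ _); apply/funext => u /=.
by rewrite addrAC per1.
Qed.

Lemma poisson_average_per2 x y : poisson_average F (x, y + 2 * pi) = poisson_average F (x, y).
Proof.
rewrite /poisson_average; congr (_ * conv _ _ _); apply/funext => u /=.
by rewrite addrAC per2.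
Qed.

Lemma poisson_average_le z : poisson_average F z <= M.
Proof.
rewrite -[leRHS](poisson_average_cst M z); apply: (@le_poisson_average (fun=> M) `|M|) => //.
by move=> w; exact: le_trans (ler_norm _) (FM w).
Qed.

(** By Tonelli the integral is an average, with total weight 1, of integrals of translates of F over
    the torus, all of which are equal by periodicity. *)
Lemma integral_poisson_average :
  (\int[m2]_(z in torus2) (poisson_average F z)%:E = \int[m2]_(z in torus2) (F z)%:E)%E.
Proof.
have mA : measurable_fun [set: RR] (fun z : RR => (poisson_average F z)%:E).
  by apply/measurable_EFinP; exact: measurable_poisson_average.
rewrite ge0_integral_plane//; last first.
  by move=> z; rewrite lee_fin poisson_average_ge0.
  exact: measurable_torus2_borel.
rewrite integral_mkcond.
pose G (w : RR * measurableTypeR R) : \bar R := (KD w * (\1_(torus2 : set RR) w.1)%:E)%E.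
have mG : measurable_fun setT G.
  apply: emeasurable_funM => //; apply/measurable_EFinP.
  have mi : measurable_fun [set: RR] (\1_(torus2 : set RR) : RR -> R).
    by apply: measurable_indic; exact: measurable_torus2_borel.
  exact: (measurableT_comp mi (@measurable_fst _ _ _ _)).
have G0 w : (0 <= G w)%E by rewrite mule_ge0// lee_fin.
transitivity (\int[borel2]_z \int[mu]_u G (z, u))%E.
  apply: eq_integral => z _; rewrite patchE /G/=.
  case: ifPn => zT; rewrite indicE ?zT ?(negbTE zT).
    by under eq_integral do rewrite mule1; exact: averageE'.
  by under eq_integral do rewrite mule0; rewrite integral0.
transitivity (\int[mu]_u \int[borel2]_z G (z, u))%E.
  exact: (@fubini_tonelli _ _ _ _ _ plane_measure mu _ mG G0).
pose I0 := (\int[m2]_(z in torus2) (F z)%:E)%E.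
transitivity (\int[mu]_(u in period 0) (((2 * pi)^-1 * poisson rho (0 - u))%:E * I0))%E.
  rewrite [RHS]integral_mkcond; apply: eq_integral => u _; rewrite patchE.
  case: ifPn => uP; last first.
    by rewrite integral0_eq// => z _; rewrite /G /KD/= indicE (negbTE uP) mule0 mul0e.
  have p0 : 0 <= (2 * pi)^-1 * poisson rho (0 - u).
    exact: weight_ge0.
  have mFs : measurable_fun [set: RR] (fun z : RR => (F (z.1 + u, z.2 + e * u))%:E).
    by apply/measurable_EFinP; exact: (measurable_section2 u (measurableT_comp mF mline)).
  transitivity (\int[borel2]_(z in torus2) (((2 * pi)^-1 * poisson rho (0 - u))%:E *
      (F (z.1 + u, z.2 + e * u))%:E))%E.
    rewrite [RHS]integral_mkcond; apply: eq_integral => z _.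
    rewrite patchE /G /KD/= !indicE uP mule1 /K/=.
    case: ifPn => _; rewrite ?mule1 ?mule0// -EFinM; congr _%:E; ring.
  rewrite ge0_integralZl_EFin//; last 3 first.
  - exact: measurable_torus2_borel.
  - by move=> z _; rewrite lee_fin.
  - exact: measurable_funTS.
  congr (_ * _)%E; rewrite -ge0_integral_plane//; last 2 first.
  - exact: measurable_torus2_borel.
  - by move=> z; rewrite lee_fin.
  have upi : `|u| <= pi.
    by move: uP; rewrite inE => /periodP; rewrite sub0r normrN.
  have pi0 := @pi_ge0 R.
  apply: (@integral_torus2_shift _ (fun z => (F z)%:E)) => //.
  - exact/measurable_EFinP.
  - by move=> x y; rewrite per1.
  - by move=> x y; rewrite per2.
  - by apply: (le_trans upi); lra.
  - rewrite normrM; apply: (@le_trans _ _ (1 * pi)); first exact: ler_pM.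
    by lra.
rewrite ge0_integralZr//; last 4 first.
- exact: measurable_period.
- apply/measurable_EFinP; apply: measurable_funTS; apply: measurable_funM => //.
  by apply: measurable_reflect; exact: measurable_poisson.
- by move=> u _; rewrite lee_fin; exact: weight_ge0.
- by apply: integral_ge0 => z _; rewrite lee_fin.
by rewrite poisson_mass mul1e.
Qed.

End Bounded.

End PoissonAverage.

Section MaximalErgodic.
Context {R : realType}.
Local Notation mu := (@lebesgue_measure R).
Local Notation m2 := (@lebesgue_measure2 R).
Local Notation RR := (measurableTypeR R * measurableTypeR R)%type.

(** Integrating the pointwise inequality, the equal integrals of f and t cancel; they are finite
    because f is bounded. *)
Let integral_excess_le (f t h : R * R -> R) (P : set (R * R)) (B lam : R) : 0 <= lam ->
  measurable_fun [set: RR] (f : RR -> R) -> measurable_fun [set: RR] (t : RR -> R) ->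
  measurable_fun [set: RR] (h : RR -> R) -> measurable (P : set RR) ->
  (forall z, 0 <= f z) -> (forall z, f z <= B) -> (forall z, 0 <= t z) -> (forall z, 0 <= h z) ->
  (forall z, f z + lam * \1_P z <= t z + h z) ->
  (\int[m2]_(z in torus2) (t z)%:E = \int[m2]_(z in torus2) (f z)%:E)%E ->
  (lam%:E * m2 (torus2 `&` P) <= \int[m2]_(z in torus2) (h z)%:E)%E.
Proof.
move=> lam0 mf mt mh mP f0 fB t0 h0 key tf.
have mpl (F : R * R -> R) : measurable_fun [set: RR] (F : RR -> R) -> measurable_fun torus2 F.
  by move=> mF; apply: measurable_fun_plane => //; exact: measurable_torus2.
have mi : measurable_fun [set: RR] (\1_P : RR -> R) by exact: measurable_indic.
have mT := @measurable_torus2 R.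
have : (\int[m2]_(z in torus2) (f z + lam * \1_P z)%:E <= \int[m2]_(z in torus2) (t z + h z)%:E)%E.
  apply: ge0_le_intR; first exact: mT.
  - by apply: mpl; apply: measurable_funD => //; exact: measurable_funM.
  - by apply: mpl; exact: measurable_funD.
  - by move=> z _; rewrite addr_ge0// mulr_ge0.
  - by move=> z _; exact: key.
rewrite ge0_intRD; [|exact: mT|exact: mpl| by apply: mpl; apply: measurable_funM|by move=> z _|by move=> z _; rewrite mulr_ge0].
rewrite ge0_intRD; [|exact: mT|exact: mpl|exact: mpl|by move=> z _|by move=> z _].
rewrite tf leeD2lE; last first.
  rewrite ge0_fin_numE; last by apply: integral_ge0 => z _; rewrite lee_fin.
  apply: (@le_lt_trans _ _ (\int[m2]_(z in torus2) B%:E)%E).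
    by apply: ge0_le_intR; [exact: mT|exact: mpl|exact: measurable_cst|move=> z _|move=> z _].
  rewrite integral_cst; last exact: mT.
  apply: lte_mul_pinfty; rewrite ?lee_fin//.
    exact: le_trans (f0 (0, 0)) (fB _).
  exact: torus2_lty.
rewrite ge0_intRZ; [|exact: mT|exact: mpl|by move=> z _|exact: lam0].
rewrite integral_indic; [|exact: mT|exact: borel_plane].
by rewrite setIC.
Qed.

Variables (s : seq (int * int)) (a b : int * int -> R) (r lam : R).
Hypotheses (r01 : 0 <= r < 1) (lam0 : 0 < lam).
Local Notation H := (tp s a b (fun=> 1)).
Hypothesis H0 : forall z, 0 <= H z.

Let q : R := Num.sqrt r.
Let r0 : 0 <= r. Proof. by case/andP: r01. Qed.
Let q01 : 0 <= q < 1.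
Proof. by case/andP: r01 => _ r1; rewrite sqrtr_ge0 -sqrtr1 ltr_sqrt. Qed.

Let e1 : `|1%:~R : R| <= 1. Proof. by rewrite normr1. Qed.
Let eN1 : `|(-1)%:~R : R| <= 1. Proof. by rewrite normrN1. Qed.

Lemma poisson_average_tp (e : int) m z :
  poisson_average e%:~R q (tp s a b m) z = tp s a b (fun p => m p * diag_mult e q p) z.
Proof.
have at0 m' : tp s a b m' z = line_sum s (fun p => p.1 + p.2 * e) (phase^~ z) a b m' 0.
  by rewrite -tp_diag mulr0 !addr0 -surjective_pairing.
rewrite /poisson_average tp_diag conv_line_sum_poisson// at0 mulrA div1r mulVf// ?mul1r//.
Qed.

(** On trigonometric sums this is multiplication by [radial_mult r], through [radial_multE] and q =
    sqrt r. *)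
Let T (F : R * R -> R) : R * R -> R :=
  poisson_average (-1)%:~R q (poisson_average 1%:~R q F).

Let f (k : nat) : R * R -> R := tp s a b (radial_mult (r ^+ k)).
Let S (n : nat) z : R := \sum_(0 <= k < n) f k z - n%:R * lam.

(* Hopf's argument: [running_max N] is the maximum of 0 and the first [N]
   partial sums of [f k - lam], and [T] is a positive contraction with [T (f k) = f k.+1]. *)
Fixpoint running_max (N : nat) (z : R * R) : R :=
  if N is N'.+1 then Num.max (running_max N' z) (S N'.+1 z) else 0.
Local Notation M := running_max.

Let mS n : measurable_fun [set: RR] (S n : RR -> R).
Proof.
apply: measurable_funB => //; apply: measurable_sum => k; exact: measurable_tp.
Qed.

Lemma measurable_running_max N : measurable_fun [set: RR] (running_max N : RR -> R).
Proof. by elim: N => [|N IH] //=; apply: measurable_maxr. Qed.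

Let M0 N z : 0 <= M N z.
Proof. by elim: N => [|N IH] //=; rewrite le_max IH. Qed.

Lemma running_max_ge N n z : (0 < n <= N)%N ->
  \sum_(0 <= k < n) tp s a b (radial_mult (r ^+ k)) z - n%:R * lam <= running_max N z.
Proof.
elim: N => [|N IH] /=; first by move=> /andP[h]; rewrite leqn0 => /eqP n0; rewrite n0 in h.
move=> /andP[n0]; rewrite leq_eqVlt => /predU1P[->|nN]; first by rewrite le_max lexx orbT.
by rewrite le_max IH// n0.
Qed.

Let M_attained N z : M N z = 0 \/ exists2 n, (n < N)%N & M N z = S n.+1 z.
Proof.
elim: N => [|N IH] /=; first by left.
case: (leP (M N z) (S N.+1 z)) => h; first by right; exists N.
by case: IH => [|[n nN ->]]; [left|right; exists n => //; exact: leqW].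
Qed.

Let bound n : R := \sum_(0 <= k < n) line_bound s a b (radial_mult (r ^+ k)) + n%:R * lam.

Let bound_ge0 n : 0 <= bound n.
Proof.
rewrite addr_ge0//; last by rewrite mulr_ge0// ltW.
by apply: sumr_ge0 => k _; exact: le_trans (normr_tp_le s a b _ (0, 0)).
Qed.

Let normr_M N z : `|M N z| <= \sum_(0 <= n < N.+1) bound n.
Proof.
rewrite ger0_norm//; have [->|[n nN ->]] := M_attained N z; first exact: sumr_ge0.
apply: (@le_trans _ _ (bound n.+1)); last first.
  rewrite (big_cat_nat (leq0n n.+1))/=; last by rewrite ltnS ltnW.
  rewrite [X in _ <= _ + X]big_ltn ?ltnS// addrCA lerDl.
  by apply: addr_ge0; apply: sumr_ge0.
apply: le_trans (ler_norm _) _; apply: le_trans (ler_normB _ _) _.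
apply: lerD; last by rewrite ger0_norm// mulr_ge0// ltW.
apply: le_trans (ler_norm_sum _ _ _) _; apply: ler_sum => k _; exact: normr_tp_le.
Qed.

Let M_per1 N x y : M N (x + 2 * pi, y) = M N (x, y).
Proof.
by elim: N => [|N IH] //=; rewrite IH /S; under eq_bigr do rewrite /f tp_per1.
Qed.

Let M_per2 N x y : M N (x, y + 2 * pi) = M N (x, y).
Proof.
by elim: N => [|N IH] //=; rewrite IH /S; under eq_bigr do rewrite /f tp_per2.
Qed.

(** The running maximum dominates the sum of f_0, ..., f_(n-1) minus n lam. Applying T, which is
    positive, fixes constants and sends f_k to f_(k+1), gives the sum of f_1, ..., f_n minus n lam.
    This is S_(n+1) without its first term H and with one lam fewer subtracted. *)
Let TM_ge N n z : (n <= N)%N -> S n.+1 z - H z + lam <= T (M N) z.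
Proof.
move=> nN; set G := tp s a b (fun p => \sum_(0 <= k < n) radial_mult (r ^+ k) p).
have GE w : G w = \sum_(0 <= k < n) f k w.
  rewrite /G /f /tp exchange_big/=; apply: eq_bigr => p _; exact: mulr_suml.
have h1 w : G w <= M N w + n%:R * lam.
  rewrite GE -lerBlDr; case: n nN {G GE} => [|n] nN; last exact: running_max_ge.
  by rewrite big_geq// mul0r subr0.
have mMc : measurable_fun [set: RR] ((fun w => M N w + n%:R * lam) : RR -> R).
  by apply: measurable_funD => //; exact: measurable_running_max.
have bMc w : `|M N w + n%:R * lam| <= \sum_(0 <= n < N.+1) bound n + `|n%:R * lam|.
  by apply: le_trans (ler_normD _ _) _; rewrite lerD2r; exact: normr_M.
have bG w : `|G w| <= _ := normr_tp_le s a b _ w.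
have mG : measurable_fun [set: RR] (G : RR -> R) by exact: measurable_tp.
have h2 w : poisson_average 1%:~R q G w <= poisson_average 1%:~R q (M N) w + n%:R * lam.
  rewrite -(poisson_averageD_cst _ q01 (measurable_running_max N) (normr_M N)).
  exact: (le_poisson_average _ q01 mG bG w mMc bMc h1).
have h2' w : poisson_average 1%:~R q G w = tp s a b (fun p => (\sum_(0 <= k < n) radial_mult (r ^+ k) p) * diag_mult 1 q p) w.
  exact: poisson_average_tp.
have mPM : measurable_fun [set: RR] (poisson_average 1%:~R q (M N) : RR -> R).
  exact: (measurable_poisson_average _ q01 (measurable_running_max N) (normr_M N) (M0 N)).
have bPM w : `|poisson_average 1%:~R q (M N) w| <= \sum_(0 <= n < N.+1) bound n.
  rewrite ger0_norm; last exact: (poisson_average_ge0 _ q01 (measurable_running_max N) (normr_M N) (M0 N)).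
  exact: (poisson_average_le _ q01 (measurable_running_max N) (normr_M N)).
have mPMc : measurable_fun [set: RR] ((fun w => poisson_average 1%:~R q (M N) w + n%:R * lam) : RR -> R).
  exact: measurable_funD.
have bPMc w : `|poisson_average 1%:~R q (M N) w + n%:R * lam| <= \sum_(0 <= n < N.+1) bound n + `|n%:R * lam|.
  by apply: le_trans (ler_normD _ _) _; rewrite lerD2r.
have : tp s a b (fun p => (\sum_(0 <= k < n) radial_mult (r ^+ k) p) * diag_mult 1 q p * diag_mult (-1) q p) z <=
    T (M N) z + n%:R * lam.
  rewrite -poisson_average_tp /T -(poisson_averageD_cst _ q01 mPM bPM).
  apply: (le_poisson_average _ q01 _ _ z mPMc bPMc).
  - exact: measurable_tp.
  - by move=> w; exact: normr_tp_le.
  - by move=> w; rewrite -h2'.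
have -> : tp s a b (fun p => (\sum_(0 <= k < n) radial_mult (r ^+ k) p) * diag_mult 1 q p * diag_mult (-1) q p) z =
    \sum_(0 <= k < n) f k.+1 z.
  rewrite /f /tp exchange_big/=; apply: eq_bigr => p _; rewrite -!mulr_suml; congr (_ * _).
  rewrite -mulrA -radial_multE// mulr_suml; apply: eq_bigr => k _.
  by rewrite /radial_mult -exprMn -exprSr.
rewrite /S big_nat_recl//= (_ : f 0%N z = H z); last first.
  by apply: eq_tp => p; rewrite /radial_mult expr0 expr1n.
by rewrite -(natr1 n); move: (\sum_(0 <= k < n) _) (T _ _) => u v; lra.
Qed.

Let T_per_integral N :
  (\int[m2]_(z in torus2) (T (M N) z)%:E = \int[m2]_(z in torus2) (M N z)%:E)%E.
Proof.
have mPM : measurable_fun [set: RR] (poisson_average 1%:~R q (M N) : RR -> R).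
  exact: (measurable_poisson_average _ q01 (measurable_running_max N) (normr_M N) (M0 N)).
have bPM w : `|poisson_average 1%:~R q (M N) w| <= \sum_(0 <= n < N.+1) bound n.
  rewrite ger0_norm; last exact: (poisson_average_ge0 _ q01 (measurable_running_max N) (normr_M N) (M0 N)).
  exact: (poisson_average_le _ q01 (measurable_running_max N) (normr_M N)).
rewrite /T (integral_poisson_average eN1 q01 mPM bPM); last 3 first.
- by move=> w; exact: (poisson_average_ge0 _ q01 (measurable_running_max N) (normr_M N) (M0 N)).
- by move=> x y; exact: poisson_average_per1.
- by move=> x y; exact: poisson_average_per2.
exact: (integral_poisson_average e1 q01 (measurable_running_max N) (normr_M N)).
Qed.

Let TM0 N z : 0 <= T (M N) z.
Proof.
apply: (@poisson_average_ge0 _ _ _ q01 _ (\sum_(0 <= n < N.+1) bound n)).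
- exact: (measurable_poisson_average _ q01 (measurable_running_max N) (normr_M N) (M0 N)).
- move=> w; rewrite ger0_norm; last exact: (poisson_average_ge0 _ q01 (measurable_running_max N) (normr_M N) (M0 N)).
  exact: (poisson_average_le _ q01 (measurable_running_max N) (normr_M N)).
- by move=> w; exact: (poisson_average_ge0 _ q01 (measurable_running_max N) (normr_M N) (M0 N)).
Qed.

Let mTM N : measurable_fun [set: RR] (T (M N) : RR -> R).
Proof.
apply: (measurable_poisson_average _ q01 (M := \sum_(0 <= n < N.+1) bound n)).
- exact: (measurable_poisson_average _ q01 (measurable_running_max N) (normr_M N) (M0 N)).
- move=> w; rewrite ger0_norm; last exact: (poisson_average_ge0 _ q01 (measurable_running_max N) (normr_M N) (M0 N)).
  exact: (poisson_average_le _ q01 (measurable_running_max N) (normr_M N)).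
- by move=> w; exact: (poisson_average_ge0 _ q01 (measurable_running_max N) (normr_M N) (M0 N)).
Qed.

(** Where the running maximum is positive it equals some partial sum, and [TM_ge] makes it exceed
    its image under T by at most H - lam. Since T preserves integrals, integration leaves only lam
    and H. *)
Lemma maximal_ergodic N :
  (lam%:E * m2 (torus2 `&` [set z | (0 < running_max N z)%R]) <=
   \int[m2]_(z in torus2) (H z)%:E)%E.
Proof.
set P := [set z | 0 < M N z].
have mP : measurable (P : set RR).
  rewrite -[P]setTI (_ : P = M N @^-1` `]0, +oo[%classic); last first.
    by apply/seteqP; split => z /=; rewrite in_itv/= andbT.
  by apply: (measurable_running_max N) => //; exact: measurable_itv.
have key z : M N z + lam * \1_P z <= T (M N) z + H z.
  rewrite indicE; have [h|h] := ltP 0 (M N z); last first.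
    have -> : M N z = 0 by apply/eqP; rewrite eq_le h M0.
    rewrite memNset ?mulr0 ?addr0 ?addr_ge0//=.
    by move=> h'; move: (lt_le_trans h' h); rewrite ltxx.
  rewrite mem_set// mulr1; have [h0|[n nN e]] := M_attained N z; first by rewrite h0 ltxx in h.
  by have := TM_ge z (ltnW nN); rewrite -e; lra.
apply: (@integral_excess_le (M N) (T (M N)) H P (\sum_(0 <= n < N.+1) bound n) lam (ltW lam0) (measurable_running_max N) (mTM N) _ mP
  (M0 N) _ (TM0 N) H0 key (T_per_integral N)).
- exact: measurable_tp.
- by move=> z; apply: le_trans (ler_norm _) _; exact: normr_M.
Qed.

End MaximalErgodic.

(** * Weak type bounds for square sums *)

Section WeakType.
Context {R : realType}.
Local Notation mu := (@lebesgue_measure R).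
Local Notation m2 := (@lebesgue_measure2 R).
Local Notation RR := (measurableTypeR R * measurableTypeR R)%type.

Lemma nondecreasing_bigcup_le d (T : measurableType d) (m : {measure set T -> \bar R})
  (F : nat -> set T) (c : \bar R) : (forall n, measurable (F n)) ->
  (forall n k, (n <= k)%N -> F n `<=` F k) -> (forall n, (m (F n) <= c)%E) ->
  (m (\bigcup_n F n) <= c)%E.
Proof.
move=> mF ndF Fc.
have cv : m (F n) @[n --> \oo] --> m (\bigcup_n F n).
  apply: nondecreasing_cvg_mu => //; first exact: bigcup_measurable.
  by move=> n k nk; apply/subsetPset; exact: ndF.
rewrite -(cvg_lim _ cv)//; apply: lime_le; first by apply/cvg_ex; eexists; exact: cv.
by apply: nearW => n; exact: Fc.
Qed.

Lemma dyadic_radius_pow i L : (i <= L)%N ->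
  dyadic_radius i = dyadic_radius L ^+ (2 ^ (L - i)) :> R.
Proof.
move=> iL; rewrite /dyadic_radius -expRM_natl; congr expR.
have -> : (2 ^ L)%:R = (2 ^ (L - i))%:R * (2 ^ i)%:R :> R by rewrite -natrM -expnD subnK.
by rewrite invfM mulrN mulrA mulfV ?mul1r// pnatr_eq0 -lt0n expn_gt0.
Qed.

Section RadialMaximal.
Variables (s : seq (int * int)) (a b : int * int -> R) (lam : R).
Hypotheses (lam0 : 0 < lam) (H0 : forall z, 0 <= tp s a b (fun=> 1) z).

Lemma radial_maximal_measurable i :
  measurable ([set z | lam < tp s a b (radial_mult (dyadic_radius i)) z] : set RR).
Proof.
rewrite -[X in measurable X]setTI (_ : [set z | _] =
    tp s a b (radial_mult (dyadic_radius i)) @^-1` `]lam, +oo[%classic); last first.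
  by apply/seteqP; split => z /=; rewrite in_itv/= andbT.
by apply: (@measurable_tp R s a b (radial_mult (dyadic_radius i))) => //; exact: measurable_itv.
Qed.

(** For i <= L every radius is a power r^k of the finest radius r. If the mean at r^k exceeds lam,
    those at r^j for k <= j < 2 k exceed lam/16 by Harnack, so the ergodic average over the first 2
    k powers exceeds lam/32. The resulting bound does not depend on L, which then tends to
    infinity. *)
Lemma radial_maximal_weak :
  (m2 (torus2 `&` \bigcup_i [set z | (lam < tp s a b (radial_mult (dyadic_radius i)) z)%R]) <=
   (32 / lam)%:E * \int[m2]_(z in torus2) (tp s a b (fun=> 1) z)%:E)%E.
Proof.
pose E L := torus2 `&` \bigcup_(i in `I_L.+1) [set z | lam < tp s a b (radial_mult (dyadic_radius i)) z].
have mE L : measurable (E L : set RR).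
  apply: measurableI; first exact: measurable_torus2_borel.
  by apply: bigcup_measurable => i _; exact: radial_maximal_measurable.
have -> : torus2 `&` \bigcup_i [set z | lam < tp s a b (radial_mult (dyadic_radius i)) z] = \bigcup_L E L.
  rewrite /E -setI_bigcupr; congr (_ `&` _); apply/seteqP; split => z.
    by move=> [i _ h]; exists i => //; exists i => /=.
  by move=> [L _] [i _ h]; exists i.
apply: nondecreasing_bigcup_le.
- by move=> L; exact: borel_plane.
- move=> L k Lk z [zT [i /= iL h]]; split => //.
  by exists i => //=; exact: leq_trans iL _.
move=> L; set r := dyadic_radius L : R.
have r01 : 0 <= r < 1 := dyadic_radius01 L.
have l0 : 0 < lam / 32 by rewrite divr_gt0.
have mx := @maximal_ergodic R s a b r (lam / 32) r01 l0 H0 (2 ^ L.+1)%N.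
rewrite -lee_pdivrMl; last by rewrite divr_gt0.
have -> : (32 / lam)^-1 = lam / 32 by rewrite invf_div.
apply: le_trans mx; rewrite lee_pmul2l// ?lte_fin//.
have mP : measurable ([set z | 0 < running_max s a b r (lam / 32) (2 ^ L.+1) z] : set RR).
  rewrite -[X in measurable X]setTI (_ : [set z | _] =
    running_max s a b r (lam / 32) (2 ^ L.+1) @^-1` `]0, +oo[%classic); last first.
    by apply/seteqP; split => z /=; rewrite in_itv/= andbT.
  by apply: measurable_running_max => //; exact: measurable_itv.
apply: le_measure; rewrite ?inE; [exact: borel_plane| |].
  by apply: borel_plane; apply: measurableI => //; exact: measurable_torus2_borel.
move=> z [zT [i /= iL h]]; split => //=.
set k := (2 ^ (L - i))%N.
have k0 : (0 < k)%N by rewrite expn_gt0.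
have kL : (0 < k.*2 <= 2 ^ L.+1)%N.
  by rewrite double_gt0 k0/= expnS mul2n leq_double leq_exp2l// leq_subr.
apply: lt_le_trans (running_max_ge s a b r (lam / 32) z kL).
rewrite (dyadic_radius_pow (i := i) (L := L))// -/r -/k in h.
have rk j : 0 <= r ^+ j <= 1.
  by case/andP: r01 => r0 r1; rewrite exprn_ge0//= exprn_ile1// ltW.
have r0 : 0 <= r by case/andP: r01.
have r1 : r <= 1 by case/andP: r01 => _ /ltW.
have rk1 j : (0 < j)%N -> 0 <= r ^+ j < 1.
  move=> j0; case/andP: (rk j) => -> _ /=.
  by rewrite exprn_ilt1// -?lt0n//; case/andP: r01.
have tpE m : tp s a b (fun p => 1 * m p) z = tp s a b m z.
  by apply: eq_tp => p; rewrite mul1r.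
have f0 j : 0 <= tp s a b (radial_mult (r ^+ j)) z.
  case: j => [|j].
    rewrite (@eq_tp _ _ _ _ _ (fun=> 1))// => p.
    by rewrite /radial_mult expr0 expr1n.
  have hj := rk1 j.+1 isT.
  have hjj : (r ^+ j.+1) ^+ 2 <= r ^+ j.+1 <= r ^+ j.+1.
    by rewrite lexx andbT expr2 ler_piMr//; case/andP: (rk j.+1).
  have /andP[] := @tp_radial_poisson_le R s a b (fun=> 1) _ _ z hj hjj H0.
  by rewrite tpE.
rewrite (big_cat_nat (leq0n k))/=; last by rewrite -addnn leq_addr.
have s1 : 0 <= \sum_(0 <= j < k) tp s a b (radial_mult (r ^+ j)) z by exact: sumr_ge0.
have s2 : k%:R * (tp s a b (radial_mult (r ^+ k)) z / 16) <=
    \sum_(k <= j < k.*2) tp s a b (radial_mult (r ^+ j)) z.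
  have -> : k%:R * (tp s a b (radial_mult (r ^+ k)) z / 16) =
      \sum_(k <= j < k.*2) tp s a b (radial_mult (r ^+ k)) z / 16.
    by rewrite sumr_const_nat -addnn addnK mulr_natl.
  apply: ler_sum_nat => j /andP[kj jk].
  have hkj : (r ^+ k) ^+ 2 <= r ^+ j <= r ^+ k.
    by rewrite -exprM !ler_wiXn2l// muln2 ltnW.
  have /andP[_] := @tp_radial_poisson_le R s a b (fun=> 1) _ _ z (rk1 k k0) hkj H0.
  by rewrite !tpE; lra.
have k0' : 0 < k%:R :> R by rewrite ltr0n.
have -> : k.*2%:R = k%:R + k%:R :> R by rewrite -natrD addnn.
have s3 : k%:R * (lam / 16) < k%:R * (tp s a b (radial_mult (r ^+ k)) z / 16).
  by rewrite ltr_pM2l// ltr_pM2r.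
move: (k%:R : R) (tp _ _ _ _ _ / 16) (\sum_(0 <= j < k) _) (\sum_(k <= j < k.*2) _) s1 s2 s3.
by move=> {}k' v S1 S2 *; lra.
Qed.

End RadialMaximal.

Section SquareSums.
Variables (s : seq (int * int)) (a b a' b' : int * int -> R) (lam : R).
Hypothesis lam0 : 0 < lam.
Local Notation h := (tp s a b (fun=> 1)).
Local Notation H := (tp s a' b' (fun=> 1)).
Hypothesis hH : forall z, `|h z| <= H z.

Let exceed (D : nat -> nat -> R * R -> R) : set (R * R) :=
  torus2 `&` \bigcup_i [set z |
    (2 ^ i)%:R * 12 < \sum_(0 <= n < 2 ^ i) expR (`|D i n z| / (4 * (exp_const * lam)))].

Let measurable_exceed D : (forall i n, measurable_fun [set: RR] (D i n : RR -> R)) ->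
  measurable (exceed D : set RR).
Proof.
move=> mD; apply: measurableI; first exact: measurable_torus2_borel.
apply: bigcup_measurable => i _.
set F := fun z => \sum_(0 <= n < 2 ^ i) expR (`|D i n z| / (4 * (exp_const * lam))).
rewrite -[X in measurable X]setTI (_ : [set z | _] = F @^-1` `](2 ^ i)%:R * 12, +oo[%classic); last first.
  by apply/seteqP; split => z /=; rewrite in_itv/= andbT.
have mF : measurable_fun [set: RR] (F : RR -> R).
  apply: measurable_sum => n; apply: (measurableT_comp (@measurable_expR R)).
  by apply: measurable_funM => //; apply: measurableT_comp.
by apply: mF => //; exact: measurable_itv.
Qed.

Let mrow e i n : measurable_fun [set: RR] (row_diff s a b e n (dyadic_radius i) : RR -> R).
Proof.
rewrite (_ : row_diff s a b e n _ = fun z => - tp s a b (fun p => half_mult e p * gap n (dyadic_radius i) p.1) z); last first.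
  by apply/funext => z; rewrite row_diffE// dyadic_radius01.
by apply: measurableT_comp => //; exact: measurable_tp.
Qed.

Let mcol e i n : measurable_fun [set: RR] (col_diff s a b e n (dyadic_radius i) : RR -> R).
Proof.
rewrite (_ : col_diff s a b e n _ = fun z => - tp s a b (fun p => half_mult e p * gap n (dyadic_radius i) p.2) z); last first.
  by apply/funext => z; rewrite col_diffE// dyadic_radius01.
by apply: measurableT_comp => //; exact: measurable_tp.
Qed.

Let cutoff_fin (g : R -> R) (B : R) : measurable_fun [set: R] g -> (forall u, `|g u| <= B) ->
  exists S, (\int[mu]_t (cutoff g t)%:E <= S%:E)%E.
Proof.
move=> mg gB.
have fin : (\int[mu]_t (cutoff g t)%:E \is a fin_num)%E.
  rewrite ge0_fin_numE; last by apply: integral_ge0 => t _; rewrite lee_fin cutoff_ge0.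
  rewrite /cutoff intR_indicT.
  apply: (@le_lt_trans _ _ (\int[mu]_(t in `[(- (3 * pi))%R, (3 * pi)%R]) B%:E)%E).
    apply: ge0_le_intR => //.
    by apply: measurable_funTS; exact: measurableT_comp.
  rewrite integral_cst//=; apply: lte_mul_pinfty; rewrite ?lee_fin//.
    exact: le_trans (gB 0).
  by rewrite lebesgue_measure_itv/= lte_fin; case: ifP => _; rewrite -?EFinB ltry.
by exists (fine (\int[mu]_t (cutoff g t)%:E)%E); rewrite fineK.
Qed.

Let half_bound e z : `|conj_half s a b e z| <= line_bound s (fun p => - b p) a (half_mult e).
Proof. exact: normr_tp_le. Qed.

Let row_exceed e : (m2 (exceed (fun i n => row_diff s a b e n (dyadic_radius i))) <=
  (105 / lam)%:E * \int[m2]_(z in torus2) (`|conj_half s a b e z|)%:E)%E.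
Proof.
have mc : measurable_fun [set: RR] (conj_half s a b e : RR -> R) by exact: measurable_tp.
apply: (row_weak mc (half_bound e) lam0) => //.
- by apply: measurable_exceed => i n; exact: mrow.
- by move=> z [].
- by move=> x y; exact: tp_per1.
move=> x y [zT [i _ /= hi]]; apply: contrapT => xbad.
have mg : measurable_fun [set: R] (fun u => conj_half s a b e (u, y)).
  exact: (measurable_section2 y mc).
have [S hS] := cutoff_fin mg (fun u => half_bound e (u, y)).
have xpi : - pi <= x <= pi by case/andP: zT => /= /andP[-> /ltW ->].
have := exp_window_conv i mg (fun u => half_bound e (u, y)) hS lam0 xpi xbad.
by rewrite leNgt => /negP; apply; exact: hi.
Qed.

Let col_exceed e : (m2 (exceed (fun i n => col_diff s a b e n (dyadic_radius i))) <=
  (105 / lam)%:E * \int[m2]_(z in torus2) (`|conj_half s a b e z|)%:E)%E.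
Proof.
have mc : measurable_fun [set: RR] (conj_half s a b e : RR -> R) by exact: measurable_tp.
apply: (col_weak mc (half_bound e) lam0) => //.
- by apply: measurable_exceed => i n; exact: mcol.
- by move=> z [].
- by move=> x y; exact: tp_per2.
move=> x y [zT [i _ /= hi]]; apply: contrapT => xbad.
have mg : measurable_fun [set: R] (fun u => conj_half s a b e (x, u)).
  exact: (measurable_section1 x mc).
have [S hS] := cutoff_fin mg (fun u => half_bound e (x, u)).
have xpi : - pi <= y <= pi by case/andP: zT => /= _ /andP[-> /ltW ->].
have := exp_window_conv i mg (fun u => half_bound e (x, u)) hS lam0 xpi xbad.
by rewrite leNgt => /negP; apply; exact: hi.
Qed.

Let tp_addl (c : R) m z : tp s (fun p => a' p + c * a p) (fun p => b' p + c * b p) m z =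
  tp s a' b' m z + c * tp s a b m z.
Proof. by rewrite /tp mulr_sumr -big_split/=; apply: eq_bigr => p _; ring. Qed.

(** Positivity of the radial mean is applied to the majorant plus and minus the given sum. *)
Let radial_le r z : 0 <= r < 1 -> `|tp s a b (radial_mult r) z| <= tp s a' b' (radial_mult r) z.
Proof.
move=> r01; have rr : r ^+ 2 <= r <= r.
  by case/andP: r01 => r0 r1; rewrite lexx andbT expr2 ler_piMr// ltW.
have pos (c : R) : `|c| = 1 -> 0 <= tp s a' b' (radial_mult r) z + c * tp s a b (radial_mult r) z.
  move=> c1; rewrite -tp_addl.
  have h1 w : 0 <= tp s (fun p => a' p + c * a p) (fun p => b' p + c * b p) (fun=> 1) w.
    rewrite tp_addl -lerBlDr sub0r; apply: le_trans (hH w).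
    by apply: le_trans (ler_norm _) _; rewrite normrN normrM c1 mul1r.
  have /andP[] := @tp_radial_poisson_le R s _ _ (fun=> 1) _ _ z r01 rr h1.
  by rewrite (@eq_tp _ _ _ _ _ (radial_mult r))// => p; rewrite mul1r.
have := pos 1 (normr1 _); have := pos (-1) (normrN1 _); rewrite mul1r mulN1r => h1 h2.
by rewrite ler_norml; apply/andP; split; lra.
Qed.

Let H0 z : 0 <= H z.
Proof. exact: le_trans (hH z). Qed.

(** The exceptional set is the union of five: rows and columns for each of the two conjugates, and
    the set where the radial means of the majorant are large. Each conjugate is used twice, for rows
    and for columns, hence 210 = 2 * 105. *)
Lemma square_sums_weak : exists E : set (R * R),
  [/\ measurable (E : set RR), E `<=` torus2,
    (m2 E <= (210 / lam)%:E * (\int[m2]_(z in torus2) (`|conj_half s a b 1 z|)%:E +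
      \int[m2]_(z in torus2) (`|conj_half s a b (-1) z|)%:E) +
      (32 / lam)%:E * \int[m2]_(z in torus2) (H z)%:E)%E &
    forall z, torus2 z -> ~ E z -> forall i, \sum_(0 <= n < 2 ^ i)
      expR (`|tp s a b (square_mult n) z| / (8 * (exp_const * lam))) <= (2 ^ i)%:R * 24].
Proof.
set E1 := exceed (fun i n => row_diff s a b 1 n (dyadic_radius i)).
set E2 := exceed (fun i n => col_diff s a b 1 n (dyadic_radius i)).
set E3 := exceed (fun i n => row_diff s a b (-1) n (dyadic_radius i)).
set E4 := exceed (fun i n => col_diff s a b (-1) n (dyadic_radius i)).
set E5 := torus2 `&` \bigcup_i [set z | lam < tp s a' b' (radial_mult (dyadic_radius i)) z].
have mE1 : measurable (E1 : set RR) by apply: measurable_exceed => i n; exact: mrow.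
have mE2 : measurable (E2 : set RR) by apply: measurable_exceed => i n; exact: mcol.
have mE3 : measurable (E3 : set RR) by apply: measurable_exceed => i n; exact: mrow.
have mE4 : measurable (E4 : set RR) by apply: measurable_exceed => i n; exact: mcol.
have mE5 : measurable (E5 : set RR).
  apply: measurableI; first exact: measurable_torus2_borel.
  by apply: bigcup_measurable => i _; exact: radial_maximal_measurable.
exists (E1 `|` E2 `|` (E3 `|` E4) `|` E5); split.
- apply: measurableU; last exact: mE5.
  by apply: measurableU; apply: measurableU; [exact: mE1|exact: mE2|exact: mE3|exact: mE4].
- by move=> z [[[[]|[]]|[[]|[]]]|[]].
- have U A B : measurable (A : set RR) -> measurable (B : set RR) -> (m2 (A `|` B) <= m2 A + m2 B)%E.
    by move=> mA mB; apply: measureU2; exact: borel_plane.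
  have mE12 : measurable (E1 `|` E2 : set RR) by apply: measurableU; [exact: mE1|exact: mE2].
  have mE34 : measurable (E3 `|` E4 : set RR) by apply: measurableU; [exact: mE3|exact: mE4].
  apply: le_trans (U _ _ _ mE5) _; first by apply: measurableU; [exact: mE12|exact: mE34].
  apply: leeD; last exact: (radial_maximal_weak lam0 H0).
  apply: le_trans (U _ _ mE12 mE34) _.
  apply: (@le_trans _ _ (m2 E1 + m2 E2 + (m2 E3 + m2 E4))%E).
    by apply: leeD; apply: U; [exact: mE1|exact: mE2|exact: mE3|exact: mE4].
  rewrite ge0_muleDr; last 2 first.
  + by apply: integral_ge0.
  + by apply: integral_ge0.
  have e : ((210 / lam)%:E = (105 / lam)%:E + (105 / lam)%:E :> \bar R)%E.
    by rewrite -EFinD; congr _%:E; rewrite -mulrDl; congr (_ / _); rewrite -natrD.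
  have c0 : (0 <= (105 / lam)%:E :> \bar R)%E by rewrite lee_fin divr_ge0// ltW.
  rewrite e !ge0_muleDl//.
  apply: leeD; apply: leeD; [exact: (row_exceed 1)|exact: (col_exceed 1)|
    exact: (row_exceed (-1))|exact: (col_exceed (-1))].
move=> z zT nE i.
have nexc D : ~ exceed D z -> \sum_(0 <= n < 2 ^ i)
    expR (`|D i n z| / (4 * (exp_const * lam))) <= (2 ^ i)%:R * 12.
  by move=> h; rewrite leNgt; apply/negP => h'; apply: h; split => //; exists i.
apply: square_window => //.
- apply: le_trans (radial_le z (dyadic_radius01 i)) _.
  rewrite leNgt; apply/negP => h'; apply: nE; right; split => //; by exists i.
- by apply: (nexc (fun i n => row_diff s a b 1 n (dyadic_radius i))) => h'; apply: nE; left; left; left.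
- by apply: (nexc (fun i n => col_diff s a b 1 n (dyadic_radius i))) => h'; apply: nE; left; left; right.
- by apply: (nexc (fun i n => row_diff s a b (-1) n (dyadic_radius i))) => h'; apply: nE; left; right; left.
- by apply: (nexc (fun i n => col_diff s a b (-1) n (dyadic_radius i))) => h'; apply: nE; left; right; right.
Qed.

End SquareSums.
End WeakType.

(** * Exponential integrability of conjugate sums *)

Section ExponentialIntegrability.
Context {R : realType}.
Local Notation mu := (@lebesgue_measure R).

Lemma is_derive_seq_sum (I : Type) (s : seq I) (h : I -> R -> R) (dh : I -> R) (x : R) :
  (forall p, is_derive x (1 : R) (h p) (dh p)) ->
  is_derive x (1 : R) (fun y => \sum_(p <- s) h p y) (\sum_(p <- s) dh p).
Proof.
move=> hd; elim: s => [|p s IH].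
  rewrite big_nil (_ : (fun y => _) = cst 0); last by apply/funext => y; rewrite big_nil.
  exact: is_derive_cst.
rewrite big_cons (_ : (fun y => _) = h p + (fun y => \sum_(p <- s) h p y)); last first.
  by apply/funext => y; rewrite big_cons.
exact: is_deriveD.
Qed.

Lemma cos_ge_cos1 (y : R) : `|y| <= 1 -> cos 1 <= cos y.
Proof.
move=> y1; rewrite -(cos_norm y).
have p1 : 1 <= pi :> R by have := @pi_ge2 R; lra.
move: y1; rewrite le_eqVlt => /predU1P[->//|y1]; apply/ltW.
by rewrite ltr_cos// in_itv/= ?ler01 ?normr_ge0//= (le_trans (ltW y1)).
Qed.

Section Line.
Variables (I : Type) (s : seq I) (n : I -> int) (phi a b : I -> R) (c : R).
Implicit Types (t u : R).

(** [A] is the harmonic extension of the sum to height t and [B] its conjugate. Their derivatives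
    are A_t = -P, B_t = A_u = Q and B_u = P. *)
Let dk t p : R := expR (- (t * `|n p|%N%:R)).
Let A t u := line_sum s n phi a b (dk t) u.
Let B t u := line_sum s n phi (fun p => - b p) a (fun p => (sgz (n p))%:~R * dk t p) u.
Let P t u := line_sum s n phi a b (fun p => `|n p|%N%:R * dk t p) u.
Let Q t u := line_sum s n phi b (fun p => - a p) (fun p => (n p)%:~R * dk t p) u.
(* [W t + i V t = exp (c (B t + i A t))] is analytic, so [W] has constant means:
   [W_t] and [V_u] below are the Cauchy-Riemann equation. *)
Let W t u := expR (c * B t u) * cos (c * A t u).
Let V t u := expR (c * B t u) * sin (c * A t u).
Let w t u := c * (Q t u * W t u + P t u * V t u).

Let sgabs (m : int) : (sgz m)%:~R * `|m|%N%:R = m%:~R :> R.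
Proof. by rewrite {3}(intEsg m) intrM. Qed.

Let absE (m : int) : (sgz m)%:~R * m%:~R = `|m|%N%:R :> R.
Proof. by rewrite -[RHS]/((`|m|%N : int)%:~R) abszEsg intrM. Qed.

Let is_derive_dk t p : is_derive t (1 : R) (dk^~ p) (- `|n p|%N%:R * dk t p).
Proof.
have d : is_derive t (1 : R) (fun t : R => - (t * `|n p|%N%:R)) (- `|n p|%N%:R).
  rewrite (_ : (fun t => _) = (fun t => (- `|n p|%N%:R) * t)); last by apply/funext => y; ring.
  by apply: is_derive_eq; rewrite /GRing.scale/= mulr1.
have := @is_derive1_comp _ (@expR R) _ _ _ _ (is_derive_expR _) d.
by rewrite mulrC.
Qed.

Let is_derive_decay (k : I -> R) (al be : I -> R) t u :
  is_derive t (1 : R) (fun t => line_sum s n phi al be (fun p => k p * dk t p) u)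
   (- line_sum s n phi al be (fun p => k p * (`|n p|%N%:R * dk t p)) u).
Proof.
rewrite /line_sum -sumrN; apply: is_derive_seq_sum => p.
have := is_deriveZ (k p * trig (n p) (phi p) (al p) (be p) u) (is_derive_dk t p).
rewrite (_ : _ \*: _ = (fun t => k p * dk t p * trig (n p) (phi p) (al p) (be p) u)); last first.
  by apply/funext => y; rewrite /GRing.scale/= mulrAC.
by move=> h; apply: is_derive_eq h _; rewrite /GRing.scale/=; ring.
Qed.

Let is_derive_line (m : I -> R) (al be : I -> R) u :
  is_derive u (1 : R) (line_sum s n phi al be m)
   (line_sum s n phi be (fun p => - al p) (fun p => (n p)%:~R * m p) u).
Proof.
apply: is_derive_seq_sum => p.
have := is_deriveZ (m p) (is_derive_trig (n p) (phi p) (al p) (be p) u).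
by move=> h; apply: is_derive_eq h _; rewrite /GRing.scale/=; ring.
Qed.

Let A_t t u : is_derive t (1 : R) (A^~ u) (- P t u).
Proof.
have := is_derive_decay (fun=> 1) a b t u.
rewrite (_ : (fun t => _) = A^~ u); last first.
  by apply/funext => y; apply: eq_bigr => p _; rewrite mul1r.
move=> h; apply: is_derive_eq h _; congr (- _).
by apply: eq_bigr => p _; rewrite mul1r.
Qed.

Let B_t t u : is_derive t (1 : R) (B^~ u) (Q t u).
Proof.
apply: is_derive_eq (is_derive_decay (fun p => (sgz (n p))%:~R) (fun p => - b p) a t u) _.
rewrite /line_sum /Q /line_sum -sumrN; apply: eq_bigr => p _.
by rewrite mulrA sgabs /trig; ring.
Qed.

Let A_u t u : is_derive u (1 : R) (A t) (Q t u).
Proof. exact: is_derive_line. Qed.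

Let B_u t u : is_derive u (1 : R) (B t) (P t u).
Proof.
apply: is_derive_eq (is_derive_line _ _ _ u) _.
by apply: eq_bigr => p _; rewrite mulrA [_ * (sgz _)%:~R]mulrC absE /trig opprK.
Qed.

Let derive_pair (al be : R -> R) (dal dbe x : R) :
  is_derive x (1 : R) al dal -> is_derive x (1 : R) be dbe ->
  is_derive x (1 : R) (fun y => expR (c * be y) * cos (c * al y))
    (c * (expR (c * be x) * (dbe * cos (c * al x) - dal * sin (c * al x)))) /\
  is_derive x (1 : R) (fun y => expR (c * be y) * sin (c * al y))
    (c * (expR (c * be x) * (dbe * sin (c * al x) + dal * cos (c * al x)))).
Proof.
move=> da db.
have dca : is_derive x (1 : R) (fun y => c * al y) (c * dal) by exact: (is_derive_eq (is_deriveZ c da)).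
have dcb : is_derive x (1 : R) (fun y => c * be y) (c * dbe) by exact: (is_derive_eq (is_deriveZ c db)).
have de := @is_derive1_comp _ (@expR R) _ _ _ _ (is_derive_expR _) dcb.
have dc := @is_derive1_comp _ (@cos R) _ _ _ _ (is_derive_cos _) dca.
have ds := @is_derive1_comp _ (@sin R) _ _ _ _ (is_derive_sin _) dca.
split.
  by apply: is_derive_eq (is_deriveM de dc) _; rewrite /GRing.scale/=; ring.
by apply: is_derive_eq (is_deriveM de ds) _; rewrite /GRing.scale/=; ring.
Qed.

Let W_t t u : is_derive t (1 : R) (W^~ u) (w t u).
Proof.
apply: is_derive_eq (derive_pair (A_t t u) (B_t t u)).1 _.
by rewrite /w /W /V; ring.
Qed.

Let V_u t u : is_derive u (1 : R) (V t) (w t u).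
Proof.
apply: is_derive_eq (derive_pair (A_u t u) (B_u t u)).2 _.
by rewrite /w /W /V; ring.
Qed.

Let continuous_w t : continuous (w t : R -> R).
Proof.
move=> u; have dW := (derive_pair (A_u t u) (B_u t u)).1; have dV := (derive_pair (A_u t u) (B_u t u)).2.
have dQ : is_derive u (1 : R) (Q t) _ := is_derive_line _ _ _ u.
have dP : is_derive u (1 : R) (P t) _ := is_derive_line _ _ _ u.
have [h _] := is_deriveZ c (is_deriveD (is_deriveM dQ dW) (is_deriveM dP dV)).
by apply: differentiable_continuous; apply/derivable1_diffP.
Qed.

Let integral_w t : Rintegral mu (period 0) (w t) = 0.
Proof.
rewrite (Rintegral_period_FTC 0 (@continuous_w t) (V_u t)).
have -> : 0 + pi = 0 - pi + 2 * pi :> R by ring.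
by rewrite /V /A /B !line_sumD2pi subrr.
Qed.

Let mW t : measurable_fun [set: R] (W t).
Proof.
apply: measurable_funM.
  apply: (measurableT_comp (@measurable_expR R)); apply: measurable_funM => //.
  exact: measurable_line_sum.
apply: (measurableT_comp (@measurable_cos R)); apply: measurable_funM => //.
exact: measurable_line_sum.
Qed.

(** A bound for [B], [P] and [Q] that grows with |t| and is valid for negative heights too, so that
    differentiation under the integral is justified in a neighbourhood of height 0. *)
Let K (t : R) : R := \sum_(p <- s) (`|a p| + `|b p|) * ((`|n p|%N%:R + 1) * expR (`|t| * `|n p|%N%:R)).

Let K_mono t t' : `|t| <= `|t'| -> K t <= K t'.
Proof.
move=> h; apply: ler_sum => p _; rewrite !ler_wpM2l ?addr_ge0//.
by rewrite ler_expR ler_wpM2r.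
Qed.

Let line_le_K (m al be : I -> R) t u :
  (forall p, `|al p| + `|be p| = `|a p| + `|b p|) ->
  (forall p, `|m p| <= (`|n p|%N%:R + 1) * expR (`|t| * `|n p|%N%:R)) ->
  `|line_sum s n phi al be m u| <= K t.
Proof.
move=> e h; apply: le_trans (normr_line_sum_le _ _ _ _ _ _ _) _.
apply: ler_sum => p _; rewrite !normrM -mulrDr e mulrC ler_wpM2l ?addr_ge0//.
Qed.

Let dk_le t p : dk t p <= expR (`|t| * `|n p|%N%:R).
Proof.
rewrite ler_expR -mulNr ler_wpM2r//.
by apply: le_trans (ler_norm _) _; rewrite normrN.
Qed.

Let dk0 t p : 0 <= dk t p. Proof. exact: expR_ge0. Qed.

Let B_le t u : `|B t u| <= K t.
Proof.
apply: line_le_K => p; first by rewrite normrN addrC.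
rewrite normrM (ger0_norm (dk0 t p)); apply: ler_pM => //.
rewrite -intr_norm normr_sgz; case: (n p != 0); rewrite ?mulr1z ?mulr0z; first by rewrite lerDr.
by rewrite addr_ge0.
Qed.

Let P_le t u : `|P t u| <= K t.
Proof.
apply: line_le_K => // p; rewrite normrM (ger0_norm (dk0 t p)); apply: ler_pM => //.
by rewrite normr_nat lerDl.
Qed.

Let Q_le t u : `|Q t u| <= K t.
Proof.
apply: line_le_K => p; first by rewrite normrN addrC.
rewrite normrM (ger0_norm (dk0 t p)); apply: ler_pM => //.
by rewrite -intr_norm -abszE lerDl.
Qed.

Let eB_le t u : expR (c * B t u) <= expR (`|c| * K t).
Proof. by rewrite ler_expR; apply: le_trans (ler_norm _) _; rewrite normrM ler_wpM2l. Qed.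

Let W_le t u : `|W t u| <= expR (`|c| * K t).
Proof.
rewrite /W normrM (ger0_norm (expR_ge0 _)) -[leRHS]mulr1; apply: ler_pM => //.
by rewrite ler_norml cos_geN1 cos_le1.
Qed.

Let V_le t u : `|V t u| <= expR (`|c| * K t).
Proof.
rewrite /V normrM (ger0_norm (expR_ge0 _)) -[leRHS]mulr1; apply: ler_pM => //.
by rewrite ler_norml sin_geN1 sin_le1.
Qed.

Let w_le t u : `|w t u| <= `|c| * (K t * expR (`|c| * K t) + K t * expR (`|c| * K t)).
Proof.
rewrite /w normrM ler_wpM2l//; apply: le_trans (ler_normD _ _) _.
by apply: lerD; rewrite normrM; apply: ler_pM.
Qed.

Let Wi t : mu.-integrable (period 0) (EFin \o W t).
Proof.
apply: (@bounded_integrable _ _ _ _ _ _ (expR (`|c| * K t))) => //.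
- exact: measurable_period.
- exact: period_lty.
- by apply: measurable_funTS; exact: mW.
Qed.

(** The derivative of the mean is the integral of W_t = V_u over a period, which vanishes because V
    is periodic in u. *)
Let mean_derive t : is_derive t (1 : R) (fun t => Rintegral mu (period 0) (W t)) 0.
Proof.
pose T : R := `|t| + 1.
have T0 : 0 <= T by rewrite addr_ge0.
have tI : `]t - 1, t + 1[%classic t by rewrite /= in_itv/=; apply/andP; split; lra.
have KI x : `]t - 1, t + 1[%classic x -> K x <= K T.
  rewrite /= in_itv/= => /andP[h1 h2]; apply: K_mono; rewrite (ger0_norm T0).
  have : `|x| <= `|x - t| + `|t| by rewrite -{1}(subrK t x) ler_normD.
  have : `|x - t| <= 1 by rewrite ler_norml; apply/andP; split; lra.
  by rewrite /T; lra.
pose G (_ : R) : R := `|c| * (K T * expR (`|c| * K T) + K T * expR (`|c| * K T)).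
have K0 : 0 <= K T by exact: le_trans (B_le T 0).
have G0 (y : R) : 0 <= G y.
  by rewrite /G; apply: mulr_ge0 => //; apply: addr_ge0; apply: mulr_ge0 => //; exact: expR_ge0.
have iG : mu.-integrable (period 0) (EFin \o G).
  apply: (@bounded_integrable _ _ _ _ _ _ (G 0)); first exact: measurable_period.
  - exact: period_lty.
  - exact: measurable_cst.
  - by move=> u _; rewrite ger0_norm.
have dW x (y : R) : `]t - 1, t + 1[%classic x -> period 0 y -> derivable (W^~ y) x 1.
  by move=> _ _; case: (W_t x y).
have dWE x (y : R) : partial1of2 W x y = w x y.
  by rewrite partial1of2E; case: (W_t x y).
have ub x (y : R) : `]t - 1, t + 1[%classic x -> period 0 y -> `|partial1of2 W x y| <= G y.
  move=> xI _; rewrite dWE; apply: le_trans (w_le x y) _; rewrite /G ler_wpM2l//.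
  have h := KI x xI; have Kx : 0 <= K x by apply: le_trans (B_le x 0).
  have h2 : K x * expR (`|c| * K x) <= K T * expR (`|c| * K T).
    by apply: ler_pM => //; rewrite ler_expR ler_wpM2l.
  exact: lerD.
have iW x : `]t - 1, t + 1[%classic x -> mu.-integrable (period 0) (EFin \o W x) by move=> _; exact: Wi.
apply: DeriveDef.
  exact: (derivable_under_integral (measurable_period 0) tI iW dW G0 iG ub).
rewrite -derive1E (differentiation_under_integral (measurable_period 0) tI iW dW G0 iG ub).
by rewrite -[RHS](integral_w t); apply: eq_Rintegral => y _; exact: dWE.
Qed.

Let mean_const t : Rintegral mu (period 0) (W 0) = Rintegral mu (period 0) (W t).
Proof. exact: (is_derive_0_is_cst _ _ mean_derive). Qed.

Let L : R := \sum_(p <- s) (`|a p| + `|b p|).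

Let B_decay t u : 0 <= t -> `|B t u| <= L * expR (- t).
Proof.
move=> t0; apply: le_trans (normr_line_sum_le _ _ _ _ _ _ _) _.
rewrite /L mulr_suml; apply: ler_sum => p _; rewrite !normrM -mulrDr normrN addrC mulrC.
rewrite ler_wpM2l ?addr_ge0// -intr_norm normr_sgz (ger0_norm (dk0 t p)).
have [_|np0] := eqVneq (n p) 0; first by rewrite mul0r expR_ge0.
rewrite mul1r ler_expR lerN2 ler_peMr//.
by rewrite ler1n lt0n absz_eq0.
Qed.

(** The mean does not depend on the height, and as the height tends to infinity [B] tends to 0,
    since conjugation removes the zero frequency. The cosine is at most 1, so the limit is at most
    the length of the period. *)
Lemma mean_exp_cos_le : Rintegral mu (period 0) (fun u =>
  expR (c * line_sum s n phi (fun p => - b p) a (fun p => (sgz (n p))%:~R) u) *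
  cos (c * line_sum s n phi a b (fun=> 1) u)) <= 2 * pi.
Proof.
have -> : (fun u => expR (c * line_sum s n phi (fun p => - b p) a (fun p => (sgz (n p))%:~R) u) *
    cos (c * line_sum s n phi a b (fun=> 1) u)) = W 0.
  apply/funext => u; congr (expR (c * _) * cos (c * _)); apply: eq_bigr => p _.
    by rewrite /dk mul0r oppr0 expR0 mulr1.
  by rewrite /dk mul0r oppr0 expR0.
pose C : R := `|c| * L.
have L0 : 0 <= L by apply: sumr_ge0 => p _; rewrite addr_ge0.
have C0 : 0 <= C by rewrite mulr_ge0.
have pi0 := @pi_gt0 R.
(* The height is parametrised as t = -ln x, so that infinite height corresponds to x = 0. *)
have h x : 0 < x <= 1 -> Rintegral mu (period 0) (W 0) <= 2 * pi * expR (C * x).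
  move=> /andP[x0 x1]; pose t : R := - ln x.
  have t0 : 0 <= t by rewrite oppr_ge0 ln_le0.
  have et : expR (- t) = x by rewrite opprK lnK// posrE.
  rewrite (mean_const t).
  rewrite [leRHS](_ : _ = Rintegral mu (period 0) (fun=> expR (C * x))); last first.
    rewrite Rintegral_cst; last exact: measurable_period.
    have -> : fine (mu (period 0)) = 2 * pi.
      rewrite /period lebesgue_measure_itv/= lte_fin ifT /=; first by ring.
      by lra.
    by rewrite mulrC.
  apply: le_Rintegral; first exact: measurable_period.
  - exact: Wi.
  - apply: (@bounded_integrable _ _ _ _ _ _ `|expR (C * x)|) => //; first exact: measurable_period.
    exact: period_lty.
  - move=> u _; apply: le_trans (ler_norm _) _.
    rewrite /W normrM (ger0_norm (expR_ge0 _)) -[leRHS]mulr1; apply: ler_pM => //.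
    + rewrite ler_expR; apply: le_trans (ler_norm _) _; rewrite normrM /C -mulrA ler_wpM2l//.
      by rewrite -et; exact: B_decay.
    + by rewrite ler_norml cos_geN1 cos_le1.
apply/ler_addgt0Pl => e e0.
pose x : R := Num.min 1 (Num.min ((C + 1)^-1 / 2) (e / (4 * pi * (C + 1)))).
have C1 : 0 < C + 1 by lra.
have D0 : 0 < 4 * pi * (C + 1) by rewrite mulr_gt0// mulr_gt0.
have x01 : 0 < x <= 1.
  by rewrite ge_min lexx/= !lt_min ltr01 !divr_gt0// invr_gt0.
have x2 : x <= (C + 1)^-1 / 2 by rewrite /x !ge_min lexx/= orbT.
have x3 : x <= e / (4 * pi * (C + 1)) by rewrite /x !ge_min lexx/= !orbT.
have x0 : 0 <= x by case/andP: x01 => /ltW.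
have y2 : C * x <= 1 / 2.
  apply: (@le_trans _ _ ((C + 1) * x)); first by rewrite ler_wpM2r// lerDl.
  by rewrite mulrC -ler_pdivlMr// mul1r mulrC.
have y3 : 4 * pi * (C * x) <= e.
  apply: (@le_trans _ _ (4 * pi * (C + 1) * x)).
    by rewrite -[leRHS]mulrA ler_wpM2l ?mulr_ge0 ?pi_ge0// ler_wpM2r// lerDl.
  by rewrite mulrC -ler_pdivlMr.
apply: le_trans (h x x01) _.
have y0 : 0 <= C * x by rewrite mulr_ge0.
have e1 : expR (C * x) <= 1 + 2 * (C * x).
  by apply: le_trans (expR_le_quad y2) _; nra.
apply: (@le_trans _ _ (2 * pi * (1 + 2 * (C * x)))); first by rewrite ler_wpM2l ?mulr_ge0 ?pi_ge0.
by rewrite mulrDr mulr1 [leRHS]addrC lerD2l (_ : 2 * pi * _ = 4 * pi * (C * x))//; move: (pi : R) => p; ring.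
Qed.

(** If |c| and the sum are bounded by 1, then cos(c A) >= cos 1 > 0, and the cosine in
    [mean_exp_cos_le] can be divided out. *)
Lemma integral_exp_line_le : `|c| <= 1 -> (forall u, `|line_sum s n phi a b (fun=> 1) u| <= 1) ->
  (\int[mu]_(u in cycle) (expR (c * line_sum s n phi (fun p => - b p) a (fun p => (sgz (n p))%:~R) u))%:E
   <= (2 * pi / cos 1)%:E)%E.
Proof.
move=> c1 A1.
set E := fun u => expR (c * line_sum s n phi (fun p => - b p) a (fun p => (sgz (n p))%:~R) u).
set X := fun u => cos (c * line_sum s n phi a b (fun=> 1) u).
have mE : measurable_fun [set: R] E.
  apply: (measurableT_comp (@measurable_expR R)); apply: measurable_funM => //.
  exact: measurable_line_sum.
have mX : measurable_fun [set: R] X.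
  apply: (measurableT_comp (@measurable_cos R)); apply: measurable_funM => //.
  exact: measurable_line_sum.
have k0 : 0 < cos 1 :> R by exact: cos1_gt0.
have X1 u : cos 1 <= X u.
  apply: cos_ge_cos1; rewrite normrM -[leRHS]mulr1; exact: ler_pM.
have X0 u : 0 <= X u by apply: le_trans (X1 u); exact: ltW.
have E0 u : 0 <= E u by exact: expR_ge0.
have EX0 u : 0 <= E u * X u by rewrite mulr_ge0.
apply: (@le_trans _ _ (\int[mu]_(u in period 0) ((cos 1)^-1 * (E u * X u))%:E)%E).
  apply: (@le_trans _ _ (\int[mu]_(u in period 0) (E u)%:E)%E).
    apply: ge0_subset_integral => //.
    - exact: measurable_cycle.
    - exact: measurable_period.
    - by apply/measurable_EFinP; exact: measurable_funTS.
    - by move=> u; rewrite /cycle /period/= !in_itv/= sub0r add0r => /andP[-> /ltW].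
  apply: ge0_le_intR.
  - exact: measurable_period.
  - exact: measurable_funTS.
  - by apply: measurable_funTS; apply: measurable_funM => //; exact: measurable_funM.
  - by move=> u _.
  - by move=> u _; rewrite mulrCA ler_peMr// mulrC ler_pdivlMr// mul1r.
rewrite ge0_intRZ; [|exact: measurable_period|by apply: measurable_funTS; exact: measurable_funM|by move=> u _|by rewrite invr_ge0 ltW].
rewrite -[X in (_ * X)%E]fineK; last first.
  have := Wi 0; rewrite (_ : W 0 = (fun u => E u * X u)); last first.
    apply/funext => u; congr (expR (c * _) * cos (c * _)); apply: eq_bigr => p _.
      by rewrite /dk mul0r oppr0 expR0 mulr1.
    by rewrite /dk mul0r oppr0 expR0.
  by apply: integrable_fin_num; exact: measurable_period.
rewrite -EFinM lee_fin mulrC ler_pM2r ?invr_gt0//; exact: mean_exp_cos_le.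
Qed.

End Line.

Local Notation m2 := (@lebesgue_measure2 R).
Local Notation RR := (measurableTypeR R * measurableTypeR R)%type.

Lemma measurable_conj_half (s : seq (int * int)) (a b : int * int -> R) (e : int) :
  measurable_fun [set: RR] (conj_half s a b e : RR -> R).
Proof. exact: measurable_tp. Qed.

(** After the shear, the half-plane conjugate is on each slice the ordinary conjugate of a
    trigonometric sum bounded by 1, so the one-dimensional estimate is integrated over the
    slices. *)
Lemma integral_exp_conj_half_le (s : seq (int * int)) (a b : int * int -> R) (e : int) (c : R) :
  `|e%:~R : R| <= 1 -> `|c| <= 1 -> (forall z, `|tp s a b (fun=> 1) z| <= 1) ->
  (\int[m2]_(z in torus2) (expR (c * conj_half s a b e z))%:E <= (4 * pi ^+ 2 / cos 1)%:E)%E.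
Proof.
move=> e1 c1 h1.
have mF : measurable_fun [set: RR] (fun z : RR => expR (c * conj_half s a b e z)).
  apply: (measurableT_comp (@measurable_expR R)); apply: measurable_funM => //.
  exact: measurable_conj_half.
have mFE : measurable_fun [set: RR] (fun z : RR => (expR (c * conj_half s a b e z))%:E).
  exact/measurable_EFinP.
rewrite (integral_torus2_shear (F := fun z => (expR (c * conj_half s a b e z))%:E) mFE _ _ e1); last 2 first.
- by move=> z; rewrite lee_fin expR_ge0.
- by move=> x y; rewrite /conj_half tp_per2.
have mshear : measurable_fun [set: RR] (fun z : RR => (z.1, z.2 + e%:~R * z.1) : RR).
  apply/measurable_fun_pairP; split; first exact: measurable_fst.
  by apply: measurable_funD => //; apply: measurable_funM.
have line y : (fun x => conj_half s a b e (x, y + e%:~R * x)) =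
    line_sum s (fun p => p.1 + p.2 * e) (phase^~ (0, y)) (fun p => - b p) a
      (fun p => (sgz (p.1 + p.2 * e))%:~R).
  have := tp_diag s (fun p => - b p) a (half_mult e) e (0, y).
  by move=> <-; apply/funext => u; rewrite /conj_half/= add0r.
have line1 y u : `|line_sum s (fun p => p.1 + p.2 * e) (phase^~ (0, y)) a b (fun=> 1) u| <= 1.
  by rewrite -tp_diag.
apply: (@le_trans _ _ (\int[mu]_(y in cycle) (2 * pi / cos 1)%:E)%E).
  apply: ge0_le_integral => //.
  - exact: measurable_cycle.
  - by move=> y _; apply: integral_ge0 => x _; rewrite lee_fin expR_ge0.
  - apply: measurable_funTS.
    apply: (measurable_cycle_col (F := fun z => (expR (c * conj_half s a b e (z.1, z.2 + e%:~R * z.1)))%:E)).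
      exact: (measurableT_comp mFE mshear).
    by move=> z; rewrite lee_fin expR_ge0.
  - move=> y _; have := integral_exp_line_le (s := s) (n := fun p => p.1 + p.2 * e) c1 (line1 y).
    apply: le_trans; rewrite le_eqVlt; apply/orP; left; apply/eqP.
    by apply: eq_integral => x _; rewrite -(line y).
rewrite integral_cst; last exact: measurable_cycle.
rewrite -[leLHS]/((2 * pi / cos 1)%:E * mu cycle)%E cycle_measure -EFinM lee_fin le_eqVlt.
apply/orP; left; apply/eqP; move: (cos 1)^-1 (pi : R) => k p; ring.
Qed.

Lemma integral_exp_abs_conj_half_le (s : seq (int * int)) (a b : int * int -> R) (e : int) :
  `|e%:~R : R| <= 1 -> (forall z, `|tp s a b (fun=> 1) z| <= 1) ->
  (\int[m2]_(z in torus2) (expR `|conj_half s a b e z|)%:E <= (8 * pi ^+ 2 / cos 1)%:E)%E.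
Proof.
move=> e1 h1.
have mF (c : R) : measurable_fun [set: RR] (fun z : RR => expR (c * conj_half s a b e z)).
  apply: (measurableT_comp (@measurable_expR R)); apply: measurable_funM => //.
  exact: measurable_conj_half.
have mT := @measurable_torus2 R.
have mpl (F : R * R -> R) : measurable_fun [set: RR] (F : RR -> R) -> measurable_fun torus2 F.
  by move=> mF'; apply: measurable_fun_plane => //; exact: mT.
apply: (@le_trans _ _ (\int[m2]_(z in torus2) (expR (1 * conj_half s a b e z) + expR (-1 * conj_half s a b e z))%:E)%E).
  apply: ge0_le_intR; first exact: mT.
  - apply: mpl; apply: (measurableT_comp (@measurable_expR R)); apply: measurableT_comp => //.
    exact: measurable_conj_half.
  - by apply: mpl; apply: measurable_funD; exact: mF.
  - by move=> z _; exact: expR_ge0.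
  - move=> z _; rewrite mul1r mulN1r; have [h|h] := leP 0 (conj_half s a b e z).
      by rewrite ger0_norm// lerDl expR_ge0.
    by rewrite ltr0_norm// lerDr expR_ge0.
rewrite ge0_intRD; [|exact: mT|exact: mpl (mF _)|exact: mpl (mF _)|by move=> z _; exact: expR_ge0|by move=> z _; exact: expR_ge0].
apply: le_trans (leeD (integral_exp_conj_half_le e1 _ h1) (integral_exp_conj_half_le e1 _ h1)) _.
- by rewrite normr1.
- by rewrite normrN1.
rewrite -EFinD lee_fin le_eqVlt; apply/orP; left; apply/eqP.
by move: (cos 1)^-1 (pi : R) => k p; ring.
Qed.

End ExponentialIntegrability.

(** * Fejer means *)

Section FejerIdentities.
Context {R : realType}.

Lemma sum_centered_recr (V : nmodType) (G : int -> V) N :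
  \sum_(0 <= i < N.+1.*2.+1) G (i%:Z - N.+1%:Z) =
  G (- N.+1%:Z) + \sum_(0 <= i < N.*2.+1) G (i%:Z - N%:Z) + G N.+1%:Z.
Proof.
rewrite doubleS big_nat_recr//= big_nat_recl//= sub0r; congr (_ + _ + _).
- by apply: eq_big_nat => i _; congr G; lia.
- by congr G; lia.
Qed.

Implicit Types (G : int -> R).

Lemma sum_centered_sym G N :
  \sum_(0 <= i < N.*2.+1) G (i%:Z - N%:Z) =
  G 0 + (\sum_(0 <= k < N) G k.+1%:Z + \sum_(0 <= k < N) G (- k.+1%:Z)).
Proof.
elim: N => [|N IH]; first by rewrite /= big_nat1 !big_geq// !addr0.
by rewrite sum_centered_recr IH ![in RHS]big_nat_recr//=; ring.
Qed.

(** Enlarging the square by one row and one column adds each difference from -N to N exactly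
    once. *)
Lemma sum_difference_square G N :
  \sum_(0 <= k < N) \sum_(0 <= m < N) G (k%:Z - m%:Z) =
  \sum_(0 <= j < N) \sum_(0 <= i < j.*2.+1) G (i%:Z - j%:Z).
Proof.
elim: N => [|N IH]; first by rewrite !big_geq.
rewrite [in RHS]big_nat_recr//= -IH sum_centered_sym big_nat_recr//=.
rewrite (eq_bigr (fun k => \sum_(0 <= m < N) G (k%:Z - m%:Z) + G (k%:Z - N%:Z))); last first.
  by move=> k _; rewrite big_nat_recr.
rewrite big_split/= big_nat_recr//= subrr.
have -> : \sum_(0 <= k < N) G (k%:Z - N%:Z) = \sum_(0 <= k < N) G (- k.+1%:Z).
  by rewrite big_nat_rev/=; apply: eq_big_nat => k kN; congr G; lia.
have -> : \sum_(0 <= k < N) G (N%:Z - k%:Z) = \sum_(0 <= k < N) G k.+1%:Z.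
  by rewrite big_nat_rev/=; apply: eq_big_nat => k kN; congr G; lia.
ring.
Qed.

(** The difference i occurs in the symmetric blocks of half-length |i|, ..., N, that is N + 1 - |i|
    times. Together with [sum_difference_square] this shows the Fejer kernel as a square of
    modulus. *)
Lemma sum_triangle G N :
  \sum_(0 <= j < N.+1) \sum_(0 <= i < j.*2.+1) G (i%:Z - j%:Z) =
  \sum_(0 <= i < N.*2.+1) (N.+1 - `|(i%:Z - N%:Z)%R|)%N%:R * G (i%:Z - N%:Z).
Proof.
elim: N => [|N IH]; first by rewrite !big_nat1 /= mul1r.
rewrite big_nat_recr//= IH.
rewrite (sum_centered_recr G N) (sum_centered_recr (fun j => (N.+2 - `|j|)%N%:R * G j) N).
have -> : (N.+2 - `|(- N.+1%:Z)%R| = 1)%N by lia.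
rewrite (_ : \sum_(0 <= i < N.*2.+1) (N.+2 - `|(i%:Z - N%:Z)%R|)%N%:R * G (i%:Z - N%:Z) =
  \sum_(0 <= i < N.*2.+1) (N.+1 - `|(i%:Z - N%:Z)%R|)%N%:R * G (i%:Z - N%:Z) +
  \sum_(0 <= i < N.*2.+1) G (i%:Z - N%:Z)); last first.
  rewrite -big_split/=; apply: eq_big_nat => i iN.
  have -> : (N.+2 - `|(i%:Z - N%:Z)%R| = (N.+1 - `|(i%:Z - N%:Z)%R|).+1)%N by lia.
  by rewrite -natr1 mulrDl mul1r.
by rewrite !mul1r; ring.
Qed.

Definition fweight N (j : int) : R := (N.+1 - `|j|)%N%:R / N.+1%:R.

Lemma fweight_cos_ge0 N (t : R) :
  0 <= \sum_(0 <= i < N.*2.+1) fweight N (i%:Z - N%:Z) * cos ((i%:Z - N%:Z)%:~R * t).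
Proof.
have -> : \sum_(0 <= i < N.*2.+1) fweight N (i%:Z - N%:Z) * cos ((i%:Z - N%:Z)%:~R * t) =
    N.+1%:R^-1 * \sum_(0 <= i < N.*2.+1) (N.+1 - `|(i%:Z - N%:Z)%R|)%N%:R * cos ((i%:Z - N%:Z)%:~R * t).
  by rewrite mulr_sumr; apply: eq_bigr => i _; rewrite /fweight mulrA [_ / _]mulrC.
rewrite -(sum_triangle (fun j => cos (j%:~R * t))).
rewrite -(sum_difference_square (fun j => cos (j%:~R * t))).
rewrite mulr_ge0 ?invr_ge0//.
rewrite (eq_bigr (fun k => \sum_(0 <= m < N.+1) cos (0 + (k%:R - m%:R) * t))); last first.
  by move=> k _; apply: eq_bigr => m _; rewrite add0r intrB -!pmulrn.
by rewrite sum_cos_diff cos0 mul1r addr_ge0// sqr_ge0.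
Qed.

Lemma fweight_sin0 N (t : R) :
  \sum_(0 <= i < N.*2.+1) fweight N (i%:Z - N%:Z) * sin ((i%:Z - N%:Z)%:~R * t) = 0.
Proof.
rewrite (sum_centered_sym (fun j => fweight N j * sin (j%:~R * t))).
rewrite mul0r sin0 mulr0 add0r -big_split/= big1// => k _.
by rewrite /fweight abszN mulrNz mulNr sinN mulrN subrr.
Qed.

Definition box N : seq (int * int) :=
  [seq (i%:Z - N%:Z, k%:Z - N%:Z) | i <- iota 0 N.*2.+1, k <- iota 0 N.*2.+1].

Lemma big_box (V : nmodType) N (F : int * int -> V) :
  \sum_(p <- box N) F p =
  \sum_(0 <= i < N.*2.+1) \sum_(0 <= k < N.*2.+1) F (i%:Z - N%:Z, k%:Z - N%:Z).
Proof. by rewrite big_allpairs_dep/= /index_iota subn0. Qed.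

Definition fmult N (p : int * int) : R := fweight N p.1 * fweight N p.2.

(** The product of two one-dimensional Fejer kernels. Sines are absent because the weights are
    even. *)
Definition fejer_kernel N (u : R * R) : R := \sum_(p <- box N) fmult N p * cos (phase p u).

Lemma fejer_kernel_ge0 N u : 0 <= fejer_kernel N u.
Proof.
have -> : fejer_kernel N u =
  (\sum_(0 <= i < N.*2.+1) fweight N (i%:Z - N%:Z) * cos ((i%:Z - N%:Z)%:~R * u.1)) *
  (\sum_(0 <= i < N.*2.+1) fweight N (i%:Z - N%:Z) * cos ((i%:Z - N%:Z)%:~R * u.2)).
  rewrite /fejer_kernel big_box.
  transitivity ((\sum_(0 <= i < N.*2.+1) fweight N (i%:Z - N%:Z) * cos ((i%:Z - N%:Z)%:~R * u.1)) *
    (\sum_(0 <= i < N.*2.+1) fweight N (i%:Z - N%:Z) * cos ((i%:Z - N%:Z)%:~R * u.2)) -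
    (\sum_(0 <= i < N.*2.+1) fweight N (i%:Z - N%:Z) * sin ((i%:Z - N%:Z)%:~R * u.1)) *
    (\sum_(0 <= i < N.*2.+1) fweight N (i%:Z - N%:Z) * sin ((i%:Z - N%:Z)%:~R * u.2))); last first.
    by rewrite !fweight_sin0 mulr0 subr0.
  rewrite !big_distrl/= -sumrB; apply: eq_bigr => i _.
  rewrite !big_distrr/= -sumrB; apply: eq_bigr => k _.
  by rewrite /fmult /phase/= cosD; ring.
by rewrite mulr_ge0// fweight_cos_ge0.
Qed.

End FejerIdentities.

(** * Orthogonality of the trigonometric system on the torus *)

Section TorusOrthogonality.
Context {R : realType}.
Local Notation mu := (@lebesgue_measure R).
Local Notation m2 := (@lebesgue_measure2 R).
Local Notation RR := (measurableTypeR R * measurableTypeR R)%type.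
Local Notation plane := (caratheodory_type ((@lebesgue_measure R \x @lebesgue_measure R)%E^*)%mu).

Lemma measurable_plane (F : R * R -> R) : measurable_fun [set: RR] (F : RR -> R) ->
  measurable_fun (torus2 : set plane) (F : plane -> R).
Proof. by move=> mF; apply: measurable_fun_plane => //; exact: measurable_torus2. Qed.

Lemma bounded_torus_integrable (F : R * R -> R) (M : R) :
  measurable_fun (torus2 : set plane) (F : plane -> R) ->
  (forall z, `|F z| <= M) -> m2.-integrable torus2 (EFin \o F).
Proof.
move=> mF FM; apply: (@bounded_integrable _ _ _ m2 torus2 F M) => //.
- exact: measurable_torus2.
- exact: torus2_lty.
Qed.

Lemma Rintegral_torus2_cst (c : R) : Rintegral m2 torus2 (fun=> c) = 4 * pi ^+ 2 * c.
Proof.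
rewrite Rintegral_cst; last exact: measurable_torus2.
transitivity (c * fine ((@lebesgue_measure2 R) torus2)) => //.
by rewrite torus2_measure/= mulrC.
Qed.

(** Adding the bound M makes the function nonnegative, which reduces the claim to the Tonelli
    version. *)
Lemma Rintegral_torus2_shift (F : R * R -> R) (M s t : R) :
  measurable_fun [set: RR] (F : RR -> R) -> (forall z, `|F z| <= M) ->
  (forall x y, F (x + 2 * pi, y) = F (x, y)) -> (forall x y, F (x, y + 2 * pi) = F (x, y)) ->
  `|s| <= 2 * pi -> `|t| <= 2 * pi ->
  Rintegral m2 torus2 (fun z => F (z.1 + s, z.2 + t)) = Rintegral m2 torus2 F.
Proof.
move=> mF FM per1 per2 hs ht.
have mshift : measurable_fun [set: RR] (fun z : RR => (z.1 + s, z.2 + t) : RR).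
  by apply/measurable_fun_pairP; split; apply: measurable_funD.
have key : Rintegral m2 torus2 (fun z => F (z.1 + s, z.2 + t) + M) = Rintegral m2 torus2 (fun z => F z + M).
  congr fine; apply: (@integral_torus2_shift R (fun z => (F z + M)%:E)) => //.
  - by apply/measurable_EFinP; apply: measurable_funD.
  - by move=> z; rewrite lee_fin; have := FM z; rewrite ler_norml => /andP[? _]; lra.
  - by move=> x y; rewrite per1.
  - by move=> x y; rewrite per2.
have mT := @measurable_torus2 R.
have i1 : m2.-integrable torus2 (EFin \o (fun=> M)).
  by apply: (@bounded_torus_integrable _ `|M|); [exact: measurable_cst|].
have i2 : m2.-integrable torus2 (EFin \o F).
  by apply: (@bounded_torus_integrable _ M); [exact: measurable_plane|].
have i3 : m2.-integrable torus2 (EFin \o (fun z => F (z.1 + s, z.2 + t))).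
  apply: (@bounded_torus_integrable _ M); last by move=> z; exact: FM.
  apply: measurable_plane; exact: (measurableT_comp mF mshift).
move: key; rewrite RintegralD; [|exact: mT|exact: i3|exact: i1].
by rewrite RintegralD; [move=> /addIr|exact: mT|exact: i2|exact: i1].
Qed.

(** For p nonzero some translation by (s, t) changes the phase by exactly pi, hence the sign of the
    integrand, while it preserves the integral. *)
Lemma Rintegral_torus2_trig (p : int * int) :
  Rintegral m2 torus2 (fun z => cos (phase p z)) = 4 * pi ^+ 2 * (p == (0, 0))%:R /\
  Rintegral m2 torus2 (fun z => sin (phase p z)) = 0.
Proof.
have [->|p0] := eqVneq p (0, 0).
  rewrite (_ : (fun z => cos _) = (fun=> 1)); last first.
    by apply/funext => z; rewrite /phase/= !mul0r addr0 cos0.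
  rewrite (_ : (fun z => sin _) = (fun=> 0)); last first.
    by apply/funext => z; rewrite /phase/= !mul0r addr0 sin0.
  by rewrite !Rintegral_torus2_cst mulr0.
have [s [t [hs ht st]]] : exists s t : R, [/\ `|s| <= 2 * pi, `|t| <= 2 * pi &
    p.1%:~R * s + p.2%:~R * t = pi].
  have pi0 := @pi_ge0 R.
  have hq (j : int) : j != 0 -> `|pi / j%:~R| <= 2 * pi :> R /\ j%:~R * (pi / j%:~R) = pi :> R.
    move=> j0; have j1 : 1 <= `|j%:~R| :> R.
      by rewrite -intr_norm -[1]/(1%:~R) ler_int -gtz0_ge1 normr_gt0.
    split; last by rewrite mulrCA mulfV ?mulr1// intr_eq0.
    rewrite normrM normfV (ger0_norm pi0); apply: (@le_trans _ _ (pi * 1)).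
      by rewrite ler_wpM2l// invf_le1// (lt_le_trans ltr01).
    by rewrite mulr1; lra.
  have [p1|p1] := eqVneq p.1 0.
    have p2 : p.2 != 0 by apply: contra p0 => /eqP p2; rewrite (surjective_pairing p) p1 p2.
    have [h1 h2] := hq _ p2; exists 0, (pi / p.2%:~R); split => //.
      by rewrite normr0; lra.
    by rewrite mulr0 add0r.
  have [h1 h2] := hq _ p1; exists (pi / p.1%:~R), 0; split => //.
    by rewrite normr0; lra.
  by rewrite mulr0 addr0.
have b1 (f : R -> R) (z : R * R) : (forall x, `|f x| <= 1) -> `|f (phase p z)| <= 1 by move=> ->.
have shifted (f : R -> R) : measurable_fun [set: R] f -> (forall x, `|f x| <= 1) ->
    (forall x, f (x + pi) = - f x) -> (forall (j : int) x, f (x + j%:~R * (2 * pi)) = f x) ->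
    Rintegral m2 torus2 (fun z => f (phase p z)) = 0.
  move=> mf f1 fpi fper.
  have mF : measurable_fun [set: RR] (fun z : RR => f (phase p z)).
    by apply: (measurableT_comp mf); exact: measurable_phase.
  have per1 (x y : R) : f (phase p (x + 2 * pi, y)) = f (phase p (x, y)).
    by rewrite -[RHS](fper p.1); congr f; rewrite /phase/=; ring.
  have per2 (x y : R) : f (phase p (x, y + 2 * pi)) = f (phase p (x, y)).
    by rewrite -[RHS](fper p.2); congr f; rewrite /phase/=; ring.
  have := @Rintegral_torus2_shift (fun z => f (phase p z)) 1 s t mF (fun z => f1 _) per1 per2 hs ht.
  rewrite (_ : (fun z => f (phase p (z.1 + s, z.2 + t))) = (fun z => -1 * f (phase p z))); last first.
    apply/funext => z; rewrite mulN1r -fpi -st; congr f; rewrite /phase/=; ring.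
  rewrite RintegralZl; [move=> h; lra|exact: measurable_torus2|].
  by apply: (@bounded_torus_integrable _ 1); [exact: measurable_plane|move=> z; exact: f1].
rewrite mulr0; split; apply: shifted.
- exact: measurable_cos.
- by move=> x; rewrite ler_norml cos_geN1 cos_le1.
- by move=> x; rewrite cosDpi.
- by move=> j x; rewrite cosD_int2pi.
- exact: measurable_sin.
- by move=> x; rewrite ler_norml sin_geN1 sin_le1.
- by move=> x; rewrite sinDpi.
- by move=> j x; rewrite sinD_int2pi.
Qed.

End TorusOrthogonality.

(** * Fejer means of integrable functions and their conjugates *)

Section FejerMeans.
Context {R : realType}.
Local Notation mu := (@lebesgue_measure R).
Local Notation m2 := (@lebesgue_measure2 R).
Local Notation RR := (measurableTypeR R * measurableTypeR R)%type.
Local Notation plane := (caratheodory_type ((@lebesgue_measure R \x @lebesgue_measure R)%E^*)%mu).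
Implicit Types (h f k : R * R -> R) (p : int * int).

Let mT := @measurable_torus2 R.

(** These coefficients are summed over a symmetric box containing both p and -p, hence without the
    factor 2 of real Fourier series. *)
Definition rcos h p : R := (4 * pi ^+ 2)^-1 * Rintegral m2 torus2 (fun w => h w * cos (phase p w)).
Definition rsin h p : R := (4 * pi ^+ 2)^-1 * Rintegral m2 torus2 (fun w => h w * sin (phase p w)).

Definition fcos h N p : R := fmult N p * rcos h p.
Definition fsin h N p : R := fmult N p * rsin h p.
Definition fejer h N z : R := tp (box N) (fcos h N) (fsin h N) (fun=> 1) z.

Lemma mul_bounded_integrable h k (M : R) : m2.-integrable torus2 (EFin \o h) ->
  measurable_fun [set: RR] (k : RR -> R) -> (forall z, `|k z| <= M) ->
  m2.-integrable torus2 (EFin \o (fun z => h z * k z)).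
Proof.
move=> hi mk kM.
have M0 : 0 <= M by exact: le_trans (kM (0, 0)).
have mh : measurable_fun (torus2 : set plane) h by apply/measurable_EFinP; exact: measurable_int hi.
have hi' : m2.-integrable torus2 (EFin \o (fun z => M * h z)).
  by have := integrableZl mT M hi; apply: eq_integrable => //; exact: mT.
apply: (le_integrable mT _ _ hi').
  by apply/measurable_EFinP; apply: measurable_funM; [exact: mh|exact: measurable_plane].
by move=> z _ /=; rewrite lee_fin !normrM (ger0_norm M0) mulrC ler_wpM2r.
Qed.

Lemma measurable_cos_phase p : measurable_fun [set: RR] (fun z : RR => cos (phase p z) : R).
Proof. apply: (measurableT_comp (@measurable_cos R)); exact: measurable_phase. Qed.

Lemma measurable_sin_phase p : measurable_fun [set: RR] (fun z : RR => sin (phase p z) : R).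
Proof. apply: (measurableT_comp (@measurable_sin R)); exact: measurable_phase. Qed.

Let cos1 (x : R) : `|cos x| <= 1. Proof. by rewrite ler_norml cos_geN1 cos_le1. Qed.
Let sin1 (x : R) : `|sin x| <= 1. Proof. by rewrite ler_norml sin_geN1 sin_le1. Qed.

Lemma mul_cos_integrable h p : m2.-integrable torus2 (EFin \o h) ->
  m2.-integrable torus2 (EFin \o (fun w => h w * cos (phase p w))).
Proof. by move=> hi; apply: (mul_bounded_integrable hi (measurable_cos_phase p) (M := 1)). Qed.

Lemma mul_sin_integrable h p : m2.-integrable torus2 (EFin \o h) ->
  m2.-integrable torus2 (EFin \o (fun w => h w * sin (phase p w))).
Proof. by move=> hi; apply: (mul_bounded_integrable hi (measurable_sin_phase p) (M := 1)). Qed.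

Lemma Rintegral_mul_tp h (s : seq (int * int)) (a b m : int * int -> R) :
  m2.-integrable torus2 (EFin \o h) ->
  Rintegral m2 torus2 (fun w => h w * tp s a b m w) =
  4 * pi ^+ 2 * \sum_(p <- s) m p * (a p * rcos h p + b p * rsin h p).
Proof.
move=> hi; have q0 : 4 * pi ^+ 2 != 0 :> R.
  by rewrite mulf_neq0// expf_neq0// gt_eqF// pi_gt0.
transitivity (Rintegral m2 torus2 (fun w => \sum_(p <- s)
    (m p * a p * (h w * cos (phase p w)) + m p * b p * (h w * sin (phase p w))))).
  by apply: eq_Rintegral => w _; rewrite /tp mulr_sumr; apply: eq_bigr => p _; ring.
have ic p (c : R) : m2.-integrable torus2 (EFin \o (fun w => c * (h w * cos (phase p w)))).
  by have := integrableZl mT c (mul_cos_integrable p hi); apply: eq_integrable => //; exact: mT.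
have is' p (c : R) : m2.-integrable torus2 (EFin \o (fun w => c * (h w * sin (phase p w)))).
  by have := integrableZl mT c (mul_sin_integrable p hi); apply: eq_integrable => //; exact: mT.
rewrite Rintegral_fsum; [|exact: mT|]; last first.
  move=> p; have := integrableD mT (ic p (m p * a p)) (is' p (m p * b p)).
  by apply: eq_integrable => //; exact: mT.
rewrite mulr_sumr; apply: eq_bigr => p _.
rewrite RintegralD; [|exact: mT|exact: ic|exact: is'].
rewrite RintegralZl; [|exact: mT|exact: mul_cos_integrable].
rewrite RintegralZl; [|exact: mT|exact: mul_sin_integrable].
rewrite /rcos /rsin; move: (Rintegral _ _ _) (Rintegral _ _ _) (4 * pi ^+ 2) q0 => x y q q0.
by field.
Qed.

Lemma fejer_kernelE h N z : m2.-integrable torus2 (EFin \o h) ->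
  fejer h N z = (4 * pi ^+ 2)^-1 *
    Rintegral m2 torus2 (fun w => h w * fejer_kernel N (z.1 - w.1, z.2 - w.2)).
Proof.
move=> hi; have q0 : 4 * pi ^+ 2 != 0 :> R.
  by rewrite mulf_neq0// expf_neq0// gt_eqF// pi_gt0.
have -> : (fun w : R * R => h w * fejer_kernel N (z.1 - w.1, z.2 - w.2)) =
    (fun w => h w * tp (box N) (fun p => cos (phase p z)) (fun p => sin (phase p z)) (fmult N) w).
  apply/funext => w; congr (_ * _); apply: eq_bigr => p _; congr (_ * _).
  rewrite (_ : phase p (z.1 - w.1, z.2 - w.2) = phase p z - phase p w) ?cosB//.
  by rewrite /phase/=; ring.
rewrite Rintegral_mul_tp// mulrA mulVf// mul1r /fejer /tp; apply: eq_bigr => p _.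
by rewrite /fcos /fsin; ring.
Qed.

Lemma fejer_kernel_bounded N : exists M, forall u : R * R, `|fejer_kernel N u| <= M.
Proof.
exists (\sum_(p <- box N) `|fmult N p|) => u.
apply: le_trans (ler_norm_sum _ _ _) _; apply: ler_sum => p _.
by rewrite normrM ler_piMr.
Qed.

Lemma measurable_fejer_kernel N (z : R * R) :
  measurable_fun [set: RR] (fun w : RR => fejer_kernel N (z.1 - w.1, z.2 - w.2)).
Proof.
apply: measurable_sum => p; apply: measurable_funM => //.
apply: (measurableT_comp (@measurable_cos R)).
have -> : (fun w : RR => phase p (z.1 - w.1, z.2 - w.2)) = (fun w => phase p z - phase p w).
  by apply/funext => w; rewrite /phase/=; ring.
by apply: measurable_funB => //; exact: measurable_phase.
Qed.

Lemma le_fejer h k N z : m2.-integrable torus2 (EFin \o h) -> m2.-integrable torus2 (EFin \o k) ->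
  (forall w, h w <= k w) -> fejer h N z <= fejer k N z.
Proof.
move=> hi ki hk; have [M hM] := fejer_kernel_bounded N.
rewrite !fejer_kernelE// ler_wpM2l ?invr_ge0 ?mulr_ge0 ?exprn_ge0 ?pi_ge0//.
apply: le_Rintegral; first exact: mT.
- by apply: (mul_bounded_integrable hi (measurable_fejer_kernel N z) (M := M)) => w; exact: hM.
- by apply: (mul_bounded_integrable ki (measurable_fejer_kernel N z) (M := M)) => w; exact: hM.
- by move=> w _; rewrite ler_wpM2r// fejer_kernel_ge0.
Qed.

Lemma abs_integrable h : m2.-integrable torus2 (EFin \o h) ->
  m2.-integrable torus2 (EFin \o (fun z => `|h z|)).
Proof. by move=> hi; have := integrable_abse hi. Qed.

Lemma fejerN h N z : m2.-integrable torus2 (EFin \o h) ->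
  fejer (fun w => - h w) N z = - fejer h N z.
Proof.
move=> hi; have [M hM] := fejer_kernel_bounded N.
have hi' : m2.-integrable torus2 (EFin \o (fun w => - h w)).
  by have := integrableN hi; apply: eq_integrable => //; exact: mT.
rewrite !fejer_kernelE// -mulrN; congr (_ * _).
rewrite -[RHS]mulN1r -RintegralZl; last 2 first.
- exact: mT.
- by apply: (mul_bounded_integrable hi (measurable_fejer_kernel N z) (M := M)) => w; exact: hM.
by apply: eq_Rintegral => w _; ring.
Qed.

Lemma normr_fejer_le h k N z : m2.-integrable torus2 (EFin \o h) ->
  m2.-integrable torus2 (EFin \o k) -> (forall w, `|h w| <= k w) -> `|fejer h N z| <= fejer k N z.
Proof.
move=> hi ki hk.
have hi' : m2.-integrable torus2 (EFin \o (fun w => - h w)).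
  by have := integrableN hi; apply: eq_integrable => //; exact: mT.
rewrite ler_norml; apply/andP; split.
  rewrite lerNl -fejerN//; apply: le_fejer => // w.
  by apply: le_trans (hk w); rewrite -normrN ler_norm.
by apply: le_fejer => // w; apply: le_trans (hk w); rewrite ler_norm.
Qed.

Lemma fweight0 N : fweight N 0 = 1 :> R.
Proof. by rewrite /fweight absz0 subn0 mulfV. Qed.

Lemma cst_integrable (c : R) : m2.-integrable torus2 (EFin \o (fun=> c)).
Proof. by apply: (@bounded_torus_integrable _ _ `|c|); [exact: measurable_cst|]. Qed.

Lemma big_box_delta N (F : int * int -> R) :
  \sum_(p <- box N) F p * (p == (0, 0))%:R = F (0, 0).
Proof.
have d (G : int -> R) : \sum_(0 <= i < N.*2.+1) G (i%:Z - N%:Z) * (i%:Z - N%:Z == 0)%:R = G 0.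
  rewrite (sum_centered_sym (fun j => G j * (j == 0)%:R)) eqxx mulr1 !big1 ?addr0// => k _.
    by rewrite (_ : (- k.+1%:Z == 0) = false)// mulr0.
  by rewrite mulr0.
rewrite big_box -[RHS](d (fun j => F (j, 0))); apply: eq_bigr => i _.
rewrite -[F _](d (fun j => F (i%:Z - N%:Z, j))) mulr_suml; apply: eq_bigr => k _.
by rewrite xpair_eqE -mulnb natrM mulrA mulrAC.
Qed.

Lemma fejer_cst N z : fejer (fun=> 1) N z = 1.
Proof.
have q0 : 4 * pi ^+ 2 != 0 :> R.
  by rewrite mulf_neq0// expf_neq0// gt_eqF// pi_gt0.
rewrite -[RHS](_ : fmult N (0, 0) * cos (phase (0, 0) z) = _); last first.
  by rewrite /fmult !fweight0 /phase !mul0r addr0 cos0 !mulr1.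
rewrite -(big_box_delta N (fun p => fmult N p * cos (phase p z))) /fejer /tp.
apply: eq_bigr => p _; have [h1 h2] := @Rintegral_torus2_trig R p.
have -> : fcos (fun=> 1) N p = fmult N p * (p == (0, 0))%:R.
  rewrite /fcos /rcos (_ : (fun w => _) = (fun w => cos (phase p w))); last first.
    by apply/funext => w; rewrite mul1r.
  by rewrite h1 mulKf.
have -> : fsin (fun=> 1) N p = 0.
  rewrite /fsin /rsin (_ : (fun w => _) = (fun w => sin (phase p w))); last first.
    by apply/funext => w; rewrite mul1r.
  by rewrite h2 !mulr0.
by rewrite mul0r addr0 mul1r mulrAC.
Qed.

Lemma normr_fejer_le1 s N z : measurable_fun (torus2 : set plane) (s : plane -> R) ->
  (forall w, `|s w| <= 1) -> `|fejer s N z| <= 1.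
Proof.
move=> ms s1; rewrite -[leRHS](fejer_cst N z); apply: normr_fejer_le => //.
  exact: (bounded_torus_integrable ms s1).
exact: cst_integrable.
Qed.

Lemma tp_integrable (s : seq (int * int)) (a b m : int * int -> R) :
  m2.-integrable torus2 (EFin \o tp s a b m).
Proof.
apply: (@bounded_torus_integrable _ _ (line_bound s a b m)).
  by apply: measurable_plane; exact: measurable_tp.
by move=> z; exact: normr_tp_le.
Qed.

Lemma Rintegral_tp_box N (a b m : int * int -> R) :
  Rintegral m2 torus2 (tp (box N) a b m) = 4 * pi ^+ 2 * (m (0, 0) * a (0, 0)).
Proof.
rewrite (_ : tp (box N) a b m = (fun w => 1 * tp (box N) a b m w)); last first.
  by apply/funext => w; rewrite mul1r.
rewrite Rintegral_mul_tp; last exact: cst_integrable.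
rewrite -(big_box_delta N (fun p => m p * a p)); congr (_ * _); apply: eq_bigr => p _.
have [h1 h2] := @Rintegral_torus2_trig R p.
have q0 : 4 * pi ^+ 2 != 0 :> R.
  by rewrite mulf_neq0// expf_neq0// gt_eqF// pi_gt0.
have -> : rcos (fun=> 1) p = (p == (0, 0))%:R.
  rewrite /rcos (_ : (fun w => _) = (fun w => cos (phase p w))); last first.
    by apply/funext => w; rewrite mul1r.
  by rewrite h1 mulKf.
have -> : rsin (fun=> 1) p = 0.
  rewrite /rsin (_ : (fun w => _) = (fun w => sin (phase p w))); last first.
    by apply/funext => w; rewrite mul1r.
  by rewrite h2 mulr0.
by rewrite mulr0 addr0 mulrA.
Qed.

Lemma Rintegral_fejer h N : m2.-integrable torus2 (EFin \o h) ->
  Rintegral m2 torus2 (fejer h N) = Rintegral m2 torus2 h.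
Proof.
move=> hi; rewrite (Rintegral_tp_box N (fcos h N) (fsin h N) (fun=> 1)) mul1r.
have q0 : 4 * pi ^+ 2 != 0 :> R.
  by rewrite mulf_neq0// expf_neq0// gt_eqF// pi_gt0.
rewrite /fcos /fmult !fweight0 !mul1r /rcos mulVKf//.
by apply: eq_Rintegral => w _; rewrite /phase/= !mul0r addr0 cos0 mulr1.
Qed.

(* The half-plane conjugation is skew-adjoint; with [k] the sign of the conjugate of
   [h], this reduces its L log L to L^1 bound to bounded functions. *)
Lemma conj_half_fejer_duality h k N (e : int) :
  m2.-integrable torus2 (EFin \o h) -> m2.-integrable torus2 (EFin \o k) ->
  Rintegral m2 torus2 (fun w => k w * conj_half (box N) (fcos h N) (fsin h N) e w) =
  - Rintegral m2 torus2 (fun w => h w * conj_half (box N) (fcos k N) (fsin k N) e w).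
Proof.
move=> hi ki; rewrite /conj_half !Rintegral_mul_tp// -mulrN -sumrN; congr (_ * _).
by apply: eq_bigr => p _; rewrite /fcos /fsin; ring.
Qed.

(** Convex duality of v ln v - v and exp w gives v w <= v ln v - v + exp w. If v <= 1 the logarithm
    is negative and is replaced by 0; if v > 1 the term -v is dropped. *)
Lemma young_exp (v w : R) : 0 <= v -> v * w <= v * logp v + expR w.
Proof.
rewrite le_eqVlt => /predU1P[<-|v0]; first by rewrite !mul0r add0r expR_ge0.
have h : v * w <= v * ln v - v + expR w.
  have := expR_ge1Dx (w - ln v); rewrite expRB lnK ?posrE// ler_pdivlMr// => h.
  by rewrite -subr_ge0; nra.
apply: (le_trans h); rewrite lerD2r /logp; case: ltP => v1; first by rewrite lerBlDr lerDl ltW.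
have : v * ln v <= 0 by rewrite pmulr_rle0// ln_le0.
by rewrite mulr0; lra.
Qed.

Lemma logpE (u : R) : logp u = ln (Num.max u 1).
Proof. by rewrite /logp; case: ltP => // _; rewrite ln1. Qed.

Lemma logp_ge0 (u : R) : 0 <= logp u.
Proof. by rewrite logpE ln_ge0// le_max lexx orbT. Qed.

Lemma measurable_logp : measurable_fun [set: R] (@logp R).
Proof.
rewrite (_ : @logp R = (fun u => ln (Num.max u 1))); last by apply/funext => u; exact: logpE.
apply: (measurableT_comp (@measurable_ln R)).
by apply: measurable_maxr.
Qed.

(** The parameter K divides the additive constant produced by Young's inequality. The summand 1
    makes the size control the L^1 norm as well. *)
Definition LlogL_size (K : R) h : \bar R :=
  \int[m2]_(z in torus2) (`|h z| * (1 + logp (K * `|h z|)))%:E.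

(** With s the sign of the conjugate, duality moves the conjugation onto the Fejer mean of s, which
    is bounded by 1 and so has an exponentially integrable conjugate W. Young's inequality for K |h|
    and |W|, divided by K, gives the two terms. *)
Lemma normr_conj_half_fejer_le h N (e : int) (K : R) : 0 < K -> `|e%:~R| <= 1 :> R ->
  m2.-integrable torus2 (EFin \o h) ->
  (\int[m2]_(z in torus2) (`|conj_half (box N) (fcos h N) (fsin h N) e z|)%:E <=
   \int[m2]_(z in torus2) (`|h z| * logp (K * `|h z|))%:E + (8 * pi ^+ 2 / cos 1 / K)%:E)%E.
Proof.
move=> K0 e1 hi; pose G := conj_half (box N) (fcos h N) (fsin h N) e.
have mh : measurable_fun (torus2 : set plane) h by apply/measurable_EFinP; exact: measurable_int hi.
have mG : measurable_fun [set: RR] (G : RR -> R) by exact: measurable_conj_half.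
pose s := fun z : R * R => if 0 <= G z then 1 else -1 : R.
have ms : measurable_fun [set: RR] (s : RR -> R).
  by apply: measurable_fun_ifT => //; apply: measurable_fun_ler => //; exact: measurable_cst.
have s1 z : `|s z| <= 1 by rewrite /s; case: ifP; rewrite ?normrN normr1.
have si : m2.-integrable torus2 (EFin \o s).
  exact: (bounded_torus_integrable (measurable_plane ms) s1).
pose W := conj_half (box N) (fcos s N) (fsin s N) e.
have mW : measurable_fun [set: RR] (W : RR -> R) by exact: measurable_conj_half.
have GE z : `|G z| = s z * G z.
  rewrite /s; case: ifPn => [/ger0_norm ->|]; first by rewrite mul1r.
  by rewrite -ltNge => /ltr0_norm ->; rewrite mulN1r.
have EFinR (F : R * R -> R) : m2.-integrable torus2 (EFin \o F) ->
    (\int[m2]_(z in torus2) (F z)%:E = (Rintegral m2 torus2 F)%:E)%E.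
  by move=> Fi; rewrite /Rintegral fineK//; apply: integrable_fin_num; [exact: mT|exact: Fi].
have Gi : m2.-integrable torus2 (EFin \o (fun z => `|G z|)) by apply: abs_integrable; exact: tp_integrable.
have hWi : m2.-integrable torus2 (EFin \o (fun z => h z * W z)).
  apply: (mul_bounded_integrable hi mW) => z; exact: normr_tp_le.
rewrite (EFinR _ Gi) (_ : Rintegral _ _ _ = Rintegral m2 torus2 (fun z => s z * G z)); last first.
  by apply: eq_Rintegral => z _; exact: GE.
rewrite conj_half_fejer_duality//.
apply: (@le_trans _ _ (\int[m2]_(z in torus2) (`|h z * W z|)%:E)%E).
  rewrite (EFinR _ (abs_integrable hWi)) lee_fin.
  apply: le_trans (le_normr_Rintegral _ hWi); last exact: mT.
  by rewrite -normrN ler_norm.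
have mL : measurable_fun (torus2 : set plane) (fun z : plane => `|h z| * logp (K * `|h z|)).
  apply: measurable_funM; first exact: measurableT_comp.
  apply: (measurableT_comp measurable_logp); apply: measurable_funM; first exact: measurable_cst.
  exact: measurableT_comp.
have mE : measurable_fun [set: RR] (fun z : RR => K^-1 * expR `|W z| : R).
  apply: measurable_funM; first exact: measurable_cst.
  by apply: measurableT_comp => //; exact: measurableT_comp.
have mE' := measurable_plane mE.
apply: (@le_trans _ _ (\int[m2]_(z in torus2) (`|h z| * logp (K * `|h z|) + K^-1 * expR `|W z|)%:E)%E).
  apply: ge0_le_intR; first exact: mT.
  - by apply/measurable_EFinP; exact: measurable_int (abs_integrable hWi).
  - apply: measurable_funD; [exact: mL|exact: mE'].
  - by move=> z _; exact: normr_ge0.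
  - move=> z _; rewrite normrM.
    have := @young_exp (K * `|h z|) `|W z| _; rewrite mulr_ge0 ?(ltW K0)// => /(_ isT) h1.
    rewrite -(ler_pM2l K0) mulrDr !mulrA mulfV ?gt_eqF// mul1r.
    exact: h1.
rewrite ge0_intRD; [|exact: mT|exact: mL|exact: mE'|by move=> z _; rewrite mulr_ge0// logp_ge0|
  by move=> z _; rewrite mulr_ge0 ?expR_ge0// invr_ge0 ltW].
rewrite leeD2l// ge0_intRZ; [|exact: mT| |by move=> z _; exact: expR_ge0|by rewrite invr_ge0 ltW].
  rewrite mulrC EFinM; apply: lee_wpmul2l; first by rewrite lee_fin invr_ge0 ltW.
  apply: integral_exp_abs_conj_half_le => // z.
  exact: (normr_fejer_le1 N z (measurable_plane ms) s1).
by apply: measurable_plane; apply: measurableT_comp => //; exact: measurableT_comp.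
Qed.

(** The majorant of the Fejer mean of h is the Fejer mean of |h|, which has the same frequencies and
    the same integral as |h|. The two conjugates have equal bounds, hence 420 = 2 * 210, and 32 <=
    420 takes care of the radial term. *)
Lemma fejer_square_sums_weak h N (K lam : R) : 0 < K -> 0 < lam ->
  m2.-integrable torus2 (EFin \o h) ->
  exists E : set (R * R), [/\ measurable (E : set RR), E `<=` torus2,
   (m2 E <= (420 / lam)%:E * (LlogL_size K h + (8 * pi ^+ 2 / cos 1 / K)%:E))%E &
   forall z, torus2 z -> ~ E z -> forall i,
     \sum_(0 <= n < 2 ^ i) expR (`|tp (box N) (fcos h N) (fsin h N) (square_mult n) z| /
       (8 * (exp_const * lam))) <= 2 ^+ i * 24].
Proof.
move=> K0 l0 hi.
pose g z := `|h z|.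
have gi : m2.-integrable torus2 (EFin \o g) by exact: abs_integrable.
have maj z : `|tp (box N) (fcos h N) (fsin h N) (fun=> 1) z| <=
    tp (box N) (fcos g N) (fsin g N) (fun=> 1) z by exact: normr_fejer_le.
have [E [mE ET mE1 hE]] := square_sums_weak l0 maj.
exists E; split => //; last by move=> z zT zE i; rewrite -natrX; exact: hE.
apply: (le_trans mE1).
set I1 := (\int[m2]_(z in torus2) _)%E; set I2 := (\int[m2]_(z in torus2) _)%E.
set I3 := (\int[m2]_(z in torus2) _)%E.
set C := (8 * pi ^+ 2 / cos 1 / K).
have mh : measurable_fun (torus2 : set plane) h by apply/measurable_EFinP; exact: measurable_int hi.
have mg : measurable_fun (torus2 : set plane) (g : plane -> R).
  by apply/measurable_EFinP; exact: measurable_int gi.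
pose L := (\int[m2]_(z in torus2) (g z * logp (K * g z))%:E)%E.
have mL : measurable_fun (torus2 : set plane) (fun z : plane => g z * logp (K * g z)).
  apply: measurable_funM; first exact: mg.
  by apply: (measurableT_comp measurable_logp); apply: measurable_funM; [exact: measurable_cst|exact: mg].
have L0 : (0 <= L)%E.
  by apply: integral_ge0 => z _; rewrite lee_fin mulr_ge0 ?normr_ge0// logp_ge0.
have C0 : 0 <= C.
  rewrite /C !mulr_ge0 ?exprn_ge0 ?pi_ge0 ?invr_ge0 ?(ltW K0)//.
  by apply: ltW; exact: cos1_gt0.
have h1 : (I1 <= L + C%:E)%E by apply: normr_conj_half_fejer_le; rewrite ?normr1.
have h2 : (I2 <= L + C%:E)%E by apply: normr_conj_half_fejer_le; rewrite ?normrN ?normr1.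
have sE : LlogL_size K h = (\int[m2]_(z in torus2) (g z)%:E + L)%E.
  rewrite /LlogL_size -ge0_intRD; [|exact: mT|exact: mg|exact: mL| |].
  - by apply: eq_integral => z _; rewrite mulrDr mulr1.
  - by move=> z _; exact: normr_ge0.
  - by move=> z _; rewrite mulr_ge0 ?normr_ge0// logp_ge0.
have EFinR (F : R * R -> R) : m2.-integrable torus2 (EFin \o F) ->
    (\int[m2]_(z in torus2) (F z)%:E = (Rintegral m2 torus2 F)%:E)%E.
  by move=> Fi; rewrite /Rintegral fineK//; apply: integrable_fin_num; [exact: mT|exact: Fi].
have h3 : I3 = (\int[m2]_(z in torus2) (g z)%:E)%E.
  rewrite (EFinR _ gi) -(Rintegral_fejer N gi) -EFinR//; exact: tp_integrable.
rewrite sE -h3.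
have I30 : (0 <= I3)%E by rewrite h3; apply: integral_ge0 => z _; rewrite lee_fin normr_ge0.
have r0 (x : R) : 0 <= x -> 0 <= x / lam by move=> x0; rewrite divr_ge0// ltW.
have LC0 : (0 <= L + C%:E)%E by apply: adde_ge0; [exact: L0|rewrite lee_fin].
rewrite -(addeA I3 L C%:E) (ge0_muleDr (420 / lam)%:E I30 LC0).
rewrite [X in (X <= _)%E]addeC; apply: leeD.
  by rewrite lee_wpmul2r// lee_fin ler_pM2r ?invr_gt0// ler_nat.
apply: (@le_trans _ _ ((210 / lam)%:E * ((L + C%:E) + (L + C%:E)))%E).
  by rewrite lee_wpmul2l ?lee_fin ?r0//; exact: leeD.
rewrite (_ : 420 / lam = 210 / lam * 2); last by field; rewrite gt_eqF.
by rewrite [X in (_ <= X * _)%E]EFinM -[X in (_ <= X)%E]muleA mule_natl mule2n.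
Qed.
End FejerMeans.

(** * Weak type bound for partial sums *)

Section PartialSumsWeak.
Context {R : realType}.
Local Notation m2 := (@lebesgue_measure2 R).
Local Notation RR := (measurableTypeR R * measurableTypeR R)%type.
Implicit Types (h : R * R -> R).

Definition rsum h n z : R := tp (box n) (rcos h) (rsin h) (fun=> 1) z.

Lemma cvg_sum_seq (I : eqType) (s : seq I) (F : nat -> I -> R) (l : I -> R) :
  (forall p, F N p @[N --> \oo] --> l p) ->
  (\sum_(p <- s) F N p) @[N --> \oo] --> \sum_(p <- s) l p.
Proof.
move=> Fl; elim: s => [|p s IH].
  by rewrite big_nil; under eq_fun do rewrite big_nil; exact: cvg_cst.
by rewrite big_cons; under eq_fun do rewrite big_cons; exact: cvgD.
Qed.

Lemma sum_square_mult (V : nmodType) (F : int * int -> V) n N : (n <= N)%N ->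
  \sum_(p <- box N) (if (maxn `|p.1| `|p.2| <= n)%N then F p else 0) = \sum_(p <- box n) F p.
Proof.
have h1 (G : int -> V) M : (n <= M)%N ->
    \sum_(0 <= i < M.*2.+1) (if (`|(i%:Z - M%:Z)%R| <= n)%N then G (i%:Z - M%:Z) else 0) =
    \sum_(0 <= i < n.*2.+1) G (i%:Z - n%:Z).
  elim: M => [|M IH] nM.
    have -> : n = 0%N by lia.
    by rewrite !big_nat1.
  have [->|n1] := eqVneq n M.+1.
    by apply: eq_big_nat => i iM; rewrite ifT//; lia.
  rewrite (sum_centered_recr (fun j => if (`|j| <= n)%N then G j else 0)).
  rewrite IH; last by lia.
  by rewrite !ifF ?add0r ?addr0//; apply/negbTE; lia.
move=> nN; rewrite !big_box -(h1 (fun j => \sum_(0 <= k < n.*2.+1) F (j, k%:Z - n%:Z)) _ nN).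
apply: eq_bigr => i _; rewrite -(h1 (fun k => F (i%:Z - N%:Z, k)) _ nN).
case: ifP => iN; last first.
  by rewrite big1// => k _; rewrite ifF// geq_max iN.
by apply: eq_bigr => k _; rewrite geq_max iN.
Qed.

Lemma cvg_fweight (j : int) : fweight N j @[N --> \oo] --> (1 : R).
Proof.
have h : (1 - `|j|%:R * N.+1%:R^-1) @[N --> \oo] --> (1 - `|j|%:R * 0 : R).
  by apply: cvgB; [exact: cvg_cst|apply: cvgMr; exact: cvg_harmonic].
rewrite mulr0 subr0 in h; apply: cvg_trans h; apply: near_eq_cvg.
exists `|j|%N => // N /= jN.
by rewrite /fweight natrB ?(leq_trans jN)// mulrBl mulfV.
Qed.

Lemma cvg_fejer_square h n z :
  tp (box N) (fcos h N) (fsin h N) (square_mult n) z @[N --> \oo] --> rsum h n z.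
Proof.
have hl : (\sum_(p <- box n) fmult N p * (1 * (rcos h p * cos (phase p z) + rsin h p * sin (phase p z)))) @[N --> \oo] --> rsum h n z.
  rewrite /rsum /tp.
  apply: cvg_sum_seq => p.
  move: (1 * _) => c.
  have : (fmult N p * c) @[N --> \oo] --> (1 * 1) * c.
    by apply: cvgM; [apply: cvgM; exact: cvg_fweight|exact: cvg_cst].
  by rewrite !mul1r.
apply: cvg_trans hl; apply: near_eq_cvg; exists n => // N /= nN.
rewrite -(sum_square_mult _ nN) /tp; apply: eq_bigr => p _.
by rewrite /square_mult /fcos /fsin; case: ifP => _ /=; ring.
Qed.

(** The exceptional set is the lower limit of those of the Fejer means: each intersection over N >=
    M lies in the set of index M, so the increasing union obeys the same bound. A violation for the
    limit is strict, hence persists for all large N, and the point lies in the lower limit. *)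
Lemma rsum_weak h (K lam : R) : 0 < K -> 0 < lam ->
  m2.-integrable torus2 (EFin \o h) ->
  exists E : set (R * R), [/\ measurable (E : set RR), E `<=` torus2,
   (m2 E <= (420 / lam)%:E * (LlogL_size K h + (8 * pi ^+ 2 / cos 1 / K)%:E))%E &
   forall z, torus2 z -> ~ E z -> forall i,
     \sum_(0 <= n < 2 ^ i) expR (`|rsum h n z| / (8 * (exp_const * lam))) <= 2 ^+ i * 24].
Proof.
move=> K0 l0 hi.
have /choice[E hE] := fun N => fejer_square_sums_weak N K0 l0 hi.
pose F M := \bigcap_(N in [set N | (M <= N)%N]) E N.
have mF M : measurable (F M : set RR).
  apply: bigcap_measurable => [|N _]; first by exists M => /=.
  by have [? _ _ _] := hE N.
have mEN N : measurable (E N : set RR) by have [? _ _ _] := hE N.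
exists (\bigcup_M F M); split.
- by apply: bigcup_measurable => M _; exact: mF.
- move=> z [M _ FM]; have [_ ET _ _] := hE M; apply: ET; exact: (FM M (leqnn M)).
- apply: nondecreasing_bigcup_le => [M|n k nk z Fz N /= kN|M].
  + exact: borel_plane (mF M).
  + by apply: Fz => /=; exact: leq_trans kN.
  + have [_ _ EM _] := hE M; apply: le_trans EM.
    apply: le_measure; rewrite ?inE; [exact: borel_plane (mF M)|exact: borel_plane (mEN M)|].
    by move=> z; apply => /=.
- move=> z zT nz i; rewrite leNgt; apply/negP => h24.
  have lim : (\sum_(0 <= n < 2 ^ i) expR (`|tp (box N) (fcos h N) (fsin h N) (square_mult n) z| /
       (8 * (exp_const * lam)))) @[N --> \oo] -->
     \sum_(0 <= n < 2 ^ i) expR (`|rsum h n z| / (8 * (exp_const * lam))).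
    apply: (@cvg_sum_seq _ _
      (fun N n => expR (`|tp (box N) (fcos h N) (fsin h N) (square_mult n) z| / (8 * (exp_const * lam))))) => n.
    have hn : (`|tp (box N) (fcos h N) (fsin h N) (square_mult n) z| / (8 * (exp_const * lam)))
        @[N --> \oo] --> `|rsum h n z| / (8 * (exp_const * lam)).
      by apply: cvgMl; apply: cvg_norm; exact: cvg_fejer_square.
    exact: (cvg_comp _ _ hn (@continuous_expR R _)).
  have [M _ hM] := cvgr_gt _ lim _ h24.
  apply: nz; exists M => // N /= MN; apply: contrapT => nE.
  have [_ _ _ /(_ z zT nE i)] := hE N.
  by rewrite leNgt hM.
Qed.

End PartialSumsWeak.

(** * Approximation by trigonometric polynomials *)

Section TrigPolynomials.
Context {R : realType}.
Local Notation m2 := (@lebesgue_measure2 R).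
Local Notation RR := (measurableTypeR R * measurableTypeR R)%type.
Implicit Types (P Q : R * R -> R).

Inductive trigpoly : (R * R -> R) -> Prop :=
| trigpoly0 : trigpoly (fun=> 0)
| trigpoly_cons a b p P : trigpoly P ->
    trigpoly (fun z => a * cos (phase p z) + b * sin (phase p z) + P z).

Lemma trigpolyD P Q : trigpoly P -> trigpoly Q -> trigpoly (fun z => P z + Q z).
Proof.
move=> tP tQ; elim: tP => [|a b p P' _ IH].
  by rewrite (_ : (fun z => _) = Q)//; apply/funext => z; rewrite add0r.
rewrite (_ : (fun z => _) = (fun z => a * cos (phase p z) + b * sin (phase p z) + (P' z + Q z))).
  exact: trigpoly_cons.
by apply/funext => z; rewrite addrA.
Qed.

Lemma trigpoly_term a b p : trigpoly (fun z => a * cos (phase p z) + b * sin (phase p z)).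
Proof.
rewrite (_ : (fun z => _) = (fun z => a * cos (phase p z) + b * sin (phase p z) + 0)).
  by apply: trigpoly_cons; exact: trigpoly0.
by apply/funext => z; rewrite addr0.
Qed.

Lemma phaseB p q (z : R * R) : phase (p.1 - q.1, p.2 - q.2) z = phase p z - phase q z :> R.
Proof. by rewrite /phase/= !intrB; ring. Qed.

Lemma phaseD p q (z : R * R) : phase (p.1 + q.1, p.2 + q.2) z = phase p z + phase q z :> R.
Proof. by rewrite /phase/= !intrD; ring. Qed.

Lemma trigpolyM P Q : trigpoly P -> trigpoly Q -> trigpoly (fun z => P z * Q z).
Proof.
move=> tP tQ; elim: tP => [|a b p P' _ IH].
  by rewrite (_ : (fun z => _) = (fun=> 0)); [exact: trigpoly0|apply/funext => z; rewrite mul0r].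
rewrite (_ : (fun z => _) = (fun z => (a * cos (phase p z) + b * sin (phase p z)) * Q z + P' z * Q z)); last first.
  by apply/funext => z; rewrite mulrDl.
apply: trigpolyD => //; elim: tQ => [|c d q Q' _ IH'].
  by rewrite (_ : (fun z => _) = (fun=> 0)); [exact: trigpoly0|apply/funext => z; rewrite mulr0].
rewrite (_ : (fun z => _) = (fun z =>
    (1 / 2 * (a * c + b * d)) * cos (phase (p.1 - q.1, p.2 - q.2) z) +
    (1 / 2 * (b * c - a * d)) * sin (phase (p.1 - q.1, p.2 - q.2) z) +
   ((1 / 2 * (a * c - b * d)) * cos (phase (p.1 + q.1, p.2 + q.2) z) +
    (1 / 2 * (b * c + a * d)) * sin (phase (p.1 + q.1, p.2 + q.2) z) +
    (a * cos (phase p z) + b * sin (phase p z)) * Q' z))).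
  by do 2 apply: trigpoly_cons; exact: IH'.
apply/funext => z; rewrite phaseB phaseD cosB sinB cosD sinD.
move: (phase p z) (phase q z) => s t; by field.
Qed.

Lemma trigpoly_bounded P : trigpoly P -> exists2 M, 0 < M & forall z, `|P z| <= M.
Proof.
elim => [|a b p P' _ [M M0 hM]]; first by exists 1 => // z; rewrite normr0.
exists (`|a| + `|b| + M); first by rewrite ltr_wpDl// addr_ge0.
move=> z; rewrite (le_trans (ler_normD _ _))// lerD// (le_trans (ler_normD _ _))//.
rewrite !normrM; apply: lerD; apply: ler_piMr => //.
  by rewrite ler_norml cos_geN1 cos_le1.
by rewrite ler_norml sin_geN1 sin_le1.
Qed.

Lemma measurable_trigpoly P : trigpoly P -> measurable_fun [set: RR] (P : RR -> R).
Proof.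
elim => [|a b p P' _ IH]; first exact: measurable_cst.
apply: measurable_funD => //; apply: measurable_funD; apply: measurable_funM.
- exact: measurable_cst.
- exact: measurable_cos_phase.
- exact: measurable_cst.
- exact: measurable_sin_phase.
Qed.

End TrigPolynomials.

(** * The L log L size *)

Section OrliczSize.
Context {R : realType}.
Local Notation m2 := (@lebesgue_measure2 R).
Local Notation RR := (measurableTypeR R * measurableTypeR R)%type.
Local Notation plane := (caratheodory_type ((@lebesgue_measure R \x @lebesgue_measure R)%E^*)%mu).
Local Notation mT := (@measurable_torus2 R).
Implicit Types (f g h : R * R -> R) (K u v : R).

Definition orlicz K u : R := u * (1 + logp (K * u)).

Lemma logp_le u : 0 <= u -> logp u <= u.
Proof.
move=> u0; rewrite /logp; case: ltP => // u1; apply: ltW; apply: ln_sublinear.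
exact: lt_trans u1.
Qed.

Lemma ler_logp u v : u <= v -> logp u <= logp v.
Proof.
move=> uv; rewrite !logpE ler_ln ?posrE ?lt_max ?ltr01 ?orbT//.
by rewrite ge_max !le_max uv lexx orbT.
Qed.

Lemma orlicz_ge0 K u : 0 <= u -> 0 <= orlicz K u.
Proof. by move=> u0; rewrite mulr_ge0// addr_ge0// logp_ge0. Qed.

Lemma ler_orlicz K u v : 0 < K -> 0 <= u -> u <= v -> orlicz K u <= orlicz K v.
Proof.
move=> K0 u0 uv; apply: ler_pM => //; first by rewrite addr_ge0// logp_ge0.
by rewrite lerD2l ler_logp// ler_wpM2l// ltW.
Qed.

Lemma orlicz_le K u : 0 < K -> 0 <= u -> orlicz K u <= u * (1 + K * u).
Proof. by move=> K0 u0; rewrite ler_wpM2l// lerD2l logp_le// mulr_ge0// ltW. Qed.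

(** The larger of the two arguments bounds the sum by its double. The doubling is taken out as a
    factor and as a change of K, so no convexity of the size is used. *)
Lemma orliczD K u v : 0 < K -> 0 <= u -> 0 <= v ->
  orlicz K (u + v) <= 2 * orlicz (2 * K) u + 2 * orlicz (2 * K) v.
Proof.
move=> K0; wlog uv : u v / u <= v => [hw u0 v0|u0 v0].
  have [/hw|/ltW/hw] := leP u v; first exact.
  by move=> h; rewrite addrC [leRHS]addrC; exact: h.
apply: (@le_trans _ _ (orlicz K (2 * v))); first by apply: ler_orlicz => //; [exact: addr_ge0|lra].
rewrite (_ : orlicz K (2 * v) = 2 * orlicz (2 * K) v); last first.
  by rewrite /orlicz (_ : K * (2 * v) = 2 * K * v); ring.
by rewrite lerDr mulr_ge0// orlicz_ge0.
Qed.

Lemma measurable_orlicz K h : measurable_fun (torus2 : set plane) h ->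
  measurable_fun (torus2 : set plane) (fun z : plane => orlicz K `|h z|).
Proof.
move=> mh; have mn : measurable_fun (torus2 : set plane) (fun z : plane => `|h z|).
  exact: measurableT_comp.
apply: measurable_funM; first exact: mn.
apply: measurable_funD; first exact: measurable_cst.
by apply: (measurableT_comp measurable_logp); apply: measurable_funM; [exact: measurable_cst|exact: mn].
Qed.

Lemma LlogL_size_le K f g : 0 < K -> measurable_fun (torus2 : set plane) f ->
  measurable_fun (torus2 : set plane) g -> (forall z, torus2 z -> `|f z| <= `|g z|) ->
  (LlogL_size K f <= LlogL_size K g)%E.
Proof.
move=> K0 mf mg fg; apply: ge0_le_intR.
- exact: mT.
- exact: (measurable_orlicz K mf).
- exact: (measurable_orlicz K mg).
- by move=> z _; exact: orlicz_ge0.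
- by move=> z zT; apply: ler_orlicz => //; exact: fg.
Qed.

Lemma LlogL_sizeD K f g : 0 < K -> measurable_fun (torus2 : set plane) f ->
  measurable_fun (torus2 : set plane) g ->
  (LlogL_size K (fun z => f z + g z)%R <=
   2%:E * LlogL_size (2 * K)%R f + 2%:E * LlogL_size (2 * K)%R g)%E.
Proof.
move=> K0 mf mg; have K20 : 0 < 2 * K by rewrite mulr_gt0.
have mf' := measurable_orlicz (2 * K) mf; have mg' := measurable_orlicz (2 * K) mg.
have m2f : measurable_fun (torus2 : set plane) (fun z : plane => 2 * orlicz (2 * K) `|f z|).
  by apply: measurable_funM; [exact: measurable_cst|exact: mf'].
have m2g : measurable_fun (torus2 : set plane) (fun z : plane => 2 * orlicz (2 * K) `|g z|).
  by apply: measurable_funM; [exact: measurable_cst|exact: mg'].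
have z0 (h : R * R -> R) z : 0 <= 2 * orlicz (2 * K) `|h z| by rewrite mulr_ge0// orlicz_ge0.
rewrite /LlogL_size -!ge0_intRZ; [|exact: mT|exact: mg'|by move=> z _; exact: orlicz_ge0|by []|
  exact: mT|exact: mf'|by move=> z _; exact: orlicz_ge0|by []].
rewrite -ge0_intRD; [|exact: mT|exact: m2f|exact: m2g|by move=> z _; exact: z0|by move=> z _; exact: z0].
apply: ge0_le_intR.
- exact: mT.
- by apply: (measurable_orlicz K (h := fun z => f z + g z)); apply: measurable_funD; [exact: mf|exact: mg].
- by apply: measurable_funD; [exact: m2f|exact: m2g].
- by move=> z _; exact: orlicz_ge0.
- move=> z _; apply: (@le_trans _ _ (orlicz K (`|f z| + `|g z|))); last exact: orliczD.
  by apply: ler_orlicz => //; exact: ler_normD.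
Qed.

Lemma LlogL_sizeM K (M : R) f g : 0 < K -> 0 < M -> measurable_fun (torus2 : set plane) f ->
  measurable_fun (torus2 : set plane) g -> (forall z, `|g z| <= M) ->
  (LlogL_size K (fun z => g z * f z)%R <= M%:E * LlogL_size (K * M)%R f)%E.
Proof.
move=> K0 M0 mf mg gM; have mf' := measurable_orlicz (K * M) mf.
rewrite /LlogL_size -ge0_intRZ; [|exact: mT|exact: mf'|by move=> z _; exact: orlicz_ge0|exact: ltW].
apply: ge0_le_intR.
- exact: mT.
- by apply: (measurable_orlicz K (h := fun z => g z * f z)); apply: measurable_funM; [exact: mg|exact: mf].
- by apply: measurable_funM; [exact: measurable_cst|exact: mf'].
- by move=> z _; exact: orlicz_ge0.
- move=> z _; apply: (@le_trans _ _ (orlicz K (M * `|f z|))).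
    by apply: ler_orlicz => //; rewrite normrM ler_wpM2r.
  by rewrite /orlicz !mulrA.
Qed.

Lemma LlogL_size_cst K (c : R) : 0 < K -> (LlogL_size K (fun=> c) < +oo)%E.
Proof.
move=> K0; rewrite /LlogL_size integral_cst; last exact: mT.
by rewrite lte_mul_pinfty ?lee_fin ?orlicz_ge0//; exact: torus2_lty.
Qed.

End OrliczSize.

(** * Closure properties of approximable functions *)

Section Approximation.
Context {R : realType}.
Local Notation mu := (@lebesgue_measure R).
Local Notation m2 := (@lebesgue_measure2 R).
Local Notation RR := (measurableTypeR R * measurableTypeR R)%type.
Local Notation plane := (caratheodory_type ((@lebesgue_measure R \x @lebesgue_measure R)%E^*)%mu).
Local Notation mT := (@measurable_torus2 R).
Implicit Types (f g h : R * R -> R) (K e : R).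

(** Approximation is required for every K because sums and products change this parameter: the size
    is not homogeneous. *)
Definition approximable h : Prop := measurable_fun (torus2 : set plane) (h : plane -> R) /\
  forall K e, 0 < K -> 0 < e ->
    exists2 P, trigpoly P & (LlogL_size K (fun z => h z - P z)%R <= e%:E)%E.

Lemma trigpoly_measurable P : trigpoly P -> measurable_fun (torus2 : set plane) (P : plane -> R).
Proof. by move=> tP; apply: measurable_plane; exact: measurable_trigpoly. Qed.

Lemma LlogL_size0 K : LlogL_size K (fun=> 0 : R) = 0%E.
Proof.
rewrite /LlogL_size (eq_integral (fun=> 0%E)) ?integral0// => z _.
by rewrite normr0 mul0r.
Qed.

Lemma trigpoly_approximable P : trigpoly P -> approximable P.
Proof.
move=> tP; split; first exact: trigpoly_measurable.
move=> K e K0 e0; exists P => //.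
rewrite (_ : (fun z => _) = (fun=> 0)); last by apply/funext => z; rewrite subrr.
by rewrite LlogL_size0 lee_fin ltW.
Qed.

Let EFin_double (c d e : R) : e = 2 * c + 2 * d -> (e%:E = 2%:E * c%:E + 2%:E * d%:E)%E.
Proof. by move=> ->. Qed.

Lemma approximable_close h : measurable_fun (torus2 : set plane) (h : plane -> R) ->
  (forall K e, 0 < K -> 0 < e ->
    exists2 g, approximable g & (LlogL_size K (fun z => h z - g z)%R <= e%:E)%E) ->
  approximable h.
Proof.
move=> mh hh; split => // K e K0 e0.
have K20 : 0 < 2 * K by rewrite mulr_gt0.
have e40 : 0 < e / 4 by rewrite divr_gt0.
have [g [mg ag] hg] := hh _ _ K20 e40.
have [P tP gP] := ag _ _ K20 e40.
exists P => //; have mP := trigpoly_measurable tP.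
rewrite (_ : (fun z => _) = (fun z => (h z - g z) + (g z - P z))); last first.
  by apply/funext => z; rewrite addrA subrK.
apply: (le_trans (@LlogL_sizeD _ _ (fun z => h z - g z) (fun z => g z - P z) K0 _ _)).
- by apply: measurable_funB; [exact: mh|exact: mg].
- by apply: measurable_funB; [exact: mg|exact: mP].
- rewrite (@EFin_double (e / 4) (e / 4) e); last by field.
  by apply: leeD; apply: lee_wpmul2l.
Qed.

Lemma approximableD f g : approximable f -> approximable g -> approximable (fun z => f z + g z).
Proof.
move=> [mf af] [mg ag]; split; first by apply: measurable_funD; [exact: mf|exact: mg].
move=> K e K0 e0; have K20 : 0 < 2 * K by rewrite mulr_gt0.
have e40 : 0 < e / 4 by rewrite divr_gt0.
have [P tP fP] := af _ _ K20 e40; have [Q tQ gQ] := ag _ _ K20 e40.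
exists (fun z => P z + Q z); first exact: trigpolyD.
have mP := trigpoly_measurable tP; have mQ := trigpoly_measurable tQ.
rewrite (_ : (fun z => _) = (fun z => (f z - P z) + (g z - Q z))); last first.
  by apply/funext => z; ring.
apply: (le_trans (@LlogL_sizeD _ _ (fun z => f z - P z) (fun z => g z - Q z) K0 _ _)).
- by apply: measurable_funB; [exact: mf|exact: mP].
- by apply: measurable_funB; [exact: mg|exact: mQ].
- rewrite (@EFin_double (e / 4) (e / 4) e); last by field.
  by apply: leeD; apply: lee_wpmul2l.
Qed.

(** In f g - P Q = f (g - Q) + Q (f - P) the polynomial Q is chosen first. The precision and the
    parameter K demanded of P then depend on the bound of Q. *)
Lemma approximableM f g (M : R) : (forall z, `|f z| <= M) ->
  approximable f -> approximable g -> approximable (fun z => f z * g z).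
Proof.
wlog M0 : M / 0 < M => [hw fM|fM].
  have M1 : 0 <= M by exact: le_trans (fM (0, 0)).
  by apply: (hw (M + 1)); [rewrite ltr_wpDl|move=> z; rewrite (le_trans (fM z))// lerDl].
move=> [mf af] [mg ag]; split; first by apply: measurable_funM; [exact: mf|exact: mg].
move=> K e K0 e0; have K20 : 0 < 2 * K by rewrite mulr_gt0.
have eM (L : R) : 0 < L -> 0 < e / (4 * L) by move=> L0; rewrite divr_gt0// mulr_gt0.
have [Q tQ gQ] := ag (2 * K * M) _ (mulr_gt0 K20 M0) (eM _ M0).
have [N N0 QN] := trigpoly_bounded tQ.
have [P tP fP] := af (2 * K * N) _ (mulr_gt0 K20 N0) (eM _ N0).
exists (fun z => P z * Q z); first exact: trigpolyM.
have mP := trigpoly_measurable tP; have mQ := trigpoly_measurable tQ.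
have mfP : measurable_fun (torus2 : set plane) (fun z : plane => f z - P z).
  by apply: measurable_funB; [exact: mf|exact: mP].
have mgQ : measurable_fun (torus2 : set plane) (fun z : plane => g z - Q z).
  by apply: measurable_funB; [exact: mg|exact: mQ].
rewrite (_ : (fun z => _) = (fun z => f z * (g z - Q z) + Q z * (f z - P z))); last first.
  by apply/funext => z; ring.
apply: (le_trans (@LlogL_sizeD _ _ (fun z => f z * (g z - Q z)) (fun z => Q z * (f z - P z)) K0 _ _)).
- by apply: measurable_funM; [exact: mf|exact: mgQ].
- by apply: measurable_funM; [exact: mQ|exact: mfP].
rewrite (@EFin_double (M * (e / (4 * M))) (N * (e / (4 * N))) e); last first.
  by field; rewrite !gt_eqF.
rewrite [(M * _)%:E]EFinM [(N * _)%:E]EFinM; apply: leeD; apply: lee_wpmul2l; rewrite ?lee_fin//.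
  apply: le_trans (@LlogL_sizeM _ _ M (fun z => g z - Q z) f K20 M0 mgQ mf fM) _.
  by apply: lee_wpmul2l => //; rewrite lee_fin ltW.
apply: le_trans (@LlogL_sizeM _ _ N (fun z => f z - P z) Q K20 N0 mfP mQ QN) _.
by apply: lee_wpmul2l => //; rewrite lee_fin ltW.
Qed.

(** Dominated convergence for the integrand of the size. *)
Lemma LlogL_size_cvg0 K (u : nat -> R * R -> R) g : 0 < K ->
  (forall n, measurable_fun (torus2 : set plane) (u n : plane -> R)) ->
  measurable_fun (torus2 : set plane) (g : plane -> R) ->
  (LlogL_size K g < +oo)%E ->
  (forall n z, torus2 z -> `|u n z| <= `|g z|) ->
  (forall z, torus2 z -> u n z @[n --> \oo] --> 0) ->
  forall e, 0 < e -> exists n, (LlogL_size K (u n) <= e%:E)%E.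
Proof.
move=> K0 mu_ mg gfin ug u0 e e0.
have mug n := measurable_orlicz K (mu_ n); have mgg := measurable_orlicz K mg.
have [|||||_ _ cvg] := @dominated_convergence _ _ _ m2 torus2 mT (fun n z => (orlicz K `|u n z|)%:E) (fun=> 0%E)
  (fun z => (orlicz K `|g z|)%:E).
- by move=> n; apply/measurable_EFinP; exact: mug.
- exact: measurable_cst.
- apply: aeW => z zT.
  (* The quadratic majorant of [orlicz] is a polynomial in |u n z|, so its limit 0 is immediate and
     squeezes the integrand. *)
  have : (`|u n z| * (1 + K * `|u n z|)) @[n --> \oo] --> `|0 : R| * (1 + K * `|0 : R|).
    have h : `|u n z| @[n --> \oo] --> `|0 : R| by apply: cvg_norm; exact: u0.
    apply: cvgM; first exact: h.
    by apply: cvgD; [exact: cvg_cst|apply: cvgMr; exact: h].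
  rewrite normr0 mul0r => h; apply: cvg_EFin; first by near=> n.
  apply: (squeeze_cvgr _ (cvg_cst 0) h).
  by apply: nearW => n; rewrite orlicz_ge0//= orlicz_le.
- apply/integrableP; split; first by apply/measurable_EFinP; exact: mgg.
  rewrite (_ : (\int[m2]_(x in torus2) _)%E = LlogL_size K g); first exact: gfin.
  by apply: eq_integral => z _; rewrite /= ger0_norm// orlicz_ge0.
- apply: aeW => z n zT; rewrite /= lee_fin ger0_norm ?orlicz_ge0//.
  by apply: ler_orlicz => //; exact: ug.
rewrite integral0 in cvg.
have /fine_cvgP[fin fcvg] := cvg.
have [N _ hN] : \forall n \near \oo, (LlogL_size K (u n) <= e%:E)%E.
  near=> n.
  have fn : LlogL_size K (u n) \is a fin_num by near: n; exact: fin.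
  rewrite -(fineK fn) lee_fin ltW//; near: n.
  exact: (cvgr_lt _ fcvg).
by exists N; exact: (hN N (leqnn N)).
Unshelve. all: by end_near. Qed.

Lemma approximable_lim (u : nat -> R * R -> R) h g :
  (forall n, approximable (u n)) -> measurable_fun (torus2 : set plane) (g : plane -> R) ->
  (forall K, 0 < K -> (LlogL_size K g < +oo)%E) ->
  (forall n z, torus2 z -> `|h z - u n z| <= `|g z|) ->
  (forall z, torus2 z -> u n z @[n --> \oo] --> h z) -> approximable h.
Proof.
move=> au mg gfin ug uh.
have mu_ n : measurable_fun (torus2 : set plane) (u n : plane -> R) by have [] := au n.
have mh : measurable_fun (torus2 : set plane) (h : plane -> R).
  by apply: (@measurable_fun_cvg _ plane R torus2 u h) => [n|z zT]; [exact: mu_|exact: uh].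
apply: approximable_close => // K e K0 e0.
have [||n hn] := @LlogL_size_cvg0 K (fun n z => h z - u n z) g K0 _ mg (gfin K K0) ug _ e e0.
- by move=> n; apply: measurable_funB; [exact: mh|exact: mu_].
- move=> z zT; rewrite -(subrr (h z)); apply: cvgB; [exact: cvg_cst|exact: uh].
- by exists (u n).
Qed.

Lemma approximable_bounded_lim (u : nat -> R * R -> R) h (M : R) :
  (forall n, approximable (u n)) -> (forall n z, torus2 z -> `|u n z| <= M) ->
  (forall z, torus2 z -> u n z @[n --> \oo] --> h z) -> approximable h.
Proof.
move=> au uM uh; apply: (@approximable_lim u h (fun=> 2 * M)) => //.
- by move=> K K0; exact: LlogL_size_cst.
- move=> n z zT; have hM : `|h z| <= M.
    have hc : `|u k z| @[k --> \oo] --> `|h z| by apply: cvg_norm; exact: uh.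
    have <- := cvg_lim (@norm_hausdorff _ _) hc.
    apply: limr_le; first by apply/cvg_ex; exists `|h z|.
    by apply: nearW => k; exact: uM.
  rewrite (@ger0_norm _ (2 * M)); last by rewrite mulr_ge0// (le_trans _ hM).
  apply: le_trans (ler_normB _ _) _; have := uM n z zT; lra.
Qed.

Lemma approximable_cst (c : R) : approximable (fun=> c).
Proof.
apply: trigpoly_approximable.
rewrite (_ : (fun=> c) = (fun z => c * cos (phase (0, 0) z) + 0 * sin (phase (0, 0) z))).
  exact: trigpoly_term.
by apply/funext => z; rewrite mul0r addr0 /phase/= !mul0r addr0 cos0 mulr1.
Qed.

Lemma approximableZ (c : R) h : approximable h -> approximable (fun z => c * h z).
Proof. by apply: (@approximableM (fun=> c) h `|c|) => //; exact: approximable_cst. Qed.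

Lemma approximable_on f h : (forall z, torus2 z -> f z = h z) -> approximable f -> approximable h.
Proof.
move=> fh [mf af]; have mh : measurable_fun (torus2 : set plane) (h : plane -> R).
  by apply: eq_measurable_fun mf => z; rewrite inE => /fh.
split => // K e K0 e0; have [P tP fP] := af K e K0 e0; exists P => //.
have mP := trigpoly_measurable tP; apply: le_trans fP.
apply: (@LlogL_size_le _ _ (fun z => h z - P z) (fun z => f z - P z) K0).
- by apply: measurable_funB; [exact: mh|exact: mP].
- by apply: measurable_funB; [exact: mf|exact: mP].
- by move=> z zT; rewrite fh.
Qed.

Let normr_indic_le1 (A : set (R * R)) z : `|\1_A z : R| <= 1.
Proof. by rewrite indicE; case: (_ \in _); rewrite ?normr1 ?normr0. Qed.

Lemma approximable_indicC (A : set (R * R)) : approximable \1_A -> approximable \1_(~` A).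
Proof.
move=> aA; rewrite (_ : \1_(~` A) = (fun z => 1 + -1 * \1_A z)).
  by apply: approximableD; [exact: approximable_cst|exact: approximableZ].
by apply/funext => z; rewrite !indicE in_setC; case: (_ \in _); rewrite /=; lra.
Qed.

Lemma approximable_indicU (A B : set (R * R)) :
  approximable \1_A -> approximable \1_B -> approximable \1_(A `|` B).
Proof.
move=> aA aB; rewrite -(setCK (A `|` B)) setCU; apply: approximable_indicC.
rewrite (_ : \1_(_ `&` _) = (fun z => \1_(~` A) z * \1_(~` B) z)).
  by apply: (@approximableM _ _ 1); [exact: normr_indic_le1|exact: approximable_indicC|exact: approximable_indicC].
by apply/funext => z; rewrite indicI.
Qed.

(** Complements and finite unions come from sums and products of indicators, countable unions from
    bounded pointwise limits. *)
Lemma sigma_algebra_approximable : sigma_algebra setT [set A | approximable \1_A].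
Proof.
split => /=.
- by rewrite indic0; exact: approximable_cst.
- by move=> A; rewrite setTD; exact: approximable_indicC.
- move=> A aA; apply: (@approximable_bounded_lim (fun n => \1_(\big[setU/set0]_(i < n) A i)) _ 1).
  + elim => [|n IH]; first by rewrite big_ord0 indic0; exact: approximable_cst.
    by rewrite big_ord_recr; exact: approximable_indicU.
  + by move=> n z _; exact: normr_indic_le1.
  + move=> z _; apply: cvg_near_cst.
    have [[k _ Ak]|nA] := pselect ((\bigcup_k A k) z).
      exists k.+1 => // n /= kn; rewrite !indicE !mem_set//.
        by exists k.
      by rewrite -bigcup_mkord; exists k.
    apply: nearW => n; rewrite !indicE !memNset//.
    by rewrite -bigcup_mkord => -[k _ Ak]; apply: nA; exists k.
Qed.

Lemma approximable_preimage (q : R * R -> R) :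
  (forall a, approximable \1_[set z | a < q z]) ->
  forall B, measurable (B : set (measurableTypeR R)) -> approximable \1_(q @^-1` B).
Proof.
move=> aq B mB; have [s0 sC sU] := sigma_algebra_approximable.
suff : (@RGenOInfty.G R).-sigma.-measurable `<=` [set B | approximable \1_(q @^-1` B)].
  by apply; rewrite -RGenOInfty.measurableE.
apply: smallest_sub; first split => /=.
- by rewrite preimage_set0; exact: s0.
- by move=> A aA; rewrite setTD preimage_setC -setTD; exact: sC.
- by move=> A aA; rewrite preimage_bigcup; exact: sU.
- move=> _ [a ->] /=; rewrite (_ : _ @^-1` _ = [set z | a < q z]); first exact: aq.
  by apply/seteqP; split => z /=; rewrite in_itv/= andbT.
Qed.

(** The product sigma-algebra is generated by preimages under the coordinates, and the Borel sets of
    the line by open rays; only half-planes remain to be treated. *)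
Lemma approximable_borel (A : set (R * R)) :
  (forall a, approximable \1_[set z : R * R | a < z.1]) ->
  (forall a, approximable \1_[set z : R * R | a < z.2]) ->
  measurable (A : set RR) -> approximable \1_A.
Proof.
move=> a1 a2; suff : (measurable : set (set RR)) `<=` [set A | approximable \1_A] by exact.
apply: smallest_sub; first exact: sigma_algebra_approximable.
by move=> _ [[B mB <-]|[B mB <-]] /=; rewrite setTI; exact: approximable_preimage.
Qed.

End Approximation.

(** * Approximation of indicators and of L log L functions *)

Section Rays.
Context {R : realType}.
Local Notation mu := (@lebesgue_measure R).
Local Notation m2 := (@lebesgue_measure2 R).
Local Notation RR := (measurableTypeR R * measurableTypeR R)%type.
Local Notation plane := (caratheodory_type ((@lebesgue_measure R \x @lebesgue_measure R)%E^*)%mu).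
Local Notation mT := (@measurable_torus2 R).
Implicit Types (f g h : R * R -> R) (v : R).

(* Iterating this polynomial pushes values below 1/2 to 0 and values above 1/2 to 1. *)
Definition smoothstep v : R := 3 * v ^+ 2 - 2 * v ^+ 3.

Definition halfstep v : R := if v < 1 / 2 then 0 else if v == 1 / 2 then 1 / 2 else 1.

Lemma smoothstep_itv v : 0 <= v <= 1 -> 0 <= smoothstep v <= 1.
Proof.
move=> /andP[v0 v1]; apply/andP; split.
  rewrite (_ : smoothstep v = v ^+ 2 * (3 - 2 * v)); last by rewrite /smoothstep; ring.
  by rewrite mulr_ge0 ?sqr_ge0//; lra.
rewrite -subr_ge0 (_ : 1 - smoothstep v = (1 - v) ^+ 2 * (1 + 2 * v)); last by rewrite /smoothstep; ring.
by rewrite mulr_ge0 ?sqr_ge0//; lra.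
Qed.

Lemma iter_smoothstep_itv n v : 0 <= v <= 1 -> 0 <= iter n smoothstep v <= 1.
Proof. by move=> v01; elim: n => //= n IH; exact: smoothstep_itv. Qed.

Lemma smoothstepC v : smoothstep (1 - v) = 1 - smoothstep v.
Proof. by rewrite /smoothstep; ring. Qed.

Lemma iter_smoothstepC n v : iter n smoothstep (1 - v) = 1 - iter n smoothstep v.
Proof. by elim: n => //= n ->; exact: smoothstepC. Qed.

Lemma cvg_iter_smoothstep_lt v : 0 <= v -> v < 1 / 2 -> iter n smoothstep v @[n --> \oo] --> 0.
Proof.
move=> v0 vh; pose c := 3 * v - 2 * v ^+ 2.
have c0 : 0 <= c by rewrite /c; nra.
have c1 : c < 1 by rewrite /c; nra.
have h n : 0 <= iter n smoothstep v <= v * c ^+ n.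
  elim: n => [|n /andP[h0 h1]]; first by rewrite expr0 mulr1 v0 lexx.
  have hv : iter n smoothstep v <= v.
    by apply: (le_trans h1); rewrite ler_piMr// exprn_ile1// ltW.
  move: h0 h1 hv; rewrite iterS exprS; move: (iter n smoothstep v) (c ^+ n) => w d h0 h1 hv.
  apply/andP; split.
    by have /andP[] : 0 <= smoothstep w <= 1 by apply: smoothstep_itv; lra.
  apply: (@le_trans _ _ (c * w)); last by rewrite mulrCA ler_wpM2l.
  rewrite (_ : smoothstep w = (3 * w - 2 * w ^+ 2) * w); last by rewrite /smoothstep; ring.
  by rewrite ler_wpM2r// /c; nra.
have hl : (v * c ^+ n) @[n --> \oo] --> v * 0.
  by apply: cvgMr; apply: cvg_expr; rewrite ger0_norm.
rewrite mulr0 in hl; apply: (squeeze_cvgr _ (cvg_cst 0) hl).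
by apply: nearW => n; exact: h.
Qed.

Lemma cvg_iter_smoothstep v : 0 <= v <= 1 -> iter n smoothstep v @[n --> \oo] --> halfstep v.
Proof.
move=> /andP[v0 v1]; rewrite /halfstep; case: ltP => hv; first exact: cvg_iter_smoothstep_lt.
case: eqP => [->|/eqP ne].
  apply: cvg_near_cst; apply: nearW; elim => //= n ->; rewrite /smoothstep; lra.
have h : (1 - iter n smoothstep (1 - v)) @[n --> \oo] --> (1 - 0 : R).
  apply: cvgB; first exact: cvg_cst.
  apply: cvg_iter_smoothstep_lt; first by rewrite subr_ge0.
  by move: ne; rewrite neq_lt => /orP[|]; lra.
rewrite subr0 in h; apply: cvg_trans h; apply: near_eq_cvg; apply: nearW => n.
by rewrite iter_smoothstepC opprB addrC subrK.
Qed.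

(** The iterates of [smoothstep] are polynomials in h and converge to [halfstep], which takes the
    value 1/2 on the level set h = 1/2. Powers of this limit converge to the indicator, as they send
    1/2 to 0 and fix 0 and 1. *)
Lemma approximable_gt_half h : (forall z, 0 <= h z <= 1) -> approximable h ->
  approximable \1_[set z | 1 / 2 < h z].
Proof.
move=> h01 ah.
have n1 g : (forall z, 0 <= g z <= 1) -> forall z, `|g z| <= 1.
  by move=> g01 z; have /andP[g0 g1] := g01 z; rewrite ger0_norm.
have ait n : approximable (fun z => iter n smoothstep (h z)).
  elim: n => [//|n IH] /=.
  pose w z := iter n smoothstep (h z).
  have w01 z : 0 <= w z <= 1 by exact: iter_smoothstep_itv.
  rewrite (_ : (fun z => _) = (fun z => 3 * (w z * w z) + -2 * (w z * (w z * w z)))); last first.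
    by apply/funext => z; rewrite /smoothstep /w; ring.
  have aw2 : approximable (fun z => w z * w z) by apply: (approximableM (n1 _ w01)).
  apply: approximableD; apply: approximableZ; first exact: aw2.
  by apply: (approximableM (n1 _ w01)).
have ahs : approximable (fun z => halfstep (h z)).
  apply: (approximable_bounded_lim ait (M := 1)) => [n z _|z _]; last exact: cvg_iter_smoothstep.
  by apply: (n1 (fun z => iter n smoothstep (h z))) => {}z; exact: iter_smoothstep_itv.
have hs01 z : 0 <= halfstep (h z) <= 1.
  by rewrite /halfstep; case: ifP => _; [|case: ifP => _]; lra.
have ahn n : approximable (fun z => halfstep (h z) ^+ n.+1).
  elim: n => [|n IH]; first by under eq_fun do rewrite expr1.
  under eq_fun do rewrite exprS.
  exact: (approximableM (n1 _ hs01)).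
apply: (approximable_bounded_lim ahn (M := 1)) => [n z _|z _].
  apply: (n1 (fun z => halfstep (h z) ^+ n.+1)) => {}z; have /andP[g0 g1] := hs01 z.
  by rewrite exprn_ge0// exprn_ile1.
rewrite indicE; have [hz|hz] := ltP (1 / 2) (h z).
  rewrite mem_set//=; apply: cvg_near_cst; apply: nearW => n.
  by rewrite /halfstep ifF ?ifF ?expr1n//; apply/negbTE; rewrite ?gt_eqF// -leNgt ltW.
rewrite memNset /=; last by rewrite ltNge hz.
apply: (@squeeze_cvgr _ _ _ _ (cst 0) (fun n => (1 / 2) ^+ n.+1)).
- have hh : halfstep (h z) <= 1 / 2.
    by move: hz; rewrite /halfstep le_eqVlt => /orP[/eqP ->|->]; rewrite ?ltxx ?eqxx; lra.
  apply: nearW => n /=; have /andP[g0 _] := hs01 z; rewrite exprn_ge0//=.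
  by rewrite lerXn2r ?nnegrE//; lra.
- exact: cvg_cst.
- rewrite (cvg_shiftS (fun n => (1 / 2 : R) ^+ n)); apply: cvg_expr.
  by rewrite ger0_norm; lra.
Qed.

(** The part of the cycle beyond a is an arc with centre (a + pi)/2 and half-width (pi - a)/2, hence
    a superlevel set of a translated cosine. *)
Lemma cos_gt_ray (x a : R) : - pi <= x < pi -> - pi <= a < pi ->
  (cos ((pi - a) / 2) < cos (x - (a + pi) / 2)) = (a < x).
Proof.
move=> /andP[x0 x1] /andP[a0 a1].
have p0 := @pi_gt0 R.
set w := (pi - a) / 2; set m := (a + pi) / 2.
have hw : 0 <= w <= pi by rewrite /w; lra.
have key (t : R) : 0 <= t <= pi -> (cos w < cos t) = (t < w).
  by move=> ht; rewrite ltr_cos// in_itv.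
have [xm|xm] := leP m x.
  rewrite key; last by rewrite /m in xm *; lra.
  by rewrite /w /m in xm *; apply/idP/idP; lra.
rewrite -(cosN (x - m)) opprB; have [h|h] := leP (m - x) pi.
  rewrite key; last lra.
  by rewrite /w /m in xm h *; apply/idP/idP; lra.
(* Here x is more than half a turn from the centre, and its distance on the circle is measured the
   other way round. *)
rewrite (_ : cos (m - x) = cos (2 * pi - (m - x))); last first.
  by rewrite -[RHS]cosN -[RHS](cosD_int2pi 1); congr cos; rewrite mul1r; ring.
rewrite key; last by rewrite /m in h *; lra.
by rewrite /w /m in xm h *; apply/idP/idP; lra.
Qed.

(** For a outside [-pi, pi) the indicator is constant on the torus; otherwise the ray is an arc, a
    superlevel set of a trigonometric polynomial. *)
Lemma approximable_ray (p : int * int) (q : R * R -> R) :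
  (forall z, torus2 z -> phase p z = q z /\ - pi <= q z < pi) ->
  forall a, approximable \1_[set z | a < q z].
Proof.
move=> hq a.
have [ha|ha] := ltP a (- pi).
  apply: (@approximable_on _ (fun=> 1)); last exact: approximable_cst.
  move=> z /hq[_ /andP[h _]]; rewrite indicE mem_set//=; exact: lt_le_trans h.
have [ha'|ha'] := leP pi a.
  apply: (@approximable_on _ (fun=> 0)); last exact: approximable_cst.
  move=> z /hq[_ /andP[_ h]]; rewrite indicE memNset//= => ah.
  by have := lt_trans (le_lt_trans ha' ah) h; rewrite ltxx.
pose m := (a + pi) / 2; pose w := (pi - a) / 2.
(* An affine rescaling of the cosine to [0, 1] that moves the threshold cos w to 1/2. *)
pose v z := 1 / 2 + 1 / 4 * (cos (phase p z - m) - cos w).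
have v01 z : 0 <= v z <= 1.
  have := cos_geN1 w; have := cos_le1 w; have := cos_geN1 (phase p z - m); have := cos_le1 (phase p z - m).
  by rewrite /v; lra.
have av : approximable v.
  rewrite (_ : v = (fun z => (1 / 2 - 1 / 4 * cos w) +
     ((1 / 4 * cos m) * cos (phase p z) + (1 / 4 * sin m) * sin (phase p z)))).
    apply: approximableD; first exact: approximable_cst.
    exact/trigpoly_approximable/trigpoly_term.
  by apply/funext => z; rewrite /v cosB; ring.
apply: approximable_on (approximable_gt_half v01 av) => z /hq[qz qb].
have E : (1 / 2 < v z) = (a < q z).
  rewrite -(@cos_gt_ray (q z) a)//; last by rewrite ha.
  by rewrite /v qz -/m -/w; apply/idP/idP; lra.
by rewrite !indicE; congr (nat_of_bool _)%:R; apply/idP/idP; rewrite !inE/= E.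
Qed.

Lemma approximable_measurable_borel (A : set (R * R)) : measurable (A : set RR) -> approximable \1_A.
Proof.
apply: approximable_borel.
- apply: (@approximable_ray (1, 0)) => z /andP[z1 _]; split => //.
  by rewrite /phase/= mul1r mul0r addr0.
- apply: (@approximable_ray (0, 1)) => z /andP[_ z2]; split => //.
  by rewrite /phase/= mul1r mul0r add0r.
Qed.

(** The completed measure of A is an infimum over countable covers by Borel sets. A nearly optimal
    cover is the required set, and finiteness on the torus turns the near equality of measures into
    a small difference set. *)
Lemma caratheodory_cover (A : set plane) e : 0 < e -> measurable A -> A `<=` torus2 ->
  exists B : set (R * R), [/\ measurable (B : set RR), A `<=` B & (m2 (B `\` A) <= e%:E)%E].
Proof.
move=> e0 mA AT.
have Afin : (m2 A < +oo)%E.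
  apply: le_lt_trans torus2_lty; apply: le_measure; rewrite ?inE//; exact: mT.
have A0 : (0 <= m2 A)%E by exact: measure_ge0.
have Ar : m2 A \is a fin_num by rewrite ge0_fin_numE.
have [x [F [mF AF] Fx] xA] := lb_ereal_inf_adherent e0 Ar.
exists (\bigcup_k F k); split => //.
  by apply: bigcup_measurable => k _; exact: mF.
have mB : measurable (\bigcup_k F k : set plane).
  by apply: bigcup_measurable => k _; exact: borel_plane (mF k).
have hB : (m2 (\bigcup_k F k) <= x)%E.
  rewrite -Fx /lebesgue_measure2 /completed_measure_extension /mu_ext.
  by apply: ereal_inf_lbound; exists F => //; split => //; exact: mF.
have AF' : A `<=` \bigcup_k F k by exact: AF.
have xfin : (x < +oo)%E.
  by apply: (lt_trans xA); apply: lte_add_pinfty; [exact: Afin|exact: ltry].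
rewrite measureD//; last exact: le_lt_trans hB xfin.
rewrite setIidr//.
have -> : (e%:E = m2 A + e%:E - m2 A)%E by rewrite addeAC subee// add0e.
by apply: leeB => //; apply: (le_trans hB); apply: ltW.
Qed.

(** On the torus a Lebesgue measurable set differs from a Borel set by a set of small measure, and
    the size of an indicator is at most 1 + K times the measure of its set. *)
Lemma approximable_indic (A : set plane) : measurable A -> approximable \1_A.
Proof.
move=> mA; have mAT : measurable (A `&` torus2 : set plane).
  by apply: measurableI; [exact: mA|exact: mT].
apply: (@approximable_on _ \1_(A `&` torus2)).
  by move=> z zT; rewrite !indicE in_setI (mem_set zT) andbT.
have mI (B : set plane) : measurable B -> measurable_fun (torus2 : set plane) (\1_B : plane -> R).
  by move=> mB; apply: measurable_indic.
apply: approximable_close; first exact: mI.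
move=> K e K0 e0.
have c0 : 0 < 1 + K by rewrite addr_gt0.
have e10 : 0 < e / (1 + K) by rewrite divr_gt0.
have [|B [mB AB hB]] := caratheodory_cover e10 mAT; first by move=> z [].
exists \1_B; first exact: approximable_measurable_borel.
have mB' : measurable (B : set plane) by exact: borel_plane.
have mBA : measurable (B `\` (A `&` torus2) : set plane).
  by apply: measurableD; [exact: mB'|exact: mAT].
apply: (@le_trans _ _ ((1 + K)%:E * \int[m2]_(z in torus2) (\1_(B `\` (A `&` torus2)) z)%:E)%E).
  rewrite -ge0_intRZ; [|exact: mT|exact: mI|by move=> z _; rewrite indicE|exact: ltW].
  apply: ge0_le_intR; first exact: mT.
  - apply: (measurable_orlicz K (h := fun z => \1_(A `&` torus2) z - \1_B z)).
    by apply: measurable_funB; exact: mI.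
  - by apply: measurable_funM; [exact: measurable_cst|exact: mI].
  - by move=> z _; exact: orlicz_ge0.
  - move=> z _; apply: le_trans (orlicz_le K0 (normr_ge0 _)) _.
    rewrite !indicE in_setD; have := AB z; case: (boolP (z \in A `&` torus2)) => /=.
      by move=> /set_mem h /(_ h) /mem_set ->; rewrite subrr normr0 mul0r mulr0.
    by move=> _ _; rewrite sub0r normrN; case: (z \in B); rewrite /= ?normr1 ?normr0 ?mulr1 ?mul1r ?mul0r ?mulr0.
rewrite integral_indic; [|exact: mT|exact: mBA].
have -> : e = (1 + K) * (e / (1 + K)) by rewrite mulrCA mulfV ?mulr1// gt_eqF.
rewrite EFinM; apply: lee_wpmul2l; first by rewrite lee_fin ltW.
apply: le_trans hB; apply: le_measure; rewrite ?inE; [|exact: mBA|by move=> z []].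
by apply: measurableI; [exact: mBA|exact: mT].
Qed.

Lemma approximable_sum (I : Type) (r : seq I) (F : I -> R * R -> R) :
  (forall i, approximable (F i)) -> approximable (fun z => \sum_(i <- r) F i z).
Proof.
move=> aF; elim: r => [|i r IH].
  by under eq_fun do rewrite big_nil; exact: approximable_cst.
by under eq_fun do rewrite big_cons; exact: approximableD.
Qed.

Import HBNNSimple.

Lemma approximable_nnsfun (s : {nnsfun plane >-> R}) : approximable s.
Proof.
have -> : (s : plane -> R) = (fun z => \sum_(y <- finmap.enum_fset (fset_set (range s))) y * \1_(s @^-1` [set y]) z).
  by apply/funext => z; rewrite {1}fimfunE fsbig_finite.
apply: approximable_sum => y; apply: approximableZ; apply: approximable_indic.
exact: measurable_sfunP.
Qed.

(** Simple functions increase to h on the torus, and h itself dominates the differences. *)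
Lemma approximable_ge0 h : measurable_fun (torus2 : set plane) (h : plane -> R) ->
  (forall z, 0 <= h z) -> (forall K, 0 < K -> (LlogL_size K h < +oo)%E) -> approximable h.
Proof.
move=> mh h0 hfin.
have mhE : measurable_fun (torus2 : set plane) (EFin \o (h : plane -> R)) by apply/measurable_EFinP.
pose u := nnsfun_approx mT mhE.
have uh z : torus2 z -> u n z @[n --> \oo] --> h z.
  move=> zT; have := @cvg_nnsfun_approx _ plane R torus2 mT _ mhE (fun z _ => h0 z) z zT.
  by move=> /fine_cvgP[].
have uleh n z : torus2 z -> u n z <= h z.
  move=> zT; have := uh z zT => hc; rewrite -(cvg_lim (@norm_hausdorff _ _) hc).
  apply: nondecreasing_cvgn_le; last by apply/cvg_ex; exists (h z).
  by move=> i j ij; have /lefP := nd_nnsfun_approx mT mhE ij; exact.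
apply: (@approximable_lim _ u h h) => //; first by move=> n; exact: approximable_nnsfun.
move=> n z zT; rewrite !ger0_norm ?subr_ge0 ?uleh// gerBl; exact: fun_ge0.
Qed.

(** Up to the value e the integrand is at most a constant. Beyond it log u >= 1, and 1 + logp(K u)
    <= 1 + logp K + log u <= (2 + logp K) log u, which explains [d]. *)
Lemma LlogL_size_fin h K : 0 < K -> measurable_fun (torus2 : set plane) (h : plane -> R) ->
  (\int[m2]_(z in torus2) (`|h z| * logp `|h z|)%:E < +oo)%E -> (LlogL_size K h < +oo)%E.
Proof.
move=> K0 mh hfin; pose c := orlicz K (expR 1).
pose d := 2 + logp K.
have d0 : 0 <= d by rewrite /d addr_ge0// logp_ge0.
have c0 : 0 <= c by rewrite orlicz_ge0// expR_ge0.
have mL : measurable_fun (torus2 : set plane) (fun z : plane => `|h z| * logp `|h z|).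
  have mn : measurable_fun (torus2 : set plane) (fun z : plane => `|h z|) by exact: measurableT_comp.
  by apply: measurable_funM; [exact: mn|apply: (measurableT_comp measurable_logp); exact: mn].
have mdL : measurable_fun (torus2 : set plane) (fun z : plane => d * (`|h z| * logp `|h z|)).
  by apply: measurable_funM; [exact: measurable_cst|exact: mL].
have L0 z : 0 <= `|h z| * logp `|h z| by rewrite mulr_ge0// logp_ge0.
apply: (@le_lt_trans _ _ (\int[m2]_(z in torus2) (c + d * (`|h z| * logp `|h z|))%:E)%E).
  apply: ge0_le_intR; first exact: mT.
  - exact: (measurable_orlicz K mh).
  - by apply: measurable_funD; [exact: measurable_cst|exact: mdL].
  - by move=> z _; exact: orlicz_ge0.
  - move=> z _; move: `|h z| (normr_ge0 (h z)) (L0 z) => u u0 lu0.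
    have [ue|ue] := leP u (expR 1).
      apply: (@le_trans _ _ c); first exact: ler_orlicz.
      by rewrite lerDl mulr_ge0.
    have u1 : 1 < u by apply: le_lt_trans ue; rewrite -expR0 ler_expR.
    have l1 : 1 <= logp u.
      by rewrite /logp u1 -(expRK 1) ler_ln ?posrE ?expR_gt0 ?(lt_trans _ u1)// ltW.
    have lK : logp (K * u) <= logp K + logp u.
      rewrite {1}/logp; case: ltP => _; last by rewrite addr_ge0// logp_ge0.
      rewrite lnM ?posrE ?(lt_trans _ u1)//; apply: lerD; last by rewrite /logp u1.
      by rewrite logpE ler_ln ?posrE ?lt_max ?K0// le_max lexx.
    have lK0 := logp_ge0 K.
    apply: (@le_trans _ _ (d * (u * logp u))); last by rewrite lerDr.
    rewrite /orlicz mulrCA ler_wpM2l// /d; nra.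
rewrite ge0_intRD; [|exact: mT|exact: measurable_cst|exact: mdL|by []|by move=> z _; rewrite mulr_ge0].
apply: lte_add_pinfty.
  by rewrite integral_cst; [rewrite lte_mul_pinfty ?lee_fin//; exact: torus2_lty|exact: mT].
rewrite ge0_intRZ; [|exact: mT|exact: mL|by move=> z _|exact: d0].
by rewrite lte_mul_pinfty ?lee_fin.
Qed.

Lemma approximable_LlogL h : measurable_fun (torus2 : set plane) (h : plane -> R) ->
  (\int[m2]_(z in torus2) (`|h z| * logp `|h z|)%:E < +oo)%E -> approximable h.
Proof.
move=> mh hfin.
have part g : measurable_fun (torus2 : set plane) (g : plane -> R) -> (forall z, `|g z| <= `|h z|) ->
    (forall z, 0 <= g z) -> approximable g.
  move=> mg gh g0; apply: approximable_ge0 => // K K0.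
  apply: le_lt_trans (LlogL_size_fin K0 mh hfin).
  by apply: LlogL_size_le => // z _; exact: gh.
rewrite (_ : h = (fun z => Num.max (h z) 0 + -1 * Num.max (- h z) 0)); last first.
  by apply/funext => z; rewrite /Num.max; case: ltP => h1; case: ltP => h2; lra.
have n0 (x : R) : `|Num.max x 0| <= `|x| by rewrite /Num.max; case: ltP => //; rewrite normr0.
apply: approximableD; last apply: approximableZ; apply: part.
- by apply: measurable_maxr; [exact: mh|exact: measurable_cst].
- by move=> z; exact: n0.
- by move=> z; rewrite le_max lexx orbT.
- apply: measurable_maxr; [|exact: measurable_cst].
  by apply: measurableT_comp; [exact: oppr_measurable|exact: mh].
- by move=> z; rewrite (le_trans (n0 _))// normrN.
- by move=> z; rewrite le_max lexx orbT.
Qed.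

End Rays.

(** * Almost everywhere convergence *)

Section PartialSumsOfPolynomials.
Context {R : realType}.
Local Notation m2 := (@lebesgue_measure2 R).
Local Notation RR := (measurableTypeR R * measurableTypeR R)%type.
Local Notation plane := (caratheodory_type ((@lebesgue_measure R \x @lebesgue_measure R)%E^*)%mu).
Local Notation mT := (@measurable_torus2 R).
Implicit Types (f g h : R * R -> R) (p q : int * int).

Lemma mem_box n p : (p \in box n) = (maxn `|p.1| `|p.2| <= n)%N.
Proof.
apply/allpairsP/idP => [[[i k] [+ + ->]]|hp].
  by rewrite !mem_iota => /=; lia.
exists (`|(p.1 + n%:Z)%R|%N, `|(p.2 + n%:Z)%R|%N); rewrite !mem_iota; split.
- by move: hp => /=; lia.
- by move: hp => /=; lia.
- by rewrite [LHS]surjective_pairing /=; congr pair; move: hp; lia.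
Qed.

Lemma box_uniq n : uniq (box n).
Proof.
apply: allpairs_uniq; rewrite ?iota_uniq// => -[i k] [i' k'] _ _ /= [h1 h2].
by congr pair; lia.
Qed.

Lemma sum_box_delta n p (F : int * int -> R) : (maxn `|p.1| `|p.2| <= n)%N ->
  \sum_(q <- box n) (q == p)%:R * F q = F p.
Proof.
rewrite -mem_box => pn; rewrite (bigD1_seq p) ?box_uniq// [p == p]eqxx mul1r big1 => [|q qp]; first exact: addr0.
by rewrite (negbTE qp) mul0r.
Qed.

Lemma rcosD f g p : m2.-integrable torus2 (EFin \o f) -> m2.-integrable torus2 (EFin \o g) ->
  rcos (fun z => f z + g z) p = rcos f p + rcos g p.
Proof.
move=> fi gi; rewrite /rcos -mulrDr; congr (_ * _).
rewrite -RintegralD; [|exact: mT|exact: mul_cos_integrable|exact: mul_cos_integrable].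
by apply: eq_Rintegral => w _; rewrite mulrDl.
Qed.

Lemma rsinD f g p : m2.-integrable torus2 (EFin \o f) -> m2.-integrable torus2 (EFin \o g) ->
  rsin (fun z => f z + g z) p = rsin f p + rsin g p.
Proof.
move=> fi gi; rewrite /rsin -mulrDr; congr (_ * _).
rewrite -RintegralD; [|exact: mT|exact: mul_sin_integrable|exact: mul_sin_integrable].
by apply: eq_Rintegral => w _; rewrite mulrDl.
Qed.

Lemma rsumD f g n z : m2.-integrable torus2 (EFin \o f) -> m2.-integrable torus2 (EFin \o g) ->
  rsum (fun z => f z + g z) n z = rsum f n z + rsum g n z.
Proof.
move=> fi gi; rewrite /rsum /tp -big_split; apply: eq_bigr => p _ /=.
by rewrite rcosD// rsinD//; ring.
Qed.

Lemma trigpoly_integrable P : trigpoly P -> m2.-integrable torus2 (EFin \o P).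
Proof.
move=> tP; have [M _ PM] := trigpoly_bounded tP.
exact: (bounded_torus_integrable (trigpoly_measurable tP) PM).
Qed.

(** By the product formulas the coefficients of the term sit at p and at -p, half at each. Both lie
    in the symmetric box, and their contributions add up to the term, also when p = 0. *)
Lemma rsum_term (a b : R) p n (z : R * R) : (maxn `|p.1| `|p.2| <= n)%N ->
  rsum (fun w => a * cos (phase p w) + b * sin (phase p w)) n z =
  a * cos (phase p z) + b * sin (phase p z).
Proof.
move=> pn; have q0 : 4 * pi ^+ 2 != 0 :> R.
  by rewrite mulf_neq0// expf_neq0// gt_eqF// pi_gt0.
pose d q : R := (q == p)%:R; pose d' q : R := (q == (- p.1, - p.2))%:R.
have hm q : Rintegral m2 torus2 (fun w => cos (phase (q.1 - p.1, q.2 - p.2) w)) = 4 * pi ^+ 2 * d q.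
  have [-> _] := @Rintegral_torus2_trig R (q.1 - p.1, q.2 - p.2).
  congr (_ * (nat_of_bool _)%:R); rewrite xpair_eqE !subr_eq0.
  by case: q p {pn d d'} => [q1 q2] [p1 p2]; rewrite xpair_eqE.
have hp q : Rintegral m2 torus2 (fun w => cos (phase (q.1 + p.1, q.2 + p.2) w)) = 4 * pi ^+ 2 * d' q.
  have [-> _] := @Rintegral_torus2_trig R (q.1 + p.1, q.2 + p.2).
  congr (_ * (nat_of_bool _)%:R); rewrite xpair_eqE !addr_eq0.
  by case: q p {pn d d' hm} => [q1 q2] [p1 p2]; rewrite xpair_eqE.
have ic q := bounded_torus_integrable (measurable_plane (@measurable_cos_phase R q)) (M := 1).
have is' q := bounded_torus_integrable (measurable_plane (@measurable_sin_phase R q)) (M := 1).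
have cos1 (x : R) : `|cos x| <= 1 by rewrite ler_norml cos_geN1 cos_le1.
have sin1 (x : R) : `|sin x| <= 1 by rewrite ler_norml sin_geN1 sin_le1.
have lin (F G H K : R * R -> R) (x y u v : R) :
    m2.-integrable torus2 (EFin \o F) -> m2.-integrable torus2 (EFin \o G) ->
    m2.-integrable torus2 (EFin \o H) -> m2.-integrable torus2 (EFin \o K) ->
    Rintegral m2 torus2 (fun w => (x * F w + y * G w) + (u * H w + v * K w)) =
    (x * Rintegral m2 torus2 F + y * Rintegral m2 torus2 G) +
    (u * Rintegral m2 torus2 H + v * Rintegral m2 torus2 K).
  move=> Fi Gi Hi Ki.
  have iZ (J : R * R -> R) c : m2.-integrable torus2 (EFin \o J) ->
      m2.-integrable torus2 (EFin \o (fun w => c * J w)).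
    by move=> Ji; have := integrableZl mT c Ji; apply: eq_integrable => //; exact: mT.
  have iD (J L : R * R -> R) : m2.-integrable torus2 (EFin \o J) ->
      m2.-integrable torus2 (EFin \o L) -> m2.-integrable torus2 (EFin \o (fun w => J w + L w)).
    by move=> Ji Li; have := integrableD mT Ji Li; apply: eq_integrable => //; exact: mT.
  rewrite RintegralD; [|exact: mT|by apply: iD; exact: iZ|by apply: iD; exact: iZ].
  rewrite !RintegralD; [|exact: mT|exact: iZ|exact: iZ|exact: mT|exact: iZ|exact: iZ].
  by rewrite !RintegralZl//; exact: mT.
have Ec q : rcos (fun w => a * cos (phase p w) + b * sin (phase p w)) q = a / 2 * (d q + d' q).
  rewrite /rcos (_ : (fun w => _) = (fun w =>
    (a / 2 * cos (phase (q.1 - p.1, q.2 - p.2) w) + a / 2 * cos (phase (q.1 + p.1, q.2 + p.2) w)) +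
    (b / 2 * sin (phase (q.1 + p.1, q.2 + p.2) w) + - (b / 2) * sin (phase (q.1 - p.1, q.2 - p.2) w)))); last first.
    by apply/funext => w; rewrite !phaseB !phaseD; move: (phase p w) (phase q w) => s t; rewrite cosB cosD sinB sinD; field.
  rewrite lin; [|by apply: ic|by apply: ic|by apply: is'|by apply: is'].
  rewrite hm hp !(proj2 (@Rintegral_torus2_trig R _)).
  by move: (4 * pi ^+ 2) q0 => c c0; field.
have Es q : rsin (fun w => a * cos (phase p w) + b * sin (phase p w)) q = b / 2 * (d q - d' q).
  rewrite /rsin (_ : (fun w => _) = (fun w =>
    (b / 2 * cos (phase (q.1 - p.1, q.2 - p.2) w) + - (b / 2) * cos (phase (q.1 + p.1, q.2 + p.2) w)) +
    (a / 2 * sin (phase (q.1 + p.1, q.2 + p.2) w) + a / 2 * sin (phase (q.1 - p.1, q.2 - p.2) w)))); last first.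
    by apply/funext => w; rewrite !phaseB !phaseD; move: (phase p w) (phase q w) => s t; rewrite cosB cosD sinB sinD; field.
  rewrite lin; [|by apply: ic|by apply: ic|by apply: is'|by apply: is'].
  rewrite hm hp !(proj2 (@Rintegral_torus2_trig R _)).
  by move: (4 * pi ^+ 2) q0 => c c0; field.
transitivity (\sum_(q <- box n) (d q * (a / 2 * cos (phase q z) + b / 2 * sin (phase q z))) +
  \sum_(q <- box n) (d' q * (a / 2 * cos (phase q z) - b / 2 * sin (phase q z)))).
  by rewrite -big_split; apply: eq_bigr => q _; rewrite Ec Es /=; ring.
rewrite !sum_box_delta// ?abszN//.
rewrite (_ : phase (- p.1, - p.2) z = - phase p z) ?cosN ?sinN; first by field.
by rewrite /phase/= !intrN; ring.
Qed.

Lemma rsum_trigpoly P : trigpoly P -> exists N, forall n (z : R * R), (N <= n)%N -> rsum P n z = P z.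
Proof.
elim => [|a b p P' tP [N IH]].
  exists 0%N => n z _; rewrite -[RHS](_ : 0 * cos (phase (0, 0) z) + 0 * sin (phase (0, 0) z) = 0); last by ring.
  rewrite -(@rsum_term 0 0 (0, 0) n z)//; congr (rsum _ n z).
  by apply/funext => w; ring.
exists (maxn N (maxn `|p.1| `|p.2|)) => n z; rewrite geq_max => /andP[Nn pn].
rewrite rsumD ?IH ?rsum_term//; last exact: trigpoly_integrable.
exact/trigpoly_integrable/trigpoly_term.
Qed.

End PartialSumsOfPolynomials.

(** * Convergence of strong means for real functions *)

Section StrongMeans.
Context {R : realType}.
Local Notation m2 := (@lebesgue_measure2 R).
Local Notation RR := (measurableTypeR R * measurableTypeR R)%type.
Local Notation plane := (caratheodory_type ((@lebesgue_measure R \x @lebesgue_measure R)%E^*)%mu).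
Local Notation mT := (@measurable_torus2 R).
Implicit Types (h : R * R -> R).

Lemma negligible_small d (T : measurableType d) (m : {measure set T -> \bar R}) (G : set T) :
  (forall e : R, 0 < e -> exists B, [/\ measurable B, G `<=` B & (m B <= e%:E)%E]) ->
  m.-negligible G.
Proof.
move=> hG; have n0 (k : nat) : 0 < k.+1%:R^-1 :> R by rewrite invr_gt0.
have /choice[B hB] := fun k => hG _ (n0 k).
have mB : measurable (\bigcap_k B k) by apply: bigcapT_measurable => k; have [] := hB k.
exists (\bigcap_k B k); split => //; last by move=> z Gz k _; have [_ + _] := hB k; exact.
apply/eqP; rewrite eq_le measure_ge0 andbT.
apply/lee_addgt0Pr => e e0; rewrite add0e.
have [k ke] : exists k : nat, k.+1%:R^-1 < e.
  have e1 : 0 <= e^-1 by rewrite invr_ge0 ltW.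
  exists (Num.bound e^-1); rewrite invf_plt ?posrE//.
  by apply: (lt_trans (archi_boundP e1)); rewrite ltr_nat.
have [mBk _ Bk] := hB k; apply: (@le_trans _ _ (m (B k))).
  by apply: le_measure; rewrite ?inE// => z; apply.
by apply: (le_trans Bk); rewrite lee_fin ltW.
Qed.

(** Convexity of exp between 0 and t, from the tangent inequality at s t evaluated at both ends. It
    converts a bounded exponential mean into one of order s. *)
Lemma expR_scale (s t : R) : 0 <= s <= 1 -> expR (s * t) <= 1 + s * (expR t - 1).
Proof.
move=> /andP[s0 s1]; have x0 := expR_gt0 (s * t).
have h1 : expR (s * t) * (1 + (t - s * t)) <= expR t.
  have -> : expR t = expR (s * t) * expR (t - s * t) by rewrite -expRD addrC subrK.
  by rewrite ler_wpM2l ?expR_ge1Dx// ltW.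
have h2 : expR (s * t) * (1 - s * t) <= 1.
  rewrite -[leRHS](_ : expR (s * t) * expR (- (s * t)) = 1); last by rewrite -expRD subrr expR0.
  by rewrite ler_wpM2l ?expR_ge1Dx// ltW.
have h3 := ler_wpM2l s0 h1.
have s1' : 0 <= 1 - s by rewrite subr_ge0.
have h4 := ler_wpM2l s1' h2.
move: h3 h4; move: (expR (s * t)) (expR t) => x y h3 h4; nra.
Qed.

(** The smallest power of 2 above m + 1 is at most 2 (m + 1), which is the loss of the factor 2. *)
Lemma window_sum_le (a : nat -> R) (D : R) : (forall n, 0 <= a n) ->
  (forall i, \sum_(0 <= n < 2 ^ i) a n <= 2 ^+ i * D) ->
  forall m, \sum_(0 <= n < m.+1) a n <= m.+1%:R * (2 * D).
Proof.
move=> a0 hD m; have /andP[t1 t2] := @trunc_log_bounds 2 m.+1 isT isT.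
set i := trunc_log 2 m.+1 in t1 t2.
have D0 : 0 <= D.
  by have := hD 0%N; rewrite big_nat1 expr0 mul1r; exact: le_trans.
apply: (@le_trans _ _ (\sum_(0 <= n < 2 ^ i.+1) a n)).
  rewrite [leRHS](@big_cat_nat _ _ _ m.+1)//=; [by rewrite lerDl sumr_ge0|exact: ltnW].
apply: (le_trans (hD i.+1)); rewrite exprS -mulrA mulrCA ler_wpM2r ?mulr_ge0//.
by rewrite -natrX ler_nat.
Qed.

Definition strong_mean (c : R) h (m : nat) z : R := m.+1%:R^-1 *
  \sum_(0 <= n < m.+1) (expR (c * `|rsum h n z - h z|) - 1).

(** For n >= N the polynomial P reproduces itself and only g = h - P counts. As |g| <= lam, the
    exponent is at most s times |S_n g|/B + 1, where B = 8 [exp_const] lam, and [expR_scale]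
    extracts the factor s. In the bound 48 = 2 * 24, the factor e comes from the 1 in the exponent,
    and the final 1 pays for the first N terms. *)
Lemma strong_mean_le (c lam s : R) h P N z : 0 < c -> 0 < lam -> 0 < s <= 1 ->
  s = c * (8 * (exp_const * lam)) ->
  m2.-integrable torus2 (EFin \o h) -> trigpoly P ->
  (forall n, (N <= n)%N -> rsum P n z = P z) ->
  `|h z - P z| <= lam ->
  (forall i, \sum_(0 <= n < 2 ^ i) expR (`|rsum (fun w => h w - P w) n z| / (8 * (exp_const * lam)))
     <= 2 ^+ i * 24) ->
  exists M : nat, forall m, (M <= m)%N -> strong_mean c h m z <= (48 * expR 1 + 1) * s.
Proof.
move=> c0 l0 /andP[s0 s1] sE hi tP hN hz hw.
set B := 8 * (exp_const * lam) in sE hw.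
have x1 := @exp_const_ge1 R.
have B0 : 0 < B by rewrite /B !mulr_gt0// (lt_le_trans ltr01).
pose g w := h w - P w.
have gi : m2.-integrable torus2 (EFin \o g).
  have := integrableB mT hi (trigpoly_integrable tP); apply: eq_integrable => //; exact: mT.
have rg n : (N <= n)%N -> rsum h n z - h z = rsum g n z - g z.
  move=> Nn; have -> : rsum h n z = rsum g n z + P z.
    rewrite -(hN n Nn) -rsumD//; last exact: trigpoly_integrable.
    by congr (rsum _ n z); apply/funext => w; rewrite /g subrK.
  by rewrite /g; ring.
pose a n := s * expR 1 * expR (`|rsum g n z| / B).
pose x n := expR (c * `|rsum h n z - h z|) - 1.
have a0 n : 0 <= a n by rewrite /a !mulr_ge0 ?expR_ge0// ltW.
have xa n : (N <= n)%N -> x n <= a n.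
  move=> Nn; rewrite /x rg//.
  have h1 : c * `|rsum g n z - g z| <= s * (`|rsum g n z| / B + 1).
    apply: (@le_trans _ _ (c * (`|rsum g n z| + `|g z|))).
      by rewrite ler_wpM2l ?ler_normB// ltW.
    rewrite (_ : s * _ = c * (`|rsum g n z| + B)).
      rewrite ler_wpM2l ?lerD2l//; first exact: ltW.
      apply: (le_trans hz); rewrite /B mulrA ler_peMl//; first exact: ltW.
      by move: x1; lra.
    by rewrite sE; field; rewrite gt_eqF.
  have h2 : expR (c * `|rsum g n z - g z|) <= 1 + s * (expR (`|rsum g n z| / B + 1) - 1).
    apply: le_trans (expR_scale _ _); first by rewrite ler_expR.
    by rewrite (ltW s0).
  rewrite /a; move: h2; rewrite expRD.
  move: (expR (c * _)) (expR 1) (expR (_ / B)) => y e1 y1 h2.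
  have s0' := ltW s0; nra.
pose S0 := \sum_(0 <= n < N) `|x n|.
have S00 : 0 <= S0 by apply: sumr_ge0 => n _.
have aw m : \sum_(0 <= n < m.+1) a n <= m.+1%:R * (2 * (s * expR 1 * 24)).
  apply: window_sum_le => // i; rewrite /a -mulr_sumr [leRHS]mulrCA.
  by rewrite ler_wpM2l ?mulr_ge0 ?expR_ge0 ?(ltW s0)//; exact: hw.
have b0 : 0 <= S0 / s by rewrite divr_ge0// ltW.
(* The terms of index below N have a fixed total, which division by m + 1 makes smaller than s. *)
exists (maxn N (Num.bound (S0 / s))) => m; rewrite geq_max => /andP[Nm bm].
have m0 : 0 < m.+1%:R :> R by rewrite ltr0n.
rewrite /strong_mean ler_pdivrMl//.
rewrite (@big_cat_nat _ _ _ N)//=; last by rewrite ltnW.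
apply: (@le_trans _ _ (S0 + m.+1%:R * (2 * (s * expR 1 * 24)))).
  apply: lerD; first by apply: ler_sum => n _; exact: ler_norm.
  apply: le_trans (aw m); rewrite [leRHS](@big_cat_nat _ _ _ N)//=; last by rewrite ltnW.
  rewrite -[leLHS]add0r; apply: lerD; first exact: sumr_ge0.
  by apply: ler_sum_nat => n /andP[Nn _]; exact: xa.
have hS : S0 <= m.+1%:R * s.
  rewrite -ler_pdivrMr//; apply: ltW; apply: (lt_le_trans (archi_boundP b0)).
  by rewrite ler_nat ltnW.
by move: hS; move: (m.+1%:R : R) (expR 1) => k e1; lra.
Qed.

Let div1680_le (y : R) : 0 < y -> y / 1680 <= y / 2.
Proof. by move=> y0; lra. Qed.

(** The level lam is determined by s. For each e, a large K and a polynomial close to h for that K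
    make both exceptional sets small: the one of [rsum_weak], and the set where |h - P| exceeds lam,
    bounded by Chebyshev's inequality. *)
Lemma strong_mean_exceptional (c s : R) h : 0 < c -> 0 < s <= 1 ->
  m2.-integrable torus2 (EFin \o h) -> approximable h ->
  m2.-negligible [set z | torus2 z /\
    ~ exists M : nat, forall m, (M <= m)%N -> strong_mean c h m z <= (48 * expR 1 + 1) * s].
Proof.
move=> c0 s01 hi [mh ah]; apply: negligible_small => e e0.
have s0 : 0 < s by have /andP[] := s01.
have x1 := @exp_const_ge1 R.
have x0 : 0 < exp_const :> R by rewrite (lt_le_trans ltr01).
pose lam := s / (c * (8 * exp_const)).
have l0 : 0 < lam by rewrite /lam divr_gt0// !mulr_gt0.
have sE : s = c * (8 * (exp_const * lam)).
  by rewrite /lam; field; rewrite !gt_eqF.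
pose C := 8 * pi ^+ 2 / cos 1 : R.
have C0 : 0 < C by rewrite /C !mulr_gt0 ?exprn_gt0 ?pi_gt0 ?invr_gt0 ?cos1_gt0.
(* Since 1680 = 4 * 420, the size of h - P and the constant C / K each contribute e/4 to the measure
   bound of [rsum_weak]. *)
pose K := 1680 * C / (lam * e).
have K0 : 0 < K.
  by apply: divr_gt0; [apply: mulr_gt0; [rewrite ltr0n|exact: C0]|exact: mulr_gt0 l0 e0].
pose t := lam * e / 1680.
have t0 : 0 < t by apply: divr_gt0; [exact: mulr_gt0 l0 e0|rewrite ltr0n].
have [P tP hP] := ah K t K0 t0.
have mP := trigpoly_measurable tP.
pose g w := h w - P w.
have mg : measurable_fun (torus2 : set plane) (g : plane -> R).
  by apply: measurable_funB; [exact: mh|exact: mP].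
have gi : m2.-integrable torus2 (EFin \o g).
  have := integrableB mT hi (trigpoly_integrable tP); apply: eq_integrable => //; exact: mT.
have [E [mE ET Ele hE]] := rsum_weak K0 l0 gi.
pose F : set plane := torus2 `&` [set z | lam < `|g z|].
have mF : measurable F.
  have mn : measurable_fun (torus2 : set plane) (fun z : plane => `|g z|) by exact: measurableT_comp.
  rewrite (_ : F = torus2 `&` (fun z => `|g z|) @^-1` `]lam, +oo[).
    by apply: mn; [exact: mT|exact: measurable_itv].
  by apply/seteqP; split => z [zT]; rewrite /= in_itv/= ?andbT.
have mE' : measurable (E : set plane) by exact: borel_plane.
exists (E `|` F); split; first by apply: measurableU; [exact: mE'|exact: mF].
  move=> z [zT nz]; apply: contrapT => /not_orP[nE nF]; apply: nz.
  have [N hN] := rsum_trigpoly tP.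
  apply: (@strong_mean_le c lam s h P N z) => //.
  - by move=> n Nn; exact: hN.
  - by rewrite leNgt; apply/negP => lt; apply: nF.
  - by move=> i; exact: hE.
have Fle : (lam%:E * m2 F <= t%:E)%E.
  apply: (le_trans _ hP).
  have mIF : measurable_fun (torus2 : set plane) (\1_F : plane -> R) by exact: measurable_indic.
  rewrite (_ : m2 F = \int[m2]_(z in torus2) (\1_F z)%:E)%E; last first.
    rewrite integral_indic; [|exact: mT|exact: mF].
    by congr (m2 _); rewrite setIidl// => z [].
  rewrite -ge0_intRZ; [|exact: mT|exact: mIF|by move=> z _; rewrite indicE|exact: ltW].
  apply: ge0_le_intR; first exact: mT.
  - by apply: measurable_funM; [exact: measurable_cst|exact: mIF].
  - exact: (measurable_orlicz K mg).
  - by move=> z _; rewrite indicE mulr_ge0// ltW.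
  - move=> z _; rewrite indicE; case: (boolP (z \in F)) => [/set_mem[_ /= zF]|_]; last first.
      by rewrite mulr0; exact: orlicz_ge0.
    rewrite mulr1; apply: (le_trans (ltW zF)).
    by rewrite /orlicz ler_peMr// lerDl logp_ge0.
have Fle' : (m2 F <= (t / lam)%:E)%E.
  rewrite (_ : m2 F = lam^-1%:E * (lam%:E * m2 F))%E; last first.
    by rewrite muleA -EFinM mulVf ?gt_eqF// mul1e.
  rewrite (_ : (t / lam)%:E = lam^-1%:E * t%:E)%E; last by rewrite -EFinM mulrC.
  by apply: lee_wpmul2l; [rewrite lee_fin invr_ge0 ltW|exact: Fle].
apply: (le_trans (measureU2 _ _ _)); [exact: mE'|exact: mF|].
have -> : e%:E = ((e / 2)%:E + (e / 2)%:E)%E by rewrite -EFinD -splitr.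
apply: leeD.
  apply: (le_trans Ele); rewrite (_ : e / 2 = 420 / lam * (t + C / K)).
    rewrite (EFinM (420 / lam)); apply: lee_wpmul2l.
      by rewrite lee_fin; apply: divr_ge0; [rewrite ler0n|exact: ltW].
    by rewrite EFinD; apply: leeD; [exact: hP|exact: lexx].
  by rewrite /K /t; field; rewrite !gt_eqF.
apply: (le_trans Fle'); rewrite lee_fin /t.
rewrite (_ : lam * e / 1680 / lam = e / 1680); last by field; rewrite gt_eqF.
exact: div1680_le.
Qed.

(** The exceptional sets for s = 1/(k + 1) are countably many. Outside their union the means, which
    are nonnegative, are eventually below every multiple of s. *)
Lemma strong_mean_cvg (c : R) h : 0 < c ->
  m2.-integrable torus2 (EFin \o h) -> approximable h ->
  {ae m2, forall z, torus2 z -> strong_mean c h m z @[m --> \oo] --> (0 : R)}.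
Proof.
move=> c0 hi ah.
have s01 (k : nat) : 0 < (k.+1%:R^-1 : R) <= 1 by rewrite invr_gt0 ltr0n invf_le1 ?ler1n ?ltr0n.
have := negligible_bigcup (fun k => strong_mean_exceptional c0 (s01 k) hi ah).
apply: negligibleS => z /= /not_implyP[zT nc]; apply: contrapT => nG; apply: nc.
apply/cvgrPdist_le => e e0.
have Q0 : 0 < 48 * expR 1 + 1 :> R by rewrite addr_gt0 ?mulr_gt0 ?expR_gt0.
have q0 : 0 <= (48 * expR 1 + 1) / e by rewrite divr_ge0// ltW.
pose k := Num.bound ((48 * expR 1 + 1) / e).
have ke : (48 * expR 1 + 1) * k.+1%:R^-1 <= e.
  rewrite ler_pdivrMr// -(ler_pdivrMl _ _ e0) [leLHS]mulrC; apply: ltW; apply: (lt_trans (archi_boundP q0)).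
  by rewrite ltr_nat.
have [M hM] : exists M : nat, forall m, (M <= m)%N ->
    strong_mean c h m z <= (48 * expR 1 + 1) * k.+1%:R^-1.
  by apply: contrapT => nM; apply: nG; exists k.
exists M => // m /= Mm; rewrite sub0r normrN ger0_norm; first exact: le_trans (hM m Mm) ke.
rewrite /strong_mean mulr_ge0// sumr_ge0// => n _.
by rewrite subr_ge0 -expR0 ler_expR mulr_ge0// ltW.
Qed.

End StrongMeans.

(** * Reduction of complex functions to real and imaginary parts *)

Section ComplexPartialSums.
Context {R : realType}.
Local Notation m2 := (@lebesgue_measure2 R).
Local Notation RR := (measurableTypeR R * measurableTypeR R)%type.
Local Notation plane := (caratheodory_type ((@lebesgue_measure R \x @lebesgue_measure R)%E^*)%mu).
Local Notation mT := (@measurable_torus2 R).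
Implicit Types (f : R * R -> R[i]) (g h : R * R -> R) (p : int * int).
Local Open Scope complex_scope.

Lemma modulusE (w : R[i]) : modulus w = Num.sqrt (complex.Re w ^+ 2 + complex.Im w ^+ 2).
Proof. by case: w. Qed.

Lemma normr_Re_le (w : R[i]) : `|complex.Re w| <= modulus w.
Proof. by rewrite modulusE -sqrtr_sqr ler_wsqrtr// lerDl sqr_ge0. Qed.

Lemma normr_Im_le (w : R[i]) : `|complex.Im w| <= modulus w.
Proof. by rewrite modulusE -sqrtr_sqr ler_wsqrtr// lerDr sqr_ge0. Qed.

Lemma modulus_le (w : R[i]) : modulus w <= `|complex.Re w| + `|complex.Im w|.
Proof.
rewrite modulusE -[leRHS]ger0_norm ?addr_ge0// -sqrtr_sqr ler_wsqrtr//.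
rewrite sqrrD !real_normK ?num_real// -addrA [_ *+ 2 + _]addrC addrA lerDl.
by rewrite mulrn_wge0// mulr_ge0.
Qed.

Lemma sum_complex (I : Type) (r : seq I) (a b : I -> R) :
  \sum_(i <- r) (a i +i* b i) = (\sum_(i <- r) a i) +i* (\sum_(i <- r) b i).
Proof.
elim: r => [|i r IH]; first by rewrite !big_nil.
by rewrite !big_cons IH.
Qed.

Lemma sum_boxN n (F : int * int -> R) :
  \sum_(p <- box n) F (- p.1, - p.2) = \sum_(p <- box n) F p.
Proof.
rewrite !big_box [RHS]big_nat_rev; apply: eq_big_nat => i hi.
rewrite [RHS]big_nat_rev; apply: eq_big_nat => k hk /=.
by congr F; congr pair; lia.
Qed.

Lemma rcosN g p : rcos g (- p.1, - p.2) = rcos g p.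
Proof.
rewrite /rcos; congr (_ * _); apply: eq_Rintegral => w _; rewrite -[in RHS]cosN.
by congr (_ * cos _); rewrite /phase/= !intrN; ring.
Qed.

Lemma rsinN g p : m2.-integrable torus2 (EFin \o g) -> rsin g (- p.1, - p.2) = - rsin g p.
Proof.
move=> gi; rewrite /rsin -mulrN; congr (_ * _); rewrite -[RHS]mulN1r -RintegralZl.
- apply: eq_Rintegral => w _; rewrite mulN1r -mulrN -sinN.
  by congr (_ * sin _); rewrite /phase/= !intrN; ring.
- exact: mT.
- exact: mul_sin_integrable.
Qed.

(* These are the cross terms between the real and imaginary parts of [f] in a
   square partial sum; they cancel since the square is symmetric. *)
Lemma sum_box_odd n g z : m2.-integrable torus2 (EFin \o g) ->
  \sum_(p <- box n) (rsin g p * cos (phase p z) - rcos g p * sin (phase p z)) = 0.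
Proof.
move=> gi; pose F p := rsin g p * cos (phase p z) - rcos g p * sin (phase p z).
have FN p : F (- p.1, - p.2) = - F p.
  rewrite /F rsinN// rcosN (_ : phase (- p.1, - p.2) z = - phase p z).
    by rewrite cosN sinN; ring.
  by rewrite /phase/= !intrN; ring.
have := sum_boxN n F; rewrite (eq_bigr _ (fun p _ => FN p)) sumrN -/(F _) => h.
by move: h; set S := \sum_(p <- box n) F p; lra.
Qed.

(** The complex coefficient mixes both parts of f through the sines; these mixed terms disappear
    only after summation over a symmetric box. *)
Lemma fourier_coefE f p :
  m2.-integrable torus2 (EFin \o (fun z => complex.Re (f z))) ->
  m2.-integrable torus2 (EFin \o (fun z => complex.Im (f z))) ->
  fourier_coef f p.1 p.2 =
  (rcos (fun z => complex.Re (f z)) p + rsin (fun z => complex.Im (f z)) p) +i*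
  (rcos (fun z => complex.Im (f z)) p - rsin (fun z => complex.Re (f z)) p).
Proof.
move=> ui vi; rewrite /fourier_coef /cintegral /cis.
have -> : Rintegral m2 torus2 (fun z => complex.Re (f z * (cos (- (p.1%:~R * z.1 + p.2%:~R * z.2)) +i*
    sin (- (p.1%:~R * z.1 + p.2%:~R * z.2))))) =
  Rintegral m2 torus2 (fun z => complex.Re (f z) * cos (phase p z)) +
  Rintegral m2 torus2 (fun z => complex.Im (f z) * sin (phase p z)).
  rewrite -RintegralD; [|exact: mT|exact: mul_cos_integrable|exact: mul_sin_integrable].
  apply: eq_Rintegral => z _; rewrite -/(phase p z) cosN sinN.
  by case: (f z) => a b /=; ring.
have -> : Rintegral m2 torus2 (fun z => complex.Im (f z * (cos (- (p.1%:~R * z.1 + p.2%:~R * z.2)) +i*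
    sin (- (p.1%:~R * z.1 + p.2%:~R * z.2))))) =
  Rintegral m2 torus2 (fun z => complex.Im (f z) * cos (phase p z)) -
  Rintegral m2 torus2 (fun z => complex.Re (f z) * sin (phase p z)).
  rewrite -RintegralB; [|exact: mT|exact: mul_cos_integrable|exact: mul_sin_integrable].
  apply: eq_Rintegral => z _; rewrite -/(phase p z) cosN sinN.
  by case: (f z) => a b /=; ring.
by apply/eqP; rewrite eq_complex /rcos /rsin /=; apply/andP; split; apply/eqP; ring.
Qed.

Lemma partial_sumE f n z :
  m2.-integrable torus2 (EFin \o (fun z => complex.Re (f z))) ->
  m2.-integrable torus2 (EFin \o (fun z => complex.Im (f z))) ->
  partial_sum f n z =
  rsum (fun z => complex.Re (f z)) n z +i* rsum (fun z => complex.Im (f z)) n z.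
Proof.
move=> ui vi; set u := (fun z => complex.Re (f z)); set v := (fun z => complex.Im (f z)).
transitivity (\sum_(p <- box n) (fourier_coef f p.1 p.2 * cis (phase p z))).
  rewrite big_box big_mkord; apply: eq_bigr => j _.
  by rewrite big_mkord; apply: eq_bigr => k _.
pose A p := (rcos u p * cos (phase p z) + rsin u p * sin (phase p z)) +
  (rsin v p * cos (phase p z) - rcos v p * sin (phase p z)).
pose B p := (rcos v p * cos (phase p z) + rsin v p * sin (phase p z)) -
  (rsin u p * cos (phase p z) - rcos u p * sin (phase p z)).
rewrite (eq_bigr (fun p => A p +i* B p)); last first.
  move=> p _; rewrite fourier_coefE// /cis /A /B.
  by apply/eqP; rewrite eq_complex /=; apply/andP; split; apply/eqP; rewrite -/u -/v; ring.
rewrite sum_complex /rsum /tp; congr (_ +i* _).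
  rewrite /A big_split /= (sum_box_odd n z vi) addr0.
  by apply: eq_bigr => p _; rewrite mul1r.
rewrite /B sumrB (sum_box_odd n z ui) subr0.
by apply: eq_bigr => p _; rewrite mul1r.
Qed.

Lemma integrable_LlogL h : measurable_fun (torus2 : set plane) (h : plane -> R) ->
  (\int[m2]_(z in torus2) (`|h z| * logp `|h z|)%:E < +oo)%E ->
  m2.-integrable torus2 (EFin \o h).
Proof.
move=> mh hfin; apply/integrableP; split; first exact/measurable_EFinP.
apply: le_lt_trans (LlogL_size_fin ltr01 mh hfin); apply: ge0_le_intR.
- exact: mT.
- exact: measurableT_comp.
- exact: (measurable_orlicz 1 mh).
- by move=> z _; exact: normr_ge0.
- by move=> z _; rewrite /orlicz ler_peMr// lerDl logp_ge0.
Qed.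

Lemma LlogL_component f g : LlogL f -> measurable_fun (torus2 : set plane) (g : plane -> R) ->
  (forall z, `|g z| <= modulus (f z)) ->
  (\int[m2]_(z in torus2) (`|g z| * logp `|g z|)%:E < +oo)%E.
Proof.
move=> [_ mu_ mv ffin] mg gf; apply: le_lt_trans ffin.
have mm : measurable_fun (torus2 : set plane) (fun z : plane => modulus (f z)).
  under eq_fun do rewrite modulusE.
  apply: (measurableT_comp (continuous_measurable_fun (@sqrt_continuous R))).
  by apply: measurable_funD; apply: measurable_funX; [exact: mu_|exact: mv].
have mn : measurable_fun (torus2 : set plane) (fun z : plane => `|g z|) by exact: measurableT_comp.
apply: ge0_le_intR; first exact: mT.
- by apply: measurable_funM; [exact: mn|apply: (measurableT_comp measurable_logp); exact: mn].
- by apply: measurable_funM; [exact: mm|apply: (measurableT_comp measurable_logp); exact: mm].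
- by move=> z _; rewrite mulr_ge0// logp_ge0.
- by move=> z _; apply: ler_pM => //; [exact: logp_ge0|exact: ler_logp].
Qed.

(** The inequality 2 a b <= a^2 + b^2 for a = exp x and b = exp y: it separates the real and
    imaginary parts at the price of doubling the exponent. *)
Lemma expR_mean_le (x y : R) : expR (x + y) - 1 <= 1 / 2 * ((expR (2 * x) - 1) + (expR (2 * y) - 1)).
Proof.
rewrite !expRM_natl expRD; move: (expR x) (expR y) => a b.
have := sqr_ge0 (a - b); rewrite sqrrB; lra.
Qed.

End ComplexPartialSums.

Theorem theorem2 (R : realType) (f : R * R -> R[i]) (hf : LlogL f)
    (A : R) (hA : 0 < A) :
  {ae @lebesgue_measure2 R, forall z, torus2 z ->
    (fun m : nat => (m.+1%:R)^-1 *
       \sum_(0 <= n < m.+1)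
         (expR (A * modulus (partial_sum f n z - f z)) - 1))
      @ \oo --> (0 : R)}.
Proof.
have [_ mu_ mv _] := hf.
pose u := fun z => complex.Re (f z); pose v := fun z => complex.Im (f z).
have ufin := LlogL_component hf mu_ (fun z => normr_Re_le (f z)).
have vfin := LlogL_component hf mv (fun z => normr_Im_le (f z)).
have ui := integrable_LlogL mu_ ufin; have vi := integrable_LlogL mv vfin.
have A2 : 0 < 2 * A by rewrite mulr_gt0.
have hu := strong_mean_cvg A2 ui (approximable_LlogL mu_ ufin).
have hv := strong_mean_cvg A2 vi (approximable_LlogL mv vfin).
apply: filterS2 hu hv => z hu hv zT.
(* The modulus is at most the sum of the absolute values of both parts, so by [expR_mean_le] the
   mean is squeezed between 0 and the average of the two real strong means at exponent 2 A. *)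
have lim : (1 / 2 * (strong_mean (2 * A) u m z + strong_mean (2 * A) v m z)) @[m --> \oo] -->
    (1 / 2 * (0 + 0) : R).
  by apply: cvgMr; apply: cvgD; [exact: hu|exact: hv].
rewrite addr0 mulr0 in lim; apply: (squeeze_cvgr _ (cvg_cst 0) lim).
apply: nearW => m; apply/andP; split.
  rewrite mulr_ge0// sumr_ge0// => n _.
  by rewrite subr_ge0 -expR0 ler_expR mulr_ge0 ?(ltW hA)// modulusE sqrtr_ge0.
rewrite /strong_mean -mulrDr -big_split mulrCA ler_wpM2l// mulr_sumr.
apply: ler_sum => n _ /=; rewrite partial_sumE//.
pose a := rsum u n z - u z; pose b := rsum v n z - v z.
have mab : modulus ((rsum u n z +i* rsum v n z)%C - f z) <= `|a| + `|b|.
  by apply: le_trans (modulus_le _) _; rewrite /a /b /u /v; case: (f z).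
have h := expR_mean_le (A * `|a|) (A * `|b|); rewrite !mulrA in h.
by apply: le_trans h; rewrite lerB// ler_expR -mulrDr ler_wpM2l// ltW.
Qed.
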